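(* Let $y,f$ be functions satisfying the system $$\begin{aligned} &-a^6 b^2 c_3^2 f^7 y' y''-a^4 c_3^2 c_4 f^3 f' f''-2 a^6 c_2 c_3^2 H_0 f^5 \left(f'' y'+f' y''\right)\\ &\quad-2 a^2 c_4 f^2 (f')^3 \left(a^2 c_3^2-8 c_2 H_0 f' y'\right)-4 a^4 b^2 f^6 f' (y')^2 \left(a^2 c_3^2-4 c_2 H_0 f' y'\right)\\ &\quad+a^2 f^4 f' \left(-12 a^4 c_2 c_3^2 H_0 f' y'+4 \left(a^4 c_3^2-12 a^2 \left(c_3^2-1\right) H_0^2-48 H_0^4\right) (f')^2 (y')^2\right)\\ &\quad+2 a^4 b^4 f^8 f' (y')^4+a^8c_3^4f^4 f' +2 c_4^2 (f')^5=0,\\[4pt] &a^4 c_3^2 f ^3 \left(f' y'' -f'' y' \right)-a^2 b^4 f ^6 (y')^3+a^2 b^2 f ^4 y' \left(a^2 c_3^2-6 c_2 H_0 f' y' \right)\\ &\quad+f ^2 f' \left(2 a^4 c_2 c_3^2 H_0+\left(a^4 c_3^2+12 a^2 \left(c_3^2-1\right) H_0^2+48 H_0^4\right) f' y' \right)-2 c_2 c_4 H_0 (f')^3=0 \end{aligned}$$ for some non-zero constants $a,c_2,c_3$ satisfying $b^2=a^2-4 H_0^2>0$ and $c_2^2+c_3^2+\frac{4H_0^2}{a^2}=1$, where $c_4=a^2 c_3^2+4 H_0^2$. Then the Robertson-Walker space $L^5_1(f,0)$ admits a space-like, biconservative PMCV surface $M$ with mean curvature $H_0$ parametrized by $$\phi(u,v)=\left(u,\frac{\sin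 (a v)}{a f(u)},\frac{\cos (a v)}{a f(u)},y(u),\frac{2 H_0-c_2 a^2 f(u)y(u)}{c_3a^2 f(u)}\right).$$ Conversely, if a Robertson-Walker space $L^5_1(f,0)$ admits a space-like, biconservative PMCV surface (with mean curvature $H_0$), then there exist a function $y$ and non-zero constants $a,c_2,c_3$ satisfying $b^2=a^2-4 H_0^2>0$ and $c_2^2+c_3^2+\frac{4H_0^2}{a^2}=1$ such that, with $c_4=a^2 c_3^2+4 H_0^2$, the functions $f$ and $y$ satisfy $$\begin{aligned} &-a^6 b^2 c_3^2 f^7 y' y''-a^4 c_3^2 c_4 f^3 f' f''-2 a^6 c_2 c_3^2 H_0 f^5 \left(f'' y'+f' y''\right)\\ &\quad-2 a^2 c_4 f^2 (f')^3 \left(a^2 c_3^2-8 c_2 H_0 f' y'\right)-4 a^4 b^2 f^6 f' (y')^2 \left(a^2 c_3^2-4 c_2 H_0 f' y'\right)\\ &\quad+a^2 f^4 f' \left(-12 a^4 c_2 c_3^2 H_0 f' y'+4 \left(a^4 c_3^2-12 a^2 \left(c_3^2-1\right) H_0^2-48 H_0^4\right) (f')^2 (y')^2\right)\\ &\quad+2 a^4 b^4 f^8 f' (y')^4+a^8c_3^4f^4 f' +2 c_4^2 (f')^5=0,\\[4pt] &a^4 c_3^2 f ^3 \left(f' y'' -f'' y' \right)-a^2 b^4 f ^6 (y')^3+a^2 b^2 f ^4 y' \left(a^2 c_3^2-6 c_2 H_0 f' y' \right)\\ &\quad+f ^2 f' \left(2 a^4 c_2 c_3^2 H_0+\left(a^4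 c_3^2+12 a^2 \left(c_3^2-1\right) H_0^2+48 H_0^4\right) f' y' \right)-2 c_2 c_4 H_0 (f')^3=0, \end{aligned}$$ and the surface must be locally congruent to the surface parametrized by $$\phi(u,v)=\left(u,\frac{\sin (a v)}{a f(u)},\frac{\cos (a v)}{a f(u)},y(u),\frac{2 H_0-c_2 a^2 f(u)y(u)}{c_3a^2 f(u)}\right).$$
   Context: $L^5_1(f,0)=I\times\mathbb E^4$, with $I$ an open interval and $f:I\to\mathbb R$ smooth and non-vanishing, carries the metric $\langle\cdot,\cdot\rangle=-dt^2+f(t)^2(dx_1^2+\dots+dx_4^2)$; $\widetilde\nabla$ is its Levi-Civita connection and $\widetilde R(X,Y)Z=\widetilde\nabla_X\widetilde\nabla_YZ-\widetilde\nabla_Y\widetilde\nabla_XZ-\widetilde\nabla_{[X,Y]}Z$. Points are written in coordinates $(t,x_1,\dots,x_4)$. In the system, $f=f(u)$, $y=y(u)$ and primes denote $d/du$. Let $M$ be a space-like surface (isometrically immersed by $\phi$, with positive definite induced metric), with second fundamental form $h$, shape operators $A$, normal connection $\nabla^\perp$ and mean curvature vector $H=\frac12\mathrm{tr}\,h$. $M$ is PMCV if $\nabla^\perp H=0$. $M$ is biconservative if the tangential part of the bitension field $\tau_2(\phi)=\Delta\tau(\phi)-\mathrm{tr}\,\widetilde R(d\phi,\tau(\phi))d\phi$ vanishes, where $\tau(\phi)=\mathrm{tr}\,\nabla d\phi=2H$ and $\Delta$ is the rough Laplacian; equivalently $2\nabla\|H\|^2+4\,\mathrm{tr}\,A_{\nabla^\perp_\cdot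 H}(\cdot)+4\,\mathrm{tr}(\widetilde R(\cdot,H)\cdot)^T=0$. ''Mean curvature $H_0$'' means $H=H_0e_4$ for a unit normal vector field $e_4$ and a non-zero constant $H_0$. Standing assumptions: writing $\frac{\partial}{\partial t}|_M=T+\eta$ with $T$ tangent and $\eta$ normal to $M$, $T$ vanishes nowhere on $M$; $\frac{f''}{f}-\frac{(f')^2}{f^2}\neq0$ everywhere on $I$; surfaces are connected and oriented, all objects are smooth; $H\neq0$.
   Formalization: In the direct part, that the parametrized surface is space-like (positive definite induced metric) is assumed rather than concluded, since solutions of the system with small f', y' give time-like surfaces. *)

(* Defs.v *)
From HB Require Import structures.
From mathcomp Require Import all_boot all_order all_algebra.
From mathcomp Require Import all_classical all_reals all_analysis.

Set Implicit Arguments.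
Unset Strict Implicit.
Unset Printing Implicit Defensive.

Import Order.TTheory GRing.Theory Num.Theory.
Import numFieldNormedType.Exports.

Local Open Scope ring_scope.
Local Open Scope classical_set_scope.

Definition open_interval (R : realType) (I : set R) : Prop :=
  [/\ open I, is_interval I & I !=set0].

Definition smooth1 (R : realType) (I : set R) (f : R -> R) : Prop :=
  forall (k : nat) (t : R), I t -> derivable (f^`(k)) t 1.

Section Calculus.
Variable R : realType.

Definition partial n (V : normedModType R) (i : 'I_n) (F : 'rV[R]_n -> V) :
    'rV[R]_n -> V :=
  fun p => 'D_(delta_mx 0 i) F p.

(* C^oo on the open set U: all iterated partial derivatives exist and are
   continuous at the points of U. *)
Definition smooth_on n (V : normedModType R) (U : set 'rV[R]_n)
    (F : 'rV[R]_n -> V) : Prop :=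
  forall (s : seq 'I_n) (p : 'rV[R]_n), U p ->
    let G := foldr (fun i => @partial n V i) F s in
    {for p, continuous G} /\ forall i, derivable G p (delta_mx 0 i).

(* Row convention: row i is dF(e_i), so that dF_p(v) = v *m jac F p. *)
Definition jac n m (F : 'rV[R]_n -> 'rV[R]_m) (p : 'rV[R]_n) : 'M[R]_(n, m) :=
  \matrix_(i < n) partial i F p.

Definition positive_definite n (A : 'M[R]_n) : Prop :=
  forall v : 'rV[R]_n, v != 0 -> 0 < (v *m A *m v^T) 0 0.

(* g p is the Gram matrix at p of a semi-Riemannian metric. *)
Section Metric.
Variable n : nat.
Variable g : 'rV[R]_n -> 'M[R]_n.

Definition inner (p v w : 'rV[R]_n) : R := (v *m g p *m w^T) 0 0.

(* Gamma^k_{ij} *)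
Definition christoffel (p : 'rV[R]_n) (k i j : 'I_n) : R :=
  2^-1 * \sum_(l < n) invmx (g p) k l *
    (partial i g p j l + partial j g p i l - partial l g p i j).

Definition levi_civita (X Y : 'rV[R]_n -> 'rV[R]_n) : 'rV[R]_n -> 'rV[R]_n :=
  fun p => (\sum_(i < n) X p 0 i *: partial i Y p) +
    \row_k \sum_(i < n) \sum_(j < n) christoffel p k i j * X p 0 i * Y p 0 j.

Definition lie_bracket (X Y : 'rV[R]_n -> 'rV[R]_n) : 'rV[R]_n -> 'rV[R]_n :=
  fun p => \sum_(i < n) (X p 0 i *: partial i Y p - Y p 0 i *: partial i X p).

Definition curvature_field (X Y Z : 'rV[R]_n -> 'rV[R]_n) :
    'rV[R]_n -> 'rV[R]_n :=
  fun p => levi_civita X (levi_civita Y Z) p - levi_civita Y (levi_civita X Z) p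
           - levi_civita (lie_bracket X Y) Z p.

(* The value at p of the curvature tensor, computed (by tensoriality) on the
   extensions of x, y, z with constant coefficients. *)
Definition curvature (p x y z : 'rV[R]_n) : 'rV[R]_n :=
  curvature_field (fun=> x) (fun=> y) (fun=> z) p.

End Metric.

(* A global isometry of the open set U endowed with the metric g. *)
Definition isometry n (g : 'rV[R]_n -> 'M[R]_n) (U : set 'rV[R]_n)
    (Psi : 'rV[R]_n -> 'rV[R]_n) : Prop :=
  (exists Psi' : 'rV[R]_n -> 'rV[R]_n,
    [/\ forall p, U p -> U (Psi p) /\ Psi' (Psi p) = p,
        forall p, U p -> U (Psi' p) /\ Psi (Psi' p) = p,
        smooth_on U Psi & smooth_on U Psi']) /\
  (forall p, U p -> jac Psi p *m g (Psi p) *m (jac Psi p)^T = g p).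

(* Vector fields along F are functions of the parameter q with values in R^n. *)
Section ParametrizedSurface.
Variable n : nat.
Variable g : 'rV[R]_n -> 'M[R]_n.
Variable F : 'rV[R]_2 -> 'rV[R]_n.

Local Notation ip q := (inner g (F q)).

Definition first_form (q : 'rV[R]_2) : 'M[R]_2 :=
  jac F q *m g (F q) *m (jac F q)^T.

Local Notation gi q := (invmx (first_form q)).

Definition tan_part (q : 'rV[R]_2) (v : 'rV[R]_n) : 'rV[R]_n :=
  \sum_(i < 2) \sum_(j < 2) (gi q i j * ip q v (partial j F q)) *: partial i F q.

Definition nor_part (q : 'rV[R]_2) (v : 'rV[R]_n) : 'rV[R]_n :=
  v - tan_part q v.

(* Ambient covariant derivative along F of the field V, in direction e_i. *)
Definition cov_along (i : 'I_2) (V : 'rV[R]_2 -> 'rV[R]_n) :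
    'rV[R]_2 -> 'rV[R]_n :=
  fun q => partial i V q +
    \row_k \sum_(l < n) \sum_(m < n)
      christoffel g (F q) k l m * partial i F q 0 l * V q 0 m.

Definition second_form (i j : 'I_2) (q : 'rV[R]_2) : 'rV[R]_n :=
  nor_part q (cov_along i (partial j F) q).

Definition mean_curvature (q : 'rV[R]_2) : 'rV[R]_n :=
  2^-1 *: \sum_(i < 2) \sum_(j < 2) gi q i j *: second_form i j q.

Definition nabla_perp (i : 'I_2) (xi : 'rV[R]_2 -> 'rV[R]_n) (q : 'rV[R]_2) :
    'rV[R]_n :=
  nor_part q (cov_along i xi q).

Definition tension (q : 'rV[R]_2) : 'rV[R]_n :=
  \sum_(i < 2) \sum_(j < 2) gi q i j *:
    (cov_along i (partial j F) q
     - \sum_(k < 2) christoffel first_form q k i j *: partial k F q).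

(* Sign convention: the trace of the second covariant derivative. *)
Definition rough_laplacian (V : 'rV[R]_2 -> 'rV[R]_n) (q : 'rV[R]_2) :
    'rV[R]_n :=
  \sum_(i < 2) \sum_(j < 2) gi q i j *:
    (cov_along i (cov_along j V) q
     - \sum_(k < 2) christoffel first_form q k i j *: cov_along k V q).

Definition bitension (q : 'rV[R]_2) : 'rV[R]_n :=
  rough_laplacian tension q
  - \sum_(i < 2) \sum_(j < 2) gi q i j *:
      curvature g (F q) (partial i F q) (tension q) (partial j F q).

End ParametrizedSurface.

Record chart (M : topologicalType) := Chart {
  ch_dom : set M;
  ch_cod : set 'rV[R]_2;
  ch_coord : M -> 'rV[R]_2;
  ch_para : 'rV[R]_2 -> M;
  ch_dom_open : open ch_dom;
  ch_cod_open : open ch_cod;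
  ch_coordP : forall p, ch_dom p ->
    ch_cod (ch_coord p) /\ ch_para (ch_coord p) = p;
  ch_paraP : forall q, ch_cod q ->
    ch_dom (ch_para q) /\ ch_coord (ch_para q) = q;
  ch_coord_cont : forall p, ch_dom p -> {for p, continuous ch_coord};
  ch_para_cont : forall q, ch_cod q -> {for q, continuous ch_para} }.

Definition overlap (M : topologicalType) (c d : chart M) : set 'rV[R]_2 :=
  ch_cod c `&` ch_para c @^-1` ch_dom d.

Definition transition (M : topologicalType) (c d : chart M) :
    'rV[R]_2 -> 'rV[R]_2 :=
  ch_coord d \o ch_para c.

Definition compatible (M : topologicalType) (c d : chart M) : Prop :=
  smooth_on (overlap c d) (transition c d) /\
  smooth_on (overlap d c) (transition d c).

(* A non-empty connected oriented smooth surface; the orientation is given by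
   the atlas, whose transition maps have positive Jacobian determinant. *)
Record surface := Surface {
  surf_carrier :> topologicalType;
  atlas : set (chart surf_carrier);
  surf_hausdorff : hausdorff_space surf_carrier;
  surf_second_countable : @second_countable surf_carrier;
  surf_connected : connected [set: surf_carrier];
  surf_nonempty : [set: surf_carrier] !=set0;
  atlas_cover : forall p : surf_carrier, exists2 c, atlas c & ch_dom c p;
  atlas_compatible : forall c d, atlas c -> atlas d -> compatible c d;
  atlas_oriented : forall c d, atlas c -> atlas d ->
    forall q, overlap c d q -> 0 < \det (jac (transition c d) q) }.

(* Coordinate 0 is t, and coordinates 1, ..., 4 are x_1, ..., x_4. *)
Definition rw_metric (f : R -> R) (p : 'rV[R]_5) : 'M[R]_5 :=
  \matrix_(i, j) if i == j then (if i == 0 then -1 else f (p 0 0) ^+ 2) else 0.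

Definition rw_space (I : set R) : set 'rV[R]_5 := [set p : 'rV[R]_5 | I (p 0 0)].

Definition d_dt : 'rV[R]_5 := delta_mx 0 0.

Section SurfacesInRW.
Variables (I : set R) (f : R -> R) (M : surface) (phi : M -> 'rV[R]_5).

Local Notation g := (rw_metric f).
Local Notation loc c := (phi \o ch_para c).

(* Positive definiteness of the induced metric makes phi an immersion. *)
Definition spacelike_immersion : Prop :=
  (forall p, rw_space I (phi p)) /\
  (forall c, atlas c -> smooth_on (ch_cod c) (loc c) /\
    forall q, ch_cod c q -> positive_definite (first_form g (loc c) q)).

Definition T_nonvanishing : Prop :=
  forall c, atlas c -> forall q, ch_cod c q -> tan_part g (loc c) q d_dt != 0.

Definition PMCV : Prop :=
  forall c, atlas c -> forall q, ch_cod c q ->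
    forall i, nabla_perp g (loc c) i (mean_curvature g (loc c)) q = 0.

Definition biconservative : Prop :=
  forall c, atlas c -> forall q, ch_cod c q ->
    tan_part g (loc c) q (bitension g (loc c) q) = 0.

(* H = H0 e4 for a smooth unit normal vector field e4 on M. *)
Definition has_mean_curvature (H0 : R) : Prop :=
  exists e4 : M -> 'rV[R]_5, forall c, atlas c ->
    smooth_on (ch_cod c) (e4 \o ch_para c) /\
    forall q, ch_cod c q ->
      [/\ forall i, inner g (loc c q) (e4 (ch_para c q))
                      (partial i (loc c) q) = 0,
          inner g (loc c q) (e4 (ch_para c q)) (e4 (ch_para c q)) = 1
        & mean_curvature g (loc c) q = H0 *: e4 (ch_para c q)].

Definition biconservative_PMCV_surface (H0 : R) : Prop :=
  [/\ spacelike_immersion, T_nonvanishing, PMCV, biconservative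
    & has_mean_curvature H0].

(* A single chart of the smooth structure of M identifies M with D, and phi
   with psi. *)
Definition parametrized_by (D : set 'rV[R]_2) (psi : 'rV[R]_2 -> 'rV[R]_5) :
    Prop :=
  exists c : chart M,
    [/\ forall d, atlas d -> compatible c d,
        ch_dom c = [set: M], ch_cod c = D
      & forall q, D q -> phi (ch_para c q) = psi q].

(* Near every point of M, some chart of the smooth structure of M with values
   in D identifies phi with psi, up to an isometry of the ambient space. *)
Definition locally_congruent (D : set 'rV[R]_2)
    (psi : 'rV[R]_2 -> 'rV[R]_5) : Prop :=
  forall p : M, exists (Psi : 'rV[R]_5 -> 'rV[R]_5) (c : chart M),
    [/\ isometry g (rw_space I) Psi,
        forall d, atlas d -> compatible c d,
        ch_dom c p, ch_cod c `<=` D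
      & forall q, ch_cod c q -> Psi (phi (ch_para c q)) = psi q].

End SurfacesInRW.

Definition strip (J : set R) : set 'rV[R]_2 := [set q : 'rV[R]_2 | J (q 0 0)].

Definition admissible_constants (H0 a b c2 c3 : R) : Prop :=
  [/\ a != 0, c2 != 0 & c3 != 0] /\
  [/\ b ^+ 2 = a ^+ 2 - 4 * H0 ^+ 2, 0 < b ^+ 2
    & c2 ^+ 2 + c3 ^+ 2 + 4 * H0 ^+ 2 / a ^+ 2 = 1].

(* F, F1, F2 stand for f, f', f'' and Y1, Y2 for y', y''. *)
Definition system_eq1 (H0 a b c2 c3 F F1 F2 Y1 Y2 : R) : Prop :=
  let c4 := a ^+ 2 * c3 ^+ 2 + 4 * H0 ^+ 2 in
  - (a ^+ 6 * b ^+ 2 * c3 ^+ 2 * F ^+ 7 * Y1 * Y2)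
  - a ^+ 4 * c3 ^+ 2 * c4 * F ^+ 3 * F1 * F2
  - 2 * a ^+ 6 * c2 * c3 ^+ 2 * H0 * F ^+ 5 * (F2 * Y1 + F1 * Y2)
  - 2 * a ^+ 2 * c4 * F ^+ 2 * F1 ^+ 3
      * (a ^+ 2 * c3 ^+ 2 - 8 * c2 * H0 * F1 * Y1)
  - 4 * a ^+ 4 * b ^+ 2 * F ^+ 6 * F1 * Y1 ^+ 2
      * (a ^+ 2 * c3 ^+ 2 - 4 * c2 * H0 * F1 * Y1)
  + a ^+ 2 * F ^+ 4 * F1
      * (- (12 * a ^+ 4 * c2 * c3 ^+ 2 * H0 * F1 * Y1)
         + 4 * (a ^+ 4 * c3 ^+ 2 - 12 * a ^+ 2 * (c3 ^+ 2 - 1) * H0 ^+ 2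
                - 48 * H0 ^+ 4) * F1 ^+ 2 * Y1 ^+ 2)
  + 2 * a ^+ 4 * b ^+ 4 * F ^+ 8 * F1 * Y1 ^+ 4
  + a ^+ 8 * c3 ^+ 4 * F ^+ 4 * F1
  + 2 * c4 ^+ 2 * F1 ^+ 5 = 0.

Definition system_eq2 (H0 a b c2 c3 F F1 F2 Y1 Y2 : R) : Prop :=
  let c4 := a ^+ 2 * c3 ^+ 2 + 4 * H0 ^+ 2 in
  a ^+ 4 * c3 ^+ 2 * F ^+ 3 * (F1 * Y2 - F2 * Y1)
  - a ^+ 2 * b ^+ 4 * F ^+ 6 * Y1 ^+ 3
  + a ^+ 2 * b ^+ 2 * F ^+ 4 * Y1
      * (a ^+ 2 * c3 ^+ 2 - 6 * c2 * H0 * F1 * Y1)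
  + F ^+ 2 * F1
      * (2 * a ^+ 4 * c2 * c3 ^+ 2 * H0
         + (a ^+ 4 * c3 ^+ 2 + 12 * a ^+ 2 * (c3 ^+ 2 - 1) * H0 ^+ 2
            + 48 * H0 ^+ 4) * F1 * Y1)
  - 2 * c2 * c4 * H0 * F1 ^+ 3 = 0.

Definition system_on (J : set R) (H0 a b c2 c3 : R) (f y : R -> R) : Prop :=
  forall u, J u ->
    let f1 : R := f^`() u in let f2 : R := f^`(2) u in
    let y1 : R := y^`() u in let y2 : R := y^`(2) u in
    system_eq1 H0 a b c2 c3 (f u) f1 f2 y1 y2 /\
    system_eq2 H0 a b c2 c3 (f u) f1 f2 y1 y2.

Definition model_surface (H0 a c2 c3 : R) (f y : R -> R) (q : 'rV[R]_2) :
    'rV[R]_5 :=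
  let u := q 0 0 in let v := q 0 1 in
  \row_(k < 5) [:: u;
                   sin (a * v) / (a * f u);
                   cos (a * v) / (a * f u);
                   y u;
                   (2 * H0 - c2 * a ^+ 2 * f u * y u) / (c3 * a ^+ 2 * f u)]`_k.

End Calculus.

(* Main.v *)
(* When H = H0 e4 is parallel, the contracted Codazzi equation makes the tangential
   part of the bitension a multiple of <e4, d/dt> T, by a factor that the
   hypothesis on f keeps non-zero; so M is biconservative iff e4 is orthogonal to
   d/dt.  For the parametrized surface such a parallel unit normal is explicit,
   and the two equations say that the mean curvature vector is H0 e4.

   Conversely, if e4 is orthogonal to d/dt, the R^4-part n of f e4 is unit and has
   rank one, and in coordinates (u, s) with u = t and n = n(s) the surface splits
   as Z(u) - n(s)/(2 H0 f(u)).  Comparing the trace of the second fundamental form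
   with 2 H0 e4 gives a first order equation for E = |phi_u|^2 and shows that n
   runs on a circle; the quantity b^2 = 2 q^2 - (f''/f - q^2)/E, with q = f'/f, is
   locally constant and independent of the chart, hence constant on M.  So E is a
   function of t alone, Z' lies in a fixed plane orthogonal to that of the circle,
   and one more constant of integration determines Z up to a rigid motion of R^4,
   which can be chosen so that c_2 = c_3. *)
Require Import Defs.
From HB Require Import structures.
From mathcomp Require Import all_boot all_order all_algebra.
From mathcomp Require Import all_classical all_reals all_analysis.
From mathcomp Require Import ring lra.

Set Implicit Arguments.
Unset Strict Implicit.
Unset Printing Implicit Defensive.

Import Order.TTheory GRing.Theory Num.Theory.
Import numFieldNormedType.Exports.

Local Open Scope ring_scope.
Local Open Scope classical_set_scope.

#[local] Hint Extern 0 (@Filter (matrix (Real.sort ?R) _ ?n) (@nbhs _ _ ?p)) =>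
  exact (@nbhs_filter 'rV[R]_n p) : typeclass_instances core.

(** * Smooth functions *)

(** In the direct half, two scalar equations must yield the three space components of the mean
    curvature equation. They do because the residual is automatically orthogonal to the normal, and
    the equations kill its product with the velocity and one minor. In the converse half the charts
    are arbitrary, whereas the constants and $y$ have to serve the whole time range. So $E$ is read
    off from the time component $-1/E$ of the tangential part of $\partial/\partial t$, which no
    chart changes. Genericity of $f$ keeps $2q^2-b^2$ away from zero, so $E$ is an explicit function
    of $t$, and $D=f^2+(f^2-f'^2/b^2)/E$ is a first integral on the time range. The component of
    $Z'$ towards the centre of the circle is forced by orthogonality to $e_4$; the square of the
    other one is $DE/f^4$, and its sign cannot change because a differentiable function of constant
    square is constant. An orthonormal basis of the plane of $Z'$ may be chosen freely; the one at
    45 degrees to the centre direction gives both axes the same product with the normal. This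
    product is $c_2=c_3$, and it is non-zero since $b^2>0$. *)

Section ClassCk.
Variables (R : realType) (n : nat).
Implicit Types (U V : set 'rV[R]_n) (F G : 'rV[R]_n -> R).

Lemma open_near U p (P : 'rV[R]_n -> Prop) :
  open U -> U p -> (forall x, U x -> P x) -> \forall x \near p, P x.
Proof.
by move=> oU Up UP; apply: filterS (open_nbhs_nbhs (conj oU Up)) => x /UP.
Qed.

(** Finite orders make the closure properties provable by induction: the derivative of a product, an
    inverse or a composite contains the functions themselves, which re-enter at order k through
    [CkW]. The derivative peeled off first is the innermost one. *)
Fixpoint Ck k U F : Prop :=
  (forall p, U p -> {for p, continuous F}) /\
  if k is k'.+1 then
    (forall p i, U p -> derivable F p (delta_mx 0 i)) /\
    forall i, Ck k' U (partial i F)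
  else True.

Lemma Ck_cont k U F p : Ck k U F -> U p -> {for p, continuous F}.
Proof. by case: k => [|k] [cF _]; exact: cF. Qed.

Lemma Ck_sub k U V F : V `<=` U -> Ck k U F -> Ck k V F.
Proof.
move=> VU; elim: k F => [|k IH] F /= [cF].
  by move=> _; split => // p /VU/cF.
move=> [dF CF]; split; first by move=> p /VU/cF.
by split=> [p i /VU|i]; [exact: dF|exact: IH].
Qed.

Lemma CkW k U F : Ck k.+1 U F -> Ck k U F.
Proof.
elim: k F => [|k IH] F /= [cF [dF CF]]; split => //.
by split=> // i; exact/IH/CF.
Qed.

Lemma eq_near_continuous (W : topologicalType) (F G : 'rV[R]_n -> W) (p : 'rV[R]_n) :
  {near p, F =1 G} -> {for p, continuous F} -> {for p, continuous G}.
Proof.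
move=> FG; rewrite /prop_for /continuous_at -(nbhs_singleton FG) => cF.
by move=> A /cF; apply: (@filterS2 _ (nbhs p) _ _ _ _ _ FG) => x /= ->.
Qed.

Lemma eq_near_derivable (W : normedModType R) (F G : 'rV[R]_n -> W)
    (p v : 'rV[R]_n) :
  (\forall x \near p, F x = G x) -> derivable F p v -> derivable G p v.
Proof. exact: near_eq_derivable. Qed.

Lemma eq_Ck k U F G : open U -> (forall p, U p -> F p = G p) ->
  Ck k U F -> Ck k U G.
Proof.
move=> oU; elim: k F G => [|k IH] F G FG /= [cF];
  have e p : U p -> {near p, F =1 G} by move=> Up; exact: open_near oU Up FG.
  by move=> _; split => // p Up; exact: eq_near_continuous (e p Up) (cF p Up).
move=> [dF CF].
split=> [p Up|]; first exact: eq_near_continuous (e p Up) (cF p Up).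
split=> [p i Up|i]; first exact: near_eq_derivable (e p Up) (dF p i Up).
apply: IH (CF i) => p Up; rewrite /partial; apply: near_eq_derive.
exact: e.
Qed.

Lemma Ck_cst k U c : Ck k U (fun=> c).
Proof.
elim: k c => [|k IH] c /=; (split; [by move=> p _; exact: cst_continuous|]) => //.
split=> [p i _|i]; first exact: derivable_cst.
suff -> : partial i (fun=> c) = (fun=> 0 : R) :> ('rV[R]_n -> R) by exact: IH.
by apply/funext => p; rewrite /partial derive_cst.
Qed.

Lemma Ck_add k U F G : open U -> Ck k U F -> Ck k U G ->
  Ck k U (fun p => F p + G p).
Proof.
move=> oU; elim: k F G => [|k IH] F G /= [cF HF] [cG HG]; 
  (split; [by move=> p Up; apply: continuousD; [exact: cF|exact: cG]|]) => //.
split=> [p i Up|i].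
  by apply: derivableD; [exact: HF.1|exact: HG.1].
apply: eq_Ck oU _ (IH _ _ (HF.2 i) (HG.2 i)) => p Up.
by rewrite /partial (deriveD (HF.1 p i Up) (HG.1 p i Up)).
Qed.

Lemma Ck_mul k U F G : open U -> Ck k U F -> Ck k U G ->
  Ck k U (fun p => F p * G p).
Proof.
move=> oU; elim: k F G => [|k IH] F G HF0 HG0; have [cF HF] := HF0;
  have [cG HG] := HG0; 
  (split; [by move=> p Up; apply: continuousM; [exact: cF|exact: cG]|]) => //.
split=> [p i Up|i].
  by apply: derivableM; [exact: HF.1|exact: HG.1].
have C := Ck_add oU (IH _ _ (CkW HF0) (HG.2 i)) (IH _ _ (CkW HG0) (HF.2 i)).
apply: eq_Ck oU _ C => p Up.
by rewrite /partial (deriveM (HF.1 p i Up) (HG.1 p i Up)).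
Qed.

Lemma Ck_opp k U F : open U -> Ck k U F -> Ck k U (fun p => - F p).
Proof.
move=> oU CF; apply: eq_Ck oU _ (Ck_mul oU (Ck_cst k U (-1)) CF) => p _.
by rewrite mulN1r.
Qed.

Lemma Ck_inv k U F : open U -> (forall p, U p -> F p != 0) -> Ck k U F ->
  Ck k U (fun p => (F p)^-1).
Proof.
move=> oU F0; elim: k F F0 => [|k IH] F F0 HF0; have [cF HF] := HF0; 
  (split; [by move=> p Up; apply: continuousV; [exact: F0|exact: cF]|]) => //.
split=> [p i Up|i].
  by apply: derivableV; [exact: F0|exact: HF.1].
have C := IH _ F0 (CkW HF0).
apply: eq_Ck oU _ (Ck_opp oU (Ck_mul oU (Ck_mul oU C C) (HF.2 i))) => p Up.
rewrite /partial (deriveV (F0 p Up) (HF.1 p i Up)) /GRing.scale /=.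
by rewrite expr2 invfM mulNr.
Qed.

Lemma coord_derive (p : 'rV[R]_n) i j :
  is_derive p (delta_mx 0 i : 'rV[R]_n) (fun q : 'rV[R]_n => q 0 j) ((i == j)%:R : R).
Proof.
have /derivable_mxP /(_ 0 j) dj := @derivable_id R 'rV[R]_n p (delta_mx 0 i).
apply: DeriveDef => //.
have := derive_id p (delta_mx 0 i : 'rV[R]_n); rewrite derive_mx; last exact: derivable_id.
by move=> /matrixP /(_ 0 j); rewrite !mxE eqxx /= eq_sym.
Qed.

Lemma Ck_coord k U j : Ck k U (fun p => p 0 j).
Proof.
have c p : U p -> {for p, continuous (fun p : 'rV[R]_n => p 0 j)}.
  by move=> _; exact: coord_continuous.
case: k => [|k] /=; split => //.
split=> [p i _|i]; first by have [] := coord_derive p i j.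
suff -> : partial i (fun p : 'rV[R]_n => p 0 j) = (fun=> (i == j)%:R).
  exact: Ck_cst.
by apply/funext => p; rewrite /partial; have [_ ->] := coord_derive p i j.
Qed.

Lemma continuous_rV m (G : 'rV[R]_n -> 'rV[R]_m) (p : 'rV[R]_n) :
  (forall j, {for p, continuous (fun q => G q 0 j : R)}) -> {for p, continuous G}.
Proof.
move=> cG; suff: G @ p --> G p by [];
  apply/(@cvgrPdist_le _ _ _ (nbhs p)) => e e0.
have h : \forall x \near p, forall j, `|G p 0 j - G x 0 j| <= e.
  apply: (@filter_forall _ _ _ (nbhs p) _) => j.
  have cGj : (fun q => G q 0 j : R) @ p --> (G p 0 j : R) := cG j.
  by move/cvgrPdist_le: cGj; exact.
apply: (@filterS _ (nbhs p) _ _ _ _ h) => x hx.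
rewrite /Num.Def.normr/= mx_normrE (bigmax_le _ (ltW e0))//= => -[i j] _.
by rewrite mxE [X in _ + X]mxE (ord1 i) hx.
Qed.

Definition sm U F := forall k, Ck k U F.

Lemma sm_partial U F i : sm U F -> sm U (partial i F).
Proof. by move=> sF k; have [_ [_]] := sF k.+1; exact. Qed.

Lemma sm_derivable U F p i : sm U F -> U p -> derivable F p (delta_mx 0 i).
Proof. by move=> sF Up; have [_ [+ _]] := sF 1%N; exact. Qed.

Lemma partial_mx m i (F : 'rV[R]_n -> 'rV[R]_m) p j :
  derivable F p (delta_mx 0 i) ->
  partial i F p 0 j = partial i (fun q => F q 0 j) p.
Proof. by move=> dF; rewrite /partial derive_mx// mxE. Qed.

(** Passage from the vector-valued [smooth_on] of the definitions to scalar entries. [foldr] takes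
    the derivative of the last index first, whence [rcons] in one direction. *)
Lemma smVP m (U : set 'rV[R]_n) (F : 'rV[R]_n -> 'rV[R]_m) : open U ->
  smooth_on U F <-> forall j, sm U (fun q => F q 0 j).
Proof.
move=> oU; split=> [sF j|sF s p Up /=].
  move=> k; elim: k F sF => [|k IH] F sF.
    split=> // p /(sF [::])[cF _].
    apply: (@continuous_comp _ _ _ F (fun x => x 0 j)); first exact: cF.
    exact: coord_continuous.
  split=> [p /(sF [::])[cF _]|].
    apply: (@continuous_comp _ _ _ F (fun x => x 0 j)); first exact: cF.
    exact: coord_continuous.
  split=> [p i /(sF [::])[_ /(_ i)]|i]; first by move/derivable_mxP; exact.
  have sP : smooth_on U (partial i F).
    by move=> s p Up; have := sF (rcons s i) p Up; rewrite foldr_rcons.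
  apply: eq_Ck oU _ (IH _ sP) => p /(sF [::])[_ /(_ i)]; exact: partial_mx.
(* An entry of a partial derivative is the partial derivative of the entry only where the vector
   field is derivable, so the induction carries the smoothness of the scalar iterates along. *)
have H : forall s p, U p -> forall j, foldr (@partial R n 'rV[R]_m) F s p 0 j =
  foldr (@partial R n R) (fun q => F q 0 j) s p /\
  sm U (foldr (@partial R n R) (fun q => F q 0 j) s).
  elim=> [|i {}s IH] q Uq j //=; split; last exact/sm_partial/(IH q Uq j).2.
  have e : \forall x \near q, foldr (@partial R n 'rV[R]_m) F s x 0 j =
      foldr (@partial R n R) (fun y => F y 0 j) s x.
    by apply: open_near oU Uq _ => x Ux; exact: (IH x Ux j).1.
  rewrite partial_mx; first exact: near_eq_derive.
  apply/derivable_mxP => i0 j0; rewrite (ord1 i0).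
  have [_ sj] := IH q Uq j0.
  apply: (eq_near_derivable _ (sm_derivable sj Uq)).
  by apply: open_near oU Uq _ => x Ux; rewrite (IH x Ux j0).1.
have E j : {near p, (fun x => foldr (@partial R n R) (fun y => F y 0 j) s x) =1
    (fun x => foldr (@partial R n 'rV[R]_m) F s x 0 j)}.
  by apply: open_near oU Up _ => x Ux; rewrite (H s x Ux j).1.
split.
  by apply: continuous_rV => j; apply: eq_near_continuous (E j) _;
    exact: Ck_cont ((H s p Up j).2 0%N) Up.
move=> i; apply/derivable_mxP => i0 j; rewrite (ord1 i0).
exact: (eq_near_derivable (E j) (sm_derivable (H s p Up j).2 Up)).
Qed.

End ClassCk.

(** * Chain rule and symmetry of second derivatives in the plane *)

Section Plane.
Variable R : realType.
Implicit Types (U : set 'rV[R]_2) (F : 'rV[R]_2 -> R) (p : 'rV[R]_2).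

Definition mk2 (x y : R) : 'rV[R]_2 := \row_j (if j == 0 then x else y).

Lemma mk20 x y : mk2 x y 0 0 = x. Proof. by rewrite mxE. Qed.
Lemma mk21 x y : mk2 x y 0 1 = y. Proof. by rewrite mxE. Qed.

Lemma ord2P (P : 'I_2 -> Prop) : P 0 -> P 1 -> forall i, P i.
Proof.
move=> P0 P1 [[|[|//]] i]; first by rewrite (_ : Ordinal i = 0)//; exact: val_inj.
by rewrite (_ : Ordinal i = 1)//; exact: val_inj.
Qed.

Lemma rV2P p (q : 'rV[R]_2) : p 0 0 = q 0 0 -> p 0 1 = q 0 1 -> p = q.
Proof. by move=> h0 h1; apply/rowP; exact: ord2P. Qed.

Lemma mk2K p : mk2 (p 0 0) (p 0 1) = p.
Proof. by apply: rV2P; rewrite ?mk20 ?mk21. Qed.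

Lemma sum2 (W : zmodType) (F : 'I_2 -> W) : \sum_(i < 2) F i = F 0 + F 1.
Proof. by rewrite big_ord_recl big_ord1; congr (_ + F _); apply: val_inj. Qed.

Lemma norm2_le p e : 0 <= e -> `|p 0 0| <= e -> `|p 0 1| <= e -> `|p| <= e.
Proof.
move=> e0 h0 h1; rewrite /Num.Def.normr/= mx_normrE (bigmax_le _ e0)//= => -[i j] _ /=.
by rewrite (ord1 i); move: j; exact: ord2P.
Qed.

Lemma norm2_lt p e : 0 < e -> `|p 0 0| < e -> `|p 0 1| < e -> `|p| < e.
Proof.
move=> e0 h0 h1; rewrite /Num.Def.normr/= mx_normrE (bigmax_lt _ e0)//= => -[i j] _ /=.
by rewrite (ord1 i); move: j; exact: ord2P.
Qed.

Lemma coord_le_norm n (p : 'rV[R]_n) j : `|p 0 j| <= `|p|.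
Proof.
by rewrite [leRHS]/Num.Def.normr/= mx_normrE; exact: (le_bigmax _ _ (ord0, j)).
Qed.

Lemma open_ball n (U : set 'rV[R]_n) (p : 'rV[R]_n) : open U -> U p ->
  exists2 e : R, 0 < e & forall q : 'rV[R]_n, `|p - q| < e -> U q.
Proof.
move=> oU Up; have : nbhs p U by apply: open_nbhs_nbhs.
by move/nbhs_normP => [e e0 he]; exists e => // q pq; apply: he.
Qed.

Lemma near_norm_ball n (P : set 'rV[R]_n) (p : 'rV[R]_n) (e : R) : 0 < e ->
  (forall q : 'rV[R]_n, `|p - q| < e -> P q) -> \forall x \near p, P x.
Proof. by move=> e0 he; apply/nbhs_normP; exists e. Qed.

(** Increments have no prescribed sign, so the intermediate point is located by its distance to
    [a]. *)
Lemma MVT_unordered (f df : R -> R) (a b : R) :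
  (forall x : R, `|x - a| <= `|b - a| -> is_derive x 1 f (df x)) ->
  exists2 c, `|c - a| <= `|b - a| & f b - f a = df c * (b - a).
Proof.
have cont (x y : R) (g dg : R -> R) : (forall z, z \in `[x, y]%R -> is_derive z 1 g (dg z)) ->
    {within `[x, y], continuous g}.
  move=> h; apply: derivable_within_continuous => z /h [] //.
move=> H; have [ab|ba] := leP a b.
  have D x : x \in `[a, b]%R -> is_derive x 1 f (df x).
    rewrite in_itv /= => /andP[ax xb]; apply: H.
    by rewrite !ger0_norm ?subr_ge0 ?lerB.
  have [c] := MVT_segment ab (fun x h => D x (subset_itv_oo_cc h)) (cont _ _ _ _ D).
  rewrite in_itv /= => /andP[ac cb] e; exists c => //.
  by rewrite !ger0_norm ?subr_ge0 ?lerB.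
have D x : x \in `[b, a]%R -> is_derive x 1 f (df x).
  rewrite in_itv /= => /andP[bx xa]; apply: H.
  by rewrite !ler0_norm ?subr_le0 ?lerN2 ?lerB// ltW.
have [c] := MVT_segment (ltW ba) (fun x h => D x (subset_itv_oo_cc h)) (cont _ _ _ _ D).
rewrite in_itv /= => /andP[bc ca] e; exists c => //.
  by rewrite !ler0_norm ?subr_le0 ?lerN2 ?lerB// ltW.
by rewrite -opprB e -mulrN opprB.
Qed.

Lemma slice_derive F p (i : 'I_2) (g : R -> 'rV[R]_2) (x : R) :
  (forall h, g (h + x) = h *: delta_mx 0 i + g x) ->
  derivable F (g x) (delta_mx 0 i) ->
  is_derive x 1 (F \o g) (partial i F (g x)).
Proof.
move=> gE dF.
have e : (fun h : R => h^-1 *: ((F \o g) (h *: (1 : R) + x) - (F \o g) x)) =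
  (fun h => h^-1 *: (F (h *: delta_mx 0 i + g x) - F (g x))).
  by apply/funext => h /=; rewrite /GRing.scale /= mulr1 gE.
by apply: DeriveDef; rewrite /derivable /partial /derive e.
Qed.

Lemma slice0 x y h : mk2 (h + x) y = h *: delta_mx 0 0 + mk2 x y.
Proof. by apply: rV2P; rewrite !mxE /= ?mulr1 ?mulr0 ?add0r. Qed.

Lemma slice1 x y h : mk2 x (h + y) = h *: delta_mx 0 1 + mk2 x y.
Proof. by apply: rV2P; rewrite !mxE /= ?mulr1 ?mulr0 ?add0r. Qed.

Lemma slice0_derive F x y : derivable F (mk2 x y) (delta_mx 0 0) ->
  is_derive x 1 (fun x => F (mk2 x y)) (partial 0 F (mk2 x y)).
Proof. exact: (slice_derive (mk2 x y) (fun h => slice0 x y h)). Qed.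

Lemma slice1_derive F x y : derivable F (mk2 x y) (delta_mx 0 1) ->
  is_derive y 1 (fun y => F (mk2 x y)) (partial 1 F (mk2 x y)).
Proof. exact: (slice_derive (mk2 x y) (fun h => slice1 x y h)). Qed.

(* The increment of F is taken along one coordinate at a time. *)
Lemma MVT2 F p (q : 'rV[R]_2) :
  (forall z i, `|z - p| <= `|q - p| -> derivable F z (delta_mx 0 i)) ->
  exists z0 z1, [/\ `|z0 - p| <= `|q - p|, `|z1 - p| <= `|q - p| &
    F q - F p = partial 0 F z0 * (q 0 0 - p 0 0) +
                partial 1 F z1 * (q 0 1 - p 0 1)].
Proof.
move=> dF; set r := `|q - p|.
have r0 : 0 <= r by exact: normr_ge0.
have c0 : `|q 0 0 - p 0 0| <= r.
  by have := coord_le_norm (q - p) 0; rewrite !mxE.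
have c1 : `|q 0 1 - p 0 1| <= r.
  by have := coord_le_norm (q - p) 1; rewrite !mxE.
have inr x y : `|x - p 0 0| <= r -> `|y - p 0 1| <= r -> `|mk2 x y - p| <= r.
  by move=> hx hy; apply: norm2_le; rewrite ?mxE.
have [x hx ex] := @MVT_unordered (fun x => F (mk2 x (q 0 1)))
  (fun x => partial 0 F (mk2 x (q 0 1))) (p 0 0) (q 0 0) (fun x hx =>
    slice0_derive (dF _ 0 (inr _ _ (le_trans hx c0) c1))).
have [y hy ey] := @MVT_unordered (fun y => F (mk2 (p 0 0) y))
  (fun y => partial 1 F (mk2 (p 0 0) y)) (p 0 1) (q 0 1) (fun y hy =>
    slice1_derive (dF _ 1 (inr _ _ (etrans (congr1 (fun z => z <= r)
     (etrans (congr1 Num.norm (subrr _)) (normr0 _))) r0) (le_trans hy c1)))).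
exists (mk2 x (q 0 1)), (mk2 (p 0 0) y); split.
- by apply: inr => //; exact: le_trans hx c0.
- by apply: inr; [rewrite subrr normr0|exact: le_trans hy c1].
- by move: ex ey; rewrite !mk2K => <- <-; rewrite addrA subrK.
Qed.

Lemma cvg_rV2 (T : Type) (A : set_system T) (FA : Filter A) (g : T -> 'rV[R]_2) p :
  (forall j, (fun x => g x 0 j) @ A --> p 0 j) ->
  forall e, 0 < e -> \forall x \near A, `|g x - p| < e.
Proof.
move=> c e e0.
have h j : \forall x \near A, `|p 0 j - g x 0 j| < e.
  by move/cvgrPdist_lt: (c j); exact.
apply: filterS2 (h 0) (h 1) => x h0 h1.
by apply: norm2_lt => //; rewrite !mxE distrC.
Qed.

Lemma continuous_near (F : 'rV[R]_2 -> R) p e : {for p, continuous F} -> 0 < e ->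
  exists2 d, 0 < d & forall q : 'rV[R]_2, `|q - p| < d -> `|F q - F p| < e.
Proof.
move=> cF e0; have cF' : F @ p --> F p := cF.
have : nbhs p [set q | `|F p - F q| < e].
  by move/cvgrPdist_lt: cF' => /(_ e e0).
move/nbhs_normP => [d d0 hd]; exists d => // q qp.
by rewrite distrC; apply: hd; rewrite /ball_ /= distrC.
Qed.

(** No total differential is used: [MVT2] splits the increment of F into two partial derivatives at
    intermediate points, and these tend to the values at [G t] because the partial derivatives are
    continuous. *)
Lemma chain (V : normedModType R) U F (G : V -> 'rV[R]_2) t v :
  open U -> Ck 1 U F -> U (G t) ->
  (forall j, derivable (fun x => G x 0 j : R) t v) ->
  is_derive t v (fun x => F (G x))
    (\sum_(j < 2) partial j F (G t) * 'D_v (fun x => G x 0 j : R) t).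
Proof.
move=> oU [cF [dF CF]] UG dG; rewrite sum2.
pose g (h : R) := G (h *: v + t).
pose q j (h : R) := h^-1 * (g h 0 j - G t 0 j).
have qj j : q j @ 0^' --> 'D_v (fun x => G x 0 j : R) t by exact: dG j.
have gj j : (fun h => g h 0 j) @ 0^' --> G t 0 j.
  (* Derivability yields continuity at h = 0: each component of g is h times its difference quotient
     plus a constant. *)
  have h0 : (fun h : R => h * q j h + G t 0 j) @ 0^' --> 0 * 'D_v (fun x => G x 0 j : R) t + G t 0 j.
    apply: cvgD; last exact: cvg_cst.
    apply: cvgM (qj j); apply: cvg_within_filter; exact: cvg_id.
  rewrite mul0r add0r in h0; apply: cvg_trans h0; apply: near_eq_cvg.
  near=> h; rewrite /q mulrA divff ?mul1r ?subrK//.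
  by near: h; exact: nbhs_dnbhs_neq.
have [r r0 hr] := open_ball oU UG.
have gr := @cvg_rV2 _ _ (dnbhs_filter (0 : R)) _ _ gj.
(* The intermediate points become functions of h by choice, with default (0, 0) where [g h] leaves
   the ball. *)
pose P h (z : 'rV[R]_2 * 'rV[R]_2) := `|g h - G t| < r ->
    [/\ `|z.1 - G t| <= `|g h - G t|, `|z.2 - G t| <= `|g h - G t| &
    F (g h) - F (G t) = partial 0 F z.1 * (g h 0 0 - G t 0 0) +
                partial 1 F z.2 * (g h 0 1 - G t 0 1)].
have /choice[z Hz] : forall h, exists z, P h z.
  move=> h; rewrite /P.
  have [ghr|] := pselect (`|g h - G t| < r); last by exists (0, 0).
  have [|z0 [z1 [a b c]]] := @MVT2 F (G t) (g h); last by exists (z0, z1).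
  by move=> w i wr; apply: dF; apply: hr; rewrite distrC; exact: le_lt_trans wr _.
have Dz j (y : R -> 'rV[R]_2) : (forall h, `|g h - G t| < r -> `|y h - G t| <= `|g h - G t|) ->
    (fun h => partial j F (y h)) @ 0^' --> partial j F (G t).
  move=> hy; apply/cvgrPdist_lt => e e0.
  have [d d0 hd] := continuous_near ((CF j).1 _ UG) e0.
  apply: filterS2 (gr r r0) (gr d d0) => h h1 h2.
  by rewrite distrC; apply: hd; exact: le_lt_trans (hy h h1) h2.
have L : (fun h => h^-1 *: (F (g h) - F (G t))) @ 0^' -->
   partial 0 F (G t) * 'D_v (fun x => G x 0 0 : R) t +
   partial 1 F (G t) * 'D_v (fun x => G x 0 1 : R) t.
  have D0 := Dz 0 (fun h => (z h).1) (fun h hh => let: And3 a _ _ := Hz h hh in a).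
  have D1 := Dz 1 (fun h => (z h).2) (fun h hh => let: And3 _ a _ := Hz h hh in a).
  have C : (fun h => partial 0 F (z h).1 * q 0 h + partial 1 F (z h).2 * q 1 h) @ 0^' -->
      partial 0 F (G t) * 'D_v (fun x : V => G x 0 0 : R) t +
      partial 1 F (G t) * 'D_v (fun x : V => G x 0 1 : R) t.
    by apply: cvgD; [exact: cvgM D0 (qj 0)|exact: cvgM D1 (qj 1)].
  apply: cvg_trans C.
  apply: near_eq_cvg; apply: filterS (gr r r0) => h /Hz[_ _ e] /=.
  by rewrite e /q /GRing.scale /=; ring.
apply: DeriveDef; first by apply/cvg_ex; eexists; exact: L.
exact/cvg_lim.
Unshelve. all: by end_near. Qed.

Lemma Ck_le n (U : set 'rV[R]_n) (F : 'rV[R]_n -> R) k l :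
  (k <= l)%N -> Ck l U F -> Ck k U F.
Proof.
by move=> /subnK <-; elim: (l - k)%N => //= m IH /(@CkW _ _ (m + k)); exact: IH.
Qed.

Lemma Ck_comp n (k : nat) (V : set 'rV[R]_n) U F (G : 'rV[R]_n -> 'rV[R]_2) :
  open V -> open U -> (forall q : 'rV[R]_n, V q -> U (G q)) -> Ck k U F ->
  (forall j, Ck k V (fun q => G q 0 j)) -> Ck k V (fun q => F (G q)).
Proof.
move=> oV oU VU; elim: k F => [|k IH] F HF HG.
  split=> // q Vq; apply: (@continuous_comp _ _ _ G F).
    by apply: continuous_rV => j; exact: Ck_cont (HG j) Vq.
  exact: Ck_cont HF (VU q Vq).
have D (q : 'rV[R]_n) i (Vq : V q) := @chain 'rV[R]_n U F G q (delta_mx 0 i) oU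
  (Ck_le (isT : (1 <= k.+1)%N) HF) (VU q Vq) (fun j => (HG j).2.1 q i Vq).
split; [|split].
- move=> q Vq; apply: (@continuous_comp _ _ _ G F).
    by apply: continuous_rV => j; exact: Ck_cont (HG j) Vq.
  exact: Ck_cont HF (VU q Vq).
- by move=> q i Vq; have [] := D q i Vq.
- move=> i.
  have C j : Ck k V (fun q => partial j F (G q) * partial i (fun x => G x 0 j) q).
    apply: Ck_mul => //; last exact: (HG j).2.2.
    by apply: IH => [|j']; [exact: HF.2.2|exact: CkW].
  apply: eq_Ck oV _ (Ck_add oV (C 0) (C 1)) => q Vq.
  by rewrite [RHS](@derive_val _ _ _ _ _ _ _ (D q i Vq)) sum2.
Qed.

Lemma mulr_sqr_inj (h c d : R) : h != 0 -> c * h * h = d * h * h -> c = d.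
Proof. by move=> h0 /(mulIf h0)/(mulIf h0). Qed.

Lemma half_dist_lt (a b c : R) :
  `|c - a| < `|a - b| / 2 -> `|c - b| < `|a - b| / 2 -> False.
Proof.
move=> ca cb; have := ltrD ca cb; rewrite -splitr distrC.
by move=> /(le_lt_trans (ler_normD _ _)); rewrite addrA subrK ltxx.
Qed.

(** Schwarz by contradiction: the second difference [D] over a square of side h is h^2 times either
    mixed derivative, each taken at some point within h of p. The two mixed derivatives then share a
    value close to both of their values at p, against the gap |a - b|. *)
Lemma partialC U F p : open U -> Ck 2 U F -> U p ->
  partial 0 (partial 1 F) p = partial 1 (partial 0 F) p.
Proof.
move=> oU [cF [dF CF]] Up; apply/eqP; apply: contraT => ab.
set a := partial 0 _ p in ab *; set b := partial 1 _ p in ab *.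
have e0 : 0 < `|a - b| / 2 by rewrite divr_gt0// normr_gt0 subr_eq0.
have [r r0 hr] := open_ball oU Up.
have [d1 d10 h1] := continuous_near (((CF 1).2.2 0).1 p Up) e0.
have [d2 d20 h2] := continuous_near (((CF 0).2.2 1).1 p Up) e0.
pose h := Num.min r (Num.min d1 d2) / 2.
have h0 : 0 < h by rewrite divr_gt0// !lt_min r0 d10.
have hm : h < Num.min r (Num.min d1 d2).
  by rewrite ltr_pdivrMr// ltr_pMr ?ltr1n// !lt_min r0 d10.
move: hm; rewrite !lt_min => /and3P[hrr hd1 hd2].
set x := p 0 0; set y := p 0 1.
have inr s t : `|s - x| <= h -> `|t - y| <= h -> `|mk2 s t - p| <= h.
  by move=> hs ht; apply: norm2_le; rewrite ?mxE //; exact: ltW.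
have inU s t : `|s - x| <= h -> `|t - y| <= h -> U (mk2 s t).
  by move=> hs ht; apply: hr; rewrite distrC; exact: le_lt_trans (inr _ _ hs ht) _.
have xh : `|x + h - x| = h by rewrite addrC addKr ger0_norm// ltW.
have yh : `|y + h - y| = h by rewrite addrC addKr ger0_norm// ltW.
have x0 : `|x - x| <= h by rewrite subrr normr0 ltW.
have y0 : `|y - y| <= h by rewrite subrr normr0 ltW.
have y1 : `|y + h - y| <= h by rewrite yh.
have x1 : `|x + h - x| <= h by rewrite xh.
pose D := F (mk2 (x + h) (y + h)) - F (mk2 (x + h) y) -
          (F (mk2 x (y + h)) - F (mk2 x y)).
have [z zr Dz] : exists2 z, `|z - p| <= h & D = partial 1 (partial 0 F) z * h * h.
  have [s] := @MVT_unordered (fun s => F (mk2 s (y + h)) - F (mk2 s y))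
    (fun s => partial 0 F (mk2 s (y + h)) - partial 0 F (mk2 s y)) x (x + h) (fun s hs =>
    is_deriveB (slice0_derive (dF _ 0 (inU _ _ (le_trans hs x1) y1)))
       (slice0_derive (dF _ 0 (inU _ _ (le_trans hs x1) y0)))).
  rewrite xh => hs e1.
  have [t] := @MVT_unordered (fun t => partial 0 F (mk2 s t))
    (fun t => partial 1 (partial 0 F) (mk2 s t)) y (y + h) (fun t ht =>
    slice1_derive ((CF 0).2.1 _ 1 (inU _ _ hs (le_trans ht y1)))).
  rewrite yh => ht e2; exists (mk2 s t); first exact: inr.
  by rewrite /D e1 e2; ring.
have [w wr Dw] : exists2 z, `|z - p| <= h & D = partial 0 (partial 1 F) z * h * h.
  have [t] := @MVT_unordered (fun t => F (mk2 (x + h) t) - F (mk2 x t))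
    (fun t => partial 1 F (mk2 (x + h) t) - partial 1 F (mk2 x t)) y (y + h) (fun t ht =>
    is_deriveB (slice1_derive (dF _ 1 (inU _ _ x1 (le_trans ht y1))))
       (slice1_derive (dF _ 1 (inU _ _ x0 (le_trans ht y1))))).
  rewrite yh => ht e1.
  have [s] := @MVT_unordered (fun s => partial 1 F (mk2 s t))
    (fun s => partial 0 (partial 1 F) (mk2 s t)) x (x + h) (fun s hs =>
    slice0_derive ((CF 1).2.1 _ 0 (inU _ _ (le_trans hs x1) ht))).
  rewrite xh => hs e2; exists (mk2 s t); first exact: inr.
  have -> : D = F (mk2 (x + h) (y + h)) - F (mk2 x (y + h)) -
          (F (mk2 (x + h) y) - F (mk2 x y)) by rewrite /D; ring.
  by rewrite e1 e2; ring.
have zw := mulr_sqr_inj (lt0r_neq0 h0) (etrans (esym Dz) Dw).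
move: (h1 w (le_lt_trans wr hd1)) (h2 z (le_lt_trans zr hd2)); rewrite zw.
by move=> c1 c2; case: (half_dist_lt c1 c2).
Qed.

End Plane.

(** * Inverse functions in the plane *)

(** Row vectors with their normed and their complete structure together, as the Banach fixed point
    theorem expects. *)
Definition rV_complete (R : realType) n : completeNormedModType R :=
  HB.pack_for (completeNormedModType R) 'rV[R]_n (NormedModule.on 'rV[R]_n)
    (Complete.on 'rV[R]_n).

Section NearIdentity.
Variables (R : realType) (L : 'rV[R]_2 -> 'rV[R]_2) (p : 'rV[R]_2) (r : R).
Hypothesis r_gt0 : 0 < r.
Hypothesis L_derivable : forall z i j, `|z - p| <= 3 * r ->
  derivable (fun q => L q 0 j : R) z (delta_mx 0 i).
Hypothesis L_near_id : forall z i j, `|z - p| <= 3 * r ->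
  `|partial i (fun q => L q 0 j : R) z - (i == j)%:R| <= 1 / 4.

(** The norm is the maximum norm, and each component of id - L has two partial derivatives of size
    at most 1/4, whence the factor 1/2. Two points within r of p are at most 2r apart, and the
    intermediate points are within |y - x| of x; this explains the radius 3r in the hypotheses. *)
Lemma near_id_contraction (x y : 'rV[R]_2) : `|x - p| <= r -> `|y - p| <= r ->
  `|(y - L y) - (x - L x)| <= 1 / 2 * `|y - x|.
Proof.
move=> xp yp.
have in3 z : `|z - x| <= `|y - x| -> `|z - p| <= 3 * r.
  move=> zx; rewrite -(subrKA x) (le_trans (ler_normD _ _))//.
  have : `|y - x| <= r + r.
    by rewrite -(subrKA p) (le_trans (ler_normD _ _))// lerD// distrC.
  by move=> h; lra.
have E j : exists z0 z1, [/\ `|z0 - p| <= 3 * r, `|z1 - p| <= 3 * r &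
    (y - L y - (x - L x)) 0 j =
     ((0 == j)%:R - partial 0 (fun q => L q 0 j : R) z0) * (y 0 0 - x 0 0) +
     ((1 == j)%:R - partial 1 (fun q => L q 0 j : R) z1) * (y 0 1 - x 0 1)].
  have [|z0 [z1 [/in3 h0 /in3 h1 e]]] := @MVT2 _ (fun q => L q 0 j : R) x y.
    by move=> z i /in3 h; exact: L_derivable.
  exists z0, z1; split => //; rewrite !mxE.
  have -> : y 0 j - L y 0 j - (x 0 j - L x 0 j) =
    y 0 j - x 0 j - (L y 0 j - L x 0 j) by ring.
  rewrite e; move: j {e}; apply: ord2P; rewrite /=.
    by ring.
  by ring.
have B j : `|(y - L y - (x - L x)) 0 j| <= 1 / 2 * `|y - x|.
  have [z0 [z1 [h0 h1 ->]]] := E j.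
  have := coord_le_norm (y - x) 0; have := coord_le_norm (y - x) 1; rewrite !mxE => c1 c0.
  rewrite (le_trans (ler_normD _ _))// !normrM.
  have n0 := L_near_id 0 j h0; have n1 := L_near_id 1 j h1.
  rewrite distrC in n0; rewrite distrC in n1.
  have := lerD (ler_pM (normr_ge0 _) (normr_ge0 _) n0 c0)
               (ler_pM (normr_ge0 _) (normr_ge0 _) n1 c1).
  by move=> h; rewrite (le_trans h)//; set t := `|y - x|; lra.
by apply: norm2_le => //; rewrite mulr_ge0.
Qed.

Lemma near_id_lipschitz (x y : 'rV[R]_2) : `|x - p| <= r -> `|y - p| <= r ->
  `|y - x| <= 2 * `|L y - L x|.
Proof.
move=> xp yp; have := near_id_contraction xp yp.
have -> : y - x = (y - L y - (x - L x)) + (L y - L x).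
  by apply/rowP => j; rewrite !mxE; ring.
set a := y - L y - _; set b := L y - L x => h.
have := ler_normD a b; lra.
Qed.

(** A solution of L x = w is a fixed point of x - L x + w. This contraction preserves the closed
    r-ball since it moves p by less than r/2 and halves distances. The Lipschitz bound for the
    inverse then gives the strict inequality. *)
Lemma near_id_surjective (w : 'rV[R]_2) : `|w - L p| < r / 2 ->
  exists2 x, `|x - p| < r & L x = w.
Proof.
move=> wp; pose U := [set x : 'rV[R]_2 | `|x - p| <= r].
pose Phi (x : 'rV[R]_2) : 'rV[R]_2 := x - L x + w.
have pp : `|p - p| <= r by rewrite subrr normr0 ltW.
have PhiU : {homo Phi : x / U x >-> U x}.
  move=> x; rewrite /U /= => xp.
  have -> : Phi x - p = (x - L x - (p - L p)) + (w - L p).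
    by rewrite /Phi; apply/rowP => j; rewrite !mxE; ring.
  rewrite (le_trans (ler_normD _ _))//.
  by have := near_id_contraction pp xp; lra.
have funPhi : isFun _ _ U U Phi by split.
pose f : {fun U >-> U} := HB.pack Phi funPhi.
have ctr : is_contraction f.
  have h2 : 0 <= (1 / 2 : R) by [].
  exists (NngNum h2); split=> /=; first by lra.
  move=> [x y] [/= Ux Uy]; rewrite /f /= /Phi.
  have -> : x - L x + w - (y - L y + w) = x - L x - (y - L y).
    by apply/rowP => j; rewrite !mxE; ring.
  exact: near_id_contraction.
have clU : closed U.
  have -> : U = closed_ball p r.
    by rewrite closed_ballE//; apply/seteqP; split => x; rewrite /U /closed_ball_ /= distrC.
  exact: closed_ball_closed.
have [x Ux xE] := @banach_fixed_point R (rV_complete R 2) U f ctr clU (ex_intro _ p pp).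
have Lx : L x = w.
  move: xE; rewrite /f /= /Phi => /(congr1 (fun z => z - x + L x)).
  rewrite subrr add0r => ->; apply/rowP => j; rewrite !mxE; ring.
exists x => //; have := near_id_lipschitz pp Ux; rewrite Lx => h.
by rewrite (le_lt_trans h)//; lra.
Qed.

End NearIdentity.

Lemma cramer0 (R : realFieldType) (h k0 k1 a b m00 m10 m01 m11 : R) :
  h != 0 -> m00 * m11 - m10 * m01 != 0 ->
  h * a = m00 * k0 + m10 * k1 -> h * b = m01 * k0 + m11 * k1 ->
  (a * m11 - b * m10) / (m00 * m11 - m10 * m01) = h^-1 * k0.
Proof.
move=> h0 d0 e0 e1.
have -> : a = (m00 * k0 + m10 * k1) / h by rewrite -e0 mulrAC divff ?mul1r.
have -> : b = (m01 * k0 + m11 * k1) / h by rewrite -e1 mulrAC divff ?mul1r.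
by field; rewrite d0 h0.
Qed.

Lemma cramer1 (R : realFieldType) (h k0 k1 a b m00 m10 m01 m11 : R) :
  h != 0 -> m00 * m11 - m10 * m01 != 0 ->
  h * a = m00 * k0 + m10 * k1 -> h * b = m01 * k0 + m11 * k1 ->
  (b * m00 - a * m01) / (m00 * m11 - m10 * m01) = h^-1 * k1.
Proof.
move=> h0 d0 e0 e1.
have -> : a = (m00 * k0 + m10 * k1) / h by rewrite -e0 mulrAC divff ?mul1r.
have -> : b = (m01 * k0 + m11 * k1) / h by rewrite -e1 mulrAC divff ?mul1r.
by field; rewrite d0 h0.
Qed.

Section InverseDerivative.
Variables (R : realType) (U W : set 'rV[R]_2) (L G : 'rV[R]_2 -> 'rV[R]_2) (C : R).
Hypotheses (oU : open U) (oW : open W).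
Hypothesis L_C1 : forall j, Ck 1 U (fun q => L q 0 j).
Hypothesis WU : forall w, W w -> U (G w).
Hypothesis LG : forall w, W w -> L (G w) = w.
Hypothesis G_lip : forall w w', W w -> W w' -> `|G w' - G w| <= C * `|w' - w|.

Definition jent i j (x : 'rV[R]_2) : R := partial i (fun q => L q 0 j : R) x.
Definition jdet x := jent 0 0 x * jent 1 1 x - jent 1 0 x * jent 0 1 x.
Hypothesis C_gt0 : 0 < C.
Hypothesis jdet_neq0 : forall x, U x -> jdet x != 0.

(** The adjugate formula for an entry of the inverse Jacobian; in ['I_2] the index other than [j] is
    [1 - j]. *)
Definition jinv i j x := ((i == j)%:R * jent (1 - j) (1 - j) x
  - (i == 1 - j)%:R * jent (1 - j) j x) / jdet x.

(** Applying [MVT2] to both components of L between G w and a translate gives a 2 by 2 linear system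
    for the difference quotients of G. Its coefficients are partial derivatives of L at points that
    tend to G w by the Lipschitz bound, so Cramer's rule passes to the limit. *)
Lemma inverse_derive w i j : W w ->
  is_derive w (delta_mx 0 i : 'rV[R]_2) (fun v => G v 0 j : R) (jinv i j (G w)).
Proof.
move=> Ww; pose x := G w; pose g (h : R) := G (h *: delta_mx 0 i + w).
have [r r0 hr] := open_ball oU (WU Ww).
have [s s0 hs] := open_ball oW Ww.
have nd (h : R) : `|h *: (delta_mx 0 i : 'rV[R]_2)| <= `|h|.
  rewrite normrZ ler_piMr//; apply: norm2_le => //; rewrite mxE eqxx /=.
    by case: eqP => _; rewrite ?normr1 ?normr0.
  by case: eqP => _; rewrite ?normr1 ?normr0.
have inW (h : R) : `|h| < s -> W (h *: delta_mx 0 i + w).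
  by move=> hh; apply: hs; rewrite opprD addrCA subrr addr0 normrN (le_lt_trans (nd h)).
have gw (h : R) : `|h| < s -> `|g h - x| <= C * `|h|.
  move=> hh; rewrite (le_trans (G_lip Ww (inW h hh)))// addrK.
  by rewrite ler_wpM2l// ltW.
have gnear e : 0 < e -> \forall h \near 0^', `|h| < s /\ `|g h - x| < e.
  move=> e0; near=> h; have hs' : `|h| < s.
    by near: h; exact: dnbhs0_lt.
  split=> //; rewrite (le_lt_trans (gw h hs'))// -ltr_pdivlMl// mulrC.
  by near: h; apply: dnbhs0_lt; rewrite divr_gt0.
have hx (z : 'rV[R]_2) : `|z - x| < r -> U z by rewrite distrC; exact: hr.
pose P l h (z : 'rV[R]_2 * 'rV[R]_2) := `|h| < s -> `|g h - x| < r ->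
  [/\ `|z.1 - x| <= `|g h - x|, `|z.2 - x| <= `|g h - x| &
   h * (i == l)%:R = jent 0 l z.1 * (g h - x) 0 0 + jent 1 l z.2 * (g h - x) 0 1].
have Pex l h : exists z, P l h z.
  have [hh|/negP nh] := boolP (`|h| < s); last by exists (0, 0) => /nh.
  have [gr|/negP nr] := boolP (`|g h - x| < r); last by exists (0, 0) => _ /nr.
  have [|z0 [z1 [a b c]]] := @MVT2 _ (fun q => L q 0 l) x (g h).
    by move=> z i' zr; apply: (L_C1 l).2.1; apply: hx; exact: le_lt_trans zr gr.
  exists (z0, z1) => _ _; split => //=.
  move: c; rewrite [RHS]addrC.
  rewrite addrC (LG (inW h hh)) (LG Ww) !mxE /= eq_sym.
  by rewrite -addrA subrr addr0 => <-.
pose z l h := projT1 (cid (Pex l h)).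
have Hz l h : P l h (z l h) by exact: projT2 (cid (Pex l h)).
have Dz l i' (y : R -> 'rV[R]_2) :
    (forall h, `|h| < s -> `|g h - x| < r -> `|y h - x| <= `|g h - x|) ->
    (fun h => jent i' l (y h)) @ 0^' --> jent i' l x.
  move=> hy; apply/cvgrPdist_lt => e e0.
  have [d d0 hd] := continuous_near ((((L_C1 l).2.2 i').1 _ (WU Ww))) e0.
  apply: filterS2 (gnear r r0) (gnear d d0) => h [h1 h2] [_ h3].
  by rewrite distrC; apply: hd; exact: le_lt_trans (hy h h1 h2) h3.
have D0 l : (fun h => jent 0 l (z l h).1) @ 0^' --> jent 0 l x.
  by apply: Dz => h h1 h2; have [] := Hz l h h1 h2.
have D1 l : (fun h => jent 1 l (z l h).2) @ 0^' --> jent 1 l x.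
  by apply: Dz => h h1 h2; have [] := Hz l h h1 h2.
pose d h := jent 0 0 (z 0 h).1 * jent 1 1 (z 1 h).2
            - jent 1 0 (z 0 h).2 * jent 0 1 (z 1 h).1.
have Dd : d @ 0^' --> jdet x.
  apply: cvgB; first exact: cvgM (D0 0) (D1 1).
  exact: cvgM (D1 0) (D0 1).
have dx := jdet_neq0 (WU Ww).
have dn : \forall h \near 0^', d h != 0 by exact: cvgr_neq0 Dd dx.
have near_ok : \forall h \near 0^', [/\ h != 0, d h != 0, `|h| < s & `|g h - x| < r].
  near=> h; split; [|by near: h| |].
  - by near: h; exact: nbhs_dnbhs_neq.
  - by have [] : `|h| < s /\ `|g h - x| < r by near: h; exact: gnear.
  - by have [] : `|h| < s /\ `|g h - x| < r by near: h; exact: gnear.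
have F : (fun h => h^-1 * ((g h - x) 0 j)) @ 0^' --> jinv i j x.
  move: j; apply: ord2P.
    have T : (fun h => ((i == 0)%:R * jent 1 1 (z 1 h).2 - (i == 1)%:R * jent 1 0 (z 0 h).2) / d h)
        @ 0^' --> jinv i 0 x.
      rewrite /jinv subr0; apply: cvgM; last exact: cvgV.
      by apply: cvgB; apply: cvgM => //; exact: cvg_cst.
    apply: cvg_trans T; apply: near_eq_cvg.
    apply: filterS near_ok => h [hn dhn h1 h2].
    have [_ _ e0] := Hz 0 h h1 h2; have [_ _ e1] := Hz 1 h h1 h2.
    exact: cramer0 e0 e1.
  have T : (fun h => ((i == 1)%:R * jent 0 0 (z 0 h).1 - (i == 0)%:R * jent 0 1 (z 1 h).1) / d h)
      @ 0^' --> jinv i 1 x.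
    rewrite /jinv subrr; apply: cvgM; last exact: cvgV.
    by apply: cvgB; apply: cvgM => //; exact: cvg_cst.
  apply: cvg_trans T; apply: near_eq_cvg.
  apply: filterS near_ok => h [hn dhn h1 h2].
  have [_ _ e0] := Hz 0 h h1 h2; have [_ _ e1] := Hz 1 h h1 h2.
  exact: cramer1 e0 e1.
have F' : (fun h => h^-1 *: ((fun v => G v 0 j : R) (h *: delta_mx 0 i + w) - G w 0 j))
    @ 0^' --> jinv i j x.
  by apply: cvg_trans F; apply: near_eq_cvg; apply: nearW => h; rewrite !mxE.
apply: DeriveDef; first by apply/cvg_ex; eexists; exact: F'.
exact/cvg_lim.
Unshelve. all: by end_near. Qed.

(** Bootstrap: the partial derivatives of G are [jinv] composed with G, so they are of class k as
    soon as G is. *)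
Lemma inverse_sm : (forall j, sm U (fun q => L q 0 j)) ->
  forall j, sm W (fun w => G w 0 j).
Proof.
move=> sL j k; move: j; elim: k => [|k IH] j.
  split=> // w Ww; apply: (@continuous_comp _ _ _ G (fun x => x 0 j));
    last exact: coord_continuous.
  suff : G @ w --> G w by [].
  apply/(@cvgrPdist_lt _ _ _ (nbhs w)) => e e0.
  have [s s0 hs] := open_ball oW Ww.
  apply: (@near_norm_ball _ _ _ _ (Num.min s (e / C))); first by rewrite lt_min s0 divr_gt0.
  move=> v /=; rewrite lt_min => /andP[vs ve].
  rewrite distrC (le_lt_trans (G_lip Ww (hs v vs)))// -ltr_pdivlMl// mulrC.
  by rewrite distrC.
have D w i (Ww : W w) := inverse_derive i j Ww.
split; [by move=> w Ww; exact: Ck_cont (IH j) Ww|split].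
  by move=> w i Ww; have [] := D w i Ww.
move=> i.
have sj l m : sm U (jent l m) by exact: sm_partial.
have Cj : Ck k U (jinv i j).
  apply: Ck_mul => //.
    by apply: Ck_add => //; [|apply: Ck_opp => //]; apply: Ck_mul => //;
      exact: Ck_cst || exact: sj.
  apply: Ck_inv => //; apply: Ck_add => //; first by apply: Ck_mul => //; exact: sj.
  by apply: Ck_opp => //; apply: Ck_mul => //; exact: sj.
apply: eq_Ck oW _ (Ck_comp oW oU WU Cj IH) => w Ww.
by rewrite [RHS](@derive_val _ _ _ _ _ _ _ (D w i Ww)).
Qed.

End InverseDerivative.

Lemma cramer_inj (R : fieldType) (a b c d w0 w1 v0 v1 : R) :
  a * d - c * b != 0 -> w0 * d - w1 * c = v0 * d - v1 * c ->
  w1 * a - w0 * b = v1 * a - v0 * b -> w0 = v0 /\ w1 = v1.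
Proof.
move=> n0 e0 e1; split; apply: (mulIf n0).
  have -> : w0 * (a * d - c * b) = (w0 * d - w1 * c) * a + (w1 * a - w0 * b) * c by ring.
  by rewrite e0 e1; ring.
have -> : w1 * (a * d - c * b) = (w0 * d - w1 * c) * b + (w1 * a - w0 * b) * d by ring.
by rewrite e0 e1; ring.
Qed.

Lemma cramer_id (R : fieldType) (a b c d : R) : a * d - c * b != 0 ->
  [/\ (a * d - b * c) / (a * d - c * b) = 1, (c * d - d * c) / (a * d - c * b) = 0,
   (b * a - a * b) / (a * d - c * b) = 0 & (d * a - c * b) / (a * d - c * b) = 1].
Proof. by move=> n0; split; field. Qed.

Section InverseFunction.
Variable R : realType.

Lemma open_preimage n (U : set 'rV[R]_n) (T : 'rV[R]_n -> 'rV[R]_2) c (e : R) :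
  open U -> (forall q j, U q -> {for q, continuous (fun q => T q 0 j : R)}) ->
  open [set q | U q /\ `|T q - c| < e].
Proof.
move=> oU cT; rewrite openE => q [Uq qe] /=.
have TT : T @ q --> T q by apply: continuous_rV => j; exact: cT.
have [s s0 hs] := open_ball oU Uq.
have : \forall x \near q, `|T q - T x| < e - `|T q - c|.
  by move/(@cvgrPdist_lt _ _ _ (nbhs q)): TT; apply; rewrite subr_gt0.
have : \forall x \near q, U x by exact: (near_norm_ball s0).
apply: (@filterS2 _ (nbhs q)) => x Ux qx; split => //.
rewrite -(subrKA (T q)) (le_lt_trans (ler_normD _ _))// distrC.
by move: qx; rewrite ltrBrDr.
Qed.

Lemma open_norm_ball n (p : 'rV[R]_n) (r : R) : open [set q : 'rV[R]_n | `|q - p| < r].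
Proof.
rewrite openE => q /= qr; apply: (@near_norm_ball _ _ _ _ (r - `|q - p|)).
  by rewrite subr_gt0.
move=> x; rewrite ltrBrDr /= => h; rewrite -(subrKA q) (le_lt_trans (ler_normD _ _))//.
by rewrite distrC.
Qed.

Lemma sm_lin n (U : set 'rV[R]_n) (f g : 'rV[R]_n -> R) a b d : open U ->
  sm U f -> sm U g -> sm U (fun q => (f q * a - g q * b) / d).
Proof.
move=> oU sf sg k; apply: Ck_mul => //; last exact: Ck_cst.
apply: Ck_add => //; first by apply: Ck_mul => //; exact: Ck_cst.
by apply: Ck_opp => //; apply: Ck_mul => //; exact: Ck_cst.
Qed.

Lemma partial_lin n (U : set 'rV[R]_n) (f g : 'rV[R]_n -> R) a b d i q :
  sm U f -> sm U g -> U q ->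
  partial i (fun q => (f q * a - g q * b) / d) q =
  (partial i f q * a - partial i g q * b) / d.
Proof.
move=> sf sg Uq.
have df := derivableP (sm_derivable (i:=i) sf Uq).
have dg := derivableP (sm_derivable (i:=i) sg Uq).
rewrite /partial.
have -> : (fun q => (f q * a - g q * b) / d) = (a / d *: f - (b / d) *: g).
  by apply/funext => x; rewrite !fctE /GRing.scale /=; ring.
by rewrite derive_val /GRing.scale /=; ring.
Qed.

(** Composing F with the inverse T of its linear part at p gives a map L whose Jacobian is the
    identity at p, hence close to it nearby. The near-identity case inverts L by some G, and
    [G \o T] inverts F. *)
Theorem inverse_function (U : set 'rV[R]_2) (F : 'rV[R]_2 -> 'rV[R]_2) p :
  open U -> (forall j, sm U (fun q => F q 0 j)) -> U p -> jdet F p != 0 ->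
  exists (V W : set 'rV[R]_2) (G : 'rV[R]_2 -> 'rV[R]_2), [/\ [/\ open V, open W, V p & V `<=` U],
    forall q, V q -> W (F q) /\ G (F q) = q,
    forall w, W w -> V (G w) /\ F (G w) = w &
    forall j, sm W (fun w => G w 0 j)].
Proof.
move=> oU sF Up d0; set d := jdet F p in d0.
pose m i j := jent F i j p.
pose T (w : 'rV[R]_2) := mk2 ((w 0 0 * m 1 1 - w 0 1 * m 1 0) / d)
                             ((w 0 1 * m 0 0 - w 0 0 * m 0 1) / d).
have Tinj w w' : T w = T w' -> w = w'.
  move=> TT; have := congr1 (fun v : 'rV[R]_2 => v 0 0) TT; have := congr1 (fun v : 'rV[R]_2 => v 0 1) TT.
  rewrite !mk20 !mk21 => /(mulIf (invr_neq0 d0)) e1 /(mulIf (invr_neq0 d0)) e0.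
  by have [] := cramer_inj d0 e0 e1; exact: rV2P.
pose L q := T (F q).
have L0 : (fun q => L q 0 0) = (fun q => (F q 0 0 * m 1 1 - F q 0 1 * m 1 0) / d).
  by apply/funext => q; rewrite mk20.
have L1 : (fun q => L q 0 1) = (fun q => (F q 0 1 * m 0 0 - F q 0 0 * m 0 1) / d).
  by apply/funext => q; rewrite mk21.
have sL j : sm U (fun q => L q 0 j : R).
  by move: j; apply: ord2P; rewrite ?L0 ?L1; exact: sm_lin.
have Lid i j : jent L i j p = (i == j)%:R.
  move: j; apply: ord2P; rewrite /jent ?L0 ?L1 (partial_lin _ _ _ _ (sF _) (sF _) Up).
    by have [] := cramer_id d0; move: i; exact: ord2P.
  by have [] := cramer_id d0; move: i; exact: ord2P.
have q4 : 0 < (1 / 4 : R) by [].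
have [s s0 hs] := open_ball oU Up.
have [e0 e00 h0] := continuous_near (Ck_cont (sm_partial 0 (sL 0) 0%N) Up) q4.
have [e1 e10 h1] := continuous_near (Ck_cont (sm_partial 0 (sL 1) 0%N) Up) q4.
have [e2 e20 h2] := continuous_near (Ck_cont (sm_partial 1 (sL 0) 0%N) Up) q4.
have [e3 e30 h3] := continuous_near (Ck_cont (sm_partial 1 (sL 1) 0%N) Up) q4.
pose t := Num.min s (Num.min (Num.min e0 e1) (Num.min e2 e3)).
have t0 : 0 < t by rewrite !lt_min s0 e00 e10 e20 e30.
(* The near-identity bounds are required on the ball of radius 3r, here t/2. *)
pose r := t / 6.
have r0 : 0 < r by rewrite divr_gt0.
have inT (z : 'rV[R]_2) : `|z - p| < t -> U z /\ forall i j, `|jent L i j z - (i == j)%:R| <= 1 / 4.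
  rewrite !lt_min => /and3P[zs /andP[z0 z1] /andP[z2 z3]]; split.
    by apply: hs; rewrite distrC.
  move=> i j; rewrite -(Lid i j); apply/ltW; move: i j.
  by apply: ord2P; apply: ord2P; [exact: h0|exact: h1|exact: h2|exact: h3].
have in3 (z : 'rV[R]_2) : `|z - p| <= 3 * r -> `|z - p| < t.
  by move=> h; apply: (le_lt_trans h); rewrite /r; move: t0; lra.
have nL z i j : `|z - p| <= 3 * r -> derivable (fun q => L q 0 j : R) z (delta_mx 0 i).
  by move=> /in3/inT[Uz _]; exact: sm_derivable Uz.
have nid z i j : `|z - p| <= 3 * r -> `|partial i (fun q => L q 0 j : R) z - (i == j)%:R| <= 1 / 4.
  by move=> /in3/inT[_]; exact.
pose U' := [set q : 'rV[R]_2 | `|q - p| < r].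
have oU' : open U' by exact: open_norm_ball.
have U'U : U' `<=` U.
  by move=> q /ltW h; have [] := inT q _ => //; apply: in3; rewrite (le_trans h)// ler_peMl// ?ltW//; lra.
pose WL := [set w : 'rV[R]_2 | `|w - L p| < r / 2].
have oWL : open WL by exact: open_norm_ball.
have /choice[G hG] : forall w, exists x, WL w -> U' x /\ L x = w.
  move=> w; have [/(near_id_surjective r0 nL nid)[x xr Lx]|nw] := pselect (WL w).
    by exists x.
  by exists p.
have G_lip w w' : WL w -> WL w' -> `|G w' - G w| <= 2 * `|w' - w|.
  move=> /hG[a b] /hG[a' b'].
  by have := near_id_lipschitz nL nid (ltW a) (ltW a'); rewrite b b'.
have detL x : U' x -> jdet L x != 0.
  move=> /ltW h; have [|_ hx] := inT x.
    by apply: in3; rewrite (le_trans h)// ler_peMl// ?ltW//; lra.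
  (* The diagonal entries are at least 3/4 and the others at most 1/4 in absolute value, so the
     determinant is positive. *)
  move: (hx 0 0) (hx 0 1) (hx 1 0) (hx 1 1); rewrite /= !ler_norml.
  rewrite /jdet; move: (jent L 0 0 x) (jent L 0 1 x) (jent L 1 0 x) (jent L 1 1 x) => a b c e.
  by move=> /andP[? ?] /andP[? ?] /andP[? ?] /andP[? ?]; apply: lt0r_neq0; nra.
have sG : forall j, sm WL (fun w => G w 0 j : R).
  apply: (@inverse_sm R U' WL L G 2) => //.
  - by move=> j; apply: Ck_sub U'U _; exact: sL.
  - by move=> w /hG[].
  - by move=> w /hG[].
  - by move=> j k; apply: Ck_sub U'U _; exact: sL.
pose V := [set q | U' q /\ `|L q - L p| < r / 2].
pose W := [set w : 'rV[R]_2 | [set: 'rV[R]_2] w /\ `|T w - L p| < r / 2].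
have sT j : sm setT (fun w => T w 0 j : R).
  have sc i : sm setT (fun w : 'rV[R]_2 => w 0 i) by move=> k; exact: Ck_coord.
  move: j; apply: ord2P.
    have -> : (fun w => T w 0 0) = (fun w => (w 0 0 * m 1 1 - w 0 1 * m 1 0) / d).
      by apply/funext => q; rewrite mk20.
    by apply: sm_lin => //; exact: openT.
  have -> : (fun w => T w 0 1) = (fun w => (w 0 1 * m 0 0 - w 0 0 * m 0 1) / d).
    by apply/funext => q; rewrite mk21.
  by apply: sm_lin => //; exact: openT.
have oW : open W.
  by apply: open_preimage => [|q j _]; [exact: openT|exact: (Ck_cont (sT j 0%N))].
exists V, W, (G \o T); split.
- split => //.
  + apply: open_preimage => // q j /U'U Uq; exact: Ck_cont (sL j 0%N) Uq.
  + by split; [rewrite /U' /= subrr normr0|rewrite subrr normr0 divr_gt0].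
  + by move=> q [/U'U].
- move=> q [U'q Vq]; split; first by split.
  have [a b] := hG (L q) Vq.
  have := near_id_lipschitz nL nid (ltW U'q) (ltW a).
  by rewrite b subrr normr0 mulr0 normr_le0 subr_eq0 => /eqP.
- move=> w [_ Ww]; have [a b] := hG (T w) Ww; split; first by split => //=; rewrite b.
  exact: Tinj.
- move=> j k; apply: (@Ck_comp R 2 k W WL (fun w => G w 0 j) T) => //.
  + by move=> w [].
  + exact: sG.
  + by move=> i; apply: Ck_sub (sT i k).
Qed.

End InverseFunction.

(** * Calculus of smooth functions *)

Section SmoothCalculus.
Variables (R : realType) (n : nat).
Implicit Types (U V : set 'rV[R]_n) (F G : 'rV[R]_n -> R).

Lemma sm_cst U c : sm U (fun=> c). Proof. by move=> k; exact: Ck_cst. Qed.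

Lemma sm_coord U j : sm U (fun q => q 0 j). Proof. by move=> k; exact: Ck_coord. Qed.

Lemma eq_sm U F G : open U -> (forall p, U p -> F p = G p) -> sm U F -> sm U G.
Proof. by move=> oU FG sF k; exact: eq_Ck oU FG (sF k). Qed.

Lemma sub_sm U V F : V `<=` U -> sm U F -> sm V F.
Proof. by move=> VU sF k; exact: Ck_sub VU (sF k). Qed.

Lemma sm_add U F G : open U -> sm U F -> sm U G -> sm U (fun p => F p + G p).
Proof. by move=> oU sF sG k; exact: Ck_add. Qed.

Lemma sm_opp U F : open U -> sm U F -> sm U (fun p => - F p).
Proof. by move=> oU sF k; exact: Ck_opp. Qed.

Lemma sm_sub U F G : open U -> sm U F -> sm U G -> sm U (fun p => F p - G p).
Proof. by move=> oU sF sG; apply: sm_add => //; exact: sm_opp. Qed.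

Lemma sm_mul U F G : open U -> sm U F -> sm U G -> sm U (fun p => F p * G p).
Proof. by move=> oU sF sG k; exact: Ck_mul. Qed.

Lemma sm_inv U F : open U -> (forall p, U p -> F p != 0) -> sm U F ->
  sm U (fun p => (F p)^-1).
Proof. by move=> oU F0 sF k; exact: Ck_inv. Qed.

Lemma sm_div U F G : open U -> (forall p, U p -> G p != 0) -> sm U F ->
  sm U G -> sm U (fun p => F p / G p).
Proof. by move=> oU G0 sF sG; apply: sm_mul => //; exact: sm_inv. Qed.

Lemma sm_exp U F m : open U -> sm U F -> sm U (fun p => F p ^+ m).
Proof.
move=> oU sF; elim: m => [|m IH].
  by apply: eq_sm oU _ (sm_cst U 1) => p _; rewrite expr0.
by apply: eq_sm oU _ (sm_mul oU sF IH) => p _; rewrite exprS.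
Qed.

Lemma sm_sum m U (F : 'I_m -> 'rV[R]_n -> R) : open U -> (forall i, sm U (F i)) ->
  sm U (fun p => \sum_i F i p).
Proof.
move=> oU sF.
suff H (r : seq 'I_m) : sm U (fun p => \sum_(i <- r) F i p) by exact: H.
elim: r => [|i r IH].
  by apply: eq_sm oU _ (sm_cst U 0) => p _; rewrite big_nil.
by apply: eq_sm oU _ (sm_add oU (sF i) IH) => p _; rewrite big_cons.
Qed.

Lemma sm_continuous U F p : sm U F -> U p -> {for p, continuous F}.
Proof. by move=> sF; exact: Ck_cont (sF 0%N). Qed.

Lemma partial_cst i (c : R) (p : 'rV[R]_n) : partial i (fun=> c) p = 0 :> R.
Proof. by rewrite /partial derive_cst. Qed.

Lemma partial_coord i j (p : 'rV[R]_n) :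
  partial i (fun q : 'rV[R]_n => q 0 j) p = (i == j)%:R :> R.
Proof. by rewrite /partial; have [_ ->] := coord_derive p i j. Qed.

Lemma eq_partial (W : normedModType R) i U (F G : 'rV[R]_n -> W) p : open U -> U p ->
  (forall q, U q -> F q = G q) -> partial i F p = partial i G p.
Proof.
by move=> oU Up FG; apply: near_eq_derive; exact: open_near oU Up FG.
Qed.

Section AtPoint.
Variables (i : 'I_n) (p : 'rV[R]_n).
Local Notation e := (delta_mx 0 i : 'rV[R]_n).

Lemma partialV F : F p != 0 -> derivable F p e ->
  partial i (fun q => (F q)^-1) p = - partial i F p / F p ^+ 2.
Proof.
move=> F0 dF; rewrite /partial deriveV// /GRing.scale /=.
by rewrite mulrC mulrN mulNr.
Qed.

End AtPoint.

End SmoothCalculus.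

(** * Functions of one real variable *)

Section OneVariable.
Variable R : realType.
Implicit Types (J K : set R) (g h : R -> R).

Lemma open_strip J : open J -> open (strip J).
Proof.
move=> oJ; apply: open_comp => // q _; exact: coord_continuous.
Qed.

Lemma coord_comp_derive n g (q : 'rV[R]_n) i j : derivable g (q 0 j) 1 ->
  is_derive q (delta_mx 0 i : 'rV[R]_n) (fun q : 'rV[R]_n => g (q 0 j))
    ((i == j)%:R * derive1 g (q 0 j)).
Proof.
move=> dg; have [->|ij] := eqVneq i j; last first.
  rewrite mul0r.
  have E : (fun h : R => h^-1 *: (g ((h *: delta_mx 0 i + q : 'rV[R]_n) 0 j) - g (q 0 j))) = cst 0.
    by apply/funext => h /=; rewrite !mxE /= eq_sym (negPf ij) mulr0 add0r subrr scaler0.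
  apply: DeriveDef; rewrite /derivable /derive E; first exact: is_cvg_cst.
  by apply: cvg_lim => //; exact: cvg_cst.
rewrite mul1r derive1E.
have E : (fun h : R => h^-1 *: (g ((h *: delta_mx 0 j + q : 'rV[R]_n) 0 j) - g (q 0 j))) =
    (fun h : R => h^-1 *: (g (h *: 1 + q 0 j) - g (q 0 j))).
  by apply/funext => h /=; rewrite !mxE !eqxx.
by apply: DeriveDef; rewrite /derivable /derive E.
Qed.

(** Read as a function of the first coordinate of a strip, a smooth function of one variable
    inherits all closure properties of [sm]. This is how smoothness in one variable is proved
    below. *)
Lemma smooth1_strip J g : open J -> smooth1 J g <-> sm (strip J) (fun q : 'rV[R]_2 => g (q 0 0)).
Proof.
move=> oJ; have oS := open_strip oJ; split=> [sg k|].
  suff H m : Ck k (strip J) (fun q : 'rV[R]_2 => derive1n (m) g (q 0 0)) by exact: (H 0%N).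
  have c (q : 'rV[R]_2) m' : strip J q -> {for q, continuous (fun q : 'rV[R]_2 => derive1n (m') g (q 0 0))}.
    move=> Jq; apply: (@continuous_comp _ _ _ (fun q : 'rV[R]_2 => q 0 0) (derive1n m' g)).
      exact: coord_continuous.
    by apply: differentiable_continuous; apply/derivable1_diffP; exact: sg.
  elim: k m => [|k IH] m; first by split=> // q; exact: c.
  have D (q : 'rV[R]_2) i (Jq : strip J q) := coord_comp_derive i (sg m _ Jq).
  split; [by move=> q; exact: c|split=> [q i Jq|i]]; first by have [] := D q i Jq.
  apply: eq_Ck oS _ (Ck_mul oS (Ck_cst k _ (i == 0)%:R) (IH m.+1)) => q Jq.
  by rewrite [RHS](@derive_val _ _ _ _ _ _ _ (D q i Jq)) derive1nS.
move=> + k; elim: k g => [|k IH] g sg t Jt.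
  have Jm : strip J (mk2 t 0) by rewrite /strip /= mk20.
  have := slice0_derive (sm_derivable (i:=0) sg Jm).
  by rewrite (_ : (fun x => g (mk2 x 0 0 0)) = g)//; apply/funext => x; rewrite mk20.
rewrite derive1Sn; apply: IH => //.
apply: eq_sm oS _ (sm_partial 0 sg) => q Jq.
have dg : derivable g (q 0 0) 1.
  have Jm : strip J (mk2 (q 0 0) 0) by rewrite /strip /= mk20.
  have := slice0_derive (sm_derivable (i:=0) sg Jm).
  by rewrite (_ : (fun x => g (mk2 x 0 0 0)) = g)//; apply/funext => x; rewrite mk20.
by rewrite [LHS](@derive_val _ _ _ _ _ _ _ (coord_comp_derive 0 dg)) eqxx mul1r.
Qed.

Lemma smooth1_derive J g : smooth1 J g -> smooth1 J (derive1 g).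
Proof. by move=> sg k t Jt; rewrite -derive1Sn; exact: sg. Qed.

Lemma smooth1_derivable J g t : smooth1 J g -> J t -> derivable g t 1.
Proof. by move=> sg Jt; exact: (sg 0%N). Qed.

Lemma smooth1_is_derive J g t : smooth1 J g -> J t -> is_derive t 1 g (derive1 g t).
Proof. by move=> sg Jt; rewrite derive1E; apply: derivableP; exact: (sg 0%N). Qed.

Lemma sub_smooth1 J K g : K `<=` J -> smooth1 J g -> smooth1 K g.
Proof. by move=> KJ sg k t /KJ; exact: sg. Qed.

Lemma derive1_near g h t : (\forall x \near t, g x = h x) -> derive1 g t = derive1 h t.
Proof. by move=> gh; rewrite !derive1E; apply: near_eq_derive. Qed.

Lemma eq_smooth1 J g h : open J -> (forall x, J x -> g x = h x) ->
  smooth1 J g -> smooth1 J h.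
Proof.
move=> oJ gh /(smooth1_strip g oJ) sg; apply/(smooth1_strip h oJ).
by apply: eq_sm sg => [|q]; [exact: open_strip|exact: gh].
Qed.

Lemma smooth1_integrate J g : (forall x, J x -> derivable g x 1) ->
  smooth1 J (derive1 g) -> smooth1 J g.
Proof. by move=> dg sg [|k] t Jt; [exact: dg|rewrite derive1Sn; exact: sg]. Qed.

Section Composition.
Variables (n : nat) (U : set 'rV[R]_n) (J : set R) (g : R -> R) (F : 'rV[R]_n -> R).
Hypotheses (oU : open U) (oJ : open J) (sg : smooth1 J g) (sF : sm U F).
Hypothesis FJ : forall q, U q -> J (F q).

(** F is padded with a zero second component, so that the composition results for maps into the
    plane apply. *)
Lemma sm_comp1 : sm U (fun q => g (F q)).
Proof.
move=> k.
have S0 : (fun q => mk2 (F q) 0 0 0) = F by apply/funext => q; rewrite mk20.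
have S1 : (fun q => mk2 (F q) 0 0 1) = (fun=> 0) by apply/funext => q; rewrite mk21.
have -> : (fun q => g (F q)) = (fun q => (fun x : 'rV[R]_2 => g (x 0 0)) (mk2 (F q) 0)).
  by apply/funext => q; rewrite mk20.
apply: (@Ck_comp R n k U (strip J) (fun x => g (x 0 0)) (fun q => mk2 (F q) 0)) => //; first exact: open_strip.
- by move=> q /FJ; rewrite /strip /= mk20.
- exact: (smooth1_strip g oJ).1.
- by apply: ord2P; rewrite ?S0 ?S1; [exact: sF|exact: sm_cst].
Qed.

Lemma partial_comp1 i p : U p ->
  partial i (fun q => g (F q)) p = derive1 g (F p) * partial i F p.
Proof.
move=> Up.
have S0 : (fun q => mk2 (F q) 0 0 0) = F by apply/funext => q; rewrite mk20.
have S1 : (fun q => mk2 (F q) 0 0 1) = (fun=> 0) by apply/funext => q; rewrite mk21.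
have E : (fun q => g (F q)) = (fun q => (fun x : 'rV[R]_2 => g (x 0 0)) (mk2 (F q) 0)).
  by apply/funext => q; rewrite mk20.
have Jp : strip J (mk2 (F p) 0) by rewrite /strip /= mk20; exact: FJ.
have dg : derivable g ((mk2 (F p) 0) 0 0) 1.
  by apply: (smooth1_derivable sg); rewrite mk20; exact: FJ.
have [|_] := @chain R 'rV[R]_n (strip J) (fun x => g (x 0 0)) (fun q => mk2 (F q) 0)
  p (delta_mx 0 i) (open_strip oJ) ((smooth1_strip g oJ).1 sg 1%N) Jp.
  by apply: ord2P; rewrite ?S0 ?S1; [exact: sm_derivable|exact: derivable_cst].
rewrite -E sum2 S0 S1 derive_cst mulr0 addr0 => DE; rewrite [LHS]DE.
by rewrite [partial 0 _ _](@derive_val _ _ _ _ _ _ _ (coord_comp_derive 0 dg)) eqxx mul1r mk20.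
Qed.

End Composition.

(** Bootstrap on the derivative 1/(2 sqrt x), which is of class k when the square root is. *)
Lemma sm_sqrt n (U : set 'rV[R]_n) (F : 'rV[R]_n -> R) : open U ->
  (forall q, U q -> 0 < F q) -> sm U F -> sm U (fun q => Num.sqrt (F q)).
Proof.
move=> oU F0 sF; have sq : smooth1 [set x : R | 0 < x] Num.sqrt.
  have oP : open [set x : R | 0 < x] by exact: open_gt.
  apply/smooth1_strip => // k; have oS := open_strip oP.
  have D (q : 'rV[R]_2) i (Jq : strip [set x : R | 0 < x] q) :=
    coord_comp_derive i (@ex_derive _ _ _ _ _ _ _ (is_derive1_sqrt Jq)).
  have c (q : 'rV[R]_2) : strip [set x : R | 0 < x] q ->
      {for q, continuous (fun q : 'rV[R]_2 => Num.sqrt (q 0 0))}.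
    move=> Jq; apply: (@continuous_comp _ _ _ (fun q : 'rV[R]_2 => q 0 0) Num.sqrt).
      exact: coord_continuous.
    exact: sqrt_continuous.
  elim: k => [|k IH]; first by split => // q; exact: c.
  split; [by move=> q; exact: c|split=> [q i Jq|i]]; first by have [] := D q i Jq.
  have n0 (q : 'rV[R]_2) : strip [set x : R | 0 < x] q -> 2 * Num.sqrt (q 0 0) != 0.
    by move=> Jq; rewrite mulf_neq0// sqrtr_eq0 -ltNge.
  have C2 := Ck_mul oS (Ck_cst k _ 2) IH.
  apply: eq_Ck oS _ (Ck_mul oS (Ck_cst k _ (i == 0)%:R) (Ck_inv oS n0 C2)) => q Jq.
  rewrite [RHS](@derive_val _ _ _ _ _ _ _ (D q i Jq)) derive1E.
  by rewrite (@derive_val _ _ _ _ _ _ _ (is_derive1_sqrt Jq)).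
apply: (@sm_comp1 n U [set x : R | 0 < x]) => //; exact: open_gt.
Qed.

Lemma smooth1_trig : smooth1 setT (@sin R) /\ smooth1 setT (@cos R).
Proof.
(* The span of sin and cos is stable under differentiation, which the induction needs. *)
have H k (a b t : R) : derivable (derive1n k (fun x => a * sin x + b * cos x)) t 1.
  elim: k a b t => [|k IH] a b t.
    by apply: derivableD; apply: derivableM => //; apply: derivable_cst.
  rewrite derive1Sn.
  rewrite (_ : derive1 _ = fun x => (- b) * sin x + a * cos x); first exact: IH.
  apply/funext => x; rewrite derive1E.
  have [_ ->] := is_deriveD (is_deriveZ a (is_derive_sin x)) (is_deriveZ b (is_derive_cos x)).
  by rewrite /GRing.scale /= addrC mulrN mulNr.
split=> k t _.
  by have := H k 1 0 t; rewrite (_ : (fun x => _) = sin)//; apply/funext => x; ring.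
by have := H k 0 1 t; rewrite (_ : (fun x => _) = cos)//; apply/funext => x; ring.
Qed.

Lemma interval_between (J : set R) a b c : is_interval J -> J a -> J b ->
  `|c - a| <= `|b - a| -> `|c - b| <= `|b - a| -> J c.
Proof.
move=> iJ Ja Jb; have [ab|ba] := leP a b.
  rewrite (ger0_norm (_ : 0 <= b - a)) ?subr_ge0// !ler_norml => /andP[? ?] /andP[? ?].
  by apply: (iJ a b) => //; apply/andP; split; lra.
rewrite (ltr0_norm (_ : b - a < 0)) ?subr_lt0// !ler_norml => /andP[? ?] /andP[? ?].
by apply: (iJ b a) => //; apply/andP; split; lra.
Qed.

Lemma MVT_interval (J : set R) (f df : R -> R) a b : is_interval J -> J a -> J b ->
  (forall x : R, J x -> is_derive x 1 f (df x)) ->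
  exists2 c, J c & f b - f a = df c * (b - a).
Proof.
move=> iJ Ja Jb D; have [ab|ba] := leP a b.
  have H x : x \in `[a, b]%R -> J x.
    by rewrite in_itv /= => /andP[ax xb]; apply: (iJ a b) => //; rewrite ax.
  have D' x : x \in `]a, b[%R -> is_derive x 1 f (df x).
    by move=> /subset_itv_oo_cc/H/D.
  have [|c /H Jc e] := MVT_segment ab D'.
    by apply: derivable_within_continuous => x /H/D[].
  by exists c.
have H x : x \in `[b, a]%R -> J x.
  by rewrite in_itv /= => /andP[ax xb]; apply: (iJ b a) => //; rewrite ax.
have D' x : x \in `]b, a[%R -> is_derive x 1 f (df x).
  by move=> /subset_itv_oo_cc/H/D.
have [|c /H Jc e] := MVT_segment (ltW ba) D'.
  by apply: derivable_within_continuous => x /H/D[].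
by exists c => //; rewrite -opprB e -mulrN opprB.
Qed.

Lemma derive0_cst (J : set R) (f : R -> R) a b : is_interval J -> J a -> J b ->
  (forall x : R, J x -> is_derive x 1 f 0) -> f a = f b.
Proof.
move=> iJ Ja Jb D; have [c _] := MVT_interval iJ Ja Jb D.
by rewrite mul0r => /eqP; rewrite subr_eq0 => /eqP.
Qed.

Lemma primitive_segment (a b : R) (f : R -> R) : a < b ->
  (forall x, a <= x <= b -> {for x, continuous f}) ->
  exists G : R -> R, forall x, a < x < b -> is_derive x 1 G (f x).
Proof.
move=> ab cf; pose G x : R := (\int[@lebesgue_measure R]_(t in `[a, x]) f t)%R.
exists G => x /andP[ax xb].
have cfx : {for x, continuous f} by apply: cf; rewrite (ltW ax) (ltW xb).
have fi : (@lebesgue_measure R).-integrable `[a, b] (EFin \o f).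
  apply: continuous_compact_integrable; first exact: segment_compact.
  apply: continuous_in_subspaceT => z; rewrite inE /= in_itv /=; exact: cf.
have [dG <-] := continuous_FTC1_closed xb fi ax cfx.
by rewrite derive1E; exact: derivableP.
Qed.

(** Integration takes place on compact segments. Each x gets a segment of J with both x and the base
    point u in its interior; subtracting the value at u makes the local primitives agree, since two
    of them differ by a constant on the common interval. *)
Lemma primitive (J : set R) g : open_interval J -> smooth1 J g ->
  exists G, smooth1 J G /\ forall x, J x -> derive1 G x = g x.
Proof.
move=> [oJ iJ [u Ju]] sg.
have cg x : J x -> {for x, continuous g}.
  move=> Jx; apply: differentiable_continuous; apply/derivable1_diffP.
  exact: (sg 0%N).
have room x : J x -> exists a b, [/\ J a, J b, a < x < b & a < u < b].
  have R0 y : J y -> exists2 e, 0 < e & J (y - e) /\ J (y + e).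
    move=> Jy; have : nbhs y J by apply: open_nbhs_nbhs.
    move/nbhs_normP => [e /= e0 he]; exists (e / 2); first by rewrite divr_gt0.
    by split; apply: he; rewrite /= ?opprB ?(addrC y) ?addrK ?subrK ?opprD ?addrNK
       ?addNKr ?normrN gtr0_norm ?divr_gt0// ltr_pdivrMr// ltr_pMr// ltr1n.
  move=> Jx; have [e e0 [Jm Jp]] := R0 x Jx; have [d d0 [Jm' Jp']] := R0 u Ju.
  exists (Num.min (x - e) (u - d)), (Num.max (x + e) (u + d)); split.
  - by rewrite /Num.min; case: ifP.
  - by rewrite /Num.max; case: ifP.
  - by rewrite gt_min lt_max; apply/andP; split; apply/orP; left; lra.
  - by rewrite gt_min lt_max; apply/andP; split; apply/orP; right; lra.
pose P x (y : R) := J x -> exists a b (G : R -> R),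
  [/\ a < x < b, a < u < b, J a, J b &
     (forall t, a < t < b -> is_derive t 1 G (g t)) /\ y = G x - G u].
have /choice[G hG] : forall x, exists y, P x y.
  move=> x; have [Jx|nJ] := pselect (J x); last by exists 0.
  have [a [b [Ja Jb ax au]]] := room x Jx.
  have [|t|H HG] := @primitive_segment a b g.
  - by move: ax => /andP[]; exact: lt_trans.
  - by move=> /andP[at_ tb]; apply: cg; apply: (iJ a b) => //; rewrite at_.
  - by exists (H x - H u) => _; exists a, b, H.
have GD x : J x -> is_derive x 1 G (g x).
  move=> Jx; have [a [b [H [ax au Ja Jb [HG Gx]]]]] := hG x Jx.
  have E y : a < y < b -> G y = H y - H u.
    move=> ay; have Jy : J y.
      by move: ay => /andP[? ?]; apply: (iJ a b) => //; rewrite !ltW.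
    have [a' [b' [H' [ax' au' Ja' Jb' [HG' ->]]]]] := hG y Jy.
    pose K := [set t | (a < t < b) && (a' < t < b')].
    have iK : is_interval K.
      move=> s t /= /andP[/andP[s1 s2] /andP[s3 s4]] /andP[/andP[t1 t2] /andP[t3 t4]] r.
      move=> /andP[sr rt]; rewrite /K /= (lt_le_trans s1 sr) (le_lt_trans rt t2).
      by rewrite (lt_le_trans s3 sr) (le_lt_trans rt t4).
    have : (H' - H) y = (H' - H) u.
      apply: (derive0_cst iK); rewrite /K /= ?ay ?au//.
      move=> t /andP[h1 h2]; rewrite -(subrr (g t)).
      by apply: is_deriveB; [exact: HG'|exact: HG].
    rewrite !fctE => e; apply/eqP; rewrite -subr_eq0; apply/eqP.
    have -> : H' y - H' u - (H y - H u) = (H' y - H y) - (H' u - H u) by ring.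
    by rewrite e subrr.
  have N : \forall y \near x, H y - H u = G y.
    move: (ax) => /andP[ax1 ax2]; near=> y; rewrite E//; apply/andP; split; near: y.
      exact: lt_nbhsr.
    exact: lt_nbhsl.
  apply: (near_eq_is_derive N).
  rewrite -[g x]subr0; exact: is_deriveB (HG x ax) (is_derive_cst (H u) x 1).
exists G; split; last by move=> x Jx; rewrite derive1E; have [_ ->] := GD x Jx.
have GE x : J x -> derive1 G x = g x by move=> Jx; rewrite derive1E; have [_ ->] := GD x Jx.
apply: smooth1_integrate => [x Jx|]; first by have [] := GD x Jx.
by apply: eq_smooth1 sg => // x Jx; rewrite GE.
Unshelve. all: by end_near. Qed.

End OneVariable.

(** * Geometry of the ambient space *)

Lemma is_derive_as (R : realType) (V W : normedModType R) (g h : V -> W) (p v : V) dg dh :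
  is_derive p v g dg -> h = g -> dg = dh -> is_derive p v h dh.
Proof. by move=> D -> <-. Qed.

Section Space.
Variable R : realType.
Implicit Types (v w : 'rV[R]_5) (x y z : 'rV[R]_4).

Lemma rVD n (v w : 'rV[R]_n) j : (v + w) 0 j = v 0 j + w 0 j. Proof. exact: mxE. Qed.
Lemma rVN n (v : 'rV[R]_n) j : (- v) 0 j = - v 0 j. Proof. exact: mxE. Qed.
Lemma rVZ n a (v : 'rV[R]_n) j : (a *: v) 0 j = a * v 0 j. Proof. exact: mxE. Qed.
Definition rVE := (rVD, rVN, rVZ).

Definition sp v : 'rV[R]_4 := \row_k v 0 (lift 0 k).
Definition dot x y : R := \sum_k x 0 k * y 0 k.
Definition mk5 (t : R) x : 'rV[R]_5 :=
  \row_k (if unlift 0 k is Some j then x 0 j else t).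

Lemma spE v k : sp v 0 k = v 0 (lift 0 k). Proof. by rewrite mxE. Qed.

Lemma ord5P (P : 'I_5 -> Prop) : P 0 -> (forall k, P (lift 0 k)) -> forall i, P i.
Proof. by move=> P0 P1 i; case: (unliftP 0 i) => [j|] ->. Qed.

Lemma rV5P v w : v 0 0 = w 0 0 -> sp v = sp w -> v = w.
Proof.
move=> h0 h1; apply/rowP; apply: ord5P => // k.
by rewrite -!spE h1.
Qed.

Lemma mk50 t x : mk5 t x 0 0 = t. Proof. by rewrite mxE unlift_none. Qed.
Lemma sp_mk5 t x : sp (mk5 t x) = x.
Proof. by apply/rowP => k; rewrite !mxE liftK. Qed.
Lemma mk5K v : mk5 (v 0 0) (sp v) = v.
Proof. by apply: rV5P; rewrite ?mk50 ?sp_mk5. Qed.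

Fact sp_is_linear : linear sp.
Proof. by move=> a v w; apply/rowP => k; rewrite !mxE. Qed.
HB.instance Definition _ := GRing.isLinear.Build R 'rV[R]_5 'rV[R]_4 _ sp sp_is_linear.

Lemma spD v w : sp (v + w) = sp v + sp w. Proof. exact: linearD. Qed.
Lemma spN v : sp (- v) = - sp v. Proof. exact: linearN. Qed.
Lemma spZ a v : sp (a *: v) = a *: sp v. Proof. exact: linearZ. Qed.
Definition spL := (spD, spN, spZ).

Lemma dotC x y : dot x y = dot y x.
Proof. by apply: eq_bigr => k _; rewrite mulrC. Qed.
Lemma dotDl x y z : dot (x + y) z = dot x z + dot y z.
Proof. by rewrite -big_split; apply: eq_bigr => k _; rewrite mxE mulrDl. Qed.
Lemma dotZl a x y : dot (a *: x) y = a * dot x y.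
Proof. by rewrite mulr_sumr; apply: eq_bigr => k _; rewrite mxE mulrA. Qed.
Lemma dotDr x y z : dot x (y + z) = dot x y + dot x z.
Proof. by rewrite ![dot x _]dotC dotDl. Qed.
Lemma dotZr a x y : dot x (a *: y) = a * dot x y.
Proof. by rewrite ![dot x _]dotC dotZl. Qed.
Lemma dotNl x y : dot (- x) y = - dot x y.
Proof. by rewrite -scaleN1r dotZl mulN1r. Qed.
Lemma dotNr x y : dot x (- y) = - dot x y.
Proof. by rewrite -scaleN1r dotZr mulN1r. Qed.
Lemma dot0l x : dot 0 x = 0. Proof. by rewrite -(scale0r 0) dotZl mul0r. Qed.
Lemma dot0r x : dot x 0 = 0. Proof. by rewrite dotC dot0l. Qed.
Definition dotE := (dotDl, dotDr, dotNl, dotNr, dotZl, dotZr, dot0l, dot0r).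

Lemma dot_ge0 x : 0 <= dot x x.
Proof. by apply: sumr_ge0 => k _; rewrite -expr2 sqr_ge0. Qed.
Lemma dot_eq0 x : (dot x x == 0) = (x == 0).
Proof.
apply/eqP/eqP => [|->]; last by rewrite dot0l.
move=> /psumr_eq0P h; apply/rowP => k; rewrite mxE.
have /eqP := h (fun i _ => sqr_ge0 (x 0 i)) k isT.
by rewrite -expr2 sqrf_eq0 => /eqP.
Qed.

Variable f : R -> R.

Lemma inner_rw (p v w : 'rV[R]_5) :
  inner (rw_metric f) p v w = - (v 0 0 * w 0 0) + f (p 0 0) ^+ 2 * dot (sp v) (sp w).
Proof.
have E k : (v *m rw_metric f p) 0 k = v 0 k * (if k == 0 then -1 else f (p 0 0) ^+ 2).
  rewrite mxE (bigD1 k)//= mxE eqxx big1 ?addr0// => i ik.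
  by rewrite mxE (negPf ik) mulr0.
rewrite /inner mxE big_ord_recl E eqxx !mxE mulrN1 mulNr; congr (_ + _).
rewrite mulr_sumr; apply: eq_bigr => k _; rewrite E !mxE /=.
by rewrite (mulrC (v 0 _)) -mulrA.
Qed.

Lemma invmx_rw (p : 'rV[R]_5) : f (p 0 0) != 0 -> invmx (rw_metric f p) =
  \matrix_(i, j) if i == j then (if i == 0 then -1 else (f (p 0 0) ^+ 2)^-1) else 0.
Proof.
move=> f0; set G := rw_metric f p; set K := \matrix_(i, j) _.
have KG : K *m G = 1%:M.
  apply/matrixP => i j; rewrite !mxE (bigD1 i)//= !mxE eqxx big1 ?addr0; last first.
    by move=> k ki; rewrite !mxE eq_sym (negPf ki) mul0r.
  case: (i == j); last by rewrite mulr0.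
  by case: (i == 0); rewrite ?mulrNN ?mulr1// mulVf// expf_neq0.
have [uG _] := mulmx1_unit (mulmx1C KG).
by rewrite -[K]mulmx1 -(mulmxV uG) mulmxA KG mul1mx.
Qed.

Lemma partial_rw_metric (i a b : 'I_5) (p : 'rV[R]_5) : derivable f (p 0 0) 1 ->
  partial i (rw_metric f) p a b =
  ((i == 0) && (a == b) && (a != 0))%:R * (2 * f (p 0 0) * derive1 f (p 0 0)).
Proof.
move=> df.
have D1 c d : is_derive p (delta_mx 0 i : 'rV[R]_5) (fun q => rw_metric f q c d : R)
    (((i == 0) && (c == d) && (c != 0))%:R * (2 * f (p 0 0) * derive1 f (p 0 0))).
  have [cd|cd] := eqVneq c d; last first.
    rewrite andbF mul0r (_ : (fun q => _) = fun=> 0); first exact: is_derive_cst.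
    by apply/funext => q; rewrite mxE (negPf cd).
  have [c0|c0] := eqVneq c 0.
    rewrite andbF mul0r (_ : (fun q => _) = fun=> -1); first exact: is_derive_cst.
    by apply/funext => q; rewrite mxE cd eqxx -cd c0.
  rewrite !andbT (_ : (fun q => _) = (fun q : 'rV[R]_5 => f (q 0 0) ^+ 2)); last first.
    by apply/funext => q; rewrite mxE cd eqxx -cd (negPf c0).
  have D := coord_comp_derive i df.
  apply: (is_derive_as (is_deriveX 2 D)) => //.
  by rewrite /GRing.scale /= expr1; ring.
have dG : derivable (rw_metric f) p (delta_mx 0 i).
  by apply/derivable_mxP => c d; have [] := D1 c d.
by rewrite /partial derive_mx// mxE; have [_ ->] := D1 a b.
Qed.

Lemma christoffel_rw (p : 'rV[R]_5) k i j : derivable f (p 0 0) 1 -> f (p 0 0) != 0 ->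
  christoffel (rw_metric f) p k i j =
  if k == 0 then ((i == j) && (i != 0))%:R * (f (p 0 0) * derive1 f (p 0 0))
  else (((i == 0) && (j == k))%:R + ((j == 0) && (i == k))%:R) *
    (derive1 f (p 0 0) / f (p 0 0)).
Proof.
move=> df f0; pose pd a b c := partial a (rw_metric f) p b c.
have pdE a b c : pd a b c = ((a == 0) && (b == c) && (b != 0))%:R *
    (2 * f (p 0 0) * derive1 f (p 0 0)) by exact: partial_rw_metric.
have -> : christoffel (rw_metric f) p k i j =
    2^-1 * \sum_l invmx (rw_metric f p) k l * (pd i j l + pd j i l - pd l i j) by [].
rewrite (invmx_rw f0) (bigD1 k)//= big1 ?addr0; last first.
  by move=> l lk; rewrite mxE eq_sym (negPf lk) mul0r.
rewrite !pdE mxE eqxx.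
have [->|k0] := eqVneq k 0.
  case: (eqVneq i 0) => [i0|i0]; case: (eqVneq j 0) => [j0|j0];
    by rewrite ?andbF ?andbT /=; field.
case: (eqVneq i 0) => [i0|i0]; case: (eqVneq j 0) => [j0|j0]; rewrite /= ?andbF ?andbT /=.
- by rewrite i0 j0 eq_sym (negPf k0) /=; field.
- by case: (j == k) => /=; field.
- by case: (i == k) => /=; field.
- by field.
Qed.

Lemma sum_christoffel_rw (p v w : 'rV[R]_5) k : derivable f (p 0 0) 1 -> f (p 0 0) != 0 ->
  \sum_i \sum_j christoffel (rw_metric f) p k i j * v 0 i * w 0 j =
  if k == 0 then f (p 0 0) * derive1 f (p 0 0) * dot (sp v) (sp w)
  else derive1 f (p 0 0) / f (p 0 0) * (v 0 0 * w 0 k + w 0 0 * v 0 k).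
Proof.
move=> df f0; have [->|k0] := eqVneq k 0.
  rewrite big_ord_recl big1 ?add0r => [|j _]; last by rewrite christoffel_rw//= andbF !mul0r.
  rewrite mulr_sumr; apply: eq_bigr => i _; rewrite (bigD1 (lift ord0 i))//= big1 ?addr0.
    by rewrite christoffel_rw//= !eqxx /= mul1r !mxE mulrA.
  by move=> j ji; rewrite christoffel_rw//= eq_sym (negPf ji) !mul0r.
rewrite (bigD1 0)//= (bigD1 k)//= [X in _ + X + _]big1 => [|j jk]; last first.
  rewrite christoffel_rw// (negPf k0) eqxx (negPf jk) /= (eq_sym 0 k) (negPf k0) andbF.
  by rewrite add0r !mul0r.
rewrite (bigD1 k)//= [X in _ + (_ + X)]big1 => [|i /andP[i0 ik]]; last first.
  apply: big1 => j _; rewrite christoffel_rw// (negPf k0) (negPf i0) (negPf ik) /= andbF.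
  by rewrite add0r !mul0r.
rewrite (bigD1 0)//= [X in _ + (_ + X + _)]big1 => [|j j0]; last first.
  by rewrite christoffel_rw// (negPf k0) (negPf j0) /= addr0 !mul0r.
rewrite !christoffel_rw// !eqxx (negPf k0) (eq_sym 0 k) (negPf k0) /=.
by field.
Qed.

(** The warped-product curvature: planes containing d/dt have sectional curvature f''/f, planes
    orthogonal to it (f'/f)^2. *)
Definition rw_curv (t : R) (x y z : 'rV[R]_5) : 'rV[R]_5 :=
  let f0 := f t in let f1 := derive1 f t in let f2 := derive1 (derive1 f) t in
  mk5 (f0 * f2 * (x 0 0 * dot (sp y) (sp z) - y 0 0 * dot (sp x) (sp z)))
    (f2 / f0 * z 0 0 *: (x 0 0 *: sp y - y 0 0 *: sp x)
     + f1 ^+ 2 *: (dot (sp y) (sp z) *: sp x - dot (sp x) (sp z) *: sp y)).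

(* The Christoffel term of the covariant derivative: Gamma(v, w) at p. *)
Definition gam (p v w : 'rV[R]_5) : 'rV[R]_5 :=
  mk5 (f (p 0 0) * derive1 f (p 0 0) * dot (sp v) (sp w))
    (derive1 f (p 0 0) / f (p 0 0) *: (v 0 0 *: sp w + w 0 0 *: sp v)).

(** The t-derivative of [gam] with its vector arguments fixed; [gam] depends on the point through t
    alone. *)
Definition dgam (p y z : 'rV[R]_5) : 'rV[R]_5 :=
  mk5 ((derive1 f (p 0 0) ^+ 2 + f (p 0 0) * derive1 (derive1 f) (p 0 0)) * dot (sp y) (sp z))
    ((derive1 (derive1 f) (p 0 0) / f (p 0 0) - (derive1 f (p 0 0) / f (p 0 0)) ^+ 2) *:
      (y 0 0 *: sp z + z 0 0 *: sp y)).

(** The coordinate expression of the curvature: derivative of Gamma plus Gamma composed with Gamma,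
    antisymmetrized in x and y. *)
Lemma gam_comm (p x y z : 'rV[R]_5) : f (p 0 0) != 0 ->
  x 0 0 *: dgam p y z + gam p x (gam p y z) -
  (y 0 0 *: dgam p x z + gam p y (gam p x z)) = rw_curv (p 0 0) x y z.
Proof.
move=> fp; rewrite /gam /dgam /rw_curv; apply: rV5P.
  by rewrite !rVE !mk50 !sp_mk5 !dotE (dotC (sp y) (sp x)); field.
rewrite !spL !sp_mk5 !mk50.
by apply/rowP => k; rewrite !rVE; field.
Qed.

Lemma gamE (p v w : 'rV[R]_5) : derivable f (p 0 0) 1 -> f (p 0 0) != 0 ->
  \row_k (\sum_i \sum_j christoffel (rw_metric f) p k i j * v 0 i * w 0 j) = gam p v w.
Proof.
move=> df f0; apply/rowP => k; rewrite mxE sum_christoffel_rw//.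
move: k; apply: ord5P; first by rewrite mk50.
by move=> k; rewrite -[RHS]spE sp_mk5 !mxE.
Qed.

Variable I : set R.
Hypotheses (oI : open I) (sf : smooth1 I f) (f0 : forall t, I t -> f t != 0).

Lemma gam_derive (p y z : 'rV[R]_5) i : I (p 0 0) ->
  is_derive p (delta_mx 0 i : 'rV[R]_5) (fun q => gam q y z)
   ((i == 0)%:R *: dgam p y z).
Proof.
move=> Ip; have fp := f0 Ip.
have D0 := coord_comp_derive i (smooth1_derivable sf Ip).
have D1 := coord_comp_derive i (smooth1_derivable (smooth1_derive sf) Ip).
have D : forall k, is_derive p (delta_mx 0 i : 'rV[R]_5) (fun q => gam q y z 0 k : R)
   (((i == 0)%:R *: dgam p y z) 0 k).
  apply: ord5P => [|k].
    rewrite rVZ /dgam mk50 (_ : (fun q => _) = (fun q : 'rV[R]_5 =>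
       f (q 0 0) * derive1 f (q 0 0) * dot (sp y) (sp z))); last first.
      by apply/funext => q; rewrite mk50.
    apply: (is_derive_as (is_deriveM (is_deriveM D0 D1)
      (is_derive_cst (dot (sp y) (sp z)) p _))) => //.
    by rewrite scaler0 add0r /cst /GRing.scale /=; ring.
  rewrite rVZ /dgam -[mk5 _ _ 0 _]spE sp_mk5 (_ : (fun q => _) = (fun q : 'rV[R]_5 =>
       derive1 f (q 0 0) * (f (q 0 0))^-1 * (y 0 0 *: sp z + z 0 0 *: sp y) 0 k)); last first.
    by apply/funext => q; rewrite -spE sp_mk5 mxE.
  have DV : is_derive p (delta_mx 0 i : 'rV[R]_5) (fun q : 'rV[R]_5 => (f (q 0 0))^-1 : R)
      (- ((i == 0)%:R * derive1 f (p 0 0)) / f (p 0 0) ^+ 2).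
    have [dF eF] := D0; apply: DeriveDef; first exact: derivableV.
    by rewrite [LHS](partialV fp dF) /partial eF.
  apply: (is_derive_as (is_deriveM (is_deriveM D1 DV)
    (is_derive_cst ((y 0 0 *: sp z + z 0 0 *: sp y) 0 k) p _))) => //.
  rewrite scaler0 add0r /cst [in RHS]mxE.
  by move: ((y 0 0 *: sp z + z 0 0 *: sp y) 0 k) => W; rewrite /GRing.scale /=; field.
have dG : derivable (fun q => gam q y z) p (delta_mx 0 i).
  by apply/derivable_mxP => c k; rewrite (ord1 c); have [] := D k.
apply: DeriveDef => //; rewrite derive_mx//; apply/rowP => k.
by rewrite mxE; have [_ ->] := D k.
Qed.

Lemma curvature_rw (p x y z : 'rV[R]_5) : I (p 0 0) ->
  curvature (rw_metric f) p x y z = rw_curv (p 0 0) x y z.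
Proof.
move=> Ip; have fp := f0 Ip; have df := smooth1_derivable sf Ip.
have oU : open [set q : 'rV[R]_5 | I (q 0 0)].
  by apply: open_comp => // q _; exact: coord_continuous.
have L (u w q : 'rV[R]_5) : I (q 0 0) -> levi_civita (rw_metric f) (fun=> u) (fun=> w) q = gam q u w.
  move=> Iq; rewrite /levi_civita gamE; [|exact: smooth1_derivable Iq|exact: f0].
  by rewrite big1 ?add0r// => i _; rewrite /partial derive_cst scaler0.
have LL (u v w : 'rV[R]_5) : levi_civita (rw_metric f) (fun=> u) (levi_civita (rw_metric f) (fun=> v) (fun=> w)) p =
   u 0 0 *: dgam p v w + gam p u (gam p v w).
  rewrite {1}/levi_civita gamE// L//; congr (_ + _).
  under eq_bigr => i _ do rewrite (eq_partial i oU Ip (L v w))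
     [partial i _ p](@derive_val _ _ _ _ _ _ _ (gam_derive v w i Ip)).
  rewrite big_ord_recl big1 ?addr0 ?scale1r// => i _.
  by rewrite /= scale0r scaler0.
have -> : curvature (rw_metric f) p x y z =
    levi_civita (rw_metric f) (fun=> x) (levi_civita (rw_metric f) (fun=> y) (fun=> z)) p -
    levi_civita (rw_metric f) (fun=> y) (levi_civita (rw_metric f) (fun=> x) (fun=> z)) p.
  rewrite /curvature /curvature_field -[RHS]subr0; congr (_ - _).
  have -> : lie_bracket (fun=> x) (fun=> y) = fun=> 0.
    apply/funext => q; rewrite /lie_bracket big1// => i _.
    by rewrite /partial !derive_cst !scaler0 subrr.
  rewrite L//; apply: rV5P; rewrite ?mk50 ?sp_mk5 ?linear0 ?mxE ?dotE ?mulr0//.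
  by rewrite scale0r addr0 scaler0.
by rewrite !LL gam_comm.
Qed.

End Space.

Lemma mk5S (R : realType) (t : R) x k : mk5 t x 0 (lift 0 k) = x 0 k.
Proof. by rewrite -spE sp_mk5. Qed.

Lemma ord2_cases (i : 'I_2) : i = 0 \/ i = 1.
Proof. by move: i; apply: ord2P; [left|right]. Qed.

Section DeriveRules.
Variables (R : realType) (V : normedModType R) (p v : V).
Implicit Types (F G : V -> R) (a b : R).

Lemma idD F G a b : is_derive p v F a -> is_derive p v G b ->
  is_derive p v (fun x => F x + G x) (a + b).
Proof. exact: is_deriveD. Qed.

Lemma idN F a : is_derive p v F a -> is_derive p v (fun x => - F x) (- a).
Proof. exact: is_deriveN. Qed.

Lemma idB F G a b : is_derive p v F a -> is_derive p v G b ->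
  is_derive p v (fun x => F x - G x) (a - b).
Proof. exact: is_deriveB. Qed.

Lemma idM F G a b : is_derive p v F a -> is_derive p v G b ->
  is_derive p v (fun x => F x * G x) (F p * b + G p * a).
Proof. by move=> DF DG; exact: is_deriveM DF DG. Qed.

Lemma idV F a : F p != 0 -> is_derive p v F a ->
  is_derive p v (fun x => (F x)^-1) (- a / F p ^+ 2).
Proof.
move=> F0 [dF <-]; apply: DeriveDef; first exact: derivableV.
by rewrite [LHS](deriveV F0 dF) /GRing.scale /= mulrC mulrN mulNr.
Qed.

Lemma id_div F G a b : G p != 0 -> is_derive p v F a -> is_derive p v G b ->
  is_derive p v (fun x => F x / G x) ((a * G p - F p * b) / G p ^+ 2).
Proof.
move=> G0 DF DG; apply: (is_derive_as (idM DF (idV G0 DG))) => //.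
by field.
Qed.

End DeriveRules.

Lemma partialE (R : realType) n (W : normedModType R) (F : 'rV[R]_n -> W) i p w :
  is_derive p (delta_mx 0 i : 'rV[R]_n) F w -> partial i F p = w.
Proof. by case. Qed.

Lemma regroup (V : zmodType) (a b c x y z : V) :
  a + (b + c + x) + (y + z) = a + (b + z) + (c + (x + y)).
Proof. by rewrite -!addrA; do 2!congr (_ + _); rewrite addrA [RHS]addrC -!addrA. Qed.

Lemma cancel_outer (V : zmodType) (a b c x y z : V) :
  a + b + (x + (y + z)) - (a + c + (x + (z + y))) = b - c.
Proof.
by rewrite (addrAC a b) (addrAC a c) opprD addrACA (addrC z) subrr add0r.
Qed.

Local Opaque partial.

(** * Covariant calculus along a parametrized surface *)

Section Along.
Variables (R : realType) (I : set R) (f : R -> R).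
Hypotheses (oI : open I) (sf : smooth1 I f) (f0 : forall t, I t -> f t != 0).
Variables (U : set 'rV[R]_2) (F : 'rV[R]_2 -> 'rV[R]_5).
Hypothesis oU : open U.

Definition smF (V : 'rV[R]_2 -> 'rV[R]_5) := forall k, sm U (fun q => V q 0 k).

Hypotheses (sF : smF F) (FI : forall q, U q -> I (F q 0 0)).
Implicit Types (V W Y Z : 'rV[R]_2 -> 'rV[R]_5) (a b : 'rV[R]_2 -> R).

Local Notation g := (rw_metric f).
Local Notation ip q := (inner g (F q)).
Local Notation D := (cov_along g F).
Local Notation d := (@partial R 2 'rV[R]_5).

Lemma fld_derivable V q i : smF V -> U q -> derivable V q (delta_mx 0 i).
Proof.
by move=> sV Uq; apply/derivable_mxP => c k; rewrite (ord1 c); exact: sm_derivable (sV k) Uq.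
Qed.

Lemma fld_partial V q i k : smF V -> U q ->
  d i V q 0 k = partial i (fun q => V q 0 k : R) q.
Proof. by move=> sV Uq; apply: partial_mx; exact: fld_derivable. Qed.

Lemma eq_smF V W : (forall q, U q -> V q = W q) -> smF V -> smF W.
Proof. by move=> VW sV k; apply: eq_sm (sV k) => // q /VW ->. Qed.

Lemma smF_partial V i : smF V -> smF (d i V).
Proof.
move=> sV k; apply: eq_sm oU _ (sm_partial i (sV k)) => q Uq.
by rewrite fld_partial.
Qed.

Lemma smF_add V W : smF V -> smF W -> smF (fun q => V q + W q).
Proof.
move=> sV sW k; apply: eq_sm oU _ (sm_add oU (sV k) (sW k)) => q Uq.
by rewrite rVD.
Qed.

Lemma smF_scale a V : sm U a -> smF V -> smF (fun q => a q *: V q).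
Proof.
move=> sa sV k; apply: eq_sm oU _ (sm_mul oU sa (sV k)) => q Uq.
by rewrite rVZ.
Qed.

Lemma sm_dot V W : smF V -> smF W -> sm U (fun q => dot (sp (V q)) (sp (W q))).
Proof.
move=> sV sW; apply: sm_sum => // k.
apply: eq_sm oU _ (sm_mul oU (sV (lift 0 k)) (sW (lift 0 k))) => q Uq.
by rewrite !spE.
Qed.

Lemma sm_f : sm U (fun q => f (F q 0 0)).
Proof. exact: (sm_comp1 oU oI sf (sF 0) FI). Qed.

Lemma sm_f1 : sm U (fun q => derive1 f (F q 0 0)).
Proof. exact: (sm_comp1 oU oI (smooth1_derive sf) (sF 0) FI). Qed.

Lemma fld_derive V q i k : smF V -> U q ->
  is_derive q (delta_mx 0 i : 'rV[R]_2) (fun q => V q 0 k : R) (d i V q 0 k).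
Proof.
by move=> sV Uq; rewrite fld_partial//; apply: derivableP; exact: sm_derivable (sV k) Uq.
Qed.

Lemma derive_dot V W q i : smF V -> smF W -> U q ->
  is_derive q (delta_mx 0 i : 'rV[R]_2) (fun q => dot (sp (V q)) (sp (W q)))
    (dot (sp (d i V q)) (sp (W q)) + dot (sp (V q)) (sp (d i W q))).
Proof.
move=> sV sW Uq.
have H k := idM (fld_derive i (lift 0 k) sV Uq) (fld_derive i (lift 0 k) sW Uq).
apply: (is_derive_as (is_derive_sum H)).
  apply/funext => x; rewrite fct_sumE; apply: eq_bigr => k _; by rewrite !spE.
rewrite /dot -big_split /=; apply: eq_bigr => k _; rewrite !spE.
by rewrite addrC (mulrC (W q 0 _)).
Qed.

Lemma derive_f q i : U q -> is_derive q (delta_mx 0 i : 'rV[R]_2)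
  (fun q => f (F q 0 0)) (derive1 f (F q 0 0) * d i F q 0 0).
Proof.
move=> Uq; rewrite fld_partial// -(partial_comp1 oI sf (sF 0) FI)//.
by apply: derivableP; exact: sm_derivable sm_f Uq.
Qed.

Lemma derive_f1 q i : U q -> is_derive q (delta_mx 0 i : 'rV[R]_2)
  (fun q => derive1 f (F q 0 0)) (derive1 (derive1 f) (F q 0 0) * d i F q 0 0).
Proof.
move=> Uq; rewrite fld_partial// -(partial_comp1 oI (smooth1_derive sf) (sF 0) FI)//.
by apply: derivableP; exact: sm_derivable sm_f1 Uq.
Qed.

Lemma covE i V q : U q -> D i V q = d i V q + gam f (F q) (d i F q) (V q).
Proof.
move=> Uq; rewrite -gamE//; first exact: (smooth1_derivable sf (FI Uq)).
exact: f0 (FI Uq).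
Qed.

Lemma smF_gam Y Z : smF Y -> smF Z -> smF (fun q => gam f (F q) (Y q) (Z q)).
Proof.
move=> sY sZ; apply: ord5P => [|k].
  apply: eq_sm oU _ (sm_mul oU (sm_mul oU sm_f sm_f1) (sm_dot sY sZ)) => q Uq.
  by rewrite mk50.
have s1 := sm_add oU (sm_mul oU (sY 0) (sZ (lift 0 k))) (sm_mul oU (sZ 0) (sY (lift 0 k))).
have s2 : sm U (fun q => derive1 f (F q 0 0) / f (F q 0 0)).
  by apply: sm_div => //; [move=> q /FI/f0|exact: sm_f1|exact: sm_f].
apply: eq_sm oU _ (sm_mul oU s2 s1) => q Uq.
by rewrite mk5S !rVE !spE.
Qed.

Lemma smF_cov i V : smF V -> smF (D i V).
Proof.
move=> sV; apply: eq_smF (smF_add (smF_partial i sV) (smF_gam (smF_partial i sF) sV)).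
by move=> q Uq; rewrite covE.
Qed.

Lemma partial_gam i Y Z q : smF Y -> smF Z -> U q ->
  d i (fun q => gam f (F q) (Y q) (Z q)) q =
  d i F q 0 0 *: dgam f (F q) (Y q) (Z q) +
  gam f (F q) (d i Y q) (Z q) + gam f (F q) (Y q) (d i Z q).
Proof.
move=> sY sZ Uq; have fq := f0 (FI Uq).
have Df := derive_f i Uq; have Df1 := derive_f1 i Uq.
apply/rowP; apply: ord5P => [|k]; rewrite (fld_partial _ _ (smF_gam sY sZ) Uq).
  apply: etrans (partialE (is_derive_as (idM (idM Df Df1) (derive_dot i sY sZ Uq)) _ erefl)) _.
    by apply/funext => x; rewrite mk50.
  rewrite !rVE !mk50.
  by ring.
have DY m := fld_derive i m sY Uq; have DZ m := fld_derive i m sZ Uq.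
apply: etrans (partialE (is_derive_as (idM (id_div fq Df1 Df) (idD
  (idM (DY 0) (DZ (lift 0 k))) (idM (DZ 0) (DY (lift 0 k))))) _ erefl)) _.
  by apply/funext => x; rewrite mk5S !rVE !spE.
by rewrite !rVE !mk5S !rVE !spE; field.
Qed.

Lemma ipC q (v w : 'rV[R]_5) : ip q v w = ip q w v.
Proof. by rewrite !inner_rw dotC (mulrC (v 0 0)). Qed.
Lemma ipDl q (u v w : 'rV[R]_5) : ip q (u + v) w = ip q u w + ip q v w.
Proof. by rewrite !inner_rw spD dotDl rVD; ring. Qed.
Lemma ipZl q c (v w : 'rV[R]_5) : ip q (c *: v) w = c * ip q v w.
Proof. by rewrite !inner_rw spZ dotZl rVZ; ring. Qed.
Lemma ipDr q (u v w : 'rV[R]_5) : ip q u (v + w) = ip q u v + ip q u w.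
Proof. by rewrite ipC ipDl !(ipC q u). Qed.
Lemma ipZr q c (v w : 'rV[R]_5) : ip q v (c *: w) = c * ip q v w.
Proof. by rewrite ipC ipZl (ipC q v). Qed.
Lemma ipNl q (v w : 'rV[R]_5) : ip q (- v) w = - ip q v w.
Proof. by rewrite -scaleN1r ipZl mulN1r. Qed.
Lemma ipNr q (v w : 'rV[R]_5) : ip q v (- w) = - ip q v w.
Proof. by rewrite -scaleN1r ipZr mulN1r. Qed.
Lemma ip0l q (v : 'rV[R]_5) : ip q 0 v = 0.
Proof. by rewrite -(scale0r v) ipZl mul0r. Qed.
Lemma ip0r q (v : 'rV[R]_5) : ip q v 0 = 0.
Proof. by rewrite ipC ip0l. Qed.

Lemma sm_ip V W : smF V -> smF W -> sm U (fun q => ip q (V q) (W q)).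
Proof.
move=> sV sW; have s1 := sm_mul oU (sm_exp 2 oU sm_f) (sm_dot sV sW).
apply: eq_sm oU _ (sm_add oU (sm_opp oU (sm_mul oU (sV 0) (sW 0))) s1) => q Uq.
by rewrite inner_rw.
Qed.

Lemma ip_compat k V W q : smF V -> smF W -> U q ->
  partial k (fun q => ip q (V q) (W q)) q = ip q (D k V q) (W q) + ip q (V q) (D k W q).
Proof.
move=> sV sW Uq; have fq := f0 (FI Uq).
have Df := derive_f k Uq.
apply: etrans (partialE (is_derive_as (idD (idN (idM (fld_derive k 0 sV Uq) (fld_derive k 0 sW Uq)))
  (idM (idM Df Df) (derive_dot k sV sW Uq))) _ erefl)) _.
  by apply/funext => x; rewrite inner_rw expr2.
rewrite !covE// !inner_rw !rVE !mk50 !spL !sp_mk5 !dotE.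
by rewrite (dotC (sp (V q)) (sp (d k F q))); field.
Qed.

Lemma partial_fldC V i j q : smF V -> U q -> d i (d j V) q = d j (d i V) q.
Proof.
move=> sV Uq; apply/rowP => k.
have E m n : d m (d n V) q 0 k = partial m (partial n (fun q => V q 0 k : R)) q.
  apply: etrans (fld_partial _ _ (smF_partial _ sV) Uq) _.
  by apply: eq_partial oU Uq _ => x Ux; rewrite fld_partial.
have C := partialC oU (sV k 2%N) Uq.
apply: etrans (E i j) _; apply: etrans _ (esym (E j i)).
by have [->|->] := ord2_cases i; have [->|->] := ord2_cases j;
  [exact: erefl|exact: C|exact: esym C|exact: erefl].
Qed.

Lemma gamC p (v w : 'rV[R]_5) : gam f p v w = gam f p w v.
Proof. by rewrite /gam dotC addrC. Qed.

Lemma cov_sym i j q : U q -> D i (d j F) q = D j (d i F) q.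
Proof. move=> Uq; rewrite (covE i (d j F) Uq) (covE j (d i F) Uq) (partial_fldC i j sF Uq).
by rewrite (gamC (F q) (d i F q) (d j F q)). Qed.

Lemma gamDl p (u v w : 'rV[R]_5) : gam f p (u + v) w = gam f p u w + gam f p v w.
Proof.
apply: rV5P; rewrite ?rVD !(mk50, sp_mk5, spD, dotE, rVD); first by ring.
by apply/rowP => k; rewrite !rVE; ring.
Qed.

Lemma gamDr p (u v w : 'rV[R]_5) : gam f p u (v + w) = gam f p u v + gam f p u w.
Proof. by rewrite !(gamC p u) gamDl. Qed.

Local Opaque gam dgam.

(** Everything that involves derivatives of V or second derivatives of F is symmetric in i and j and
    cancels; [gam_comm] evaluates the rest. *)
Lemma cov_comm i j V q : smF V -> U q ->
  D i (D j V) q - D j (D i V) q = rw_curv f (F q 0 0) (d i F q) (d j F q) (V q).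
Proof.
move=> sV Uq.
have E m n : D m (D n V) q = d m (d n V) q +
    (d m F q 0 0 *: dgam f (F q) (d n F q) (V q) +
     gam f (F q) (d m F q) (gam f (F q) (d n F q) (V q))) +
    (gam f (F q) (d m (d n F) q) (V q) + (gam f (F q) (d n F q) (d m V q) +
    gam f (F q) (d m F q) (d n V q))).
  rewrite (covE m (D n V) Uq) (eq_partial m oU Uq (fun x Ux => covE n V Ux)) (covE n V Uq).
  rewrite (gamDr (F q) (d m F q) (d n V q) (gam f (F q) (d n F q) (V q))).
  have -> : d m (fun x => d n V x + gam f (F x) (d n F x) (V x)) q =
      d m (d n V) q + d m (fun x => gam f (F x) (d n F x) (V x)) q.
    apply: deriveD; first exact: fld_derivable (smF_partial n sV) Uq.
    exact: fld_derivable (smF_gam (smF_partial n sF) sV) Uq.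
  rewrite (partial_gam m (smF_partial n sF) sV Uq).
  exact: regroup.
rewrite (E i j) (E j i) -(gam_comm (d i F q) (d j F q) (V q) (f0 (FI Uq))).
rewrite (partial_fldC i j sV Uq) (partial_fldC i j sF Uq).
exact: cancel_outer.
Qed.

End Along.

(** * Geometry of parametrized surfaces *)

Local Transparent partial gam dgam.

Lemma partial_entry (R : realType) n m p i (M : 'rV[R]_n -> 'M[R]_(m, p)) q a b :
  derivable M q (delta_mx 0 i) -> partial i M q a b = partial i (fun x => M x a b : R) q.
Proof. by move=> dM; rewrite /partial derive_mx// mxE. Qed.

Local Opaque partial gam dgam.

Lemma invmx2 (R : fieldType) (A : 'M[R]_2) : A 0 0 * A 1 1 - A 0 1 * A 1 0 != 0 ->
  [/\ invmx A 0 0 = A 1 1 / (A 0 0 * A 1 1 - A 0 1 * A 1 0),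
   invmx A 0 1 = - A 0 1 / (A 0 0 * A 1 1 - A 0 1 * A 1 0),
   invmx A 1 0 = - A 1 0 / (A 0 0 * A 1 1 - A 0 1 * A 1 0) &
   invmx A 1 1 = A 0 0 / (A 0 0 * A 1 1 - A 0 1 * A 1 0)].
Proof.
set D := _ - _ => D0.
pose B : 'M[R]_2 := \matrix_(i, j) (if i == 0 then (if j == 0 then A 1 1 / D else - A 0 1 / D)
   else (if j == 0 then - A 1 0 / D else A 0 0 / D)).
have AB : A *m B = 1%:M.
  apply/matrixP => i j; rewrite !mxE sum2 !mxE /=.
  have [->|->] := ord2_cases i; have [->|->] := ord2_cases j; rewrite /= /D; field; exact: D0.
have [uA _] := mulmx1_unit AB.
have -> : invmx A = B by rewrite -[RHS]mul1mx -(mulVmx uA) -mulmxA AB mulmx1.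
by split; rewrite mxE.
Qed.

Section Gram.
Variables (R : fieldType) (V : lmodType R) (b : V -> V -> R) (e : 'I_2 -> V) (G : 'M[R]_2).
Hypotheses (bC : forall v w, b v w = b w v)
  (bD : forall u v w, b (u + v) w = b u w + b v w)
  (bZ : forall c v w, b (c *: v) w = c * b v w).
Hypothesis GE : forall i j, G i j = b (e i) (e j).

Definition gram_det := b (e 0) (e 0) * b (e 1) (e 1) - b (e 0) (e 1) * b (e 0) (e 1).
Hypothesis gram_det0 : gram_det != 0.

Lemma invmx_gram : [/\ invmx G 0 0 = b (e 1) (e 1) / gram_det,
  invmx G 0 1 = - b (e 0) (e 1) / gram_det,
  invmx G 1 0 = - b (e 0) (e 1) / gram_det & invmx G 1 1 = b (e 0) (e 0) / gram_det].
Proof.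
have D : G 0 0 * G 1 1 - G 0 1 * G 1 0 = gram_det by rewrite !GE (bC (e 1) (e 0)).
by have := @invmx2 _ G; rewrite D !GE (bC (e 1) (e 0)); exact.
Qed.

(** [tan_part] over an abstract symmetric form: the projection identities are proved without
    unfolding the metric and then transferred by conversion. *)
Definition span_proj v := \sum_i \sum_j (invmx G i j * b v (e j)) *: e i.

Lemma b_span_proj v k : b (span_proj v) (e k) = b v (e k).
Proof.
rewrite /span_proj !sum2 !(bD, bZ); have [-> -> -> ->] := invmx_gram.
move: gram_det0; rewrite /gram_det.
have [->|->] := ord2_cases k; rewrite ?(bC (e 1) (e 0)) => n0; field; exact: n0.
Qed.

Lemma span_proj_normal v : (forall k, b v (e k) = 0) -> span_proj v = 0.
Proof.
by move=> h; rewrite /span_proj; do 2!(apply: big1 => ? _); rewrite h mulr0 scale0r.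
Qed.

Lemma span_projD v w : span_proj (v + w) = span_proj v + span_proj w.
Proof.
rewrite /span_proj -big_split; apply: eq_bigr => i _; rewrite -big_split.
by apply: eq_bigr => j _; rewrite bD mulrDr scalerDl.
Qed.

Lemma span_projZ a v : span_proj (a *: v) = a *: span_proj v.
Proof.
rewrite /span_proj scaler_sumr; apply: eq_bigr => i _; rewrite scaler_sumr.
by apply: eq_bigr => j _; rewrite bZ mulrCA scalerA.
Qed.

Lemma span_proj_e k : span_proj (e k) = e k.
Proof.
rewrite /span_proj !sum2 -!scalerDl; have [-> -> -> ->] := invmx_gram.
move: gram_det0; rewrite /gram_det.
have [->|->] := ord2_cases k; rewrite ?(bC (e 1) (e 0)) => n0.
  rewrite [X in X *: e 0](_ : _ = 1) ?[X in X *: e 1](_ : _ = 0); try by field; exact: n0.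
  by rewrite scale1r scale0r addr0.
rewrite [X in X *: e 0](_ : _ = 0) ?[X in X *: e 1](_ : _ = 1); try by field; exact: n0.
by rewrite scale1r scale0r add0r.
Qed.

Lemma span_proj_uniq a c w : (forall k, b w (e k) = 0) ->
  span_proj (a *: e 0 + c *: e 1 + w) = a *: e 0 + c *: e 1.
Proof. by move=> w0; rewrite !span_projD !span_projZ !span_proj_e (span_proj_normal w0) addr0. Qed.

End Gram.

Section TangentNormal.
Variables (R : realType) (f : R -> R) (F : 'rV[R]_2 -> 'rV[R]_5) (q : 'rV[R]_2).

Local Notation g := (rw_metric f).
Local Notation ip := (inner g (F q)).
Local Notation e := (fun i => partial i F q).
Local Notation gi := (invmx (first_form g F q)).

Lemma first_formE i j : first_form g F q i j = ip (e i) (e j).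
Proof.
rewrite /first_form /inner !mxE; apply: eq_bigr => k _; congr (_ * _); last by rewrite !mxE.
by rewrite !mxE; apply: eq_bigr => l _; rewrite mxE.
Qed.

Definition gdet := gram_det ip e.
Hypothesis gdet0 : gdet != 0.

Let bC v w : ip v w = ip w v := ipC f F q v w.
Let bD u v w : ip (u + v) w = ip u w + ip v w := ipDl f F q u v w.
Let bZ c v w : ip (c *: v) w = c * ip v w := ipZl f F q c v w.

Lemma giE : [/\ gi 0 0 = ip (e 1) (e 1) / gdet, gi 0 1 = - ip (e 0) (e 1) / gdet,
  gi 1 0 = - ip (e 0) (e 1) / gdet & gi 1 1 = ip (e 0) (e 0) / gdet].
Proof. exact: (invmx_gram bC first_formE gdet0). Qed.

Lemma ip_tan_part v k : ip (tan_part g F q v) (e k) = ip v (e k).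
Proof. exact: (b_span_proj bC bD bZ first_formE gdet0). Qed.

Lemma tan_part_normal v : (forall k, ip v (e k) = 0) -> tan_part g F q v = 0.
Proof. exact: (@span_proj_normal _ _ ip e). Qed.

Lemma tan_part0 v : tan_part g F q v = 0 -> forall k, ip v (e k) = 0.
Proof. by move=> h k; rewrite -ip_tan_part h (ip0l f F q). Qed.

(** Normal parts are recognized from any splitting into tangent and normal vectors, without
    inverting the first fundamental form. *)
Lemma nor_part_uniq v w a c : v = a *: e 0 + c *: e 1 + w ->
  (forall k, ip w (e k) = 0) -> nor_part g F q v = w.
Proof.
move=> -> w0; have E := @span_proj_uniq _ _ ip e _ bC bD bZ first_formE gdet0 a c w w0.
apply: etrans (congr1 (fun x => _ - x) E) _.
by rewrite addrAC subrr add0r.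
Qed.

Lemma ip_nor_part v k : ip (nor_part g F q v) (e k) = 0.
Proof.
have E := ip_tan_part v k.
apply: etrans (bD _ _ _) _; apply: etrans (congr1 (fun x => _ + x) (ipNl f F q _ _)) _.
by rewrite E subrr.
Qed.

Lemma tan_part_sum v : tan_part g F q v =
  (\sum_j gi 0 j * ip v (e j)) *: e 0 + (\sum_j gi 1 j * ip v (e j)) *: e 1.
Proof. by rewrite /tan_part sum2 !scaler_suml. Qed.

End TangentNormal.

(** * The tangential part of the bitension field *)

Lemma christoffel_cancel (R : comRingType) (a b c : R) : a + b + (a + c) - (b + c) = 2 * a.
Proof. by ring. Qed.

Lemma linear_tension (R : realType) (V : lmodType R) (L : V -> R) (gi : 'M[R]_2)
    (Dphi : 'I_2 -> 'I_2 -> V) (Gam : 'I_2 -> 'I_2 -> 'I_2 -> R) (e : 'I_2 -> V) :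
  (forall v w, L (v + w) = L v + L w) -> (forall a v, L (a *: v) = a * L v) ->
  L (\sum_i \sum_j gi i j *: (Dphi i j - \sum_k Gam k i j *: e k)) =
  \sum_i \sum_j gi i j * (L (Dphi i j) - \sum_k Gam k i j * L (e k)).
Proof.
move=> LD LZ; have LN v : L (- v) = - L v by rewrite -scaleN1r LZ mulN1r.
by rewrite !sum2 !(LD, LZ, LN, sum2).
Qed.

(** For V orthogonal to x, y and z the two curvature terms of the traced Codazzi equation combine.
    The factor left is f''/f - (f'/f)^2, the difference of the two kinds of sectional curvature, and
    this is where the genericity of f enters. *)
Lemma ip_rw_curv (R : realType) (f : R -> R) (p x y z V : 'rV[R]_5) :
  let ip := inner (rw_metric f) p in
  let F := f (p 0 0) in let F1 := derive1 f (p 0 0) in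
  let F2 := derive1 (derive1 f) (p 0 0) in
  F != 0 -> ip V x = 0 -> ip V y = 0 -> ip V z = 0 ->
  ip (rw_curv f (p 0 0) x y V) z - ip (rw_curv f (p 0 0) x V z) y =
  (F * F2 - F1 ^+ 2) / F ^+ 2 * V 0 0 * (x 0 0 * ip y z + z 0 0 * ip x y - 2 * y 0 0 * ip x z).
Proof.
move=> ip F F1 F2 F0.
have N w : ip V w = 0 -> dot (sp V) (sp w) = V 0 0 * w 0 0 / F ^+ 2.
  by rewrite /ip inner_rw -/F addrC => /subr0_eq <-; field.
move=> /N Nx /N Ny /N Nz.
rewrite /ip !inner_rw /rw_curv !(mk50, sp_mk5, dotE) -/F -/F1 -/F2.
rewrite ?(dotC (sp x) (sp V)) ?(dotC (sp y) (sp V)) ?(dotC (sp z) (sp V)) Nx Ny Nz.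
by field.
Qed.

(** The three contractions contribute t_k, t_k and -2 t_k times the dimension 2, in total -2 t_k. *)
Lemma contract_inv (R : fieldType) (h : 'M[R]_2) (G : 'I_2 -> 'I_2 -> R) (t : 'I_2 -> R) d a k :
  d = G 0 0 * G 1 1 - G 0 1 * G 0 1 ->
  [/\ h 0 0 = G 1 1 / d, h 0 1 = - G 0 1 / d, h 1 0 = - G 0 1 / d & h 1 1 = G 0 0 / d] ->
  d != 0 -> G 1 0 = G 0 1 ->
  \sum_i \sum_j h i j * (a * (t i * G k j + t j * G i k - 2 * t k * G i j)) = - 2 * a * t k.
Proof.
move=> dE [a00 a01 a10 a11] d0 Gs; rewrite !sum2 a00 a01 a10 a11 dE in d0 *.
by have [->|->] := ord2_cases k; rewrite !Gs; field.
Qed.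

Lemma linear_sum2 (R : realType) (V : lmodType R) (L : V -> R) (gi : 'M[R]_2)
    (v : 'I_2 -> 'I_2 -> V) :
  (forall v w, L (v + w) = L v + L w) -> (forall a v, L (a *: v) = a * L v) ->
  L (\sum_i \sum_j gi i j *: v i j) = \sum_i \sum_j gi i j * L (v i j).
Proof. by move=> LD LZ; rewrite !sum2 !(LD, LZ). Qed.

(* The contraction of the derivative of the trace of B with the metric, once
   the metric is differentiated with x i j = <D_k e_i, e_j>. *)
Lemma trace_identity (R : realFieldType) (g00 g01 g11 B00 B01 B11 b00 b01 b11
    x00 x01 x10 x11 c : R) : g00 * g11 - g01 * g01 != 0 ->
  c = - (g11 * B00 - 2 * g01 * B01 + g00 * B11) / (g00 * g11 - g01 * g01) ->
  (2 * x11 * B00 + g11 * b00) - 2 * ((x01 + x10) * B01 + g01 * b01) +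
    (2 * x00 * B11 + g00 * b11) =
  - c * (2 * x00 * g11 + g00 * (2 * x11) - 2 * g01 * (x01 + x10)) ->
  let D := g00 * g11 - g01 * g01 in
  let h00 := g11 / D in let h01 := - g01 / D in let h11 := g00 / D in
  let s00 := h00 * B00 + h01 * B01 in let s01 := h01 * B00 + h11 * B01 in
  let s10 := h00 * B01 + h01 * B11 in let s11 := h01 * B01 + h11 * B11 in
  h00 * b00 + 2 * h01 * b01 + h11 * b11 =
  2 * (h00 * (s00 * x00 + s01 * x01) + h01 * (s00 * x10 + s01 * x11) +
       h01 * (s10 * x00 + s11 * x01) + h11 * (s10 * x10 + s11 * x11)).
Proof.
move=> D0 -> E D h00 h01 h11 s00 s01 s10 s11.
have E' : g11 * b00 - 2 * g01 * b01 + g00 * b11 =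
  (g11 * B00 - 2 * g01 * B01 + g00 * B11) / (g00 * g11 - g01 * g01) *
  (2 * x00 * g11 + g00 * (2 * x11) - 2 * g01 * (x01 + x10))
  - (2 * x11 * B00 - 2 * ((x01 + x10) * B01) + 2 * x00 * B11).
  by move: E; rewrite !mulNr opprK => <-; ring.
have -> : h00 * b00 + 2 * h01 * b01 + h11 * b11 =
   (g11 * b00 - 2 * g01 * b01 + g00 * b11) / D by rewrite /h00 /h01 /h11; ring.
by rewrite E' /s00 /s01 /s10 /s11 /h00 /h01 /h11 /D; field.
Qed.

Lemma bitension_shuffle (R : comRingType) (x1 x2 x3 x4 x5 x6 : R) :
  x3 + x4 = x1 + x2 -> x1 = x5 + x6 - x6 + x4 - x2 + (x3 - x5).
Proof. by move=> h; have -> : x1 = x3 + x4 - x2; [rewrite h; ring | ring]. Qed.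

(** The factor [s] expresses that the derivatives of V are tangent. The hypothesis on the trace of
    y, where y stands for the derivative of B, cancels the connection terms, so that only the
    curvature terms r and r' survive. *)
Lemma bitension_algebra (R : comRingType) (gi B y r r' ck : 'I_2 -> 'I_2 -> R)
    (c : 'I_2 -> 'I_2 -> 'I_2 -> R) k :
  gi 1 0 = gi 0 1 -> B 1 0 = B 0 1 ->
  let s i m := \sum_l gi m l * B i l in
  \sum_i \sum_j gi i j * y i j = 2 * \sum_i \sum_j gi i j * \sum_m s i m * ck j m ->
  \sum_i \sum_j gi i j * (y i j - \sum_m s i m * ck j m + \sum_m s k m * c i j m
     - \sum_m s j m * ck i m + r i j - \sum_m (\sum_l gi m l * c i j l) * B m k)
  - \sum_i \sum_j gi i j * r' i j = \sum_i \sum_j gi i j * (r i j - r' i j).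
Proof.
move=> gs Bs s H.
have -> : \sum_i \sum_j gi i j * (r i j - r' i j) = \sum_i \sum_j gi i j * (r i j - r' i j)
  + (\sum_i \sum_j gi i j * y i j - 2 * \sum_i \sum_j gi i j * \sum_m s i m * ck j m).
  by rewrite H subrr addr0.
rewrite {H} /s; have [->|->] := ord2_cases k; rewrite !sum2 gs Bs; ring.
Qed.

Lemma trace_clear (R : fieldType) (d g00 g01 g11 B00 B01 B11 c : R) : d != 0 ->
  c = - (g11 * B00 - 2 * g01 * B01 + g00 * B11) / d ->
  g11 * B00 - 2 * (g01 * B01) + g00 * B11 = - c * d.
Proof. by move=> d0 ->; field. Qed.

Lemma trace_derivative (R : comRingType) (g00 g01 g11 B00 B01 B11 b00 b01 b11
    x00 x01 x10 x11 c : R) :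
  g11 * b00 + B00 * (x11 + x11) - (2 * (g01 * b01 + B01 * (x01 + x10)) + g01 * B01 * 0) +
    (g00 * b11 + B11 * (x00 + x00)) =
  - c * (g00 * (x11 + x11) + g11 * (x00 + x00) - (g01 * (x01 + x10) + g01 * (x01 + x10))) +
    (g00 * g11 - g01 * g01) * 0 ->
  (2 * x11 * B00 + g11 * b00) - 2 * ((x01 + x10) * B01 + g01 * b01) +
    (2 * x00 * B11 + g00 * b11) =
  - c * (2 * x00 * g11 + g00 * (2 * x11) - 2 * g01 * (x01 + x10)).
Proof. by move=> E; apply: etrans (etrans _ E) _; ring. Qed.

Lemma inv_trace (R : fieldType) (h : 'M[R]_2) (B : 'I_2 -> 'I_2 -> R) g00 g01 g11 d c :
  [/\ h 0 0 = g11 / d, h 0 1 = - g01 / d, h 1 0 = - g01 / d & h 1 1 = g00 / d] ->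
  d != 0 -> c = - \sum_i \sum_j h i j * B i j -> B 1 0 = B 0 1 ->
  c = - (g11 * B 0 0 - 2 * g01 * B 0 1 + g00 * B 1 1) / d.
Proof. by move=> [a00 a01 a10 a11] d0 -> Bs; rewrite !sum2 a00 a01 a10 a11 Bs; field. Qed.

Lemma inv_trace2 (R : fieldType) (h : 'M[R]_2) (B b x : 'I_2 -> 'I_2 -> R) g00 g01 g11 d :
  [/\ h 0 0 = g11 / d, h 0 1 = - g01 / d, h 1 0 = - g01 / d & h 1 1 = g00 / d] ->
  B 1 0 = B 0 1 -> b 1 0 = b 0 1 ->
  (let h00 := g11 / d in let h01 := - g01 / d in let h11 := g00 / d in
  let s00 := h00 * B 0 0 + h01 * B 0 1 in let s01 := h01 * B 0 0 + h11 * B 0 1 in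
  let s10 := h00 * B 0 1 + h01 * B 1 1 in let s11 := h01 * B 0 1 + h11 * B 1 1 in
  h00 * b 0 0 + 2 * h01 * b 0 1 + h11 * b 1 1 =
  2 * (h00 * (s00 * x 0 0 + s01 * x 0 1) + h01 * (s00 * x 1 0 + s01 * x 1 1) +
       h01 * (s10 * x 0 0 + s11 * x 0 1) + h11 * (s10 * x 1 0 + s11 * x 1 1))) ->
  \sum_i \sum_j h i j * b i j =
  2 * \sum_i \sum_j h i j * \sum_m (\sum_l h m l * B i l) * x j m.
Proof.
move=> [a00 a01 a10 a11] Bs bs /= E; rewrite !sum2 a00 a01 a10 a11 Bs bs.
by apply: etrans (etrans _ E) _; ring.
Qed.

Section Surface.
Variables (R : realType) (I : set R) (f : R -> R).
Hypotheses (oI : open I) (sf : smooth1 I f) (f0 : forall t, I t -> f t != 0).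
Variables (U : set 'rV[R]_2) (F : 'rV[R]_2 -> 'rV[R]_5).
Hypotheses (oU : open U) (sF : smF U F) (FI : forall q, U q -> I (F q 0 0)).
Hypothesis gdet0 : forall q, U q -> gdet f F q != 0.

Local Notation g := (rw_metric f).
Local Notation ip q := (inner g (F q)).
Local Notation D := (cov_along g F).
Local Notation e i := (partial i F).
Local Notation gi q := (invmx (first_form g F q)).

Let sfe i : smF U (e i) := smF_partial oU i sF.

Lemma partial_first_form k i j q : U q ->
  partial k (first_form g F) q i j =
  ip q (D k (e i) q) (e j q) + ip q (e i q) (D k (e j) q).
Proof.
move=> Uq; rewrite -(ip_compat oI sf f0 oU sF FI k (sfe i) (sfe j) Uq).
have S a b : sm U (fun q => first_form g F q a b : R).
  by apply: eq_sm oU _ (sm_ip oI sf oU sF FI (sfe a) (sfe b)) => x _; rewrite first_formE.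
have dG : derivable (first_form g F) q (delta_mx 0 k).
  by apply/derivable_mxP => a b; exact: sm_derivable (S a b) Uq.
rewrite (partial_entry i j dG).
by apply: eq_partial oU Uq _ => x _; rewrite first_formE.
Qed.

(** Koszul formula: metric compatibility and symmetry of the ambient derivatives identify the
    induced connection with the tangential part of the ambient one. *)
Lemma christoffel_first_form k i j q : U q ->
  christoffel (first_form g F) q k i j = \sum_l gi q k l * ip q (D i (e j) q) (e l q).
Proof.
move=> Uq; rewrite /christoffel mulr_sumr; apply: eq_bigr => l _.
suff -> : partial i (first_form g F) q j l + partial j (first_form g F) q i l -
    partial l (first_form g F) q i j = 2 * ip q (D i (e j) q) (e l q) by field.
have E1 := partial_first_form i j l Uq.
have E2 := partial_first_form j i l Uq; rewrite (cov_sym sf f0 oU sF FI j i Uq) in E2.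
have E3 := partial_first_form l i j Uq; rewrite (cov_sym sf f0 oU sF FI l i Uq)
  (cov_sym sf f0 oU sF FI l j Uq) in E3.
rewrite (ipC f F q (e j q) (D i (e l) q)) in E1; rewrite (ipC f F q (e i q) (D j (e l) q)) in E2.
apply: etrans (congr2 (fun x y => x - y) (congr2 +%R E1 E2) E3) _.
rewrite (ipC f F q (e i q) (D j (e l) q)).
exact: christoffel_cancel.
Qed.

(** The Christoffel correction in the tension field is exactly the tangential part, so each summand
    is a value of the second fundamental form. *)
Lemma tension_mean q : U q -> tension g F q = 2 *: mean_curvature g F q.
Proof.
move=> Uq; rewrite /tension /mean_curvature scalerA mulfV ?scale1r ?pnatr_eq0//.
apply: eq_bigr => i _; apply: eq_bigr => j _; congr (_ *: _).
rewrite /second_form /nor_part; congr (_ - _); rewrite /tan_part.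
apply: eq_bigr => k _; rewrite (christoffel_first_form k i j Uq) scaler_suml.
by [].
Qed.

Lemma eq_cov i V W q : U q -> (forall x, U x -> V x = W x) -> D i V q = D i W q.
Proof.
move=> Uq VW; rewrite /cov_along.
by apply: (congr2 +%R (eq_partial i oU Uq VW)); rewrite (VW q Uq).
Qed.

Section Bitension.
Variables (V : 'rV[R]_2 -> 'rV[R]_5) (c : R).
Hypotheses (sV : smF U V) (tensionV : forall q, U q -> tension g F q = V q).
Hypothesis V_parallel : forall q, U q -> forall j, nor_part g F q (D j V q) = 0.
Hypothesis V_normal : forall q, U q -> forall k, ip q (V q) (e k q) = 0.
Hypothesis V_norm : forall q, U q -> ip q (V q) (V q) = c.

Let sDV j : smF U (D j V) := smF_cov oI sf f0 oU sF FI j sV.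

(** Since V is normal, B is minus the second fundamental form paired with V; this makes it
    symmetric. *)
Let B j l q := ip q (D j V q) (e l q).

Let BE j l q : U q -> B j l q = - ip q (V q) (D j (e l) q).
Proof.
move=> Uq; have := ip_compat oI sf f0 oU sF FI j sV (sfe l) Uq.
rewrite (_ : partial j _ q = 0); last first.
  by rewrite (eq_partial j oU Uq (fun x Ux => V_normal Ux l)) partial_cst.
by move=> /eqP; rewrite eq_sym addr_eq0 => /eqP.
Qed.

Let Bsym j l q : U q -> B j l q = B l j q.
Proof.
move=> Uq; apply: etrans (BE j l Uq) (etrans _ (esym (BE l j Uq))).
have E := congr1 (fun x => - ip q (V q) x) (cov_sym sf f0 oU sF FI j l Uq).
exact E.
Qed.

Let dB i j l q : U q -> is_derive q (delta_mx 0 i : 'rV[R]_2) (B j l)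
  (ip q (D i (D j V) q) (e l q) + ip q (D j V q) (D i (e l) q)).
Proof.
move=> Uq; rewrite -(ip_compat oI sf f0 oU sF FI i (sDV j) (sfe l) Uq).
apply: derivableP; exact: sm_derivable (sm_ip oI sf oU sF FI (sDV j) (sfe l)) Uq.
Qed.

Let DV_tan j q : U q -> D j V q = (\sum_l gi q 0 l * B j l q) *: e 0 q +
   (\sum_l gi q 1 l * B j l q) *: e 1 q.
Proof.
move=> Uq; rewrite -tan_part_sum; apply/eqP; rewrite -subr_eq0; apply/eqP.
exact: V_parallel.
Qed.

(** Pair the tension field with V, which is that field: the left side is |V|^2 = c, and the
    Christoffel terms vanish because V is normal. *)
Let trace_B q : U q -> c = - \sum_i \sum_j gi q i j * B i j q.
Proof.
move=> Uq; rewrite -(V_norm Uq).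
apply: etrans (congr1 (ip q (V q)) (esym (tensionV Uq))) _.
apply: etrans (linear_tension _ _ _ _ (ipDr f F q (V q)) (fun a v => ipZr f F q a (V q) v)) _.
rewrite -sumrN; apply: eq_bigr => i _; rewrite -sumrN; apply: eq_bigr => j _.
rewrite big1 ?subr0; last by move=> k _; rewrite (V_normal Uq) mulr0.
by rewrite -mulrN BE// opprK.
Qed.

Let gdetE q : gdet f F q = ip q (e 0 q) (e 0 q) * ip q (e 1 q) (e 1 q) -
  ip q (e 0 q) (e 1 q) * ip q (e 0 q) (e 1 q). Proof. by []. Qed.

Let trace_B' q : U q -> c = - (ip q (e 1 q) (e 1 q) * B 0 0 q -
   2 * ip q (e 0 q) (e 1 q) * B 0 1 q + ip q (e 0 q) (e 0 q) * B 1 1 q) / gdet f F q.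
Proof.
move=> Uq; exact (inv_trace (giE (gdet0 Uq)) (gdet0 Uq) (trace_B Uq) (Bsym 1 0 Uq)).
Qed.

Let dmet q k i j : U q -> is_derive q (delta_mx 0 k : 'rV[R]_2)
  (fun q => ip q (e i q) (e j q)) (ip q (D k (e i) q) (e j q) + ip q (D k (e j) q) (e i q)).
Proof.
move=> Uq; have S := sm_derivable (i:=k) (sm_ip oI sf oU sF FI (sfe i) (sfe j)) Uq.
have E := etrans (ip_compat oI sf f0 oU sF FI k (sfe i) (sfe j) Uq)
  (congr1 (fun z => _ + z) (ipC f F q (e i q) (D k (e j) q))).
exact (DeriveDef S E).
Qed.

(** The constancy of the trace of B is differentiated after multiplication by the Gram determinant,
    so that no derivative of the inverse metric appears. *)
Let trace_dB q k : U q ->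
  \sum_i \sum_j gi q i j * partial k (B i j) q =
  2 * \sum_i \sum_j gi q i j * \sum_m (\sum_l gi q m l * B i l q) * ip q (D k (e j) q) (e m q).
Proof.
move=> Uq.
have dBv i j := partialE (dB k i j Uq).
have dBD i j : is_derive q (delta_mx 0 k : 'rV[R]_2) (B i j) (partial k (B i j) q).
  by rewrite dBv; exact: dB.
have b10 : partial k (B 1 0) q = partial k (B 0 1) q.
  by apply: eq_partial oU Uq _ => x Ux; exact: Bsym.
have m00 := dmet k 0 0 Uq; have m01 := dmet k 0 1 Uq; have m11 := dmet k 1 1 Uq.
pose T1 x := ip x (e 1 x) (e 1 x) * B 0 0 x -
   2 * (ip x (e 0 x) (e 1 x) * B 0 1 x) + ip x (e 0 x) (e 0 x) * B 1 1 x.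
pose T2 x := - c * (ip x (e 0 x) (e 0 x) * ip x (e 1 x) (e 1 x) -
   ip x (e 0 x) (e 1 x) * ip x (e 0 x) (e 1 x)).
have T12 : partial k T1 q = partial k T2 q.
  apply: eq_partial oU Uq _ => x Ux.
  exact (trace_clear (gdet0 Ux) (trace_B' Ux)).
have d1 := idD (idB (idM m11 (dBD 0 0)) (idM (is_derive_cst (2 : R) _ _) (idM m01 (dBD 0 1))))
  (idM m00 (dBD 1 1)).
have d2 := idM (is_derive_cst (- c : R) _ _) (idB (idM m00 m11) (idM m01 m01)).
have E := etrans (esym (partialE d1)) (etrans T12 (partialE d2)).
have n0 := gdet0 Uq; have tr := trace_B' Uq; rewrite gdetE in n0 tr.
have E' := trace_identity n0 tr (trace_derivative E).
exact (inv_trace2 (giE (gdet0 Uq)) (Bsym 1 0 Uq) b10 E').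
Qed.

Let DV_dot j w q : U q -> ip q (D j V q) w =
  \sum_m (\sum_l gi q m l * B j l q) * ip q w (e m q).
Proof.
move=> Uq; apply: etrans (congr1 (fun v => ip q v w) (DV_tan j Uq)) _.
rewrite [RHS]sum2; apply: etrans (ipDl f F q _ _ _) _.
apply: etrans (congr2 +%R (ipZl f F q _ _ _) (ipZl f F q _ _ _)) _.
have E0 := ipC f F q (e 0 q) w; have E1 := ipC f F q (e 1 q) w.
exact (congr2 +%R (congr1 ( *%R _) E0) (congr1 ( *%R _) E1)).
Qed.

(** Codazzi: the symmetry of B moves the outer derivative from direction i to direction k, at the
    cost of one commutator and hence one curvature term. *)
Let ip_DDV i j k q : U q -> ip q (D i (D j V) q) (e k q) =
  partial k (B i j) q - ip q (D i V q) (D k (e j) q) + ip q (D k V q) (D i (e j) q)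
  - ip q (D j V q) (D k (e i) q) + ip q (rw_curv f (F q 0 0) (e i q) (e k q) (V q)) (e j q).
Proof.
move=> Uq.
have h1 := partialE (dB i j k Uq).
have h2 := partialE (dB i k j Uq).
have h3 := partialE (dB k i j Uq).
have h4 : partial i (B j k) q = partial i (B k j) q.
  by apply: eq_partial oU Uq _ => x Ux; exact: Bsym.
have h5 := congr1 (fun v => ip q v (e j q)) (cov_comm oI sf f0 oU sF FI i k sV Uq).
move: h5; rewrite (ipDl f F q) (ipNl f F q) => h5.
rewrite -(cov_sym sf f0 oU sF FI i k Uq) h3 -h5; move: h1; rewrite h4 h2 => h1.
exact: bitension_shuffle h1.
Qed.

(** The trace over i, j of [ip_DDV] contains the derivative of the trace of B, which is constant
    because |V| is. What remains of the rough Laplacian is one curvature term, to be compared with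
    the curvature term of the bitension field. *)
Lemma ip_bitension q k : U q -> ip q (bitension g F q) (e k q) =
  \sum_i \sum_j gi q i j *
    (ip q (rw_curv f (F q 0 0) (e i q) (e k q) (V q)) (e j q) -
     ip q (rw_curv f (F q 0 0) (e i q) (V q) (e j q)) (e k q)).
Proof.
move=> Uq.
have dtE j x (Ux : U x) : D j (tension g F) x = D j V x := eq_cov j Ux tensionV.
have ddtE i j : D i (D j (tension g F)) q = D i (D j V) q := eq_cov i Uq (dtE j).
have Eterm i j : ip q (D i (D j (tension g F)) q) (e k q) -
    \sum_m christoffel (first_form g F) q m i j * ip q (D m (tension g F) q) (e k q) =
    partial k (B i j) q - \sum_m (\sum_l gi q m l * B i l q) * ip q (D k (e j) q) (e m q)
     + \sum_m (\sum_l gi q m l * B k l q) * ip q (D i (e j) q) (e m q)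
     - \sum_m (\sum_l gi q m l * B j l q) * ip q (D k (e i) q) (e m q)
     + ip q (rw_curv f (F q 0 0) (e i q) (e k q) (V q)) (e j q)
     - \sum_m (\sum_l gi q m l * ip q (D i (e j) q) (e l q)) * B m k q.
  have E1 := congr1 (fun v => ip q v (e k q)) (ddtE i j).
  have E2 := ip_DDV i j k Uq.
  have E3 := congr2 (fun x y => x - y) (congr2 +%R (congr2 (fun x y => x - y) (erefl (partial k (B i j) q))
     (DV_dot i (D k (e j) q) Uq)) (DV_dot k (D i (e j) q) Uq)) (DV_dot j (D k (e i) q) Uq).
  have E4 : \sum_m christoffel (first_form g F) q m i j * ip q (D m (tension g F) q) (e k q) =
      \sum_m (\sum_l gi q m l * ip q (D i (e j) q) (e l q)) * B m k q.
    apply: eq_bigr => m _.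
    have E5 := congr1 (fun v => ip q v (e k q)) (dtE m q Uq).
    exact (congr2 *%R (christoffel_first_form m i j Uq) E5).
  exact (congr2 (fun x y => x - y) (etrans E1 (etrans E2 (congr2 +%R E3 erefl))) E4).
have L1 := linear_tension (gi q) (fun i j => D i (D j (tension g F)) q)
  (fun m i j => christoffel (first_form g F) q m i j) (fun m => D m (tension g F) q)
  (fun v w => ipDl f F q v w (e k q)) (fun a v => ipZl f F q a v (e k q)).
have L2 := linear_sum2 (gi q)
  (fun i j => curvature g (F q) (e i q) (tension g F q) (e j q))
  (fun v w => ipDl f F q v w (e k q)) (fun a v => ipZl f F q a v (e k q)).
have E3 i j : ip q (curvature g (F q) (e i q) (tension g F q) (e j q)) (e k q) =
    ip q (rw_curv f (F q 0 0) (e i q) (V q) (e j q)) (e k q).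
  have E4 := congr1 (fun v => curvature g (F q) (e i q) v (e j q)) (tensionV Uq).
  exact (congr1 (fun v => ip q v (e k q))
    (etrans E4 (curvature_rw oI sf f0 (e i q) (V q) (e j q) (FI Uq)))).
rewrite /bitension (ipDl f F q) (ipNl f F q).
apply: etrans (congr2 (fun x y => x - y) (etrans L1 _) (etrans L2 _)) _.
- by apply: eq_bigr => i _; apply: eq_bigr => j _; exact (congr1 ( *%R _) (Eterm i j)).
- by apply: eq_bigr => i _; apply: eq_bigr => j _; exact (congr1 ( *%R _) (E3 i j)).
have [_ g01 g10 _] := giE (gdet0 Uq).
exact (@bitension_algebra _ (gi q) (fun i j => B i j q) (fun i j => partial k (B i j) q)
  (fun i j => ip q (rw_curv f (F q 0 0) (e i q) (e k q) (V q)) (e j q))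
  (fun i j => ip q (rw_curv f (F q 0 0) (e i q) (V q) (e j q)) (e k q))
  (fun j m => ip q (D k (e j) q) (e m q)) (fun i j m => ip q (D i (e j) q) (e m q)) k
  (etrans g10 (esym g01)) (Bsym 1 0 Uq) (trace_dB k Uq)).
Qed.

Lemma ip_bitension_time q k : U q -> ip q (bitension g F q) (e k q) =
  - 2 * ((f (F q 0 0) * derive1 (derive1 f) (F q 0 0) - derive1 f (F q 0 0) ^+ 2) /
    f (F q 0 0) ^+ 2 * V q 0 0) * e k q 0 0.
Proof.
move=> Uq; apply: etrans (ip_bitension k Uq) _.
apply: etrans (contract_inv (fun i => e i q 0 0) _ k (gdetE q) (giE (gdet0 Uq)) (gdet0 Uq)
  (ipC f F q (e 1 q) (e 0 q))).
apply: eq_bigr => i _; apply: eq_bigr => j _; apply: (congr1 ( *%R _)).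
exact (ip_rw_curv (f0 (FI Uq)) (V_normal Uq i) (V_normal Uq k) (V_normal Uq j)).
Qed.

End Bitension.

End Surface.

(** * The model surface *)

Local Transparent partial gam dgam.

Section RadialFields.
Variables (R : realType) (a : R).
Implicit Types (T P Y W : R -> R) (q : 'rV[R]_2).

Definition mk4 (x1 x2 x3 x4 : R) : 'rV[R]_4 := \row_k [:: x1; x2; x3; x4]`_k.

Lemma dot_mk4 x1 x2 x3 x4 y1 y2 y3 y4 :
  dot (mk4 x1 x2 x3 x4) (mk4 y1 y2 y3 y4) = x1 * y1 + x2 * y2 + x3 * y3 + x4 * y4.
Proof. by rewrite /dot !big_ord_recr big_ord0 /= !mxE /= add0r. Qed.

Lemma mk4D x1 x2 x3 x4 y1 y2 y3 y4 :
  mk4 x1 x2 x3 x4 + mk4 y1 y2 y3 y4 = mk4 (x1 + y1) (x2 + y2) (x3 + y3) (x4 + y4).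
Proof. by apply/rowP => -[[|[|[|[|//]]]] lt]; rewrite !mxE. Qed.

Lemma mk4Z c x1 x2 x3 x4 : c *: mk4 x1 x2 x3 x4 = mk4 (c * x1) (c * x2) (c * x3) (c * x4).
Proof. by apply/rowP => -[[|[|[|[|//]]]] lt]; rewrite !mxE. Qed.

Lemma mk5D (s t : R) x y : mk5 s x + mk5 t y = mk5 (s + t) (x + y).
Proof. by apply: rV5P; rewrite ?(rVD, spD, mk50, sp_mk5). Qed.

Lemma mk5Z c (t : R) x : c *: mk5 t x = mk5 (c * t) (c *: x).
Proof. by apply: rV5P; rewrite ?(rVZ, spZ, mk50, sp_mk5). Qed.

(** A profile curve in u, rotated by the angle a v in the first two space coordinates. With
    [angular] this family contains the model, its normal and their first and second derivatives. *)
Definition radial T P Y W q := mk5 (T (q 0 0))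
  (mk4 (P (q 0 0) * sin (a * q 0 1)) (P (q 0 0) * cos (a * q 0 1)) (Y (q 0 0)) (W (q 0 0))).

Definition angular P q :=
  mk5 0 (mk4 (P (q 0 0) * cos (a * q 0 1)) (- (P (q 0 0) * sin (a * q 0 1))) 0 0).

Lemma partial_rowE n m i (V : 'rV[R]_n -> 'rV[R]_m) (q : 'rV[R]_n) (w : 'rV[R]_m) :
  (forall k, is_derive q (delta_mx 0 i : 'rV[R]_n) (fun x => V x 0 k : R) (w 0 k)) ->
  partial i V q = w.
Proof.
move=> D; have dV : derivable V q (delta_mx 0 i).
  by apply/derivable_mxP => c k; rewrite (ord1 c); have [] := D k.
by apply/rowP => k; rewrite partial_mx//; exact: partialE (D k).
Qed.

Lemma sin_coord_derive n (q : 'rV[R]_n) i j : is_derive q (delta_mx 0 i : 'rV[R]_n)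
  (fun q : 'rV[R]_n => sin (a * q 0 j)) ((i == j)%:R * (a * cos (a * q 0 j))).
Proof.
have D (x : R) : is_derive x (1 : R) (fun x => sin (a * x)) (a * cos (a * x)).
  have M : is_derive x (1 : R) (fun x => a * x) a.
    by apply: (is_derive_as (idM (is_derive_cst a x 1) (is_derive_id x 1))) => //; rewrite mulr1 mulr0 addr0.
  by apply: (is_derive_as (is_derive1_comp (is_derive_sin (a * x)) M)) => //; rewrite -?mulNr mulrC.
have [d E] := D (q 0 j).
have := coord_comp_derive i d; rewrite (etrans (derive1E _ _) E); exact.
Qed.

Lemma cos_coord_derive n (q : 'rV[R]_n) i j : is_derive q (delta_mx 0 i : 'rV[R]_n)
  (fun q : 'rV[R]_n => cos (a * q 0 j)) ((i == j)%:R * - (a * sin (a * q 0 j))).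
Proof.
have D (x : R) : is_derive x (1 : R) (fun x => cos (a * x)) (- (a * sin (a * x))).
  have M : is_derive x (1 : R) (fun x => a * x) a.
    by apply: (is_derive_as (idM (is_derive_cst a x 1) (is_derive_id x 1))) => //; rewrite mulr1 mulr0 addr0.
  by apply: (is_derive_as (is_derive1_comp (is_derive_cos (a * x)) M)) => //; rewrite mulNr mulrC.
have [d E] := D (q 0 j).
have := coord_comp_derive i d; rewrite (etrans (derive1E _ _) E); exact.
Qed.

Variable J : set R.
Hypothesis oJ : open J.

Let cd g q i (sg : smooth1 J g) (Jq : strip J q) :
  is_derive q (delta_mx 0 i : 'rV[R]_2) (fun q : 'rV[R]_2 => g (q 0 0))
    ((i == 0)%:R * derive1 g (q 0 0)).
Proof. exact: coord_comp_derive (smooth1_derivable sg Jq). Qed.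

Lemma partial_radial i T P Y W q : smooth1 J T -> smooth1 J P -> smooth1 J Y ->
  smooth1 J W -> strip J q -> partial i (radial T P Y W) q =
  if i == 0 then radial (derive1 T) (derive1 P) (derive1 Y) (derive1 W) q
  else angular (fun u => a * P u) q.
Proof.
move=> sT sP sY sW Jq; apply: partial_rowE; apply: ord5P => [|k].
  apply: (is_derive_as (cd i sT Jq)); first by apply/funext => x; rewrite mk50.
  by have [->|->] := ord2_cases i; rewrite /= mk50 ?mul1r ?mul0r.
case: k => [[|[|[|[|//]]]] lt].
- apply: (is_derive_as (idM (cd i sP Jq) (sin_coord_derive q i 1))).
    by apply/funext => x; rewrite mk5S mxE.
  by have [->|->] := ord2_cases i; rewrite /= mk5S mxE /=; ring.
- apply: (is_derive_as (idM (cd i sP Jq) (cos_coord_derive q i 1))).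
    by apply/funext => x; rewrite mk5S mxE.
  by have [->|->] := ord2_cases i; rewrite /= mk5S mxE /=; ring.
- apply: (is_derive_as (cd i sY Jq)).
    by apply/funext => x; rewrite mk5S mxE.
  by have [->|->] := ord2_cases i; rewrite /= mk5S mxE /=; ring.
- apply: (is_derive_as (cd i sW Jq)).
    by apply/funext => x; rewrite mk5S mxE.
  by have [->|->] := ord2_cases i; rewrite /= mk5S mxE /=; ring.
Qed.

Lemma partial_angular i P q : smooth1 J P -> strip J q -> partial i (angular P) q =
  if i == 0 then angular (derive1 P) q
  else radial (fun=> 0) (fun u => - (a * P u)) (fun=> 0) (fun=> 0) q.
Proof.
move=> sP Jq; apply: partial_rowE; apply: ord5P => [|k].
  apply: (is_derive_as (is_derive_cst (0 : R) _ _)); first by apply/funext => x; rewrite mk50.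
  by have [->|->] := ord2_cases i; rewrite /= mk50.
case: k => [[|[|[|[|//]]]] lt].
- apply: (is_derive_as (idM (cd i sP Jq) (cos_coord_derive q i 1))).
    by apply/funext => x; rewrite mk5S mxE.
  by have [->|->] := ord2_cases i; rewrite /= mk5S mxE /=; ring.
- apply: (is_derive_as (idN (idM (cd i sP Jq) (sin_coord_derive q i 1)))).
    by apply/funext => x; rewrite mk5S mxE.
  by have [->|->] := ord2_cases i; rewrite /= mk5S mxE /=; ring.
- apply: (is_derive_as (is_derive_cst (0 : R) _ _)).
    by apply/funext => x; rewrite mk5S mxE.
  by have [->|->] := ord2_cases i; rewrite /= mk5S mxE.
- apply: (is_derive_as (is_derive_cst (0 : R) _ _)).
    by apply/funext => x; rewrite mk5S mxE.
  by have [->|->] := ord2_cases i; rewrite /= mk5S mxE.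
Qed.

Let oS := open_strip oJ.
Let sm1 g (sg : smooth1 J g) := proj1 (smooth1_strip g oJ) sg.

Lemma sm_trig (U : set 'rV[R]_2) : open U -> sm U (fun q : 'rV[R]_2 => sin (a * q 0 1)) /\
  sm U (fun q : 'rV[R]_2 => cos (a * q 0 1)).
Proof.
move=> oU; have [s c] := smooth1_trig R.
have L : sm U (fun q : 'rV[R]_2 => a * q 0 1).
  exact: sm_mul oU (sm_cst _ _) (sm_coord _ _).
split; first exact: sm_comp1 oU openT s L (fun _ _ => Logic.I).
exact: sm_comp1 oU openT c L (fun _ _ => Logic.I).
Qed.

Lemma smF_radial T P Y W : smooth1 J T -> smooth1 J P -> smooth1 J Y ->
  smooth1 J W -> smF (strip J) (radial T P Y W).
Proof.
move=> /sm1 sT /sm1 sP /sm1 sY /sm1 sW; have [ss sc] := sm_trig oS; apply: ord5P => [|k].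
  by apply: eq_sm oS _ sT => q _; rewrite mk50.
case: k => [[|[|[|[|//]]]] lt].
- by apply: eq_sm oS _ (sm_mul oS sP ss) => q _; rewrite mk5S mxE.
- by apply: eq_sm oS _ (sm_mul oS sP sc) => q _; rewrite mk5S mxE.
- by apply: eq_sm oS _ sY => q _; rewrite mk5S mxE.
- by apply: eq_sm oS _ sW => q _; rewrite mk5S mxE.
Qed.

End RadialFields.

(** * The system as components of the mean curvature equation *)

Section ModelAlgebra.
Variables (R : realType) (H0 a b c2 c3 F F1 F2 y1 y2 : R).
Hypotheses (a0 : a != 0) (c30 : c3 != 0) (F0 : F != 0)
  (bE : b ^+ 2 = a ^+ 2 - 4 * H0 ^+ 2)
  (unitE : c2 ^+ 2 + c3 ^+ 2 + 4 * H0 ^+ 2 / a ^+ 2 = 1).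
(** [r1] and [r2] are the first two derivatives of the radius 1/(a f), [w1] and [w2] those of the
    last coordinate; [E] is |phi_u|^2 and [dE] its derivative. *)
Let r1 := - F1 / (a * F ^+ 2).
Let r2 := (2 * F1 ^+ 2 - F2 * F) / (a * F ^+ 3).
Let w1 := 2 * H0 / (c3 * a) * r1 - c2 / c3 * y1.
Let w2 := 2 * H0 / (c3 * a) * r2 - c2 / c3 * y2.
Let E := F ^+ 2 * (r1 ^+ 2 + y1 ^+ 2 + w1 ^+ 2) - 1.
Let dE := 2 * F * F1 * (r1 ^+ 2 + y1 ^+ 2 + w1 ^+ 2) +
  2 * F ^+ 2 * (r1 * r2 + y1 * y2 + w1 * w2).

Let c4 := a ^+ 2 * c3 ^+ 2 + 4 * H0 ^+ 2.
Let bE' : b ^+ 2 = a ^+ 2 * (c2 ^+ 2 + c3 ^+ 2).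
Proof.
have -> : a ^+ 2 * (c2 ^+ 2 + c3 ^+ 2) =
  a ^+ 2 * (c2 ^+ 2 + c3 ^+ 2 + 4 * H0 ^+ 2 / a ^+ 2) - 4 * H0 ^+ 2 by field.
by rewrite unitE mulr1.
Qed.

Let b4E : b ^+ 4 = (a ^+ 2 - 4 * H0 ^+ 2) ^+ 2.
Proof. by rewrite -bE -exprM. Qed.

Let normE : r1 ^+ 2 + y1 ^+ 2 + w1 ^+ 2 =
  (c4 * r1 ^+ 2 + b ^+ 2 * y1 ^+ 2 - 4 * a * H0 * c2 * r1 * y1) / (a ^+ 2 * c3 ^+ 2).
Proof.
by rewrite bE' /w1 /c4; field; rewrite ?a0 ?c30 ?F0.
Qed.

Let dotE' : r1 * r2 + y1 * y2 + w1 * w2 =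
  (c4 * r1 * r2 + b ^+ 2 * y1 * y2 - 2 * a * H0 * c2 * (r1 * y2 + r2 * y1)) / (a ^+ 2 * c3 ^+ 2).
Proof.
by rewrite bE' /w1 /w2 /c4; field; rewrite ?a0 ?c30 ?F0.
Qed.

(** Up to a non-zero factor and a multiple of the relation between the constants, the first equation
    is the evolution of E = |phi_u|^2, the same one that [box_E_derive] finds for an arbitrary
    surface. *)
Lemma eq1E : system_eq1 H0 a b c2 c3 F F1 F2 y1 y2 <->
  dE = 2 * E * (F1 / F) * (2 * E + 1).
Proof.
rewrite /system_eq1 -/c4 /dE /E normE dotE'.
set L := (X in X = 0 <-> _).
have LE : L = a ^+ 8 * c3 ^+ 4 * F ^+ 5 / 2 *
   (2 * (F ^+ 2 * ((c4 * r1 ^+ 2 + b ^+ 2 * y1 ^+ 2 - 4 * a * H0 * c2 * r1 * y1) / (a ^+ 2 * c3 ^+ 2)) - 1) * (F1 / F) *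
    (2 * (F ^+ 2 * ((c4 * r1 ^+ 2 + b ^+ 2 * y1 ^+ 2 - 4 * a * H0 * c2 * r1 * y1) / (a ^+ 2 * c3 ^+ 2)) - 1) + 1) -
   (2 * F * F1 * ((c4 * r1 ^+ 2 + b ^+ 2 * y1 ^+ 2 - 4 * a * H0 * c2 * r1 * y1) / (a ^+ 2 * c3 ^+ 2)) +
    2 * F ^+ 2 * ((c4 * r1 * r2 + b ^+ 2 * y1 * y2 - 2 * a * H0 * c2 * (r1 * y2 + r2 * y1)) / (a ^+ 2 * c3 ^+ 2))))
   - 32 * a ^+ 4 * H0 ^+ 2 * F1 ^+ 3 * F ^+ 4 * y1 ^+ 2 * (c2 ^+ 2 + c3 ^+ 2 + 4 * H0 ^+ 2 / a ^+ 2 - 1).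
  by rewrite /L /c4 b4E bE /r1 /r2; field; rewrite ?a0 ?c30 ?F0.
rewrite LE unitE subrr mulr0 subr0; split=> [h|->]; last by rewrite subrr mulr0.
have K0 : a ^+ 8 * c3 ^+ 4 * F ^+ 5 / 2 != 0 by rewrite !mulf_neq0 ?invr_neq0 ?expf_neq0 ?pnatr_eq0.
by move/eqP: h; rewrite mulf_eq0 (negPf K0) subr_eq0 => /eqP ->.
Qed.

(** Up to the same kind of correction, the second equation is the minor of the radial and
    y-components of the mean curvature equation against the velocity (r1, y1), which eliminates the
    tangential coefficient. *)
Lemma eq2E : system_eq2 H0 a b c2 c3 F F1 F2 y1 y2 <->
  r2 * y1 - y2 * r1 = E * (b ^+ 2 / (a * F) * y1 - 2 * H0 * c2 / F * r1).
Proof.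
rewrite /system_eq2 -/c4 /E normE.
set L := (X in X = 0 <-> _).
have LE : L = c3 ^+ 2 * a ^+ 5 * F ^+ 5 * (r2 * y1 - y2 * r1 -
   (F ^+ 2 * ((c4 * r1 ^+ 2 + b ^+ 2 * y1 ^+ 2 - 4 * a * H0 * c2 * r1 * y1) / (a ^+ 2 * c3 ^+ 2)) - 1) *
   (b ^+ 2 / (a * F) * y1 - 2 * H0 * c2 / F * r1))
   + 8 * a ^+ 2 * H0 ^+ 2 * F1 ^+ 2 * F ^+ 2 * y1 * (c2 ^+ 2 + c3 ^+ 2 + 4 * H0 ^+ 2 / a ^+ 2 - 1).
  by rewrite /L /c4 b4E bE /r1 /r2; field; rewrite ?a0 ?c30 ?F0.
rewrite LE unitE subrr mulr0 addr0; split=> [h|->]; last by rewrite subrr mulr0.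
have K0 : c3 ^+ 2 * a ^+ 5 * F ^+ 5 != 0 by rewrite !mulf_neq0 ?invr_neq0 ?expf_neq0 ?pnatr_eq0.
by move/eqP: h; rewrite mulf_eq0 (negPf K0) subr_eq0 => /eqP.
Qed.

Hypothesis E0 : E != 0.
Hypothesis N0 : r1 ^+ 2 + y1 ^+ 2 + w1 ^+ 2 != 0.
Let al := F1 / F * (2 * E + 1) / E.

(** The residual (rho, sig, om) of the mean curvature equation is orthogonal to (-2 H0/a, c2, c3) by
    the choice of the last coordinate, orthogonal to the velocity by the first equation, and has
    zero minor with (r1, y1) by the second. Up to sign the determinant of these three conditions is
    c3 (r1^2 + y1^2 + w1^2). *)
Lemma model_core :
  dE = 2 * E * (F1 / F) * (2 * E + 1) ->
  r2 * y1 - y2 * r1 = E * (b ^+ 2 / (a * F) * y1 - 2 * H0 * c2 / F * r1) ->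
  [/\ (r2 + 2 * (F1 / F) * r1) / E - a / F = al * r1 - 4 * H0 ^+ 2 / (a * F),
   (y2 + 2 * (F1 / F) * y1) / E = al * y1 + 2 * H0 * c2 / F &
   (w2 + 2 * (F1 / F) * w1) / E = al * w1 + 2 * H0 * c3 / F].
Proof.
move=> hA hB.
pose rho := (r2 + 2 * (F1 / F) * r1) / E - a / F - (al * r1 - 4 * H0 ^+ 2 / (a * F)).
pose sig := (y2 + 2 * (F1 / F) * y1) / E - (al * y1 + 2 * H0 * c2 / F).
pose om := (w2 + 2 * (F1 / F) * w1) / E - (al * w1 + 2 * H0 * c3 / F).
have n0 : - 2 * H0 / a * rho + c2 * sig + c3 * om = 0.
  have -> : - 2 * H0 / a * rho + c2 * sig + c3 * om =
    - 2 * H0 / F * (c2 ^+ 2 + c3 ^+ 2 + 4 * H0 ^+ 2 / a ^+ 2 - 1).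
    by rewrite /rho /sig /om /al /w1 /w2; field; rewrite ?a0 ?c30 ?F0 ?E0.
  by rewrite unitE subrr mulr0.
have x0 : r1 * rho + y1 * sig + w1 * om = 0.
  have -> : r1 * rho + y1 * sig + w1 * om =
     (dE - 2 * E * (F1 / F) * (2 * E + 1)) / (2 * F ^+ 2 * E).
    have cw : c2 * y1 + c3 * w1 = 2 * H0 / a * r1 by rewrite /w1; field; rewrite ?a0 ?c30 ?F0 ?E0.
    have NE : r1 ^+ 2 + y1 ^+ 2 + w1 ^+ 2 = (E + 1) / F ^+ 2 by rewrite /E; field.
    have -> : r1 * rho + y1 * sig + w1 * om = (r1 * r2 + y1 * y2 + w1 * w2 +
       2 * (F1 / F) * (r1 ^+ 2 + y1 ^+ 2 + w1 ^+ 2)) / E - a / F * r1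
       + 4 * H0 ^+ 2 / (a * F) * r1 - al * (r1 ^+ 2 + y1 ^+ 2 + w1 ^+ 2)
       - 2 * H0 / F * (c2 * y1 + c3 * w1) by rewrite /rho /sig /om; ring.
    rewrite /dE cw NE /al; move: (r1 * r2 + _ + _) => S.
    by rewrite /r1; move: E E0 => E' E0'; field; rewrite ?a0 ?E0' ?F0.
  by rewrite hA subrr mul0r.
have b0 : rho * y1 - sig * r1 = 0.
  have -> : rho * y1 - sig * r1 = (r2 * y1 - y2 * r1 -
    E * (b ^+ 2 / (a * F) * y1 - 2 * H0 * c2 / F * r1)) / E.
    by rewrite bE /rho /sig /al; field; rewrite ?a0 ?c30 ?F0 ?E0.
  by rewrite hB subrr mul0r.
have det0 : c3 * (r1 ^+ 2 + y1 ^+ 2 + w1 ^+ 2) != 0 by rewrite mulf_neq0.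
have cw : - 2 * H0 / a * r1 + c2 * y1 + c3 * w1 = 0.
  by rewrite /w1; field; rewrite ?a0 ?c30 ?F0 ?E0.
have k1 : rho = 0.
  apply: (mulfI det0); rewrite mulr0.
  have -> : c3 * (r1 ^+ 2 + y1 ^+ 2 + w1 ^+ 2) * rho =
    c3 * y1 * (rho * y1 - sig * r1) + c3 * r1 * (r1 * rho + y1 * sig + w1 * om) -
    r1 * w1 * (- 2 * H0 / a * rho + c2 * sig + c3 * om) +
    w1 * rho * (- 2 * H0 / a * r1 + c2 * y1 + c3 * w1) +
    w1 * c2 * (r1 * sig - y1 * rho) by ring.
  rewrite b0 x0 n0 cw !mulr0; rewrite (_ : r1 * sig - y1 * rho = 0) ?mulr0; first by ring.
  by rewrite -[RHS]oppr0 -b0; ring.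
have k2 : sig = 0.
  apply: (mulfI det0); rewrite mulr0.
  have -> : c3 * (r1 ^+ 2 + y1 ^+ 2 + w1 ^+ 2) * sig =
    - c3 * r1 * (rho * y1 - sig * r1) + c3 * y1 * (r1 * rho + y1 * sig + w1 * om) -
    y1 * w1 * (- 2 * H0 / a * rho + c2 * sig + c3 * om) +
    w1 * sig * (- 2 * H0 / a * r1 + c2 * y1 + c3 * w1) -
    2 * w1 * H0 / a * (y1 * rho - r1 * sig) by ring.
  rewrite b0 x0 n0 cw !mulr0; rewrite (_ : y1 * rho - r1 * sig = 0) ?mulr0; first by ring.
  by rewrite -b0; ring.
have k3 : om = 0.
  by move: n0; rewrite k1 k2 !mulr0 !add0r => /eqP; rewrite mulf_eq0 (negPf c30) => /eqP.
by split; [move: k1 => /subr0_eq|move: k2 => /subr0_eq|move: k3 => /subr0_eq].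
Qed.

End ModelAlgebra.

Lemma gam_mk5 (R : realType) (f : R -> R) (p : 'rV[R]_5) s x t y :
  gam f p (mk5 s x) (mk5 t y) = mk5 (f (p 0 0) * derive1 f (p 0 0) * dot x y)
    (derive1 f (p 0 0) / f (p 0 0) *: (s *: y + t *: x)).
Proof. by rewrite /gam !mk50 !sp_mk5. Qed.

Local Opaque partial gam dgam.

Lemma pd_matrix2 (R : realType) (G : 'M[R]_2) : positive_definite G -> G 1 0 = G 0 1 ->
  0 < G 0 0 /\ 0 < G 0 0 * G 1 1 - G 0 1 * G 0 1.
Proof.
move=> pd Gs.
have Q (x y : R) : (x != 0) || (y != 0) ->
    0 < x ^+ 2 * G 0 0 + 2 * x * y * G 0 1 + y ^+ 2 * G 1 1.
  move=> xy; have n0 : mk2 x y != 0.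
    by apply: contraL xy => /eqP E; have := mk20 x y; have := mk21 x y; rewrite E !mxE => <- <-; rewrite eqxx.
  have := pd _ n0; rewrite mxE sum2 !mxE !sum2 !mk20 !mk21 Gs /=.
  by congr (0 < _); ring.
have p0 : 0 < G 0 0.
  by have := Q 1 0; rewrite oner_neq0 => /(_ isT); congr (0 < _); ring.
split => //.
have := Q (- G 0 1) (G 0 0); rewrite (gt_eqF p0) orbT => /(_ isT).
have -> : (- G 0 1) ^+ 2 * G 0 0 + 2 * - G 0 1 * G 0 0 * G 0 1 + G 0 0 ^+ 2 * G 1 1 =
  G 0 0 * (G 0 0 * G 1 1 - G 0 1 * G 0 1) by ring.
by rewrite pmulr_rgt0.
Qed.

Lemma additive_sum2 (R : realType) (V : lmodType R) (N : V -> V) :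
  (forall v w, N (v + w) = N v + N w) -> (forall a v, N (a *: v) = a *: N v) ->
  forall (gi : 'M[R]_2) (v : 'I_2 -> 'I_2 -> V),
  N (\sum_i \sum_j gi i j *: v i j) = \sum_i \sum_j gi i j *: N (v i j).
Proof. by move=> ND NZ gi v; rewrite !sum2 !(ND, NZ). Qed.

Section MeanCurvature.
Variables (R : realType) (f : R -> R) (F : 'rV[R]_2 -> 'rV[R]_5) (q : 'rV[R]_2).
Local Notation g := (rw_metric f).
Local Notation ip := (inner g (F q)).
Local Notation e := (fun i => partial i F q).

Lemma pd_gdet : positive_definite (first_form g F q) ->
  0 < ip (e 0) (e 0) /\ 0 < gdet f F q.
Proof.
move=> pd; have E := first_formE f F q.
have [] := pd_matrix2 pd (etrans (E 1 0) (etrans (ipC f F q (e 1) (e 0)) (esym (E 0 1)))).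
by rewrite (E 0 0) (E 0 1) (E 1 1).
Qed.

Hypothesis gdet0 : gdet f F q != 0.

Let bC v w : ip v w = ip w v := ipC f F q v w.
Let bD u v w : ip (u + v) w = ip u w + ip v w := ipDl f F q u v w.
Let bZ c v w : ip (c *: v) w = c * ip v w := ipZl f F q c v w.

Lemma nor_partD (v w : 'rV[R]_5) : nor_part g F q (v + w) = nor_part g F q v + nor_part g F q w.
Proof.
have E := @span_projD _ _ ip e (first_form g F q) bD v w.
have E' := congr1 (fun x => v + w - x) E; apply: etrans E' _.
by rewrite opprD addrACA.
Qed.

Lemma nor_partZ a (v : 'rV[R]_5) : nor_part g F q (a *: v) = a *: nor_part g F q v.
Proof.
have E := @span_projZ _ _ ip e (first_form g F q) bZ a v.
have E' := congr1 (fun x => a *: v - x) E; apply: etrans E' _.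
by rewrite scalerBr.
Qed.

Lemma mean_curvature_uniq a c w :
  \sum_i \sum_j invmx (first_form g F q) i j *: cov_along g F i (partial j F) q =
    a *: e 0 + c *: e 1 + w -> (forall k, ip w (e k) = 0) ->
  mean_curvature g F q = 2^-1 *: w.
Proof.
move=> E w0; rewrite /mean_curvature -(nor_part_uniq gdet0 E w0).
exact (congr1 (fun v => 2^-1 *: v) (esym (additive_sum2 nor_partD nor_partZ
  (invmx (first_form g F q)) (fun i j => cov_along g F i (partial j F) q)))).
Qed.

End MeanCurvature.

Lemma derive1_is (R : realType) (h : R -> R) (t d : R) : is_derive t 1 h d -> derive1 h t = d.
Proof. by move=> [dh E]; exact (etrans (derive1E h t) E). Qed.

Lemma drop_mul0 (R : pzRingType) (k x u l z v : R) : k * u + x * 0 - (l * v + z * 0) = k * u - l * v.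
Proof. by rewrite !mulr0 !addr0. Qed.

Lemma inv_diag (R : fieldType) (h : 'M[R]_2) (d g00 g01 g11 E : R) :
  [/\ h 0 0 = g11 / d, h 0 1 = - g01 / d, h 1 0 = - g01 / d & h 1 1 = g00 / d] ->
  d = E -> g00 = E -> g01 = 0 -> g11 = 1 -> E != 0 ->
  [/\ h 0 0 = E^-1, h 0 1 = 0, h 1 0 = 0 & h 1 1 = 1].
Proof.
by move=> [-> -> -> ->] -> -> -> -> E0; rewrite oppr0 mul0r div1r divff.
Qed.

Lemma diag_sum (R : realType) (V : lmodType R) (h : 'M[R]_2) (D : 'I_2 -> 'I_2 -> V) c :
  [/\ h 0 0 = c, h 0 1 = 0, h 1 0 = 0 & h 1 1 = 1] ->
  \sum_i \sum_j h i j *: D i j = c *: D 0 0 + D 1 1.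
Proof. by move=> [a00 a01 a10 a11]; rewrite !sum2 a00 a01 a10 a11 !scale0r scale1r addr0 add0r. Qed.

Lemma mk5_0 (R : realType) : mk5 0 0 = 0 :> 'rV[R]_5.
Proof.
apply: rV5P; rewrite ?mk50 ?sp_mk5; first by rewrite mxE.
by apply/rowP => k; rewrite !mxE.
Qed.

Lemma model_comp (R : fieldType) (x E al r h a F S : R) :
  x / E - a / F = al * r - 4 * h ^+ 2 / (a * F) ->
  E^-1 * (x * S) + - (a / F) * S = al * (r * S) + 2 * h * (- 2 * h / a * F^-1 * S).
Proof.
move=> k; have -> : E^-1 * (x * S) + - (a / F) * S = S * (x / E - a / F) by ring.
by rewrite k invfM; ring.
Qed.

Lemma model_comp0 (R : fieldType) (x E al r h c F : R) :
  x / E = al * r + 2 * h * c / F ->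
  E^-1 * x + 0 = al * r + 2 * h * (c * F^-1).
Proof. by move=> k; rewrite addr0 mulrC k; ring. Qed.

(** * Frame, normal and mean curvature of the model *)

Section ModelGeometry.
Variables (R : realType) (I : set R) (f : R -> R) (H0 : R).
Hypotheses (oI : open I) (sf : smooth1 I f) (f0 : forall t, I t -> f t != 0).
Variables (J : set R) (y : R -> R) (a b c2 c3 : R).
Hypotheses (oJ : open J) (JI : J `<=` I) (sy : smooth1 J y).
Hypotheses (a0 : a != 0) (c30 : c3 != 0).

Let rr u := (a * f u)^-1.
Let ww u := (2 * H0 - c2 * a ^+ 2 * f u * y u) / (c3 * a ^+ 2 * f u).

Lemma model_radial : model_surface H0 a c2 c3 f y = radial a id rr y ww.
Proof.
apply/funext => q; apply/rowP; apply: ord5P => [|k]; first by rewrite mk50 mxE.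
by case: k => [[|[|[|[|//]]]] lt]; rewrite mk5S !mxE //= mulrC.
Qed.

Let Jf u : J u -> f u != 0. Proof. by move/JI/f0. Qed.

Let fD u (Ju : J u) := smooth1_is_derive sf (JI Ju).
Let f1D u (Ju : J u) := smooth1_is_derive (smooth1_derive sf) (JI Ju).
Let yD u (Ju : J u) := smooth1_is_derive sy Ju.
Let y1D u (Ju : J u) := smooth1_is_derive (smooth1_derive sy) Ju.

Let cstD (k u : R) : is_derive u (1 : R) (fun=> k) (0 : R) := is_derive_cst k u 1.

Let rr1 u : J u -> is_derive u (1 : R) rr (- derive1 f u / (a * f u ^+ 2)).
Proof.
move=> Ju; have fu := Jf Ju; have n0 : a * f u != 0 by rewrite mulf_neq0.
apply: (is_derive_as (idV (F := fun x => a * f x) n0 (idM (cstD a u) (fD Ju)))) => //.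
by move: (derive1 f u) => d; field; rewrite a0 fu.
Qed.

Let near1 (g h : R -> R) u : J u -> (forall x, J x -> g x = h x) -> derive1 g u = derive1 h u.
Proof. by move=> Ju gh; apply: derive1_near; apply: filterS (open_nbhs_nbhs (conj oJ Ju)). Qed.

Let rr2 u : J u -> derive1 (derive1 rr) u =
  (2 * derive1 f u ^+ 2 - derive1 (derive1 f) u * f u) / (a * f u ^+ 3).
Proof.
move=> Ju; rewrite (near1 (h := fun u => - derive1 f u / (a * (f u * f u))) Ju); last first.
  by move=> x Jx; rewrite (derive1_is (rr1 Jx)).
have fu := Jf Ju; have n0 : a * (f u * f u) != 0 by rewrite !mulf_neq0.
apply: derive1_is.
apply: (is_derive_as (id_div (G := fun x => a * (f x * f x)) n0 (idN (f1D Ju)) (idM (cstD a u) (idM (fD Ju) (fD Ju))))) => //.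
by move: (derive1 f u) (derive1 _ u) => d d'; field; rewrite a0 fu.
Qed.

Let wwE u : J u -> ww u = 2 * H0 / (c3 * a) * rr u - c2 / c3 * y u.
Proof. by move=> /Jf fu; rewrite /ww /rr; field; rewrite a0 c30 fu. Qed.

Let ww1 u : J u -> derive1 ww u = 2 * H0 / (c3 * a) * derive1 rr u - c2 / c3 * derive1 y u.
Proof.
move=> Ju; rewrite (near1 Ju wwE); apply: derive1_is; rewrite (derive1_is (rr1 Ju)).
apply: (is_derive_as (idB (idM (cstD _ u) (rr1 Ju)) (idM (cstD _ u) (yD Ju)))) => //.
exact: drop_mul0.
Qed.

Let srr : smooth1 J rr.
Proof.
apply/(smooth1_strip _ oJ); have oS := open_strip oJ.
apply: sm_inv => //; first by move=> q Jq; rewrite mulf_neq0// Jf.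
apply: sm_mul => //; first exact: sm_cst.
exact: (smooth1_strip f oJ).1 (sub_smooth1 JI sf).
Qed.

Let sww : smooth1 J ww.
Proof.
have E u : J u -> 2 * H0 / (c3 * a) * rr u - c2 / c3 * y u = ww u by move=> Ju; rewrite wwE.
apply: (eq_smooth1 oJ E).
apply/(smooth1_strip _ oJ); have oS := open_strip oJ.
apply: sm_sub => //; apply: sm_mul => //; try exact: sm_cst.
  exact: (smooth1_strip rr oJ).1.
exact: (smooth1_strip y oJ).1.
Qed.

Let ww2 u : J u -> derive1 (derive1 ww) u =
  2 * H0 / (c3 * a) * derive1 (derive1 rr) u - c2 / c3 * derive1 (derive1 y) u.
Proof.
move=> Ju; rewrite (near1 Ju ww1); apply: derive1_is.
have rD := smooth1_is_derive (smooth1_derive srr) Ju.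
apply: (is_derive_as (idB (idM (cstD _ u) rD) (idM (cstD _ u) (y1D Ju)))) => //.
exact: drop_mul0.
Qed.

Local Notation X := (radial a id rr y ww).
Local Notation U := (strip J).
Let oU : open U := open_strip oJ.
Let sid : smooth1 J id.
Proof. by apply/(smooth1_strip _ oJ); exact: sm_coord. Qed.
Let scst k : smooth1 J (fun=> k : R).
Proof. by apply/(smooth1_strip _ oJ); exact: sm_cst. Qed.
Let d_id : derive1 id = (fun=> 1 : R).
Proof. by apply/funext => u; exact: derive1_is (is_derive_id u 1). Qed.
Let d_cst k : derive1 (fun=> k) = (fun=> 0 : R).
Proof. by apply/funext => u; exact: derive1_is (cstD k u). Qed.

Lemma smF_model : smF U X. Proof. exact (smF_radial a oJ sid srr sy sww). Qed.

Let sarr : smooth1 J (fun u => a * rr u).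
Proof.
apply/(smooth1_strip _ oJ); apply: sm_mul => //; first exact: sm_cst.
exact: (smooth1_strip rr oJ).1.
Qed.

Let e0E q : U q -> partial 0 X q = radial a (fun=> 1) (derive1 rr) (derive1 y) (derive1 ww) q.
Proof.
move=> Uq; apply: etrans (partial_radial a 0 sid srr sy sww Uq) _.
by rewrite d_id.
Qed.

Let e1E q : U q -> partial 1 X q = angular a (fun u => a * rr u) q.
Proof. by move=> Uq; exact: etrans (partial_radial a 1 sid srr sy sww Uq) _. Qed.

Let e00E q : U q -> partial 0 (partial 0 X) q =
  radial a (fun=> 0) (derive1 (derive1 rr)) (derive1 (derive1 y)) (derive1 (derive1 ww)) q.
Proof.
move=> Uq; apply: etrans (eq_partial 0 oU Uq e0E) _.
have sr' := smooth1_derive srr; have sy' := smooth1_derive sy; have sw' := smooth1_derive sww.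
have E := partial_radial a 0 (@scst 1) sr' sy' sw' Uq; rewrite d_cst eqxx in E; exact E.
Qed.

Let e11E q : U q -> partial 1 (partial 1 X) q =
  radial a (fun=> 0) (fun u => - (a * (a * rr u))) (fun=> 0) (fun=> 0) q.
Proof.
move=> Uq; apply: etrans (eq_partial 1 oU Uq e1E) _.
exact: etrans (partial_angular a 1 sarr Uq) _.
Qed.

(** The candidate unit normal: c2 y + c3 w = (2 H0/a)/(a f) along the profile makes it orthogonal to
    phi_u, the circle makes it orthogonal to phi_v, and the relation between the constants makes it
    unit. *)
Let e4 := radial a (fun=> 0) (fun u => - 2 * H0 / a * (f u)^-1) (fun u => c2 * (f u)^-1)
  (fun u => c3 * (f u)^-1).

Let sf_inv k : smooth1 J (fun u => k * (f u)^-1).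
Proof.
apply/(smooth1_strip _ oJ); apply: sm_mul => //; first exact: sm_cst.
apply: sm_inv => //; first by move=> q /Jf.
exact: (smooth1_strip f oJ).1 (sub_smooth1 JI sf).
Qed.

Lemma smF_model_normal : smF U e4.
Proof. exact (smF_radial a oJ (@scst 0) (@sf_inv _) (@sf_inv _) (@sf_inv _)). Qed.

Let f_inv1 k u : J u -> derive1 (fun u => k * (f u)^-1) u = - k * derive1 f u / f u ^+ 2.
Proof.
move=> Ju; have fu := Jf Ju; apply: derive1_is.
apply: (is_derive_as (idM (cstD k u) (idV fu (fD Ju)))) => //.
by move: (derive1 f u) => d; field; rewrite fu.
Qed.

Section AtPoint.
Variable q : 'rV[R]_2.
Hypothesis Uq : U q.
Let u := q 0 0. Let S := sin (a * q 0 1). Let C := cos (a * q 0 1).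
Let F : R := f u. Let F1 : R := derive1 f u. Let F2 : R := derive1 (derive1 f) u.
Let y1 : R := derive1 y u. Let y2 : R := derive1 (derive1 y) u.
Let r1 : R := - F1 / (a * F ^+ 2).
Let r2 : R := (2 * F1 ^+ 2 - F2 * F) / (a * F ^+ 3).
Let w1 : R := 2 * H0 / (c3 * a) * r1 - c2 / c3 * y1.
Let w2 : R := 2 * H0 / (c3 * a) * r2 - c2 / c3 * y2.
Let N : R := r1 ^+ 2 + y1 ^+ 2 + w1 ^+ 2.
Let F0 : F != 0 := Jf Uq.

Let e0q : partial 0 X q = mk5 1 (mk4 (r1 * S) (r1 * C) y1 w1).
Proof. by rewrite (e0E Uq) /radial (ww1 Uq) (derive1_is (rr1 Uq)). Qed.

Let e1q : partial 1 X q = mk5 0 (mk4 (F^-1 * C) (- (F^-1 * S)) 0 0).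
Proof. by rewrite (e1E Uq) /angular /rr invfM mulrA mulfV// mul1r. Qed.

Let e00q : partial 0 (partial 0 X) q = mk5 0 (mk4 (r2 * S) (r2 * C) y2 w2).
Proof. by rewrite (e00E Uq) /radial (ww2 Uq) (rr2 Uq). Qed.

Let e11q : partial 1 (partial 1 X) q = mk5 0 (mk4 (- (a / F) * S) (- (a / F) * C) 0 0).
Proof. by rewrite (e11E Uq) /radial /rr invfM [a * (a^-1 * _)]mulrA mulfV// mul1r. Qed.

Let SC : S ^+ 2 + C ^+ 2 = 1. Proof. by rewrite addrC cos2Dsin2. Qed.

Let Xq0 : X q 0 0 = u. Proof. by rewrite mk50. Qed.

Let ip00 : inner (rw_metric f) (X q) (partial 0 X q) (partial 0 X q) = F ^+ 2 * N - 1.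
Proof.
rewrite e0q inner_rw Xq0 -/F !mk50 !sp_mk5 dot_mk4.
have -> : r1 * S * (r1 * S) + r1 * C * (r1 * C) + y1 * y1 + w1 * w1 =
  r1 ^+ 2 * (S ^+ 2 + C ^+ 2) + y1 ^+ 2 + w1 ^+ 2 by ring.
by rewrite SC /N; ring.
Qed.

Let ip01 : inner (rw_metric f) (X q) (partial 0 X q) (partial 1 X q) = 0.
Proof. by rewrite e0q e1q inner_rw !mk50 !sp_mk5 dot_mk4; ring. Qed.

Let ip11 : inner (rw_metric f) (X q) (partial 1 X q) (partial 1 X q) = 1.
Proof.
rewrite e1q inner_rw Xq0 -/F !mk50 !sp_mk5 dot_mk4.
have -> : F^-1 * C * (F^-1 * C) + - (F^-1 * S) * - (F^-1 * S) + 0 * 0 + 0 * 0 =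
  F^-1 ^+ 2 * (S ^+ 2 + C ^+ 2) by ring.
by rewrite SC; field.
Qed.

Let XI x : U x -> I (X x 0 0). Proof. by move=> Ux; rewrite mk50; exact: JI. Qed.

Let mk5_eq (s t : R) v w : s = t -> v = w -> mk5 s v = mk5 t w. Proof. by move=> -> ->. Qed.
Let mk4_eq (x1 x2 x3 x4 z1 z2 z3 z4 : R) : x1 = z1 -> x2 = z2 -> x3 = z3 -> x4 = z4 ->
  mk4 x1 x2 x3 x4 = mk4 z1 z2 z3 z4.
Proof. by move=> -> -> -> ->. Qed.

Let cov00 : cov_along (rw_metric f) X 0 (partial 0 X) q = mk5 (F * F1 * N)
  (mk4 ((r2 + 2 * (F1 / F) * r1) * S) ((r2 + 2 * (F1 / F) * r1) * C)
    (y2 + 2 * (F1 / F) * y1) (w2 + 2 * (F1 / F) * w1)).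
Proof.
rewrite (covE sf f0 XI 0 (partial 0 X) Uq) e00q e0q gam_mk5 Xq0 -/F -/F1.
rewrite dot_mk4 !mk4Z mk4D mk4Z mk5D mk4D.
have -> : r1 * S * (r1 * S) + r1 * C * (r1 * C) + y1 * y1 + w1 * w1 =
  r1 ^+ 2 * (S ^+ 2 + C ^+ 2) + y1 ^+ 2 + w1 ^+ 2 by ring.
rewrite SC mulr1 add0r -/N; apply: mk5_eq => //; apply: mk4_eq; ring.
Qed.

Let cov11 : cov_along (rw_metric f) X 1 (partial 1 X) q = mk5 (F1 / F)
  (mk4 (- (a / F) * S) (- (a / F) * C) 0 0).
Proof.
rewrite (covE sf f0 XI 1 (partial 1 X) Uq) e11q e1q gam_mk5 Xq0 -/F -/F1.
rewrite dot_mk4 !mk4Z mk4D mk4Z mk5D mk4D.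
have -> : F^-1 * C * (F^-1 * C) + - (F^-1 * S) * - (F^-1 * S) + 0 * 0 + 0 * 0 =
  F^-1 ^+ 2 * (S ^+ 2 + C ^+ 2) by ring.
rewrite SC; apply: mk5_eq; first by move: F0; move: F F1 => A B A0; field.
by apply: mk4_eq; ring.
Qed.

Let e4q : e4 q = mk5 0 (mk4 (- 2 * H0 / a * F^-1 * S) (- 2 * H0 / a * F^-1 * C)
  (c2 * F^-1) (c3 * F^-1)).
Proof. by []. Qed.

Let d0e4 : partial 0 e4 q = - (F1 / F) *: e4 q.
Proof.
have E := partial_radial a 0 (@scst 0) (@sf_inv (- 2 * H0 / a)) (@sf_inv c2) (@sf_inv c3) Uq.
rewrite eqxx in E; apply: etrans E _; rewrite /radial !(f_inv1 _ Uq) d_cst e4q mk5Z mk4Z -/F -/F1 -/S -/C.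
move: F0; move: F F1 => A B A0.
apply: mk5_eq; first by ring.
by apply: mk4_eq; field; rewrite ?a0 ?A0.
Qed.

Let d1e4 : partial 1 e4 q = - 2 * H0 *: partial 1 X q.
Proof.
have E := partial_radial a 1 (@scst 0) (@sf_inv (- 2 * H0 / a)) (@sf_inv c2) (@sf_inv c3) Uq.
apply: etrans E _; rewrite e1q /= /angular mk5Z mk4Z -/F -/S -/C.
move: F0; move: F => A A0.
apply: mk5_eq; first by ring.
by apply: mk4_eq; field; rewrite ?a0 ?A0.
Qed.

Let normal0 : - 2 * H0 / a * r1 + c2 * y1 + c3 * w1 = 0.
Proof. by rewrite /w1; move: r1 y1 => A B; field; rewrite a0 c30. Qed.

Lemma model_normal_e k : inner (rw_metric f) (X q) (e4 q) (partial k X q) = 0.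
Proof.
have [->|->] := ord2_cases k.
  rewrite e0q e4q inner_rw Xq0 -/F !mk50 !sp_mk5 dot_mk4.
  have -> : - 2 * H0 / a * F^-1 * S * (r1 * S) + - 2 * H0 / a * F^-1 * C * (r1 * C) +
    c2 * F^-1 * y1 + c3 * F^-1 * w1 =
    F^-1 * (- 2 * H0 / a * r1 * (S ^+ 2 + C ^+ 2) + c2 * y1 + c3 * w1) by ring.
  by rewrite SC (mulr1 (_ * r1)) normal0; ring.
by rewrite e1q e4q inner_rw Xq0 -/F !mk50 !sp_mk5 dot_mk4; ring.
Qed.

Hypothesis unitE : c2 ^+ 2 + c3 ^+ 2 + 4 * H0 ^+ 2 / a ^+ 2 = 1.

Lemma model_normal_unit : inner (rw_metric f) (X q) (e4 q) (e4 q) = 1.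
Proof.
rewrite e4q inner_rw Xq0 -/F !mk50 !sp_mk5 dot_mk4.
have -> : - 2 * H0 / a * F^-1 * S * (- 2 * H0 / a * F^-1 * S) +
   - 2 * H0 / a * F^-1 * C * (- 2 * H0 / a * F^-1 * C) + c2 * F^-1 * (c2 * F^-1) +
   c3 * F^-1 * (c3 * F^-1) =
   F^-1 ^+ 2 * (c2 ^+ 2 + c3 ^+ 2 + 4 * H0 ^+ 2 / a ^+ 2 * (S ^+ 2 + C ^+ 2)).
  by move: F0; move: F => A A0; field; rewrite a0 A0.
by rewrite SC (mulr1 (_ / a ^+ 2)) unitE; move: F0; move: F => A A0; field.
Qed.

(** Both values are tangent, so this normal is parallel in the normal bundle. *)
Lemma cov_model_normal i : cov_along (rw_metric f) X i e4 q =
  if i == 0 then 0 else - 2 * H0 *: partial 1 X q.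
Proof.
rewrite (covE sf f0 XI i e4 Uq).
have [->|->] := ord2_cases i; rewrite /=.
  rewrite d0e4 e0q {2}e4q gam_mk5 Xq0 -/F -/F1.
  have -> : dot (mk4 (r1 * S) (r1 * C) y1 w1) (mk4 (- 2 * H0 / a * F^-1 * S)
     (- 2 * H0 / a * F^-1 * C) (c2 * F^-1) (c3 * F^-1)) =
    F^-1 * (- 2 * H0 / a * r1 * (S ^+ 2 + C ^+ 2) + c2 * y1 + c3 * w1).
    by rewrite dot_mk4; ring.
  rewrite SC (mulr1 (_ * r1)) normal0 scale0r addr0 scale1r e4q mk5Z mk5D -scalerDl.
  by rewrite addNr scale0r !mulr0 addr0 mk5_0.
rewrite d1e4 e1q {1}e4q gam_mk5 Xq0 -/F -/F1 !scale0r addr0 scaler0.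
rewrite (_ : dot _ _ = 0); last by rewrite dot_mk4; ring.
by rewrite mulr0 mk5_0 addr0.
Qed.

Let E := F ^+ 2 * N - 1.
Hypotheses (E0 : E != 0) (N0 : N != 0).

Lemma model_gdet : gdet f X q = E.
Proof.
have H := congr2 (fun x y => x - y) (congr2 *%R ip00 ip11) (congr2 *%R ip01 ip01).
by apply: (etrans H); rewrite mulr1 mulr0 subr0.
Qed.

Hypothesis bE : b ^+ 2 = a ^+ 2 - 4 * H0 ^+ 2.
Hypothesis sys1 : system_eq1 H0 a b c2 c3 F F1 F2 y1 y2.
Hypothesis sys2 : system_eq2 H0 a b c2 c3 F F1 F2 y1 y2.

Lemma model_mean_curvature : mean_curvature (rw_metric f) X q = H0 *: e4 q.
Proof.
have gd : gdet f X q != 0 by rewrite model_gdet.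
have [k1 k2 k3] := model_core a0 c30 F0 bE unitE E0 N0
  ((eq1E F1 F2 y1 y2 a0 c30 F0 bE unitE).1 sys1) ((eq2E F1 F2 y1 y2 a0 c30 F0 bE unitE).1 sys2).
have dg := inv_diag (giE gd) model_gdet ip00 ip01 ip11 E0.
(* Time components determine the coefficient of phi_u: phi_u has time component 1, while phi_v and
   [e4] have none. *)
rewrite (@mean_curvature_uniq _ f X q gd (F1 / F * (2 * E + 1) / E) 0 (2 * H0 *: e4 q)).
- by rewrite scalerA mulrA mulVf ?pnatr_eq0// mul1r.
- apply: etrans (diag_sum (fun i j => cov_along (rw_metric f) X i (partial j X) q) dg) _.
  apply: etrans (congr2 (fun v w => E^-1 *: v + w) cov00 cov11) (etrans _ (esym
    (congr2 (fun v w => (F1 / F * (2 * E + 1) / E) *: v + 0 *: partial 1 X q + 2 * H0 *: w)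
       e0q e4q))).
  rewrite scale0r addr0 !mk5Z !mk4Z !mk5D !mk4D.
  have NE : N = (E + 1) / F ^+ 2 by rewrite /E; move: N F0; move: F => A B A0; field.
  apply: mk5_eq; first by rewrite NE; move: E E0 F0; move: F F1 => A B D D0 A0; field; rewrite ?A0 ?D0.
  apply: mk4_eq.
  + apply: model_comp; exact: k1.
  + apply: model_comp; exact: k1.
  + apply: model_comp0; exact: k2.
  + apply: model_comp0; exact: k3.
- move=> k; have Ek := model_normal_e k.
  by apply: etrans (ipZl f X q (2 * H0) (e4 q) (partial k X q)) _; rewrite Ek mulr0.
Qed.

End AtPoint.

End ModelGeometry.

Local Transparent partial gam dgam.

Lemma gamZr (R : realType) (f : R -> R) (p v w : 'rV[R]_5) k :
  gam f p v (k *: w) = k *: gam f p v w.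
Proof.
apply: rV5P; rewrite ?rVZ ?spZ !(mk50, sp_mk5, spZ, dotE, rVZ); first by ring.
by rewrite !scalerDr !scalerA; congr (_ + _); congr (_ *: _); ring.
Qed.

Local Opaque partial gam dgam.

(** * The strip as an abstract surface with one chart *)

Section StripSurface.
Variables (R : realType) (J : set R).
Hypotheses (oJ : open J) (iJ : is_interval J).
Variable u0 : R.
Hypothesis Ju0 : J u0.

Local Notation S := (set_type (strip J)).

Let strip0 : strip J (mk2 u0 0). Proof. by rewrite /strip /= mk20. Qed.
Let pt q (Sq : strip J q) : S := exist _ q (mem_set Sq).

Let valS (p : S) : strip J (set_val p). Proof. exact: set_valP. Qed.

(** A total inverse of the inclusion; points outside the strip go to the base point. *)
Definition strip_para (q : 'rV[R]_2) : S :=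
  if pselect (strip J q) is left h then pt h else pt strip0.

Lemma strip_paraK q : strip J q -> set_val (strip_para q) = q.
Proof. by rewrite /strip_para; case: pselect. Qed.

Lemma strip_valK p : strip_para (set_val p) = p.
Proof. by apply: val_inj; exact: strip_paraK (valS p). Qed.

Lemma nbhs_strip (p : S) N : nbhs p N ->
  exists W, [/\ open W, W (set_val p) & forall x, W (set_val x) -> N x].
Proof. by case=> _ /= [[W oW <-] /= Wp sW]; exists W. Qed.

Lemma strip_val_cont : continuous (set_val : S -> 'rV[R]_2).
Proof. exact: initial_continuous. Qed.

Lemma strip_para_cont q : strip J q -> {for q, continuous strip_para}.
Proof.
move=> Sq N /nbhs_strip [W [oW Wq WN]]; rewrite strip_paraK// in Wq.
apply: filterS (open_near (openI oW (open_strip oJ)) (conj Wq Sq) (fun x h => h)).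
by move=> x [Wx Sx]; apply: WN; rewrite strip_paraK.
Qed.

Program Definition strip_chart : chart R S := @Chart R S setT (strip J) set_val strip_para
  openT (open_strip oJ) _ _ _ _.
Next Obligation. by split; [exact: valS|exact: strip_valK]. Qed.
Next Obligation. by split => //; exact: strip_paraK. Qed.
Next Obligation. by move=> p _; exact: strip_val_cont. Qed.
Next Obligation. by move=> q; exact: strip_para_cont. Qed.

Lemma strip_hausdorff : hausdorff_space S.
Proof.
move=> p q pq; apply: val_inj; apply: (@norm_hausdorff R 'rV[R]_2) => A B Ap Bq.
have [x [Ax Bx]] := pq _ _ (strip_val_cont Ap) (strip_val_cont Bq).
by exists (set_val x).
Qed.

Lemma strip_second_countable : @second_countable S.
Proof.
pose B (k : rat * rat * nat) : set S :=
  [set x | `|set_val x - mk2 (ratr k.1.1) (ratr k.1.2)| < k.2.+1%:R^-1].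
exists (range B).
  by apply: sub_countable (card_image_le B setT) (countableP _).
split=> [_ [k _ <-]|p N /nbhs_strip [W [oW Wp WN]]].
  by exists [set x | `|x - mk2 (ratr k.1.1) (ratr k.1.2)| < k.2.+1%:R^-1] => //; exact: open_norm_ball.
have [e e0 eW] := open_ball oW Wp.
(* Two points of one ball of radius 1/(n+1) are less than 2/(n+1) apart, so a basic ball around p
   stays within the e-ball. *)
have [n ne] : exists n : nat, 2 * n.+1%:R^-1 < e.
  have e2 : 0 < e / 2 by rewrite divr_gt0.
  have [n] := ltr_add_invr e2; rewrite add0r => ne; exists n.
  by rewrite mulrC -ltr_pdivlMr.
have d0 : 0 < n.+1%:R^-1 :> R by rewrite invr_gt0.
have rt (t : R) : exists r : rat, `|t - ratr r| < n.+1%:R^-1.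
  have /rat_in_itvoo [r] : t < t + n.+1%:R^-1 by rewrite ltrDl.
  move=> /itvP h; exists r; rewrite distrC ltr_distl h andbT.
  by apply: lt_trans (_ : t < _); rewrite ?h// ltrBlDr ltrDl.
have [r hr] := rt (set_val p 0 0); have [s hs] := rt (set_val p 0 1).
have Bp : `|set_val p - mk2 (ratr r) (ratr s)| < n.+1%:R^-1.
  by apply: norm2_lt; rewrite // rVD rVN ?mk20 ?mk21.
exists (B (r, s, n)); first by split; [exists (r, s, n)|].
move=> x Bx; apply: WN; apply: eW; rewrite -(subrKA (mk2 (ratr r) (ratr s))).
apply: le_lt_trans (ler_normD _ _) (lt_trans _ ne); rewrite mulr_natl mulr2n.
by apply: ltrD => //; rewrite distrC; exact: Bx.
Qed.

(** The strip is a union of segments that all start at the base point. *)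
Lemma strip_connected : connected [set: S].
Proof.
pose seg (x : S) (t : R) : S := strip_para (mk2 u0 0 + t *: (set_val x - mk2 u0 0)).
have Sseg (x : S) (t : R) : 0 <= t <= 1 ->
    strip J (mk2 u0 0 + t *: (set_val x - mk2 u0 0)).
  move=> /andP[t0 t1]; have Jx : J (set_val x 0 0) := valS x.
  rewrite /strip /= !rVE mk20; apply: (interval_between iJ Ju0 Jx).
    by rewrite addrC addKr normrM (ger0_norm t0) ler_piMl.
  rewrite (_ : _ - _ = (1 - t) * (u0 - set_val x 0 0)); last by ring.
  rewrite normrM (distrC u0) ger0_norm ?subr_ge0// ler_piMl// gerBl//.
have C (x : S) : connected (seg x @` `[0, 1]).
  apply: connected_continuous_connected; first exact: segment_connected.
  apply: continuous_in_subspaceT => t; rewrite inE /= in_itv /= => t01.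
  apply: (@continuous_comp _ _ _ (fun t : R => mk2 u0 0 + t *: (set_val x - mk2 u0 0))
    strip_para t); last exact: strip_para_cont (Sseg x t t01).
  apply: (@cvgD _ 'rV[R]_2); first exact: cvg_cst.
  by apply: (@cvgZr_tmp _ 'rV[R]_2); exact: cvg_id.
have -> : [set: S] = \bigcup_x (seg x @` `[0, 1]).
  apply/seteqP; split=> // x _; exists x => //; exists 1.
    by rewrite /= in_itv /= ler01 lexx.
  by rewrite /seg scale1r addrCA subrr addr0 strip_valK.
apply: bigcup_connected => // ; exists (pt strip0) => x _; exists 0.
  by rewrite /= in_itv /= ler01 lexx.
by rewrite /seg scale0r addr0; apply: val_inj; exact: strip_paraK.
Qed.

Let overlapE : overlap strip_chart strip_chart = strip J.
Proof. by apply/seteqP; split=> q // []. Qed.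

Let transitionE q : strip J q -> transition strip_chart strip_chart q = q.
Proof. exact: strip_paraK. Qed.

Lemma strip_compatible : compatible strip_chart strip_chart.
Proof.
suff h : smooth_on (strip J) (transition strip_chart strip_chart).
  by split; rewrite overlapE.
apply/(smVP _ (open_strip oJ)) => j.
by apply: eq_sm (open_strip oJ) _ (sm_coord _ j) => q Sq; rewrite transitionE.
Qed.

Lemma strip_oriented q : overlap strip_chart strip_chart q ->
  0 < \det (jac (transition strip_chart strip_chart) q).
Proof.
rewrite overlapE => Sq.
suff -> : jac (transition strip_chart strip_chart) q = 1%:M by rewrite det1.
apply/matrixP => i j; rewrite mxE.
rewrite (eq_partial i (open_strip oJ) Sq transitionE).
have E : partial i (id : 'rV[R]_2 -> 'rV[R]_2) q = delta_mx 0 i.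
  by apply: partial_rowE => k; rewrite mxE eqxx /= eq_sym; exact: coord_derive.
by rewrite E !mxE eqxx /= eq_sym.
Qed.

(** Compatibility and orientation only concern the identity transition. The definition is
    transparent because the carrier and the atlas have to compute. *)
Definition strip_surface : surface R.
Proof.
apply: (@Surface R S [set strip_chart] strip_hausdorff strip_second_countable
  strip_connected (ex_intro _ (pt strip0) Logic.I)).
- by move=> p; exists strip_chart.
- by move=> c d -> ->; exact: strip_compatible.
- by move=> c d -> -> q; exact: strip_oriented.
Defined.

End StripSurface.

(** * Locality: maps that agree on an open set *)

Section EqualSurfaces.
Variables (R : realType) (f : R -> R) (U : set 'rV[R]_2) (F X : 'rV[R]_2 -> 'rV[R]_5).
Hypotheses (oU : open U) (FX : forall q, U q -> F q = X q).
Local Notation g := (rw_metric f).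

Lemma eq_first_form q : U q -> first_form g F q = first_form g X q.
Proof.
move=> Uq; have E : jac F q = jac X q.
  by apply/matrixP => i j; rewrite !mxE (eq_partial i oU Uq FX).
by rewrite /first_form E (FX Uq).
Qed.

Lemma eq_tan_part q v : U q -> tan_part g F q v = tan_part g X q v.
Proof.
move=> Uq; rewrite /tan_part (eq_first_form Uq) (FX Uq).
apply: eq_bigr => i _; apply: eq_bigr => j _.
by rewrite (eq_partial i oU Uq FX) (eq_partial j oU Uq FX).
Qed.

Lemma eq_nor_part q v : U q -> nor_part g F q v = nor_part g X q v.
Proof. by move=> Uq; rewrite /nor_part eq_tan_part. Qed.

Lemma eq_cov_along i V W q : U q -> (forall x, U x -> V x = W x) ->
  cov_along g F i V q = cov_along g X i W q.
Proof.
move=> Uq VW; rewrite /cov_along (eq_partial i oU Uq VW) (eq_partial i oU Uq FX).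
by rewrite (FX Uq) (VW q Uq).
Qed.

Lemma eq_mean_curvature q : U q -> mean_curvature g F q = mean_curvature g X q.
Proof.
move=> Uq.
have E i j : second_form g F i j q = second_form g X i j q.
  have Ec := eq_cov_along i Uq (fun x Ux => eq_partial j oU Ux FX).
  exact (etrans (eq_nor_part _ Uq) (congr1 (nor_part g X q) Ec)).
apply: (congr1 (fun v => 2^-1 *: v)); apply: eq_bigr => i _; apply: eq_bigr => j _.
exact (congr2 (fun (h : 'M[R]_2) v => h i j *: v) (congr1 invmx (eq_first_form Uq)) (E i j)).
Qed.

End EqualSurfaces.

(** * The model is a biconservative PMCV surface *)

Section Forward.
Variables (R : realType) (I : set R) (f : R -> R) (H0 : R).
Hypotheses (oI : open I) (sf : smooth1 I f) (f0 : forall t, I t -> f t != 0).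
Variables (J : set R) (y : R -> R) (a b c2 c3 : R).
Hypotheses (oJ : open J) (iJ : is_interval J) (JI : J `<=` I) (sy : smooth1 J y).
Hypotheses (ac : admissible_constants H0 a b c2 c3) (sys : system_on J H0 a b c2 c3 f y).
Variable u0 : R.
Hypothesis Ju0 : J u0.
Local Notation g := (rw_metric f).
Local Notation X := (model_surface H0 a c2 c3 f y).
Hypothesis pd : forall q, strip J q -> positive_definite (first_form g X q).

Let a0 : a != 0. Proof. by case: ac => -[]. Qed.
Let c30 : c3 != 0. Proof. by case: ac => -[]. Qed.
Let bE : b ^+ 2 = a ^+ 2 - 4 * H0 ^+ 2. Proof. by case: ac => _ []. Qed.
Let unitE : c2 ^+ 2 + c3 ^+ 2 + 4 * H0 ^+ 2 / a ^+ 2 = 1. Proof. by case: ac => _ []. Qed.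

Local Notation U := (strip J).
Let oU : open U := open_strip oJ.
Let XE := model_radial f H0 y a c2 c3.
Let e4 := radial a (fun=> 0) (fun u => - 2 * H0 / a * (f u)^-1) (fun u => c2 * (f u)^-1)
  (fun u => c3 * (f u)^-1).

Let sX : smF U X. Proof. by rewrite XE; exact (smF_model H0 sf f0 c2 oJ JI sy a0 c30). Qed.
Let gd q : U q -> 0 < gdet f X q. Proof. by move=> Uq; have [] := pd_gdet (pd Uq). Qed.

Let square_gt1 (A N : R) : 0 < A ^+ 2 * N - 1 -> N != 0.
Proof. by apply: contraTneq => ->; rewrite mulr0 sub0r oppr_gt0 ltr10. Qed.

Let mcX q : U q -> mean_curvature g X q = H0 *: e4 q.
Proof.
move=> Uq; have := gd Uq; rewrite XE => p.
(* The Gram determinant is E, because v is arclength on the circles; its positivity gives both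
   non-vanishing conditions of [model_core]. *)
have gE := model_gdet H0 sf f0 c2 oJ JI sy a0 c30 Uq; rewrite gE in p.
have [s1 s2] := sys Uq.
exact: (model_mean_curvature sf f0 oJ JI sy a0 c30 Uq unitE (lt0r_neq0 p) (square_gt1 p) bE s1 s2).
Qed.

Let M := strip_surface oJ iJ Ju0.
Let phi (p : M) : 'rV[R]_5 := X (set_val (p : set_type U)).
Let F := phi \o ch_para (strip_chart oJ Ju0).

Let FX q : U q -> F q = X q.
Proof. by move=> Uq; rewrite /F /= /phi strip_paraK. Qed.

Let sF : smF U F.
Proof. by apply: eq_smF sX => // q Uq; rewrite FX. Qed.

Let FI q : U q -> I (F q 0 0).
Proof. by move=> Uq; rewrite (FX Uq) XE mk50; exact: JI. Qed.

Let se4 : smF U e4. Proof. exact (smF_model_normal H0 sf f0 a c2 c3 oJ JI). Qed.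

Let gdF q : U q -> 0 < gdet f F q.
Proof.
by move=> Uq; have [] := @pd_gdet _ f F q; rewrite ?(eq_first_form f oU FX Uq)//; exact: pd.
Qed.

Let gdF0 q : U q -> gdet f F q != 0. Proof. by move=> /gdF /lt0r_neq0. Qed.

Let mcF q : U q -> mean_curvature g F q = H0 *: e4 q.
Proof. by move=> Uq; rewrite (eq_mean_curvature f oU FX Uq) mcX. Qed.

Let V q := 2 * H0 *: e4 q.
Let sV : smF U V.
Proof. exact: (smF_scale oU (sm_cst U (2 * H0)) se4). Qed.

Let tensionF q : U q -> tension g F q = V q.
Proof. by move=> Uq; rewrite (tension_mean oI sf f0 oU sF FI Uq) (mcF Uq) scalerA. Qed.

Let e4_normal q k : U q -> inner g (F q) (e4 q) (partial k F q) = 0.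
Proof.
move=> Uq; rewrite (FX Uq) (eq_partial k oU Uq FX) XE.
exact (model_normal_e H0 sf f0 c2 oJ JI sy a0 c30 Uq k).
Qed.

Let e4_unit q : U q -> inner g (F q) (e4 q) (e4 q) = 1.
Proof.
move=> Uq; rewrite (FX Uq) XE; exact (model_normal_unit f0 y JI a0 Uq unitE).
Qed.

Let nor_e4 i W k q : U q -> (forall x, U x -> W x = k *: e4 x) ->
  nor_part g F q (cov_along g F i W q) = 0.
Proof.
move=> Uq WE.
have E1 : cov_along g F i W q = cov_along g F i (fun x => k *: e4 x) q.
  exact (@eq_cov_along R f U F F oU (fun _ _ => erefl) i W (fun x => k *: e4 x) q Uq WE).
have E2 : cov_along g F i (fun x => k *: e4 x) q = k *: cov_along g F i e4 q.
  have dV := fld_derivable (i:=i) se4 Uq; rewrite (covE sf f0 FI i _ Uq) (covE sf f0 FI i e4 Uq).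
  have E4 : partial i (fun x => k *: e4 x) q = k *: partial i e4 q by exact: deriveZ.
  by rewrite E4 gamZr scalerDr.
have E3 : cov_along g F i e4 q = if i == 0 then 0 else - 2 * H0 *: partial 1 F q.
  apply: etrans (@eq_cov_along R f U F X oU FX i e4 e4 q Uq (fun _ _ => erefl)) _.
  have E4 := eq_partial 1 oU Uq FX; rewrite E4 XE.
  exact (cov_model_normal H0 sf f0 c2 oJ JI sy a0 c30 Uq i).
apply: (@nor_part_uniq _ f F q (gdF0 Uq) _ 0 0 (if i == 0 then 0 else k * (- 2 * H0))).
  apply: (etrans E1 (etrans E2 (etrans (congr1 (fun v => k *: v) E3) _))).
  by rewrite scale0r add0r addr0; case: ifP => _; rewrite ?scaler0 ?scale0r// scalerA.
by move=> j; exact (ip0l f F q (partial j F q)).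
Qed.

Lemma model_is_surface : biconservative_PMCV_surface I f phi H0 /\ parametrized_by phi U X.
Proof.
split; last first.
  exists (strip_chart oJ Ju0); split => //.
  by move=> d ->; exact: strip_compatible.
split.
- split=> [p|c ->]; first by rewrite /rw_space /= /phi XE mk50; apply: JI; exact: (set_valP (p : set_type U)).
  split; first by apply/(smVP _ oU) => j; exact: sF.
  by move=> q Uq; rewrite (eq_first_form f oU FX Uq); exact: pd.
(* The product of d/dt with phi_u is -1, as phi_u has time component 1. *)
- move=> c -> q Uq; apply/eqP => T0; have := tan_part0 (gdF0 Uq) T0 0.
  rewrite inner_rw (_ : sp _ = 0) ?dot0l ?mulr0 ?addr0; last first.
    by apply/rowP => k; rewrite !mxE.
  have -> : partial 0 F q 0 0 = 1.
    apply: etrans (fld_partial 0 0 sF Uq) _.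
    rewrite (@eq_partial _ _ _ 0 U _ (fun x => x 0 0 : R) q oU Uq); last first.
      by move=> x Ux; rewrite (FX Ux) XE mk50.
    by rewrite partial_coord.
  by rewrite mxE mulr1 => /eqP; rewrite oppr_eq0 oner_eq0.
- move=> c -> q Uq i; exact: nor_e4 Uq mcF.
(* The tension field 2 H0 e4 has no time component, so the expression in [ip_bitension_time]
   vanishes. *)
- move=> c -> q Uq; apply: tan_part_normal => k.
  have V0 x : V x 0 0 = 0 by rewrite rVZ mk50 mulr0.
  have E := @ip_bitension_time _ _ _ oI sf f0 U F oU sF FI gdF0 V (4 * H0 ^+ 2) sV tensionF
    (fun q Uq j => nor_e4 j Uq (fun x _ => erefl)) _ _ q k Uq.
  apply: etrans (E _ _) _; last by rewrite V0 mulr0 mulr0 mul0r.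
    move=> x Ux l; apply: etrans (ipZl f F x (2 * H0) (e4 x) (partial l F x)) _.
    by rewrite (e4_normal l Ux) mulr0.
  move=> x Ux; apply: etrans (ipZl f F x (2 * H0) (e4 x) (V x)) _.
  apply: etrans (congr1 ( *%R (2 * H0)) (ipZr f F x (2 * H0) (e4 x) (e4 x))) _.
  by rewrite (e4_unit Ux); ring.
- exists (fun p : M => e4 (set_val (p : set_type U))) => c ->.
  have E q : U q -> e4 q = e4 (set_val (strip_para Ju0 q)) by move=> Uq; rewrite strip_paraK.
  split; first by apply/(smVP _ oU) => j; exact: (eq_smF oU E se4 j).
  move=> q Uq /=; rewrite -(E q Uq); split; first by move=> i; exact: e4_normal.
    exact: e4_unit.
  exact: mcF.
Qed.

End Forward.

(** * Change of parameters *)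

Local Transparent partial gam dgam.

Lemma gamZl (R : realType) (f : R -> R) (p v w : 'rV[R]_5) k :
  gam f p (k *: v) w = k *: gam f p v w.
Proof. by rewrite gamC gamZr gamC. Qed.

Local Opaque partial gam dgam.

Lemma reparam_sum (R : comRingType) (h gi : 'M[R]_2) (J : 'I_2 -> 'I_2 -> R)
    (K : 'I_2 -> 'I_2 -> 'I_2 -> R) (e : 'I_2 -> 'rV[R]_5) (D : 'I_2 -> 'I_2 -> 'rV[R]_5) :
  (forall i j, gi i j = \sum_a \sum_b h a b * J a i * J b j) ->
  \sum_a \sum_b h a b *: (\sum_j K a b j *: e j + \sum_i \sum_j (J a i * J b j) *: D i j) =
  (\sum_a \sum_b h a b * K a b 0) *: e 0 + (\sum_a \sum_b h a b * K a b 1) *: e 1 +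
  \sum_i \sum_j gi i j *: D i j.
Proof.
move=> giE; rewrite !sum2 !giE !sum2; apply/rowP => m; rewrite !mxE.
move: (e 0 0 m) (e 1 0 m) (D 0 0 0 m) (D 0 1 0 m) (D 1 0 0 m) (D 1 1 0 m) => *.
ring.
Qed.

(** Entrywise form of G^-1 = J^T (J G J^T)^-1 J. *)
Lemma inv_reparam (R : realType) (J G : 'M[R]_2) i j : \det J != 0 -> \det G != 0 ->
  invmx G i j = \sum_a \sum_b invmx (J *m G *m J^T) a b * J a i * J b j.
Proof.
rewrite -!unitfE -!unitmxE => uJ uG.
have uJT : J^T \in unitmx by rewrite unitmx_tr.
have E : invmx (J *m G *m J^T) = invmx J^T *m invmx G *m invmx J.
  have X : (J *m G *m J^T) *m (invmx J^T *m invmx G *m invmx J) = 1%:M.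
    by rewrite !mulmxA mulmxK// mulmxK// mulmxV.
  have [uA _] := mulmx1_unit X.
  by rewrite -[RHS](mulKmx uA) X mulmx1.
have -> : invmx G = J^T *m invmx (J *m G *m J^T) *m J.
  by rewrite E !mulmxA mulmxV// mul1mx mulmxKV.
rewrite mxE exchange_big; apply: eq_bigr => b _; rewrite mxE mulr_suml.
by apply: eq_bigr => a _; rewrite mxE [J a i * _]mulrC.
Qed.

Lemma gam_lin (R : realType) (f : R -> R) (p v0 v1 w : 'rV[R]_5) a b :
  gam f p (a *: v0 + b *: v1) w = a *: gam f p v0 w + b *: gam f p v1 w.
Proof. by rewrite gamDl !gamZl. Qed.

Lemma regroup_lin (R : pzRingType) (V : lmodType R) (a b : R) (x y x' y' : V) :
  a *: x + b *: y + (a *: x' + b *: y') = a *: (x + x') + b *: (y + y').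
Proof. by rewrite !scalerDr addrACA. Qed.

Lemma ip_lin (R : realType) (f : R -> R) (F : 'rV[R]_2 -> 'rV[R]_5) q v a b x y :
  inner (rw_metric f) (F q) v (a *: x + b *: y) =
  a * inner (rw_metric f) (F q) v x + b * inner (rw_metric f) (F q) v y.
Proof. exact (etrans (ipDr f F q v _ _) (congr2 +%R (ipZr f F q a v x) (ipZr f F q b v y))). Qed.

Lemma cov_assemble (R : comRingType) (K J A : 'I_2 -> R) (e : 'I_2 -> 'rV[R]_5)
    (D : 'I_2 -> 'I_2 -> 'rV[R]_5) :
  K 0 *: e 0 + J 0 *: (\sum_i A i *: D i 0) + (K 1 *: e 1 + J 1 *: (\sum_i A i *: D i 1)) =
  \sum_j K j *: e j + \sum_i \sum_j (A i * J j) *: D i j.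
Proof.
rewrite !sum2; apply/rowP => m; rewrite !mxE.
move: (e 0 0 m) (e 1 0 m) (D 0 0 0 m) (D 0 1 0 m) (D 1 0 0 m) (D 1 1 0 m) => *.
ring.
Qed.

Lemma add_coeffs (R : pzRingType) (V : lmodType R) (a b x y : R) (e0 e1 n : V) :
  a *: e0 + b *: e1 + (x *: e0 + y *: e1 + n) = (a + x) *: e0 + (b + y) *: e1 + n.
Proof. by rewrite addrA addrACA -!scalerDl. Qed.

Section CovLinear.
Variables (R : realType) (I : set R) (f : R -> R).
Hypotheses (sf : smooth1 I f) (f0 : forall t, I t -> f t != 0).
Variables (U : set 'rV[R]_2) (F : 'rV[R]_2 -> 'rV[R]_5).
Hypothesis FI : forall q, U q -> I (F q 0 0).
Local Notation g := (rw_metric f).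

Lemma covD V V' i w : smF U V -> smF U V' -> U w ->
  cov_along g F i (fun w => V w + V' w) w = cov_along g F i V w + cov_along g F i V' w.
Proof.
move=> sV sV' Uw; rewrite !(covE sf f0 FI i _ Uw).
have -> : partial i (fun w => V w + V' w) w = partial i V w + partial i V' w.
  exact: deriveD (fld_derivable (i:=i) sV Uw) (fld_derivable (i:=i) sV' Uw).
by rewrite gamDr addrACA.
Qed.

Lemma cov_scale (a : 'rV[R]_2 -> R) V i w : sm U a -> smF U V -> U w ->
  cov_along g F i (fun w => a w *: V w) w =
  partial i a w *: V w + a w *: cov_along g F i V w.
Proof.
move=> sa sV Uw; rewrite !(covE sf f0 FI i _ Uw) gamZr scalerDr addrA; congr (_ + _).
apply: partial_rowE => k.
have da : is_derive w (delta_mx 0 i : 'rV[R]_2) a (partial i a w).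
  by apply: derivableP; exact: sm_derivable sa Uw.
apply: (is_derive_as (idM da (fld_derive i k sV Uw))).
  by apply/funext => x; rewrite rVZ.
by rewrite rVD !rVZ; ring.
Qed.

End CovLinear.

Section Reparam.
Variables (R : realType) (I : set R) (f : R -> R).
Hypotheses (oI : open I) (sf : smooth1 I f) (f0 : forall t, I t -> f t != 0).
Variables (U : set 'rV[R]_2) (F : 'rV[R]_2 -> 'rV[R]_5).
Hypotheses (oU : open U) (sF : smF U F) (FI : forall q, U q -> I (F q 0 0)).
Variables (W : set 'rV[R]_2) (G : 'rV[R]_2 -> 'rV[R]_2).
Hypotheses (oW : open W) (WU : forall w, W w -> U (G w)).
Hypothesis sG : forall j, sm W (fun w => G w 0 j).
Local Notation g := (rw_metric f).
Local Notation J w := (jac G w).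
Local Notation FG := (fun w => F (G w)).

Lemma jacE w i j : W w -> J w i j = partial i (fun w => G w 0 j) w.
Proof.
move=> Ww; rewrite mxE partial_mx//.
by apply/derivable_mxP => c k; rewrite (ord1 c); exact: sm_derivable (sG k) Ww.
Qed.

Lemma sm_reparam (h : 'rV[R]_2 -> R) : sm U h -> sm W (fun w => h (G w)).
Proof. by move=> sh k; apply: Ck_comp oW oU WU (sh k) (fun j => sG j k). Qed.

Lemma partial_reparam (h : 'rV[R]_2 -> R) i w : sm U h -> W w ->
  partial i (fun w => h (G w)) w = \sum_j J w i j * partial j h (G w).
Proof.
move=> sh Ww.
have C := chain (t := w) (v := delta_mx 0 i) oU (sh 1%N) (WU Ww)
  (fun j => sm_derivable (i:=i) (sG j) Ww).
apply: etrans (partialE C) _; apply: eq_bigr => j _.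
by rewrite (jacE i j Ww) mulrC.
Qed.

Lemma smF_reparam V : smF U V -> smF W (fun w => V (G w)).
Proof. by move=> sV k; exact: sm_reparam (sV k). Qed.

Lemma fld_reparam V i w : smF U V -> W w ->
  partial i (fun w => V (G w)) w = \sum_j J w i j *: partial j V (G w).
Proof.
move=> sV Ww; apply/rowP => k.
apply: etrans (fld_partial i k (smF_reparam sV) Ww) _.
apply: etrans (partial_reparam i (sV k) Ww) _.
rewrite summxE; apply: eq_bigr => j _.
by rewrite rVZ (fld_partial j k sV (WU Ww)).
Qed.

Lemma FGI w : W w -> I (FG w 0 0). Proof. by move=> Ww; exact: FI (WU Ww). Qed.

Lemma cov_reparam V i w : smF U V -> W w ->
  cov_along g FG i (fun w => V (G w)) w = \sum_j J w i j *: cov_along g F j V (G w).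
Proof.
move=> sV Ww; rewrite (covE sf f0 FGI i _ Ww) (fld_reparam i sV Ww) (fld_reparam i sF Ww).
rewrite !sum2 (covE sf f0 FI 0 V (WU Ww)) (covE sf f0 FI 1 V (WU Ww)).
exact (etrans (congr1 (fun z => _ + z) (gam_lin _ _ _ _ _ _ _)) (regroup_lin _ _ _ _ _ _)).
Qed.

Lemma jac_reparam w : W w -> jac FG w = J w *m jac F (G w).
Proof.
move=> Ww; apply/matrixP => i k; rewrite mxE (fld_reparam i sF Ww) summxE mxE.
by apply: eq_bigr => j _; rewrite rVZ [jac F _ _ _]mxE.
Qed.

Lemma first_form_reparam w : W w ->
  first_form g FG w = J w *m first_form g F (G w) *m (J w)^T.
Proof. by move=> Ww; rewrite /first_form (jac_reparam Ww) trmx_mul !mulmxA. Qed.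

Hypothesis detJ : forall w, W w -> \det (J w) != 0.
Hypothesis gdet0 : forall q, U q -> gdet f F q != 0.

Lemma det2 (A : 'M[R]_2) : \det A = A 0 0 * A 1 1 - A 0 1 * A 1 0.
Proof.
rewrite (expand_det_row _ 0) sum2 /cofactor !det_mx11 !mxE /= expr0 expr1 mul1r.
rewrite (_ : lift 0 0 = 1); last exact: val_inj.
rewrite (_ : lift 1 0 = 0); last exact: val_inj.
by rewrite mulN1r mulrN.
Qed.

Lemma gdet_det (X : 'rV[R]_2 -> 'rV[R]_5) q : gdet f X q = \det (first_form g X q).
Proof.
rewrite det2; have E := first_formE f X q.
rewrite (E 0 0) (E 0 1) (E 1 0) (E 1 1).
have s := ipC f X q (partial 1 X q) (partial 0 X q).
exact (congr1 (fun z => _ - _ * z) (esym s)).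
Qed.

Lemma gdet_reparam w : W w -> gdet f FG w = \det (J w) ^+ 2 * gdet f F (G w).
Proof.
move=> Ww; rewrite !gdet_det (first_form_reparam Ww) !det_mulmx det_tr.
by rewrite expr2 mulrAC.
Qed.

Lemma gdet_reparam0 w : W w -> gdet f FG w != 0.
Proof. by move=> Ww; rewrite gdet_reparam// mulf_neq0 ?expf_neq0 ?detJ ?gdet0//; exact: WU. Qed.

Lemma span_reparam w x y : W w -> exists x' y',
  x *: partial 0 F (G w) + y *: partial 1 F (G w) =
  x' *: partial 0 FG w + y' *: partial 1 FG w.
Proof.
move=> Ww; have d0 := detJ Ww; rewrite det2 in d0.
rewrite (fld_reparam 0 sF Ww) (fld_reparam 1 sF Ww) !sum2.
move: (J w) d0 (partial 0 F (G w)) (partial 1 F (G w)) => A d0 e0 e1.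
exists ((x * A 1 1 - y * A 1 0) / (A 0 0 * A 1 1 - A 0 1 * A 1 0)).
exists ((y * A 0 0 - x * A 0 1) / (A 0 0 * A 1 1 - A 0 1 * A 1 0)).
rewrite !scalerDr !scalerA addrACA -!scalerDl.
by congr (_ *: _ + _ *: _); field.
Qed.

Lemma normal_reparam w v : W w ->
  (forall k, inner g (F (G w)) v (partial k F (G w)) = 0) ->
  forall k, inner g (FG w) v (partial k FG w) = 0.
Proof.
move=> Ww v0 k; rewrite (fld_reparam k sF Ww) sum2.
apply: etrans (ip_lin f F (G w) v _ _ _ _) _.
by rewrite (v0 0) (v0 1) !mulr0 addr0.
Qed.

Lemma tan_part_reparam w v : W w -> tan_part g FG w v = tan_part g F (G w) v.
Proof.
move=> Ww; have gd := gdet0 (WU Ww).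
have [x [y E]] := span_reparam
  (\sum_j invmx (first_form g F (G w)) 0 j * inner g (F (G w)) v (partial j F (G w)))
  (\sum_j invmx (first_form g F (G w)) 1 j * inner g (F (G w)) v (partial j F (G w))) Ww.
have T := etrans (tan_part_sum f F (G w) v) E.
have N := nor_part_uniq (gdet_reparam0 Ww) (v := v) (w := nor_part g F (G w) v) (a := x) (c := y).
have nE : nor_part g FG w v = nor_part g F (G w) v.
  apply: N; first by rewrite -T /nor_part addrC subrK.
  exact: normal_reparam Ww (ip_nor_part gd v).
by move: nE; rewrite /nor_part => /addrI /oppr_inj.
Qed.

Lemma sm_jac i j : sm W (fun w => J w i j).
Proof. by apply: eq_sm oW _ (sm_partial i (sG j)) => w Ww; rewrite (jacE i j Ww). Qed.

(** Second derivatives of the change of parameters multiply tangent vectors only; apart from them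
    the second derivatives transform as a tensor, and their trace is invariant by [inv_reparam]. The
    normal part is then identified by uniqueness of the splitting. *)
Lemma mean_curvature_reparam w : W w -> mean_curvature g FG w = mean_curvature g F (G w).
Proof.
move=> Ww.
have sFG := smF_reparam sF; have sE j := smF_reparam (smF_partial oU j sF).
have DE a b : cov_along g FG a (partial b FG) w =
    \sum_j partial a (fun w => J w b j) w *: partial j F (G w) +
    \sum_i \sum_j (J w a i * J w b j) *: cov_along g F i (partial j F) (G w).
  have E1 : cov_along g FG a (partial b FG) w = cov_along g FG a
      (fun w => J w b 0 *: partial 0 F (G w) + J w b 1 *: partial 1 F (G w)) w.
    apply: (@eq_cov_along R f W FG FG oW (fun _ _ => erefl) a) => // x Wx.
    by rewrite (fld_reparam b sF Wx) sum2.
  have sJ j : sm W (fun w => J w b j) := sm_jac b j.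
  have E2 := @covD _ _ _ sf f0 W FG FGI (fun w => J w b 0 *: partial 0 F (G w))
    (fun w => J w b 1 *: partial 1 F (G w)) a w (smF_scale oW (sJ 0) (sE 0))
    (smF_scale oW (sJ 1) (sE 1)) Ww.
  have E3 j := @cov_scale _ _ _ sf f0 W FG FGI (fun w => J w b j)
    (fun w => partial j F (G w)) a w (sJ j) (sE j) Ww.
  have E4 j := cov_reparam a (smF_partial oU j sF) Ww.
  have E5 j := etrans (E3 j) (congr1 (fun z => _ + J w b j *: z) (E4 j)).
  apply: etrans E1 (etrans E2 (etrans (congr2 +%R (E5 0) (E5 1)) _)).
  exact (cov_assemble (fun j => partial a (fun w => J w b j) w) (fun j => J w b j)
    (fun i => J w a i) (fun j => partial j F (G w))
    (fun i j => cov_along g F i (partial j F) (G w))).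
have hE i j : invmx (first_form g F (G w)) i j =
    \sum_a \sum_b invmx (first_form g FG w) a b * J w a i * J w b j.
  rewrite (first_form_reparam Ww); apply: inv_reparam; first exact: detJ.
  by rewrite -gdet_det; exact: gdet0 (WU Ww).
have S := reparam_sum (fun a b j => partial a (fun w => J w b j) w)
  (fun j => partial j F (G w)) (fun i j => cov_along g F i (partial j F) (G w)) hE.
have gd := gdet0 (WU Ww).
pose v := \sum_i \sum_j invmx (first_form g F (G w)) i j *:
  cov_along g F i (partial j F) (G w).
have vE : v = (\sum_j invmx (first_form g F (G w)) 0 j *
    inner g (F (G w)) v (partial j F (G w))) *: partial 0 F (G w) +
  (\sum_j invmx (first_form g F (G w)) 1 j *
    inner g (F (G w)) v (partial j F (G w))) *: partial 1 F (G w) + nor_part g F (G w) v.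
  by rewrite -tan_part_sum /nor_part addrC subrK.
rewrite (mean_curvature_uniq gd vE (ip_nor_part gd v)).
set tx := (\sum_j _ * _) in vE; set ty := (\sum_j _ * _) in vE.
have S1 : \sum_a \sum_b invmx (first_form g FG w) a b *: cov_along g FG a (partial b FG) w =
   (\sum_a \sum_b invmx (first_form g FG w) a b * partial a (fun w => J w b 0) w) *:
       partial 0 F (G w) +
   (\sum_a \sum_b invmx (first_form g FG w) a b * partial a (fun w => J w b 1) w) *:
       partial 1 F (G w) + v.
  apply: etrans S; apply: eq_bigr => a _; apply: eq_bigr => b _.
  exact (congr1 (fun z => _ *: z) (DE a b)).
have S2 := etrans S1 (etrans (congr1 (fun z => _ + z) vE) (add_coeffs _ _ _ _ _ _ _)).
have [x [y E]] := span_reparam (\sum_a \sum_b invmx (first_form g FG w) a b *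
    partial a (fun w => J w b 0) w + tx) (\sum_a \sum_b invmx (first_form g FG w) a b *
    partial a (fun w => J w b 1) w + ty) Ww.
have S3 := etrans S2 (congr1 (fun z => z + _) E).
exact (mean_curvature_uniq (gdet_reparam0 Ww) S3 (normal_reparam Ww (ip_nor_part gd v))).
Qed.

End Reparam.

(** * Local structure of biconservative PMCV surfaces *)

Local Transparent partial gam dgam.

Lemma gam_time (R : realType) (f : R -> R) (p v w : 'rV[R]_5) :
  gam f p v w 0 0 = f (p 0 0) * derive1 f (p 0 0) * dot (sp v) (sp w).
Proof. by rewrite mk50. Qed.

Lemma gam_space (R : realType) (f : R -> R) (p v w : 'rV[R]_5) l :
  gam f p v w 0 (lift 0 l) = derive1 f (p 0 0) / f (p 0 0) *
    (v 0 0 * w 0 (lift 0 l) + w 0 0 * v 0 (lift 0 l)).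
Proof. by rewrite mk5S rVZ rVD !rVZ !spE. Qed.

Lemma lin_coord (R : realType) (a b : R) (v w z : 'rV[R]_5) k :
  z = a *: v + b *: w -> z 0 k = a * v 0 k + b * w 0 k.
Proof. by move=> ->; rewrite rVD !rVZ. Qed.

Lemma swap0 (R : comRingType) (a b : R) : - b * a + a * b = 0.
Proof. by ring. Qed.

Lemma comb_eq0 (R : realType) (a b : R) (v w : 'rV[R]_5) :
  a * v 0 0 + b * w 0 0 = 0 ->
  (forall l, a * v 0 (lift 0 l) + b * w 0 (lift 0 l) = 0) -> a *: v + b *: w = 0.
Proof.
by move=> h0 h; apply/rowP; apply: ord5P => [|l]; rewrite rVD !rVZ [RHS]mxE ?h0 ?h.
Qed.

Local Opaque partial gam dgam.

(** A 2 by 2 matrix s that kills t has (-t1, t0) as a left eigenvector, with eigenvalue its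
    trace. *)
Lemma shear_algebra (R : comRingType) (s00 s01 s10 s11 t0 t1 x0 x1 F H : R) :
  s00 * t0 + s01 * t1 = 0 -> s10 * t0 + s11 * t1 = 0 -> s00 + s11 = - 2 * H ->
  - t1 * (F * (s00 * x0 + s01 * x1)) + t0 * (F * (s10 * x0 + s11 * x1)) =
  - 2 * H * F * (- t1 * x0 + t0 * x1).
Proof.
move=> h0 h1 <-.
have -> : - t1 * (F * (s00 * x0 + s01 * x1)) + t0 * (F * (s10 * x0 + s11 * x1)) =
  (s00 + s11) * F * (- t1 * x0 + t0 * x1) + F * x0 * (s10 * t0 + s11 * t1)
  - F * x1 * (s00 * t0 + s01 * t1) by ring.
by rewrite h0 h1 !mulr0 addr0 subr0.
Qed.

(** The matrix s has a non-zero kernel vector, hence determinant zero. *)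
Lemma rank_one_algebra (R : idomainType) (s00 s01 s10 s11 t0 t1 x0 x1 z0 z1 F : R) :
  s00 * t0 + s01 * t1 = 0 -> s10 * t0 + s11 * t1 = 0 -> (t0 != 0) || (t1 != 0) ->
  F * (s00 * x0 + s01 * x1) * (F * (s10 * z0 + s11 * z1)) =
  F * (s10 * x0 + s11 * x1) * (F * (s00 * z0 + s01 * z1)).
Proof.
move=> h0 h1 t; have d : s00 * s11 - s01 * s10 = 0.
  have [t0n|t1n] := orP t.
    apply: (mulfI t0n); rewrite mulr0.
    have -> : t0 * (s00 * s11 - s01 * s10) = s11 * (s00 * t0 + s01 * t1) -
      s01 * (s10 * t0 + s11 * t1) by ring.
    by rewrite h0 h1 !mulr0 subr0.
  apply: (mulfI t1n); rewrite mulr0.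
  have -> : t1 * (s00 * s11 - s01 * s10) = s00 * (s10 * t0 + s11 * t1) -
    s10 * (s00 * t0 + s01 * t1) by ring.
  by rewrite h0 h1 !mulr0 subr0.
apply/eqP; rewrite -subr_eq0.
have -> : F * (s00 * x0 + s01 * x1) * (F * (s10 * z0 + s11 * z1)) -
  F * (s10 * x0 + s11 * x1) * (F * (s00 * z0 + s01 * z1)) =
  F ^+ 2 * (s00 * s11 - s01 * s10) * (x0 * z1 - x1 * z0) by ring.
by rewrite d mulr0 mul0r.
Qed.

Lemma det_inverse (R : realType) (A : 'M[R]_2) t0 t1 n0 n1 :
  A 0 0 * t0 + A 0 1 * t1 = 1 -> A 1 0 * t0 + A 1 1 * t1 = 0 ->
  A 0 0 * n0 + A 0 1 * n1 = 0 -> A 1 0 * n0 + A 1 1 * n1 = 1 -> \det A != 0.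
Proof.
move=> a0 a1 b0 b1; rewrite det2.
have E : (A 0 0 * A 1 1 - A 0 1 * A 1 0) * (t0 * n1 - t1 * n0) = 1.
  have -> : (A 0 0 * A 1 1 - A 0 1 * A 1 0) * (t0 * n1 - t1 * n0) =
   (A 0 0 * t0 + A 0 1 * t1) * (A 1 0 * n0 + A 1 1 * n1) -
   (A 1 0 * t0 + A 1 1 * t1) * (A 0 0 * n0 + A 0 1 * n1) by ring.
  by rewrite a0 a1 b0 b1 mulr0 mulr1 subr0.
by apply/eqP => d0; move/eqP: E; rewrite d0 mul0r eq_sym oner_eq0.
Qed.

(** The gradients k and l are parallel, and k is non-zero since (c, d) pairs to 1 with it; so a
    direction that kills k kills l. *)
Lemma rank_one_const (R : comRingType) (a b c d k0 k1 l0 l1 : R) :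
  a * k0 + b * k1 = 0 -> c * k0 + d * k1 = 1 -> l0 * k1 = l1 * k0 -> a * l0 + b * l1 = 0.
Proof.
move=> h0 h1 h; rewrite -[LHS]mulr1 -{1}h1.
have -> : (a * l0 + b * l1) * (c * k0 + d * k1) =
  (c * l0 + d * l1) * (a * k0 + b * k1) + (a * d - b * c) * (l0 * k1 - l1 * k0) by ring.
by rewrite h0 h subrr !mulr0 addr0.
Qed.

(** Along W = (-t1, t0) the time is constant, so n/(2 H f) varies as n does and exactly compensates
    x. *)
Lemma shear_const (R : fieldType) (t0 t1 x0 x1 n n0 n1 H F F1 : R) : 2 * H * F != 0 ->
  - t1 * n0 + t0 * n1 = - 2 * H * F * (- t1 * x0 + t0 * x1) ->
  - t1 * (x0 + (n0 * (2 * H * F) - n * (2 * H * (F1 * t0) + F * 0)) / (2 * H * F) ^+ 2) +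
  t0 * (x1 + (n1 * (2 * H * F) - n * (2 * H * (F1 * t1) + F * 0)) / (2 * H * F) ^+ 2) = 0.
Proof.
move=> h E.
have -> : - t1 * (x0 + (n0 * (2 * H * F) - n * (2 * H * (F1 * t0) + F * 0)) / (2 * H * F) ^+ 2) +
  t0 * (x1 + (n1 * (2 * H * F) - n * (2 * H * (F1 * t1) + F * 0)) / (2 * H * F) ^+ 2) =
  (- t1 * x0 + t0 * x1) + (- t1 * n0 + t0 * n1) * ((2 * H * F) / (2 * H * F) ^+ 2) by ring.
rewrite E (_ : - 2 * H * F = - (2 * H * F)); last by ring.
by move: (2 * H * F) h => d d0; field.
Qed.

(** Both (c, d) and (-t1, t0) are annihilated by the non-zero covector t, so they are
    proportional. *)
Lemma shear_zero (R : idomainType) (c d t0 t1 y0 y1 : R) : (t0 != 0) || (t1 != 0) ->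
  c * t0 + d * t1 = 0 -> - t1 * y0 + t0 * y1 = 0 -> c * y0 + d * y1 = 0.
Proof.
move=> t h0 h1; have [tn|tn] := orP t; apply: (mulfI tn); rewrite mulr0.
  have -> : t0 * (c * y0 + d * y1) = y0 * (c * t0 + d * t1) + d * (- t1 * y0 + t0 * y1) by ring.
  by rewrite h0 h1 !mulr0 addr0.
have -> : t1 * (c * y0 + d * y1) = y1 * (c * t0 + d * t1) - c * (- t1 * y0 + t0 * y1) by ring.
by rewrite h0 h1 !mulr0 subr0.
Qed.

Lemma gram_nondegenerate (R : idomainType) (A B C a b : R) : (a != 0) || (b != 0) ->
  - b * A + a * B = 0 -> - b * B + a * C = 0 -> A * C - B * B != 0 -> False.
Proof.
move=> ab h0 h1 /eqP []; have [an|bn] := orP ab.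
  apply: (mulfI an); rewrite mulr0.
  have -> : a * (A * C - B * B) = A * (- b * B + a * C) - B * (- b * A + a * B) by ring.
  by rewrite h0 h1 !mulr0 subr0.
apply: (mulfI bn); rewrite mulr0.
have -> : b * (A * C - B * B) = B * (- b * B + a * C) - C * (- b * A + a * B) by ring.
by rewrite h0 h1 !mulr0 subr0.
Qed.

Lemma neq_swap (R : comRingType) (a b x y c : R) : - b * x + a * y = c -> c != 0 ->
  a * y - b * x != 0.
Proof. by move=> <-; rewrite addrC mulNr. Qed.

Lemma smooth_slice1 (R : realType) (B : set 'rV[R]_2) (K : set R) (u0 : R)
    (h : 'rV[R]_2 -> R) : open B -> open K -> (forall s, K s -> B (mk2 u0 s)) -> sm B h ->
  smooth1 K (fun s => h (mk2 u0 s)).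
Proof.
move=> oB oK KB sh; apply/(smooth1_strip _ oK) => m.
apply: (Ck_comp (G := fun q : 'rV[R]_2 => mk2 u0 (q 0 0)) (open_strip oK) oB) (sh m) _.
  by move=> q /KB.
apply: ord2P.
  have -> : (fun q : 'rV[R]_2 => mk2 u0 (q 0 0) 0 0) = (fun=> u0).
    by apply/funext => q; rewrite mk20.
  exact: Ck_cst.
have -> : (fun q : 'rV[R]_2 => mk2 u0 (q 0 0) 0 1) = (fun q => q 0 0).
  by apply/funext => q; rewrite mk21.
exact: Ck_coord.
Qed.

Lemma smooth_slice0 (R : realType) (B : set 'rV[R]_2) (K : set R) (s0 : R)
    (h : 'rV[R]_2 -> R) : open B -> open K -> (forall u, K u -> B (mk2 u s0)) -> sm B h ->
  smooth1 K (fun u => h (mk2 u s0)).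
Proof.
move=> oB oK KB sh; apply/(smooth1_strip _ oK) => m.
apply: (Ck_comp (G := fun q : 'rV[R]_2 => mk2 (q 0 0) s0) (open_strip oK) oB) (sh m) _.
  by move=> q /KB.
apply: ord2P.
  have -> : (fun q : 'rV[R]_2 => mk2 (q 0 0) s0 0 0) = (fun q => q 0 0).
    by apply/funext => q; rewrite mk20.
  exact: Ck_coord.
have -> : (fun q : 'rV[R]_2 => mk2 (q 0 0) s0 0 1) = (fun=> s0).
  by apply/funext => q; rewrite mk21.
exact: Ck_cst.
Qed.

Section LocalStructure.
Variables (R : realType) (I : set R) (f : R -> R) (H0 : R).
Hypotheses (oI : open I) (sf : smooth1 I f) (f0 : forall t, I t -> f t != 0).
Hypothesis gen : forall t, I t ->
  derive1 (derive1 f) t / f t - derive1 f t ^+ 2 / f t ^+ 2 != 0.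
Hypothesis H00 : H0 != 0.
Variables (U : set 'rV[R]_2) (F e4 : 'rV[R]_2 -> 'rV[R]_5).
Hypotheses (oU : open U) (sF : smF U F) (FI : forall q, U q -> I (F q 0 0)).
Hypothesis gdet0 : forall q, U q -> gdet f F q != 0.
Local Notation g := (rw_metric f).
Local Notation ip q := (inner g (F q)).
Local Notation D := (cov_along g F).
Local Notation gi q := (invmx (first_form g F q)).
Hypothesis se4 : smF U e4.
Hypothesis e4n : forall q, U q -> forall k, ip q (e4 q) (partial k F q) = 0.
Hypothesis e4u : forall q, U q -> ip q (e4 q) (e4 q) = 1.
Hypothesis mcE : forall q, U q -> mean_curvature g F q = H0 *: e4 q.
Hypothesis par : forall q, U q -> forall i, nabla_perp g F i (mean_curvature g F) q = 0.
Hypothesis bic : forall q, U q -> tan_part g F q (bitension g F q) = 0.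
Hypothesis T0 : forall q, U q -> tan_part g F q (d_dt R) != 0.

Let cov_cst k i q : U q -> D i (fun x => k *: e4 x) q = k *: D i e4 q.
Proof.
move=> Uq; have E := cov_scale sf f0 FI i (sm_cst U k) se4 Uq.
by apply: etrans E _; rewrite partial_cst scale0r add0r.
Qed.

Let De4_tan i q : U q -> nor_part g F q (D i e4 q) = 0.
Proof.
move=> Uq; apply: (scalerI H00); rewrite scaler0.
have E1 := eq_cov f F oU i Uq mcE.
have E2 := congr1 (nor_part g F q) (etrans E1 (cov_cst H0 i Uq)).
exact (etrans (esym (nor_partZ f F q H0 _)) (etrans (esym E2) (par Uq i))).
Qed.

Let Ht q := 2 * H0 *: e4 q.

Let bit q k : U q -> ip q (bitension g F q) (partial k F q) =
  - 2 * ((f (F q 0 0) * derive1 (derive1 f) (F q 0 0) - derive1 f (F q 0 0) ^+ 2) /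
    f (F q 0 0) ^+ 2 * Ht q 0 0) * partial k F q 0 0.
Proof.
move=> Uq; have sV : smF U Ht := smF_scale oU (sm_cst U (2 * H0)) se4.
apply: (@ip_bitension_time _ _ _ oI sf f0 U F oU sF FI gdet0 Ht (4 * H0 ^+ 2) sV) => //.
- by move=> x Ux; rewrite (tension_mean oI sf f0 oU sF FI Ux) (mcE Ux) scalerA.
- move=> x Ux j; have E := cov_cst (2 * H0) j Ux.
  by rewrite [cov_along _ _ _ _ _]E nor_partZ De4_tan// scaler0.
- move=> x Ux l; apply: etrans (ipZl f F x (2 * H0) (e4 x) (partial l F x)) _.
  by rewrite (e4n Ux l) mulr0.
- move=> x Ux; apply: etrans (ipZl f F x (2 * H0) (e4 x) (Ht x)) _.
  apply: etrans (congr1 ( *%R (2 * H0)) (ipZr f F x (2 * H0) (e4 x) (e4 x))) _.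
  by rewrite (e4u Ux); ring.
Qed.

Let t i q := partial i F q 0 0.

Lemma t_neq0 q : U q -> (t 0 q != 0) || (t 1 q != 0).
Proof.
move=> Uq; rewrite -negb_and; apply: contra (T0 Uq) => /andP[/eqP a /eqP b].
apply/eqP; apply: tan_part_normal => k.
rewrite inner_rw (_ : sp (d_dt R) = 0) ?dot0l ?mulr0 ?addr0; last first.
  by apply/rowP => j; rewrite !mxE.
by have [->|->] := ord2_cases k; rewrite -/(t _ q) ?a ?b mulr0 oppr0.
Qed.

Lemma e4_time q : U q -> e4 q 0 0 = 0.
Proof.
move=> Uq; have fq := f0 (FI Uq); have B := tan_part0 (gdet0 Uq) (bic Uq).
have gq := gen (FI Uq); apply/eqP; apply: contraT => e0.
(* If e4 had a time component, biconservativity would force t to be critical at q, against the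
   non-vanishing of T. *)
have tk k : t k q = 0.
  have := etrans (esym (bit k Uq)) (B k); rewrite -/(t k q) /Ht rVZ.
  set c := (X in X / _ * _) => /eqP; rewrite !mulf_eq0 invr_eq0 expf_eq0 /= (negPf fq) orbF.
  rewrite (negPf e0) (negPf H00) oppr_eq0 !pnatr_eq0 /= !orbF => /orP[/eqP c0|/eqP//].
  case/eqP: gq; move: c0; rewrite /c; move: (derive1 f _) (derive1 _ _) fq => d dd.
  by move: (f _) => A A0 cc; rewrite -[LHS](mulfK (expf_neq0 2 A0)) -{1}[0](mul0r (A ^+ 2)^-1) -cc; field.
by have := t_neq0 Uq; rewrite !tk eqxx.
Qed.

Let n l q := f (F q 0 0) * e4 q 0 (lift 0 l).
Let x l q := F q 0 (lift 0 l).
(** Coefficients of D_i e4 in the tangent frame, that is, minus the shape operator of e4. *)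
Let s i j q := \sum_l gi q j l * ip q (D i e4 q) (partial l F q).

Let De4E i q : U q -> D i e4 q = s i 0 q *: partial 0 F q + s i 1 q *: partial 1 F q.
Proof.
by move=> Uq; rewrite -tan_part_sum; apply/eqP; rewrite -subr_eq0; apply/eqP; exact: De4_tan.
Qed.

Let e4_dot i q : U q -> dot (sp (e4 q)) (sp (partial i F q)) = 0.
Proof.
move=> Uq; have := e4n Uq i; rewrite inner_rw (e4_time Uq) mul0r oppr0 add0r => /eqP.
by rewrite mulf_eq0 expf_eq0 /= (negPf (f0 (FI Uq))) => /eqP.
Qed.

(** This is the time component of D_i e4: the derivative of e4's own time component, which is zero,
    plus a Christoffel term proportional to the product of e4 and phi_i. It says that the shape
    operator kills T. *)
Let st i q : U q -> s i 0 q * t 0 q + s i 1 q * t 1 q = 0.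
Proof.
move=> Uq; apply: etrans (esym (lin_coord 0 (De4E i Uq))) _.
apply: etrans (congr1 (fun v : 'rV[R]_5 => v 0 0) (covE sf f0 FI i e4 Uq)) _.
apply: etrans (rVD _ _ _) _; rewrite gam_time dotC (e4_dot i Uq) mulr0 addr0.
apply: etrans (fld_partial i 0 se4 Uq) _.
by rewrite (@eq_partial _ _ _ i U _ (fun=> 0 : R) q oU Uq e4_time) partial_cst.
Qed.

Let sX i l q : U q -> partial i e4 q 0 (lift 0 l) +
   derive1 f (F q 0 0) / f (F q 0 0) * (t i q * e4 q 0 (lift 0 l)) =
   s i 0 q * partial 0 F q 0 (lift 0 l) + s i 1 q * partial 1 F q 0 (lift 0 l).
Proof.
move=> Uq; apply: etrans (lin_coord (lift 0 l) (De4E i Uq)).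
apply: esym; apply: etrans (congr1 (fun v : 'rV[R]_5 => v 0 (lift 0 l)) (covE sf f0 FI i e4 Uq)) _.
apply: etrans (rVD _ _ _) _; rewrite gam_space (e4_time Uq) mul0r addr0.
by [].
Qed.

Lemma n_derive i l q : U q -> is_derive q (delta_mx 0 i : 'rV[R]_2) (n l)
  (f (F q 0 0) * (s i 0 q * partial 0 F q 0 (lift 0 l) + s i 1 q * partial 1 F q 0 (lift 0 l))).
Proof.
move=> Uq; have fq := f0 (FI Uq).
have M := idM (derive_f oI sf oU sF FI i Uq) (fld_derive i (lift 0 l) se4 Uq).
apply: (is_derive_as M erefl).
rewrite -(sX i l Uq) -/(t i q); move: (f (F q 0 0)) (derive1 f _) fq => A B A0.
by field.
Qed.

Let strace q : U q -> s 0 0 q + s 1 1 q = - 2 * H0.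
Proof.
move=> Uq.
have B i l : ip q (D i e4 q) (partial l F q) = - ip q (e4 q) (D i (partial l F) q).
  have := ip_compat oI sf f0 oU sF FI i se4 (smF_partial oU l sF) Uq.
  rewrite (@eq_partial _ _ _ i U _ (fun=> 0 : R) q oU Uq (fun x Ux => e4n Ux l)) partial_cst.
  by move=> /eqP; rewrite eq_sym addr_eq0 => /eqP.
have sE j : s j j q = - \sum_l gi q j l * ip q (e4 q) (D j (partial l F) q).
  by rewrite /s -sumrN; apply: eq_bigr => l _; rewrite B mulrN.
pose v := \sum_i \sum_j gi q i j *: D i (partial j F) q.
have vE := linear_sum2 (gi q) (fun i j => D i (partial j F) q)
  (ipDr f F q (e4 q)) (fun a w => ipZr f F q a (e4 q) w).
have -> : s 0 0 q + s 1 1 q = - ip q (e4 q) v.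
  by rewrite (sE 0) (sE 1) [ip q (e4 q) v]vE [in RHS]sum2 opprD.
have v2 : ip q (e4 q) v = ip q (e4 q) (nor_part g F q v).
  rewrite [in RHS]/nor_part (ipDr f F q (e4 q)) (ipNr f F q (e4 q)).
  suff -> : ip q (e4 q) (tan_part g F q v) = 0 by rewrite oppr0 addr0.
  rewrite tan_part_sum (ip_lin f F q (e4 q)) (e4n Uq 0) (e4n Uq 1) !mulr0.
  by rewrite addr0.
have vd : v = (\sum_j gi q 0 j * ip q v (partial j F q)) *: partial 0 F q +
  (\sum_j gi q 1 j * ip q v (partial j F q)) *: partial 1 F q + nor_part g F q v.
  by rewrite -tan_part_sum /nor_part addrC subrK.
have m2 := mean_curvature_uniq (gdet0 Uq) vd (ip_nor_part (gdet0 Uq) v).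
have n2 : nor_part g F q v = 2 *: (H0 *: e4 q).
  by rewrite -(mcE Uq) m2 scalerA divff ?pnatr_eq0// scale1r.
rewrite v2 n2 scalerA (ipZr f F q (2 * H0) (e4 q)) (e4u Uq); ring.
Qed.

(** W = -t_1 d_0 + t_0 d_1 is tangent to the slices t = const. The shape operator of e4 has
    eigenvalues 0 and 2 H0, and W belongs to the second, so f e4 moves along W proportionally to the
    surface itself. *)
Lemma n_shear l q : U q -> - t 1 q * partial 0 (n l) q + t 0 q * partial 1 (n l) q =
  - 2 * H0 * f (F q 0 0) * (- t 1 q * partial 0 F q 0 (lift 0 l) + t 0 q * partial 1 F q 0 (lift 0 l)).
Proof.
move=> Uq; rewrite (partialE (n_derive 0 l Uq)) (partialE (n_derive 1 l Uq)).
exact: shear_algebra (st 0 Uq) (st 1 Uq) (strace Uq).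
Qed.

Lemma n_rank_one l k q : U q ->
  partial 0 (n l) q * partial 1 (n k) q = partial 1 (n l) q * partial 0 (n k) q.
Proof.
move=> Uq; rewrite !(partialE (n_derive _ _ Uq)).
exact: rank_one_algebra (st 0 Uq) (st 1 Uq) (t_neq0 Uq).
Qed.

(** W is a non-zero tangent vector without time component, so some space coordinate moves along it.
    By [n_shear] the corresponding component of n moves too and can serve as second coordinate. *)
Lemma shear_neq0 q : U q -> exists l,
  - t 1 q * partial 0 F q 0 (lift 0 l) + t 0 q * partial 1 F q 0 (lift 0 l) != 0.
Proof.
move=> Uq; apply: contrapT => /forallNP h.
have v0 : - t 1 q *: partial 0 F q + t 0 q *: partial 1 F q = 0.
  have hl l : - t 1 q * partial 0 F q 0 (lift 0 l) + t 0 q * partial 1 F q 0 (lift 0 l) = 0.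
    by have /negP := h l; rewrite negbK => /eqP.
  exact (comb_eq0 (swap0 (t 0 q) (t 1 q)) hl).
have i0 k : - t 1 q * ip q (partial k F q) (partial 0 F q) +
    t 0 q * ip q (partial k F q) (partial 1 F q) = 0.
  by rewrite -(ip_lin f F q (partial k F q)) v0 (ip0r f F q).
have C := ipC f F q (partial 1 F q) (partial 0 F q).
have i1 := etrans (congr1 (fun z => - t 1 q * z + _) (esym C)) (i0 1).
exact (gram_nondegenerate (t_neq0 Uq) (i0 0) i1 (gdet0 Uq)).
Qed.

Let sn l : sm U (n l).
Proof.
exact: sm_mul oU (sm_f oI sf oU sF FI) (se4 (lift 0 l)).
Qed.

(** The pair (t, n_k) is a coordinate system by the inverse function theorem. Its range is shrunk to
    a product of intervals, so that a function with zero partial derivative in one variable is a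
    function of the other; this applies to n and to x + n/(2 H0 f). *)
Lemma box_coordinates p : U p -> exists (k : 'I_4) (u0 s0 e : R) (N Z : 'I_4 -> R -> R)
    (V : set 'rV[R]_2) (G : 'rV[R]_2 -> 'rV[R]_2),
  let J := [set u : R | `|u - u0| < e] in let K := [set s : R | `|s - s0| < e] in
  let B := [set w : 'rV[R]_2 | J (w 0 0) /\ K (w 0 1)] in
  [/\ [/\ 0 < e, open V, V p & V `<=` U],
   forall q, V q -> [/\ J (F q 0 0), K (n k q) & G (mk2 (F q 0 0) (n k q)) = q],
   forall w, B w -> [/\ V (G w), F (G w) 0 0 = w 0 0 & n k (G w) = w 0 1],
   [/\ forall j, sm B (fun w => G w 0 j), forall w, B w -> \det (jac G w) != 0,
    forall l, smooth1 K (N l) & forall l, smooth1 J (Z l)] &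
   forall q, V q -> forall l, n l q = N l (n k q) /\
     x l q = Z l (F q 0 0) - N l (n k q) / (2 * H0 * f (F q 0 0))].
Proof.
move=> Up; have [k sk] := shear_neq0 Up.
pose T q := mk2 (F q 0 0) (n k q).
have T0' : (fun q => T q 0 0) = (fun q => F q 0 0) by apply/funext => q; rewrite mk20.
have T1' : (fun q => T q 0 1) = n k by apply/funext => q; rewrite mk21.
have sT : forall j, sm U (fun q => T q 0 j).
  by apply: ord2P; rewrite ?T0' ?T1'; [exact: sF|exact: sn].
have dT : jdet T p != 0.
  rewrite /jdet /jent T0' T1' -!(fld_partial _ 0 sF Up) -/(t 0 p) -/(t 1 p).
  have E := n_shear k Up.
  apply: (neq_swap E).
  by rewrite !mulf_neq0 ?oppr_eq0 ?pnatr_eq0// f0//; exact: FI.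
have [V0 [W [G [[oV0 oW V0p V0U] h1 h2 sG]]]] := inverse_function oU sT Up dT.
have [WTp _] := h1 p V0p; have [e e0 eW] := open_ball oW WTp.
pose u0 := F p 0 0; pose s0 := n k p.
pose J := [set u : R | `|u - u0| < e]; pose K := [set s : R | `|s - s0| < e].
pose B := [set w : 'rV[R]_2 | J (w 0 0) /\ K (w 0 1)].
have BW w : B w -> W w.
  move=> [Jw Kw]; apply: eW; apply: norm2_lt; rewrite // rVD rVN ?mk20 ?mk21 distrC //.
have oI' (c : R) : open [set u : R | `|u - c| < e].
  have -> : [set u : R | `|u - c| < e] = ball c e.
    by apply/seteqP; split => z; rewrite /ball /= distrC.
  exact: ball_open.
have iI (c : R) : is_interval [set u : R | `|u - c| < e].
  move=> z1 z2 /=; rewrite !ltr_distl => /andP[a1 a2] /andP[b1 b2] z /andP[c1 c2].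
  by rewrite ltr_distl (lt_le_trans a1 c1) (le_lt_trans c2 b2).
have oB : open B.
  have -> : B = strip J `&` [set w : 'rV[R]_2 | K (w 0 1)] by [].
  apply: openI; first exact: open_strip (oI' u0).
  by apply: open_comp (oI' s0) => q _; exact: coord_continuous.
(* The norm is the maximum norm, so the preimage of the e-ball is the preimage of the box. *)
pose V := [set q | V0 q /\ `|T q - T p| < e].
have VB q : V q -> J (F q 0 0) /\ K (n k q).
  move=> [_ Tq]; have c j := le_lt_trans (coord_le_norm (T q - T p) j) Tq.
  by have := c 0; have := c 1; rewrite !rVD !rVN /T !mk20 !mk21.
have oV : open V.
  apply: open_preimage oV0 _ => q j Vq; exact: sm_continuous (sT j) (V0U _ Vq).
have GB w : B w -> [/\ V (G w), F (G w) 0 0 = w 0 0 & n k (G w) = w 0 1].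
  move=> Bw; have [VGw TG] := h2 w (BW w Bw).
  have g0 : F (G w) 0 0 = w 0 0 by rewrite -TG mk20 TG.
  have g1 : n k (G w) = w 0 1 by rewrite -{2}TG mk21.
  split => //; split => //; rewrite TG; apply: norm2_lt; rewrite // rVD rVN ?mk20 ?mk21.
    by case: Bw.
  by case: Bw.
have sGB j : sm B (fun w => G w 0 j) := sub_sm BW (sG j).
have GU w : B w -> U (G w) by move=> /GB [[/V0U]].
(* This and the next fact differentiate t(G(u, s)) = u and n_k(G(u, s)) = s. *)
have cT i w : B w -> \sum_j jac G w i j * t j (G w) = (i == 0)%:R.
  move=> Bw; have := partial_reparam oU GU sGB i (sF 0) Bw.
  rewrite (@eq_partial _ _ _ i B _ (fun w => w 0 0) w oB Bw); last by move=> z /GB [].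
  rewrite partial_coord => ->; apply: eq_bigr => j _.
  by rewrite -(fld_partial j 0 sF (GU _ Bw)).
have cN i w : B w -> \sum_j jac G w i j * partial j (n k) (G w) = (i == 1)%:R.
  move=> Bw; have := partial_reparam oU GU sGB i (sn k) Bw.
  rewrite (@eq_partial _ _ _ i B _ (fun w => w 0 1) w oB Bw); last by move=> z /GB [].
  by rewrite partial_coord => ->.
have dJ w : B w -> \det (jac G w) != 0.
  move=> Bw; have a0 := cT 0 w Bw; have a1 := cT 1 w Bw.
  have b0 := cN 0 w Bw; have b1 := cN 1 w Bw; rewrite !sum2 /= in a0 a1 b0 b1.
  exact: det_inverse a0 a1 b0 b1.
(* The u-direction kills n_k, hence every n_l, because n has rank one. *)
have nu l w : B w -> partial 0 (fun w => n l (G w)) w = 0.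
  move=> Bw; apply: etrans (partial_reparam oU GU sGB 0 (sn l) Bw) _.
  have b0 := cN 0 w Bw; have b1 := cN 1 w Bw; rewrite !sum2 /= in b0 b1 *.
  exact: rank_one_const b0 b1 (n_rank_one l k (GU _ Bw)).
(* The correction n/(2 H0 f) undoes the motion of x along the slices t = const, so Y depends on u
   only. *)
pose Y l q := x l q + n l q / (2 * H0 * f (F q 0 0)).
have fU q : U q -> 2 * H0 * f (F q 0 0) != 0.
  by move=> Uq; rewrite !mulf_neq0 ?pnatr_eq0// f0//; exact: FI.
have sY l : sm U (Y l).
  have s1 := sm_mul oU (sm_cst U (2 * H0)) (sm_f oI sf oU sF FI).
  exact: sm_add oU (sF (lift 0 l)) (sm_div oU fU (sn l) s1).
have Yz l q : U q -> - t 1 q * partial 0 (Y l) q + t 0 q * partial 1 (Y l) q = 0.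
  move=> Uq; have D i := idD (fld_derive i (lift 0 l) sF Uq)
    (id_div (G := fun q => 2 * H0 * f (F q 0 0)) (fU q Uq) (n_derive i l Uq)
      (idM (is_derive_cst (2 * H0) q (delta_mx 0 i : 'rV[R]_2)) (derive_f oI sf oU sF FI i Uq))).
  have E := shear_algebra (partial 0 F q 0 (lift 0 l)) (partial 1 F q 0 (lift 0 l))
    (f (F q 0 0)) (st 0 Uq) (st 1 Uq) (strace Uq).
  have P := congr2 (fun z w => - t 1 q * z + t 0 q * w) (partialE (D 0)) (partialE (D 1)).
  exact (etrans P (shear_const (n l q) (derive1 f (F q 0 0)) (fU q Uq) E)).
have Ys l w : B w -> partial 1 (fun w => Y l (G w)) w = 0.
  move=> Bw; apply: etrans (partial_reparam oU GU sGB 1 (sY l) Bw) _.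
  have a1 := cT 1 w Bw; rewrite !sum2 /= in a1 *.
  exact: shear_zero (t_neq0 (GU _ Bw)) a1 (Yz l _ (GU _ Bw)).
exists k, u0, s0, e, (fun l s => n l (G (mk2 u0 s))), (fun l u => Y l (G (mk2 u s0))), V, G.
split.
- by split=> //; [split => //; rewrite subrr normr0|move=> q [/V0U]].
- move=> q Vq; have [a b] := VB q Vq; split => //.
  by have [] := h1 q (Vq.1).
- exact: GB.
- split => //.
  + move=> l; apply: (smooth_slice1 oB (oI' s0)) (sm_reparam oU oB GU sGB (sn l)).
    by move=> z Kz; split; rewrite ?mk20 ?mk21 //= /J /= subrr normr0.
  + move=> l; apply: (smooth_slice0 oB (oI' u0)) (sm_reparam oU oB GU sGB (sY l)).
    by move=> z Jz; split; rewrite ?mk20 ?mk21 //= /K /= subrr normr0.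
- move=> q Vq l; have [Jq Kq] := VB q Vq; have Uq := V0U _ Vq.1.
  have GT : G (mk2 (F q 0 0) (n k q)) = q by have [] := h1 q (Vq.1).
  have nE : n l q = n l (G (mk2 u0 (n k q))).
    rewrite -{1}GT.
    apply: (derive0_cst (f := fun z => n l (G (mk2 z (n k q)))) (iI u0) Jq); first by rewrite /= subrr normr0.
    move=> z Jz; have Bz : B (mk2 z (n k q)) by split; rewrite ?mk20 ?mk21.
    have d := sm_derivable (i:=0) (sm_reparam oU oB GU sGB (sn l)) Bz.
    exact: is_derive_as (slice0_derive d) erefl (nu l _ Bz).
  have YE : Y l q = Y l (G (mk2 (F q 0 0) s0)).
    rewrite -{1}GT.
    apply: (derive0_cst (f := fun z => Y l (G (mk2 (F q 0 0) z))) (iI s0) Kq); first by rewrite /= subrr normr0.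
    move=> z Kz; have Bz : B (mk2 (F q 0 0) z) by split; rewrite ?mk20 ?mk21.
    have d := sm_derivable (i:=1) (sm_reparam oU oB GU sGB (sY l)) Bz.
    exact: is_derive_as (slice1_derive d) erefl (Ys l _ Bz).
  by split=> //; rewrite -YE -nE /Y addrK.
Qed.

End LocalStructure.

(** * Orthonormal frames of R^4 and rigid motions *)

Section Frames.
Variable R : realType.
Implicit Types (x y v P Q S T : 'rV[R]_4) (O : 'M[R]_4).

(** A 4 by 3 matrix has a non-zero left kernel vector, which is then normalized. *)
Lemma unit_orthogonal P Q S : exists v, [/\ dot v P = 0, dot v Q = 0, dot v S = 0 & dot v v = 1].
Proof.
pose A : 'M[R]_(4, 3) := \matrix_(i, j) [:: P 0 i; Q 0 i; S 0 i]`_j.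
have ker0 : kermx A != 0.
  rewrite kermx_eq0 /row_free; apply: contraTneq (rank_leq_col A) => ->; exact: isT.
pose v := nz_row (kermx A).
have v0 : dot v v != 0 by rewrite dot_eq0 nz_row_eq0.
have vp : 0 < dot v v by rewrite lt_neqAle eq_sym v0 dot_ge0.
have vA : v *m A = 0 by apply/sub_kermxP; exact: nz_row_sub.
have cA (j : 'I_3) (w : 'rV[R]_4) : (forall i, A i j = w 0 i) -> dot v w = 0.
  move=> Aw; have := congr1 (fun B : 'rV[R]_3 => B 0 j) vA; rewrite !mxE => h.
  by rewrite -[RHS]h; apply: eq_bigr => i _; rewrite Aw.
exists ((Num.sqrt (dot v v))^-1 *: v); rewrite !dotE.
rewrite (cA 0 P) ?(cA 1 Q) ?(cA (lift 0 1) S) ?mulr0; try by move=> i; rewrite mxE.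
split=> //; rewrite mulrA -invfM -expr2 sqr_sqrtr ?ltW// mulVf//.
Qed.

Definition frame P Q S T : 'M[R]_4 := \matrix_(i, j) [:: P 0 j; Q 0 j; S 0 j; T 0 j]`_i.

Lemma mul_frame x P Q S T :
  x *m (frame P Q S T)^T = mk4 (dot x P) (dot x Q) (dot x S) (dot x T).
Proof.
apply/rowP => -[[|[|[|[|j]]]] lj]; rewrite ?mxE//=;
  by apply: eq_bigr => i _; rewrite !mxE.
Qed.

Lemma dot_mul x y : dot x y = (x *m y^T) 0 0.
Proof. by rewrite !mxE; apply: eq_bigr => i _; rewrite mxE. Qed.

Lemma frame_orthonormal P Q S T :
  [/\ dot P P = 1, dot Q Q = 1, dot S S = 1 & dot T T = 1] ->
  [/\ dot P Q = 0, dot P S = 0 & dot P T = 0] -> [/\ dot Q S = 0, dot Q T = 0 & dot S T = 0] ->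
  frame P Q S T *m (frame P Q S T)^T = 1%:M.
Proof.
move=> [PP QQ SS TT] [PQ PS PT] [QS QT ST]; apply/row_matrixP => i.
rewrite row_mul.
have -> : row i (frame P Q S T) = [:: P; Q; S; T]`_i.
  by apply/rowP => j; rewrite !mxE; case: i => -[|[|[|[|i]]]] li.
case: i => -[|[|[|[|i]]]] li //=; rewrite mul_frame ?PP ?QQ ?SS ?TT ?PQ ?PS ?PT ?QS ?QT ?ST
  ?(dotC Q P) ?(dotC S P) ?(dotC T P) ?(dotC S Q) ?(dotC T Q) ?(dotC T S) ?PQ ?PS ?PT ?QS ?QT ?ST
  ?SS ?TT; apply/rowP => -[[|[|[|[|j]]]] lj]; by rewrite !mxE.
Qed.

Lemma orthonormal_dot O x y : O *m O^T = 1%:M -> dot (x *m O^T) (y *m O^T) = dot x y.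
Proof.
move=> /mulmx1C OO; rewrite !dot_mul trmx_mul trmxK -mulmxA (mulmxA O^T) OO mul1mx.
by [].
Qed.

Lemma rotated_frame x y (s c : R) : dot x x = 1 -> dot y y = 1 -> dot x y = 0 ->
  s ^+ 2 + c ^+ 2 = 1 -> let P := s *: x - c *: y in let Q := c *: x + s *: y in
  [/\ dot P P = 1, dot Q Q = 1, dot P Q = 0, s *: P + c *: Q = x &
      forall v, dot v x = 0 -> dot v y = 0 -> dot v P = 0 /\ dot v Q = 0].
Proof.
move=> xx yy xy sc P Q; have yx : dot y x = 0 by rewrite dotC.
rewrite /P /Q; split.
- by rewrite !dotE xx yy xy yx -[RHS]sc; ring.
- by rewrite !dotE xx yy xy yx -[RHS]sc; ring.
- by rewrite !dotE xx yy xy yx; ring.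
- by apply/rowP => j; rewrite !mxE -[RHS]mul1r -sc; ring.
- by move=> v vx vy; rewrite !dotE vx vy; split; ring.
Qed.

(** From r r' = 0 the derivative vanishes wherever r does not; and r vanishes either everywhere or
    nowhere, according to D. It lets a square root be extracted with one sign on the whole
    interval. *)
Lemma square_const (J : set R) (r dr : R -> R) (D : R) a b : is_interval J -> J a -> J b ->
  (forall u, J u -> is_derive u 1 r (dr u)) -> (forall u, J u -> r u ^+ 2 = D) -> open J ->
  r a = r b.
Proof.
move=> iJ Ja Jb rD rr oJ; have [D0|D0] := eqVneq D 0.
  have r0 u : J u -> r u = 0.
    by move=> Ju; apply/eqP; have /eqP := rr u Ju; rewrite D0 sqrf_eq0.
  by rewrite !r0.
apply: (@derive0_cst _ J) => // u Ju; apply: (is_derive_as (rD u Ju)) => //.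
have r0 : r u != 0 by apply: contraNneq D0 => r0; rewrite -(rr u Ju) r0 expr0n.
have DD := idM (rD u Ju) (rD u Ju).
have near : \forall x \near u, r x * r x = D.
  by apply: filterS (open_nbhs_nbhs (conj oJ Ju)) => x Jx; rewrite -expr2 rr.
have := derive1_is DD; rewrite (derive1_near near) (derive1_is (is_derive_cst D u 1)).
move/esym/eqP; rewrite -mulr2n mulrn_eq0 /= mulf_eq0 (negPf r0) /= => /eqP.
by [].
Qed.

Lemma orthonormal_isometry (I : set R) (f : R -> R) O x : open I -> O *m O^T = 1%:M ->
  Defs.isometry (rw_metric f) (rw_space I) (fun p => mk5 (p 0 0) ((sp p - x) *m O^T)).
Proof.
move=> oI OO; have OO' := mulmx1C OO.
have oU : open (rw_space I).
  by apply: open_comp oI => q _; exact: coord_continuous.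
have smooth y z (A : 'M[R]_4) :
    smooth_on (rw_space I) (fun p : 'rV[R]_5 => mk5 (p 0 0) ((sp p - y) *m A + z)).
  apply/(smVP _ oU); apply: ord5P => [|l].
    by apply: (eq_sm oU _ (@sm_coord _ _ _ 0)) => p _; rewrite mk50.
  apply: (eq_sm oU (F := fun p : 'rV[R]_5 => \sum_k (p 0 (lift 0 k) - y 0 k) * A k l + z 0 l)).
    by move=> p _; rewrite mk5S !mxE; congr (_ + _); apply: eq_bigr => k _; rewrite !mxE.
  apply: sm_add => //; last exact: sm_cst.
  apply: sm_sum => // k; apply: sm_mul => //; last exact: sm_cst.
  by apply: sm_sub => //; [exact: sm_coord | exact: sm_cst].
have e0 y (A : 'M[R]_4) : (fun p : 'rV[R]_5 => mk5 (p 0 0) ((sp p - y) *m A)) =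
    (fun p : 'rV[R]_5 => mk5 (p 0 0) ((sp p - y) *m A + 0)).
  by apply/funext => p; rewrite addr0.
split.
  exists (fun p : 'rV[R]_5 => mk5 (p 0 0) ((sp p - 0) *m O + x)); split.
  - move=> p Up; split; first by rewrite /rw_space /= mk50.
    by rewrite mk50 sp_mk5 subr0 -mulmxA OO' mulmx1 subrK mk5K.
  - move=> p Up; split; first by rewrite /rw_space /= mk50.
    by rewrite mk50 sp_mk5 subr0 addrK -mulmxA OO mulmx1 mk5K.
  - by rewrite e0; exact: smooth.
  - exact: smooth.
move=> p Up.
pose e i : 'rV[R]_5 := delta_mx 0 i.
have dP i : partial i (fun p : 'rV[R]_5 => mk5 (p 0 0) ((sp p - x) *m O^T)) p =
    mk5 (e i 0 0) (sp (e i) *m O^T).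
  apply: partial_rowE; apply: ord5P => [|l].
    apply: (is_derive_as (coord_derive p i 0)); first by apply/funext => q; rewrite mk50.
    by rewrite mk50 mxE eqxx eq_sym.
  have D k := idM (idB (coord_derive p i (lift 0 k)) (is_derive_cst (x 0 k) p (e i)))
    (is_derive_cst (O^T k l) p (e i)).
  apply: (is_derive_as (is_derive_sum D)).
    by apply/funext => q; rewrite fct_sumE mk5S !mxE; apply: eq_bigr => k _; rewrite !mxE.
  by rewrite mk5S !mxE; apply: eq_bigr => k _; rewrite !mxE /= subr0 mulr0 add0r mulrC eq_sym.
apply/matrixP => i j.
have -> : (jac (fun p : 'rV[R]_5 => mk5 (p 0 0) ((sp p - x) *m O^T)) p *m
    rw_metric f (mk5 (p 0 0) ((sp p - x) *m O^T)) *m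
    (jac (fun p : 'rV[R]_5 => mk5 (p 0 0) ((sp p - x) *m O^T)) p)^T) i j =
    inner (rw_metric f) (mk5 (p 0 0) ((sp p - x) *m O^T)) (mk5 (e i 0 0) (sp (e i) *m O^T))
      (mk5 (e j 0 0) (sp (e j) *m O^T)).
  rewrite -(dP i) -(dP j) /inner -[RHS]/((_ *m _) 0 0).
  have rE k : partial k (fun p : 'rV[R]_5 => mk5 (p 0 0) ((sp p - x) *m O^T)) p =
    row k (jac (fun p : 'rV[R]_5 => mk5 (p 0 0) ((sp p - x) *m O^T)) p) by rewrite rowK.
  by rewrite !rE -row_mul tr_row -row_mul !mxE; apply: eq_bigr => k _; rewrite !mxE.
rewrite inner_rw !mk50 !sp_mk5 (orthonormal_dot _ _ OO).
have := inner_rw f p (e i) (e j); rewrite /inner => <-.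
by rewrite -rowE trmx_delta -colE !mxE.
Qed.

End Frames.

Section VectorCurves.
Variable R : realType.
Implicit Types (A B : 'I_4 -> R -> R) (J : set R).

Definition vec A (u : R) : 'rV[R]_4 := \row_l A l u.
Definition dv A l : R -> R := derive1 (A l).

Lemma dv_smooth J A : (forall l, smooth1 J (A l)) -> forall l, smooth1 J (dv A l).
Proof. by move=> sA l; exact: smooth1_derive. Qed.

Lemma dot_vec_derive J K A B u : (forall l, smooth1 J (A l)) -> (forall l, smooth1 K (B l)) ->
  J u -> K u -> is_derive u 1 (fun u => dot (vec A u) (vec B u))
    (dot (vec (dv A) u) (vec B u) + dot (vec A u) (vec (dv B) u)).
Proof.
move=> sA sB Ju Ku.
have H l := idM (smooth1_is_derive (sA l) Ju) (smooth1_is_derive (sB l) Ku).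
apply: (is_derive_as (is_derive_sum H)).
  by apply/funext => x; rewrite fct_sumE; apply: eq_bigr => l _; rewrite !mxE.
rewrite /dot -big_split /=; apply: eq_bigr => l _; rewrite !mxE.
by rewrite addrC (mulrC (B l u)).
Qed.

Lemma dot_cst_derive J A (v : 'rV[R]_4) u : (forall l, smooth1 J (A l)) -> J u ->
  is_derive u 1 (fun u => dot (vec A u) v) (dot (vec (dv A) u) v).
Proof.
move=> sA Ju.
have H l := idM (smooth1_is_derive (sA l) Ju) (is_derive_cst (v 0 l) u 1).
apply: (is_derive_as (is_derive_sum H)).
  by apply/funext => x; rewrite fct_sumE; apply: eq_bigr => l _; rewrite !mxE.
by rewrite /dot; apply: eq_bigr => l _; rewrite !mxE mulr0 add0r mulrC.
Qed.

Lemma derive_const J (h : R -> R) u d c : open J -> J u -> (forall x, J x -> h x = c) ->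
  is_derive u 1 h d -> d = 0.
Proof.
move=> oJ Ju h0 D; rewrite -(derive1_is D).
rewrite (@derive1_near _ h (fun=> c) u); first exact: derive1_is (is_derive_cst c u 1).
by apply: filterS (open_nbhs_nbhs (conj oJ Ju)).
Qed.

End VectorCurves.

(** * The normal form over one coordinate box *)

Lemma inv_diag2 (R : fieldType) (h : 'M[R]_2) (d g00 g01 g11 E G : R) :
  [/\ h 0 0 = g11 / d, h 0 1 = - g01 / d, h 1 0 = - g01 / d & h 1 1 = g00 / d] ->
  d = E * G -> g00 = E -> g01 = 0 -> g11 = G -> E != 0 -> G != 0 ->
  [/\ h 0 0 = E^-1, h 0 1 = 0, h 1 0 = 0 & h 1 1 = G^-1].
Proof.
move=> [-> -> -> ->] -> -> -> -> E0 G0; rewrite oppr0 mul0r.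
by split=> //; field; rewrite ?E0 ?G0.
Qed.

Lemma diag_sum2 (R : realType) (V : lmodType R) (h : 'M[R]_2) (D : 'I_2 -> 'I_2 -> V) c d :
  [/\ h 0 0 = c, h 0 1 = 0, h 1 0 = 0 & h 1 1 = d] ->
  \sum_i \sum_j h i j *: D i j = c *: D 0 0 + d *: D 1 1.
Proof. by move=> [a00 a01 a10 a11]; rewrite !sum2 a00 a01 a10 a11 !scale0r addr0 add0r. Qed.

(** Scalar content of [box_E_derive]: P, S and nz stand for the products Z'.Z', Z''.Z' and n.Z',
    while n1z and n2z are the vanishing products of n' and n'' with Z'. *)
Lemma energy_algebra (R : fieldType) (E P S S' c c' F F1 H X Y y nz n1z n2z x : R) :
  E != 0 -> F != 0 -> H != 0 -> S' = S -> n1z = 0 -> n2z = 0 -> nz = - c ->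
  c = F1 / (2 * H * F ^+ 2) -> E = F ^+ 2 * (P - c ^+ 2) - 1 ->
  E^-1 * (S + c' * nz + 2 * (F1 / F) * (P + c * nz)) + X * (Y * n2z) =
  F1 / F * (2 * E + 1) / E * (P + c * nz) + x * (y * n1z) + 2 * H / F * nz ->
  2 != 0 :> R ->
  2 * F * F1 * (P - c ^+ 2) + 2 * F ^+ 2 * (S' - c * c') = 2 * E * (F1 / F) * (2 * E + 1).
Proof.
move=> E0 F0 h0 -> -> -> -> cE EE; rewrite !mulr0 !addr0 => e two.
have PE : P = (E + 1) / F ^+ 2 + c ^+ 2 by rewrite EE; field.
have SE : S = E * (F1 / F * (2 * E + 1) / E * (P + c * - c) + 2 * H / F * - c) + c' * c -
    2 * (F1 / F) * (P + c * - c) by rewrite -e; field; rewrite ?E0 ?F0.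
have hc : 2 * H * c = F1 / F ^+ 2 by rewrite cE; field; rewrite ?two ?h0 ?F0.
have -> : 2 * F * F1 * (P - c ^+ 2) + 2 * F ^+ 2 * (S - c * c') =
  2 * F * F1 * (P - c ^+ 2) + 2 * F ^+ 2 *
    (E * (F1 / F * (2 * E + 1) / E * (P - c ^+ 2) - (2 * H * c) / F) -
    2 * (F1 / F) * (P - c ^+ 2)).
  by rewrite SE; ring.
by rewrite hc PE addrK; field; rewrite ?E0 ?F0.
Qed.

(** The product of [box_equation] with n', solved for y; L and T are n'.n' and n''.n'. *)
Lemma tangent_algebra (R : fieldType) (E a b nn c c' q L T x y F H : R) :
  H != 0 -> F != 0 -> L != 0 -> a = 0 -> b = 0 -> nn = 0 ->
  E^-1 * (a + c' * nn + q * (b + c * nn)) + 4 * H ^+ 2 / L * (- (2 * H * F)^-1 * T) =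
  x * (b + c * nn) + y * (- (2 * H * F)^-1 * L) + 2 * H / F * nn ->
  2 != 0 :> R ->
  y = 4 * H ^+ 2 * T / L ^+ 2.
Proof.
move=> h0 F0 L0 -> -> ->; rewrite !(mulr0, addr0, add0r) => e two.
have D0 : 2 * H * F != 0 by rewrite !mulf_neq0.
have -> : y = y * (- (2 * H * F)^-1 * L) * - (2 * H * F) / L.
  by move: (2 * H * F) D0 => D D0; field; rewrite ?D0 ?L0.
by rewrite -e; move: (2 * H * F) D0 => D D0; field; rewrite ?D0 ?L0.
Qed.

Lemma move_across (R : comRingType) (a b A X Y : R) : a * A + X = b * A + Y ->
  A * (a - b) = Y - X.
Proof.
move=> h; have -> : A * (a - b) = (a * A + X) - (b * A + X) by ring.
by rewrite h; ring.
Qed.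

Lemma dot_lin2 (R : realType) a (x y z : 'rV[R]_4) : dot (a *: x + y) z = a * dot x z + dot y z.
Proof. by rewrite !dotE. Qed.

Lemma dot_sub2 (R : realType) a b (x y z : 'rV[R]_4) :
  dot (a *: x - b *: y) z = a * dot x z - b * dot y z.
Proof. by rewrite !dotE. Qed.

Lemma dot_square (R : realType) (x y : 'rV[R]_4) :
  dot (x + y) (x + y) = dot x x + 2 * dot x y + dot y y.
Proof. by rewrite !dotE (dotC y x); ring. Qed.

(** Here and in the next lemma the choice 2 d^2 = b^2/a^2 enters, through 4 H^2 = a^2 - b^2. *)
Lemma profile_algebra1 (R : fieldType) (a d H b c m mu : R) : a != 0 -> d != 0 -> 2 != 0 :> R ->
  4 * H ^+ 2 = a ^+ 2 - 2 * a ^+ 2 * d ^+ 2 -> b = 2 * a ^+ 2 * d ^+ 2 ->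
  a ^+ 2 * d / b * - c + mu * m - d * - c - (- (2 * H * d / b) * (2 * H * c) + mu * m) = 0.
Proof.
move=> a0 d0 two h ->; rewrite [LHS](_ : _ = c * d * (1 - a ^+ 2 / (2 * a ^+ 2 * d ^+ 2) +
  4 * H ^+ 2 / (2 * a ^+ 2 * d ^+ 2))); last by ring.
by rewrite h; field; rewrite ?a0 ?d0 ?two.
Qed.

Lemma profile_algebra2 (R : fieldType) (a d H b c m mu : R) : a != 0 -> d != 0 -> 2 != 0 :> R ->
  4 * H ^+ 2 = a ^+ 2 - 2 * a ^+ 2 * d ^+ 2 -> b = 2 * a ^+ 2 * d ^+ 2 ->
  a ^+ 2 * d / b * - c - mu * m - d * - c -
  (4 * H ^+ 2 / (d * a ^+ 2) * - c - (- (2 * H * d / b) * (2 * H * c) + mu * m)) = 0.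
Proof.
move=> a0 d0 two h ->; rewrite [LHS](_ : _ = c * (d - a ^+ 2 * d / (2 * a ^+ 2 * d ^+ 2) +
  4 * H ^+ 2 / (d * a ^+ 2) - 4 * H ^+ 2 * d / (2 * a ^+ 2 * d ^+ 2))); last by ring.
by rewrite h; field; rewrite ?a0 ?d0 ?two.
Qed.

Section Box.
Variables (R : realType) (I : set R) (f : R -> R) (H0 : R).
Hypotheses (oI : open I) (sf : smooth1 I f) (f0 : forall t, I t -> f t != 0).
Hypothesis gen : forall t, I t ->
  derive1 (derive1 f) t / f t - derive1 f t ^+ 2 / f t ^+ 2 != 0.
Hypothesis H00 : H0 != 0.
Variables (J K : set R) (N Z : 'I_4 -> R -> R).
Hypotheses (oJ : open J) (oK : open K) (iJ : is_interval J) (iK : is_interval K).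
Hypotheses (JI : J `<=` I) (sN : forall l, smooth1 K (N l)) (sZ : forall l, smooth1 J (Z l)).
Variables (u0 s0 : R).
Hypotheses (Ju0 : J u0) (Ks0 : K s0).
Local Notation g := (rw_metric f).
Let two : 2 != 0 :> R. Proof. by rewrite pnatr_eq0. Qed.
Definition boxset := [set w : 'rV[R]_2 | J (w 0 0) /\ K (w 0 1)].
Local Notation B := boxset.
Local Notation n := (vec N). Local Notation n1 := (vec (dv N)).
Local Notation n2 := (vec (dv (dv N))).
Local Notation z1 := (vec (dv Z)). Local Notation z2 := (vec (dv (dv Z))).
Local Notation f1 := (derive1 f). Local Notation f2 := (derive1 (derive1 f)).

Definition box_map (w : 'rV[R]_2) : 'rV[R]_5 :=
  mk5 (w 0 0) (vec Z (w 0 0) - (2 * H0 * f (w 0 0))^-1 *: n (w 0 1)).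
Definition box_normal (w : 'rV[R]_2) : 'rV[R]_5 := mk5 0 ((f (w 0 0))^-1 *: n (w 0 1)).
Local Notation X := box_map.

(** Minus the derivative of 1/(2 H0 f); [c'] is the derivative of [c]. *)
Let c u := f1 u / (2 * H0 * f u ^+ 2).
Let c' u := (f2 u * f u - 2 * f1 u ^+ 2) / (2 * H0 * f u ^+ 3).

Let fD u (Ju : J u) := smooth1_is_derive sf (JI Ju).
Let f1D u (Ju : J u) := smooth1_is_derive (smooth1_derive sf) (JI Ju).
Let fJ u : J u -> f u != 0. Proof. by move=> /JI /f0. Qed.

Lemma open_box : open B.
Proof.
apply: openI; first exact: open_strip oJ.
by apply: open_comp oK => q _; exact: coord_continuous.
Qed.

Let invf1 u : J u -> is_derive u 1 (fun u => (2 * H0 * f u)^-1) (- c u).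
Proof.
move=> Ju; have fu := fJ Ju; have h : 2 * H0 * f u != 0 by rewrite !mulf_neq0 ?pnatr_eq0.
apply: (is_derive_as (idV (F := fun u => 2 * H0 * f u) h
  (idM (is_derive_cst (2 * H0) u 1) (fD Ju)))) => //.
rewrite /c; move: (f1 u) => d; rewrite /cst; field; by rewrite fu H00.
Qed.

Let cD u : J u -> is_derive u 1 c (c' u).
Proof.
move=> Ju; have fu := fJ Ju.
have h : 2 * H0 * (f u * f u) != 0 by rewrite !mulf_neq0 ?pnatr_eq0.
apply: (is_derive_as (id_div (G := fun u => 2 * H0 * (f u * f u)) h (f1D Ju)
  (idM (is_derive_cst (2 * H0) u 1) (idM (fD Ju) (fD Ju))))).
  by apply/funext => x; rewrite /c expr2.
rewrite /c' /cst; move: (f1 u) (f2 u) => d d'; field; by rewrite fu H00.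
Qed.

Let cdu g w i (sg : smooth1 J g) (Bw : B w) :
  is_derive w (delta_mx 0 i : 'rV[R]_2) (fun q : 'rV[R]_2 => g (q 0 0))
    ((i == 0)%:R * derive1 g (w 0 0)) := coord_comp_derive i (smooth1_derivable sg Bw.1).
Let cds g w i (sg : smooth1 K g) (Bw : B w) :
  is_derive w (delta_mx 0 i : 'rV[R]_2) (fun q : 'rV[R]_2 => g (q 0 1))
    ((i == 1)%:R * derive1 g (w 0 1)) := coord_comp_derive i (smooth1_derivable sg Bw.2).

Let sif : smooth1 J (fun u => (2 * H0 * f u)^-1).
Proof.
apply/(smooth1_strip _ oJ); have oS := open_strip oJ; apply: sm_inv => //.
  by move=> q Jq; rewrite !mulf_neq0 ?pnatr_eq0// fJ.
apply: sm_mul => //; first exact: sm_cst.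
exact: (smooth1_strip f oJ).1 (sub_smooth1 JI sf).
Qed.

Let sc : smooth1 J c.
Proof.
have E u : J u -> - derive1 (fun u => (2 * H0 * f u)^-1) u = c u.
  by move=> Ju; rewrite (derive1_is (invf1 Ju)) opprK.
apply: (eq_smooth1 oJ E); apply/(smooth1_strip _ oJ); apply: sm_opp; first exact: open_strip.
exact: (smooth1_strip _ oJ).1 (smooth1_derive sif).
Qed.

Let dX0 w : B w -> partial 0 X w = mk5 1 (z1 (w 0 0) + c (w 0 0) *: n (w 0 1)).
Proof.
move=> Bw; apply: partial_rowE; apply: ord5P => [|l].
  apply: (is_derive_as (coord_derive w 0 0)); first by apply/funext => q; rewrite mk50.
  by rewrite mk50.
have D := idB (cdu 0 (@sZ l) Bw) (idM (cdu 0 sif Bw) (cds 0 (@sN l) Bw)).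
apply: (is_derive_as D).
  by apply/funext => q; rewrite mk5S rVD rVN rVZ !mxE.
rewrite mk5S rVD rVZ !mxE /= (derive1_is (invf1 Bw.1)) /dv; ring.
Qed.

Let dX1 w : B w -> partial 1 X w = mk5 0 (- (2 * H0 * f (w 0 0))^-1 *: n1 (w 0 1)).
Proof.
move=> Bw; apply: partial_rowE; apply: ord5P => [|l].
  apply: (is_derive_as (coord_derive w 1 0)); first by apply/funext => q; rewrite mk50.
  by rewrite mk50.
have D := idB (cdu 1 (@sZ l) Bw) (idM (cdu 1 sif Bw) (cds 1 (@sN l) Bw)).
apply: (is_derive_as D).
  by apply/funext => q; rewrite mk5S rVD rVN rVZ !mxE.
rewrite mk5S rVZ !mxE /= /dv; ring.
Qed.

Let dX00 w : B w -> partial 0 (partial 0 X) w = mk5 0 (z2 (w 0 0) + c' (w 0 0) *: n (w 0 1)).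
Proof.
move=> Bw; apply: etrans (eq_partial 0 open_box Bw dX0) _.
apply: partial_rowE; apply: ord5P => [|l].
  apply: (is_derive_as (is_derive_cst (1 : R) _ _)); first by apply/funext => q; rewrite mk50.
  by rewrite mk50.
have D := idD (cdu 0 (@dv_smooth R J Z sZ l) Bw) (idM (cdu 0 sc Bw) (cds 0 (@sN l) Bw)).
apply: (is_derive_as D).
  by apply/funext => q; rewrite mk5S rVD rVZ !mxE.
rewrite mk5S rVD rVZ !mxE /= (derive1_is (cD Bw.1)) /dv; ring.
Qed.

Let dX11 w : B w -> partial 1 (partial 1 X) w =
  mk5 0 (- (2 * H0 * f (w 0 0))^-1 *: n2 (w 0 1)).
Proof.
move=> Bw; apply: etrans (eq_partial 1 open_box Bw dX1) _.
apply: partial_rowE; apply: ord5P => [|l].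
  apply: (is_derive_as (is_derive_cst (0 : R) _ _)); first by apply/funext => q; rewrite mk50.
  by rewrite mk50.
have D := idN (idM (cdu 1 sif Bw) (cds 1 (@dv_smooth R K N sN l) Bw)).
apply: (is_derive_as D).
  by apply/funext => q; rewrite mk5S rVZ !mxE mulNr.
rewrite mk5S rVZ !mxE /= /dv; ring.
Qed.

Hypothesis gdet0 : forall w, B w -> gdet f X w != 0.
Hypothesis E_gt0 : forall w, B w -> 0 < inner g (X w) (partial 0 X w) (partial 0 X w).
Hypothesis nunit : forall w, B w -> inner g (X w) (box_normal w) (box_normal w) = 1.
Hypothesis nnormal : forall w, B w -> forall k,
  inner g (X w) (box_normal w) (partial k X w) = 0.
Hypothesis mcX : forall w, B w -> mean_curvature g X w = H0 *: box_normal w.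

Let Bmk u s : J u -> K s -> B (mk2 u s). Proof. by move=> Ju Ks; split; rewrite ?mk20 ?mk21. Qed.

Let nn s : K s -> dot (n s) (n s) = 1.
Proof.
move=> Ks; have := nunit (Bmk Ju0 Ks); rewrite inner_rw !mk50 !sp_mk5 mk20 mk21 !dotE.
by move: (f u0) (fJ Ju0) => A A0 <-; field.
Qed.

Let nz u s : J u -> K s -> dot (n s) (z1 u) = - c u.
Proof.
move=> Ju Ks; have := nnormal (Bmk Ju Ks) 0; rewrite (dX0 (Bmk Ju Ks)).
rewrite inner_rw !mk50 !sp_mk5 mk20 mk21 !dotE (nn Ks) mul0r oppr0 add0r mulr1.
move: (f u) (fJ Ju) => A A0 h; apply/eqP; rewrite -subr_eq0 opprK; apply/eqP.
move: h; move: (dot _ _) (c u) => a b h.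
have -> : a + b = A^-1 * (A ^+ 2 * (A^-1 * a + A^-1 * b)) by field.
by rewrite h mulr0.
Qed.

Let nn1 s : K s -> dot (n1 s) (n s) = 0.
Proof.
move=> Ks; have := derive_const oK Ks nn (dot_vec_derive sN sN Ks Ks).
by rewrite (dotC (n s)) -mulr2n => /eqP; rewrite mulrn_eq0 => /eqP.
Qed.

(** The product n(s).Z'(u) = -c(u) does not depend on s, so its s-derivatives vanish. *)
Let n1z1 u s : J u -> K s -> dot (n1 s) (z1 u) = 0.
Proof.
move=> Ju Ks.
exact: derive_const oK Ks (fun x Kx => nz Ju Kx) (dot_cst_derive (z1 u) sN Ks).
Qed.

Let n2z1 u s : J u -> K s -> dot (n2 s) (z1 u) = 0.
Proof.
move=> Ju Ks.
exact: derive_const oK Ks (fun x Kx => n1z1 Ju Kx) (dot_cst_derive (z1 u) (dv_smooth sN) Ks).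
Qed.

Let n1z2 u s : J u -> K s -> dot (z2 u) (n1 s) = 0.
Proof.
move=> Ju Ks; apply: (derive_const (c := 0) oJ Ju) (dot_cst_derive (n1 s) (dv_smooth sZ) Ju).
by move=> x Jx; rewrite dotC n1z1.
Qed.

Let nn2 s : K s -> dot (n2 s) (n s) = - dot (n1 s) (n1 s).
Proof.
move=> Ks; apply/eqP; rewrite -addr_eq0; apply/eqP.
exact: derive_const oK Ks nn1 (dot_vec_derive (dv_smooth sN) sN Ks Ks).
Qed.

(* |phi_u|^2 in the coordinates (u, s). *)
Definition box_E u := f u ^+ 2 * (dot (z1 u) (z1 u) - c u ^+ 2) - 1.
Local Notation E := box_E.
Let l2 s := dot (n1 s) (n1 s).

Let ip00 u s : J u -> K s -> inner g (X (mk2 u s)) (partial 0 X (mk2 u s))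
  (partial 0 X (mk2 u s)) = E u.
Proof.
move=> Ju Ks; rewrite (dX0 (Bmk Ju Ks)) inner_rw !mk50 !sp_mk5 mk20 mk21 !dotE.
by rewrite (dotC (z1 u) (n s)) nz// nn// /E; ring.
Qed.

Let ip01 u s : J u -> K s -> inner g (X (mk2 u s)) (partial 0 X (mk2 u s))
  (partial 1 X (mk2 u s)) = 0.
Proof.
move=> Ju Ks; rewrite (dX0 (Bmk Ju Ks)) (dX1 (Bmk Ju Ks)) inner_rw !mk50 !sp_mk5 mk20 mk21 !dotE.
by rewrite (dotC (z1 u) (n1 s)) n1z1// (dotC (n s)) nn1// !mulr0 addr0 mulr0 oppr0 add0r.
Qed.

Let ip11 u s : J u -> K s -> inner g (X (mk2 u s)) (partial 1 X (mk2 u s))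
  (partial 1 X (mk2 u s)) = l2 s / (4 * H0 ^+ 2).
Proof.
move=> Ju Ks; rewrite (dX1 (Bmk Ju Ks)) inner_rw !mk50 !sp_mk5 mk20 mk21 !dotE -/(l2 s).
by move: (f u) (fJ Ju) (l2 s) => A A0 L; field; rewrite A0 H00.
Qed.

Lemma box_E_gt0 u : J u -> 0 < E u.
Proof. by move=> Ju; rewrite -(ip00 Ju Ks0); exact: E_gt0 (Bmk Ju Ks0). Qed.

Let l2_neq0 s : K s -> l2 s != 0.
Proof.
move=> Ks; have := gdet0 (Bmk Ju0 Ks).
have H := congr2 (fun x y => x - y) (congr2 *%R (ip00 Ju0 Ks) (ip11 Ju0 Ks))
  (congr2 *%R (ip01 Ju0 Ks) (ip01 Ju0 Ks)).
rewrite [gdet f X _]H; apply: contraNneq => ->.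
by rewrite mul0r !mulr0 subr0.
Qed.

Let XI w : B w -> I (X w 0 0). Proof. by move=> Bw; rewrite mk50; exact: JI Bw.1. Qed.

Let cov00 u s : J u -> K s -> cov_along g X 0 (partial 0 X) (mk2 u s) =
  mk5 (f u * f1 u * (dot (z1 u) (z1 u) - c u ^+ 2))
    (z2 u + c' u *: n s + (2 * (f1 u / f u)) *: (z1 u + c u *: n s)).
Proof.
move=> Ju Ks; have Bw := Bmk Ju Ks.
rewrite (covE sf f0 XI 0 (partial 0 X) Bw) (dX00 Bw) (dX0 Bw) gam_mk5 mk50 mk20 mk21.
rewrite mk5D add0r !dotE (dotC (z1 u) (n s)) nz// nn// !scale1r; congr mk5; first by ring.
by congr (_ + _); rewrite -mulr2n -scaler_nat scalerA mulrC.
Qed.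

Let cov11 u s : J u -> K s -> cov_along g X 1 (partial 1 X) (mk2 u s) =
  mk5 (f1 u / f u * (l2 s / (4 * H0 ^+ 2))) (- (2 * H0 * f u)^-1 *: n2 s).
Proof.
move=> Ju Ks; have Bw := Bmk Ju Ks.
rewrite (covE sf f0 XI 1 (partial 1 X) Bw) (dX11 Bw) (dX1 Bw) gam_mk5 mk50 mk20 mk21.
rewrite mk5D add0r !dotE -/(l2 s) !scale0r addr0 scaler0 addr0; congr mk5.
by move: (f u) (fJ Ju) (f1 u) (l2 s) => A A0 d L; field; rewrite A0 H00.
Qed.

Let decomposition w : B w -> exists x y,
  \sum_i \sum_j invmx (first_form g X w) i j *: cov_along g X i (partial j X) w =
  x *: partial 0 X w + y *: partial 1 X w + 2 * H0 *: box_normal w.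
Proof.
move=> Bw; set v := \sum_i _.
have vd : v = (\sum_j invmx (first_form g X w) 0 j * inner g (X w) v (partial j X w)) *:
   partial 0 X w + (\sum_j invmx (first_form g X w) 1 j * inner g (X w) v (partial j X w)) *:
   partial 1 X w + nor_part g X w v.
  by rewrite -tan_part_sum /nor_part addrC subrK.
have m2 := mean_curvature_uniq (gdet0 Bw) vd (ip_nor_part (gdet0 Bw) v).
have n2' : nor_part g X w v = 2 * H0 *: box_normal w.
  by rewrite -scalerA -(mcX Bw) m2 scalerA divff ?pnatr_eq0// scale1r.
by move: vd; rewrite n2' => vd; exists (\sum_j invmx (first_form g X w) 0 j *
  inner g (X w) v (partial j X w)), (\sum_j invmx (first_form g X w) 1 j *
  inner g (X w) v (partial j X w)).
Qed.

Local Notation x u := (f1 u / f u * (2 * E u + 1) / E u).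

(** Space part of the statement that the trace of the second derivatives is tangent plus 2 H0 e4.
    The coefficient of phi_u comes from the time part, as phi_s and e4 have no time component; the
    coefficient y of phi_s is still unknown. *)
Let box_equation u s : J u -> K s -> exists y,
  (E u)^-1 *: (z2 u + c' u *: n s + (2 * (f1 u / f u)) *: (z1 u + c u *: n s)) +
  (4 * H0 ^+ 2 / l2 s) *: (- (2 * H0 * f u)^-1 *: n2 s) =
  x u *: (z1 u + c u *: n s) + y *: (- (2 * H0 * f u)^-1 *: n1 s) +
  (2 * H0 / f u) *: n s.
Proof.
move=> Ju Ks; have Bw := Bmk Ju Ks; have [x' [y D]] := decomposition Bw.
have E0 := lt0r_neq0 (box_E_gt0 Ju); have L0 := l2_neq0 Ks.
have G0 : l2 s / (4 * H0 ^+ 2) != 0.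
  by rewrite mulf_neq0// invr_neq0// mulf_neq0 ?pnatr_eq0// expf_neq0.
have gE : gdet f X (mk2 u s) = E u * (l2 s / (4 * H0 ^+ 2)).
  have H := congr2 (fun x y => x - y) (congr2 *%R (ip00 Ju Ks) (ip11 Ju Ks))
    (congr2 *%R (ip01 Ju Ks) (ip01 Ju Ks)).
  by apply: (etrans H); rewrite mulr0 subr0.
have dg := inv_diag2 (giE (gdet0 Bw)) gE (ip00 Ju Ks) (ip01 Ju Ks) (ip11 Ju Ks) E0 G0.
have S := diag_sum2 (fun i j => cov_along g X i (partial j X) (mk2 u s)) dg.
have S1 := etrans (esym (etrans S (congr2 (fun v w => (E u)^-1 *: v +
  (l2 s / (4 * H0 ^+ 2))^-1 *: w) (cov00 Ju Ks) (cov11 Ju Ks)))) D.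
move: S1; rewrite (dX0 Bw) (dX1 Bw) /box_normal mk20 mk21 !mk5Z !mk5D => S1.
have T := congr1 (fun v : 'rV[R]_5 => v 0 0) S1; have {}S1 := congr1 (@sp R) S1.
rewrite !mk50 in T; rewrite !sp_mk5 in S1.
have xE : x' = x u.
  move: T; rewrite !mulr0 !addr0 mulr1 => <-.
  have P : dot (z1 u) (z1 u) - c u ^+ 2 = (E u + 1) / f u ^+ 2.
    by rewrite /E; move: (dot _ _) (c u) (fJ Ju) => a b A0; field.
  rewrite P; move: (E u) E0 (l2 s) L0 (f1 u) (f u) (fJ Ju) => e e0 L L0 d A A0.
  by field; rewrite ?A0 ?e0 ?L0 ?H00.
exists y; move: S1; rewrite xE invf_div => ->.
by rewrite (scalerA (2 * H0)).
Qed.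

Let ED u : J u -> is_derive u 1 E (2 * f u * f1 u * (dot (z1 u) (z1 u) - c u ^+ 2) +
  2 * f u ^+ 2 * (dot (z1 u) (z2 u) - c u * c' u)).
Proof.
move=> Ju; have D := idB (idM (idM (fD Ju) (fD Ju)) (idB (dot_vec_derive (dv_smooth sZ)
  (dv_smooth sZ) Ju Ju) (idM (cD Ju) (cD Ju)))) (is_derive_cst (1 : R) u 1).
apply: (is_derive_as D).
  by apply/funext => v; rewrite /E /cst !expr2.
rewrite (dotC (z2 u)); move: (dot _ _) (dot _ _) (c u) (c' u) (f1 u) => *; ring.
Qed.

(** In the product of [box_equation] with Z' all terms in n' and n'' drop out, and n.Z' = -c is
    known. *)
Lemma box_E_derive u : J u -> is_derive u 1 E (2 * E u * (f1 u / f u) * (2 * E u + 1)).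
Proof.
move=> Ju; apply: (is_derive_as (ED Ju) erefl).
have [y H] := box_equation Ju Ks0.
have E0 := lt0r_neq0 (box_E_gt0 Ju); have A0 := fJ Ju.
have := congr1 (fun v => dot v (z1 u)) H; rewrite !dotE => h.
exact: energy_algebra E0 A0 H00 (dotC _ _) (n1z1 Ju Ks0) (n2z1 Ju Ks0) (nz Ju Ks0) erefl erefl h two.
Qed.

(* |n'|^-1 times the derivative of n'/|n'|. *)
Definition box_k s := (l2 s)^-1 *: n2 s - (dot (n2 s) (n1 s) / l2 s ^+ 2) *: n1 s.
(** [box_al] and [box_Om] result from solving [box_equation] for [box_k]. The variables separate:
    the left side depends on s alone, and the right side depends on u except for the factor n(s). *)
Definition box_al u := - 1 + (f2 u / f u - (f1 u / f u) ^+ 2 * (2 * E u + 1)) / (4 * H0 ^+ 2 * E u).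
Definition box_Om u := (f u / (2 * H0)) *: ((E u)^-1 *: z2 u +
  (2 * (f1 u / f u) / E u - x u) *: z1 u).
Local Notation k := box_k. Local Notation al := box_al. Local Notation Om := box_Om.

Lemma box_frame u s : J u -> K s -> k s = al u *: n s + Om u.
Proof.
move=> Ju Ks; have [y H] := box_equation Ju Ks.
have E0 := lt0r_neq0 (box_E_gt0 Ju); have A0 := fJ Ju; have L0 := l2_neq0 Ks.
(* Take the product with n', which is orthogonal to n, Z' and Z''. *)
have yE : y = 4 * H0 ^+ 2 * dot (n2 s) (n1 s) / l2 s ^+ 2.
  have := congr1 (fun v => dot v (n1 s)) H; rewrite !dotE => h.
  exact: tangent_algebra H00 A0 L0 (n1z2 Ju Ks) (etrans (dotC _ _) (n1z1 Ju Ks))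
    (etrans (dotC _ _) (nn1 Ks)) h two.
apply/rowP => l; have := congr1 (fun v : 'rV[R]_4 => v 0 l) H.
rewrite yE /box_k /box_Om !mxE /box_al.
move: (N l s) (dv N l s) (dv (dv N) l s) (dv Z l u) (dv (dv Z) l u) => a0 a1 a2 b1 b2.
have -> : c u = f1 u / (2 * H0 * f u ^+ 2) by [].
have -> : c' u = (f2 u * f u - 2 * f1 u ^+ 2) / (2 * H0 * f u ^+ 3) by [].
move: (f u) A0 (f1 u) (f2 u) (E u) E0 (l2 s) L0 (dot _ _) => A A0 d d' e e0 L L0 S h.
apply/eqP; rewrite -subr_eq0; apply/eqP; apply: (mulIf (mulf_neq0 H00 (invr_neq0 A0))).
rewrite mul0r; move/eqP: h; rewrite eq_sym -subr_eq0 => /eqP h.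
rewrite -[RHS](mulr0 (2^-1)) -h; field; by rewrite ?A0 ?e0 ?L0 ?H00.
Qed.

Let kn1 s : K s -> dot (k s) (n1 s) = 0.
Proof.
move=> Ks; rewrite /box_k !dotE -/(l2 s); move: (l2 s) (l2_neq0 Ks) (dot _ _) => L L0 S.
by field.
Qed.

Let kn s : K s -> dot (k s) (n s) = - 1.
Proof.
move=> Ks; rewrite /box_k !dotE nn1// nn2// -/(l2 s) mulr0 subr0 mulrN mulVf//.
exact: l2_neq0.
Qed.

Let kz1 u s : J u -> K s -> dot (k s) (z1 u) = 0.
Proof. by move=> Ju Ks; rewrite /box_k !dotE n1z1// n2z1// !mulr0 subr0. Qed.

(** Comparing [box_frame] at u and u0 makes (al u - al u0) n(s) independent of s. Its s-derivative
    at s0, paired with n'(s0), is (al u - al u0) |n'(s0)|^2, and n' does not vanish. *)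
Lemma box_al_const u : J u -> al u = al u0.
Proof.
move=> Ju; apply/eqP; rewrite -subr_eq0; apply/eqP; apply: (mulIf (l2_neq0 Ks0)).
rewrite mul0r mulrC.
have D := idM (dot_cst_derive (n1 s0) sN Ks0) (is_derive_cst (al u - al u0) s0 1).
have := derive_const (c := dot (Om u0 - Om u) (n1 s0)) oK Ks0 _ D.
rewrite mulr0 add0r /cst mulrC; apply=> s Ks.
have := etrans (esym (box_frame Ju Ks)) (box_frame Ju0 Ks).
move/(congr1 (fun v => dot v (n1 s0))); rewrite !dotE => h.
exact: move_across h.
Qed.

Let n1Om s : K s -> dot (n1 s) (Om u0) = 0.
Proof.
move=> Ks; have h := etrans (esym (etrans (congr1 (fun v => dot v (n1 s)) (box_frame Ju0 Ks))
  (dot_lin2 (al u0) (n s) (Om u0) (n1 s)))) (kn1 Ks).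
rewrite (etrans (dotC (n s) (n1 s)) (nn1 Ks)) mulr0 add0r in h.
exact (etrans (dotC _ _) h).
Qed.

Let n2Om s : K s -> dot (n2 s) (Om u0) = 0.
Proof. move=> Ks; exact: derive_const oK Ks n1Om (dot_cst_derive (Om u0) (dv_smooth sN) Ks). Qed.

Lemma box_k_Om s : K s -> dot (k s) (Om u0) = 0.
Proof.
move=> Ks; have D : dot (k s) (Om u0) = _ :=
  dot_sub2 (l2 s)^-1 (dot (n2 s) (n1 s) / l2 s ^+ 2) (n2 s) (n1 s) (Om u0).
apply: etrans D _.
by rewrite (n1Om Ks) (n2Om Ks) !mulr0 subr0.
Qed.

(** The squared curvature of the curve n, as [box_kk] shows from k.n = -1 and k.Om = 0. *)
Definition box_kap2 := - al u0.
Local Notation kap2 := box_kap2.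

Lemma box_kk s : K s -> dot (k s) (k s) = kap2.
Proof.
move=> Ks; apply: etrans (congr1 (dot (k s)) (box_frame Ju0 Ks)) _.
apply: etrans (dotC _ _) (etrans (dot_lin2 (al u0) (n s) (Om u0) (k s)) _).
by rewrite (dotC (n s)) (dotC (Om u0)) (kn Ks) (box_k_Om Ks) addr0 mulrN1.
Qed.

(** A curve on the unit sphere has curvature at least 1: |k + n|^2 = kap2 - 1. *)
Let kap2_ge1 : 1 <= kap2.
Proof.
have := dot_ge0 (k s0 + n s0); rewrite dot_square (box_kk Ks0) (kn Ks0) (nn Ks0).
by move: kap2 => r h; lra.
Qed.

(** This is a^2 - 4 H0^2 with a = 2 H0 kappa: the circle n has radius 1/kappa, and scaled by 1/(2 H0
    f) it gets the radius 1/(a f) of the model. *)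
Definition box_b2 := 4 * H0 ^+ 2 * (kap2 - 1).
Local Notation b2 := box_b2.

Lemma box_E_b2 u : J u -> E u * (2 * (f1 u / f u) ^+ 2 - b2) = f2 u / f u - (f1 u / f u) ^+ 2.
Proof.
move=> Ju; rewrite /box_b2 /box_kap2 -(box_al_const Ju) /box_al.
have E0 := lt0r_neq0 (box_E_gt0 Ju).
by move: (E u) E0 (f1 u / f u) (f2 u / f u) => e e0 q q'; field; rewrite ?e0 ?H00.
Qed.

(** If kappa were 1, then k = -n and n would be a great circle. Since k is orthogonal to Z', so
    would n be, whence c = 0 and f' = 0 on J, against the genericity of f. *)
Lemma box_b2_gt0 : 0 < b2.
Proof.
have H2 : 0 < 4 * H0 ^+ 2 by rewrite mulr_gt0// exprn_even_gt0.
rewrite /box_b2 pmulr_rgt0// subr_gt0 lt_neqAle kap2_ge1 andbT.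
apply/eqP => k1.
have kn0 : k s0 + n s0 = 0.
  apply/eqP; rewrite -dot_eq0 dot_square (box_kk Ks0) (kn Ks0) (nn Ks0) -k1.
  by apply/eqP; ring.
have c0 u : J u -> f1 u = 0.
  move=> Ju; have := congr1 (fun v => dot v (z1 u)) kn0; rewrite (dotDl (k s0) (n s0)) dot0l (kz1 Ju Ks0) (nz Ju Ks0) add0r.
  move/eqP; rewrite oppr_eq0 => /eqP cu0.
  have cE : f1 u = c u * (2 * H0 * f u ^+ 2).
    have D0 : 2 * H0 * f u ^+ 2 != 0 by exact (mulf_neq0 (mulf_neq0 two H00) (expf_neq0 2 (fJ Ju))).
    by rewrite /c (divfK D0).
  by rewrite cE cu0 mul0r.
have f20 := derive_const oJ Ju0 c0 (f1D Ju0).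
by have := gen (JI Ju0); rewrite f20 c0// expr0n /= !mul0r subrr eqxx.
Qed.

Let l2_gt0 s : K s -> 0 < l2 s.
Proof. by move=> Ks; rewrite lt_neqAle eq_sym l2_neq0// dot_ge0. Qed.

Let lam s := Num.sqrt (l2 s).

Let lam_gt0 s : K s -> 0 < lam s. Proof. by move=> Ks; rewrite sqrtr_gt0 l2_gt0. Qed.

Let lam2 s : K s -> lam s ^+ 2 = l2 s. Proof. by move=> Ks; rewrite sqr_sqrtr// ltW// l2_gt0. Qed.

Let slam : smooth1 K lam.
Proof.
apply/(smooth1_strip _ oK); have oS := open_strip oK.
apply: (sm_sqrt (F := fun q => l2 (q 0 0))) => //; first by move=> q; exact: l2_gt0.
apply: (eq_sm (F := fun q : 'rV[R]_2 => \sum_l dv N l (q 0 0) * dv N l (q 0 0)) oS).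
  by move=> q _; apply: eq_bigr => l _; rewrite !mxE.
apply: sm_sum => // l; apply: sm_mul => //;
  exact: (smooth1_strip _ oK).1 (@dv_smooth R K N sN l).
Qed.

Let lamD s : K s -> is_derive s 1 lam (dot (n2 s) (n1 s) / lam s).
Proof.
move=> Ks; have D := smooth1_is_derive slam Ks; have l0 := lt0r_neq0 (lam_gt0 Ks).
apply: (is_derive_as D) => //.
have D1 := dot_vec_derive (dv_smooth sN) (dv_smooth sN) Ks Ks.
have near : \forall x \near s, lam x * lam x = l2 x.
  by apply: filterS (open_nbhs_nbhs (conj oK Ks)) => x Kx; rewrite -expr2 lam2.
have := derive1_is (idM D D); rewrite (derive1_near near) (derive1_is D1) (dotC (n1 s)).
move: (dot _ _) (derive1 lam s) (lam s) l0 => d x l l0 h; apply: (mulIf l0); rewrite divfK//.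
apply: (mulfI two); have -> : 2 * d = d + d by ring.
by rewrite h; ring.
Qed.

(** The form that [box_frame] gives to k; its derivative is visibly a multiple of n', without third
    derivatives of n. *)
Let kk s := al u0 *: n s + Om u0.

Let kkE s : K s -> k s = kk s. Proof. exact: box_frame. Qed.

Let wD l s : K s -> is_derive s 1 (fun s => dv N l s / lam s) (lam s * kk s 0 l).
Proof.
move=> Ks; have l0 := lt0r_neq0 (lam_gt0 Ks).
apply: (is_derive_as (id_div (F := dv N l) (G := lam) l0
  (smooth1_is_derive (@dv_smooth R K N sN l) Ks) (lamD Ks)) erefl).
have -> : kk s 0 l = (lam s ^+ 2)^-1 * dv (dv N) l s -
    dot (n2 s) (n1 s) / (lam s ^+ 2) ^+ 2 * dv N l s.
  by rewrite -(kkE Ks) (lam2 Ks) /box_k rVD rVN !rVZ [vec _ s 0 l]mxE [vec (dv N) s 0 l]mxE.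
change (derive1 (dv N l) s) with (dv (dv N) l s).
move: (dv (dv N) l s) (dot _ _) (dv N l s) (lam s) l0 => x y z t t0; by field.
Qed.

Let kkD l s : K s -> is_derive s 1 (fun s => kk s 0 l) (al u0 * dv N l s).
Proof.
move=> Ks.
apply: (is_derive_as (idD (idM (is_derive_cst (al u0) s 1) (smooth1_is_derive (@sN l) Ks))
  (is_derive_cst (Om u0 0 l) s 1))).
  by apply/funext => r; rewrite /kk rVD rVZ [vec N r 0 l]mxE.
by rewrite /dv /cst mulr0 !addr0.
Qed.

Let kap := Num.sqrt kap2.

Let kap2_gt0 : 0 < kap2. Proof. exact: lt_le_trans ltr01 kap2_ge1. Qed.

Let kap_neq0 : kap != 0. Proof. by rewrite sqrtr_eq0 -ltNge. Qed.

Let kapE : kap ^+ 2 = kap2. Proof. by rewrite sqr_sqrtr// ltW. Qed.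

Let alE : al u0 = - kap ^+ 2. Proof. by rewrite kapE opprK. Qed.

(* (k/kap, n'/|n'|) rotates with angular speed kap |n'|, so undoing the rotation by
   an angle th with th' = kap |n'| gives a constant frame (Q, -P). *)
Lemma box_circle : exists th P Q,
  [/\ smooth1 K th, forall s, K s -> 0 < derive1 th s
    & [/\ dot P P = 1, dot Q Q = 1 & dot P Q = 0]] /\
  [/\ forall u, J u -> dot (z1 u) P = 0 /\ dot (z1 u) Q = 0,
      dot (Om u0) P = 0 /\ dot (Om u0) Q = 0
    & forall s, K s -> kk s = kap *: (sin (th s) *: P + cos (th s) *: Q)].
Proof.
have oiK : open_interval K by split=> //; exists s0.
have skl : smooth1 K (fun s => kap * lam s).
  apply/(smooth1_strip _ oK); apply: sm_mul; [exact: open_strip | exact: sm_cst |].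
  exact: (smooth1_strip _ oK).1 slam.
have [th [sth thE]] := primitive oiK skl.
have thD s : K s -> is_derive s 1 th (kap * lam s).
  by move=> Ks; rewrite -thE//; exact: smooth1_is_derive sth Ks.
have sD s : K s -> is_derive s 1 (fun s => sin (th s)) (cos (th s) * (kap * lam s)).
  move=> Ks; have D := @is_derive1_comp R sin th s _ _ (is_derive_sin (th s)) (thD s Ks).
  exact D.
have cD' s : K s -> is_derive s 1 (fun s => cos (th s)) (- sin (th s) * (kap * lam s)).
  move=> Ks; have D := @is_derive1_comp R cos th s _ _ (is_derive_cos (th s)) (thD s Ks).
  exact D.
pose xv s := kap^-1 *: kk s; pose yv s := (lam s)^-1 *: n1 s.
have xx s : K s -> dot (xv s) (xv s) = 1.
  move=> Ks; have := box_kk Ks; rewrite (kkE Ks) => e; rewrite /xv dotZl dotZr e -kapE.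
  by field.
have xy s : K s -> dot (xv s) (yv s) = 0.
  move=> Ks; have := kn1 Ks; rewrite (kkE Ks) => e; rewrite /xv /yv dotZl dotZr e.
  by rewrite !mulr0.
have yy s : K s -> dot (yv s) (yv s) = 1.
  move=> Ks; rewrite /yv dotZl dotZr -/(l2 s) -(lam2 Ks).
  by move: (lam s) (lt0r_neq0 (lam_gt0 Ks)) => t t0; field.
pose vP s := sin (th s) *: xv s - cos (th s) *: yv s.
pose vQ s := cos (th s) *: xv s + sin (th s) *: yv s.
have cP s : K s -> vP s = vP s0.
  move=> Ks; apply/rowP => l; apply: (@derive0_cst _ K (fun s => vP s 0 l)) => // r Kr.
  have D := idB (idM (sD r Kr) (idM (is_derive_cst kap^-1 r 1) (kkD l Kr)))
    (idM (cD' r Kr) (wD l Kr)).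
  apply: (is_derive_as D).
    by apply/funext => q; rewrite /vP /xv /yv rVD rVN !rVZ [vec _ q 0 l]mxE (mulrC (lam q)^-1).
  rewrite /cst alE; move: (kk r 0 l) (sin _) (cos _) (dv N l r) (lam r) (lt0r_neq0 (lam_gt0 Kr)).
  by move: kap kap_neq0 => t t0 p q q' w z z0; field; rewrite ?t0 ?z0.
have cQ s : K s -> vQ s = vQ s0.
  move=> Ks; apply/rowP => l; apply: (@derive0_cst _ K (fun s => vQ s 0 l)) => // r Kr.
  have D := idD (idM (cD' r Kr) (idM (is_derive_cst kap^-1 r 1) (kkD l Kr)))
    (idM (sD r Kr) (wD l Kr)).
  apply: (is_derive_as D).
    by apply/funext => q; rewrite /vQ /xv /yv rVD !rVZ [vec _ q 0 l]mxE (mulrC (lam q)^-1).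
  rewrite /cst alE; move: (kk r 0 l) (sin _) (cos _) (dv N l r) (lam r) (lt0r_neq0 (lam_gt0 Kr)).
  by move: kap kap_neq0 => t t0 p q q' w z z0; field; rewrite ?t0 ?z0.
have sin2cos2 s : sin (th s) ^+ 2 + cos (th s) ^+ 2 = 1 by rewrite addrC cos2Dsin2.
have fr s (Ks : K s) := rotated_frame (xx s Ks) (yy s Ks) (xy s Ks) (sin2cos2 s).
have [PP QQ PQ _ orth] := fr s0 Ks0.
exists th, (vP s0), (vQ s0); split; split=> //.
- by move=> s Ks; rewrite thE// mulr_gt0 ?lam_gt0// sqrtr_gt0.
- move=> u Ju; apply: orth.
    by rewrite /xv dotZr (dotC (z1 u)) -(kkE Ks0) kz1// mulr0.
  by rewrite /yv dotZr (dotC (z1 u)) n1z1// mulr0.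
- apply: orth.
    have e := etrans (dotC _ _) (box_k_Om Ks0); rewrite (kkE Ks0) in e.
    by rewrite /xv dotZr e mulr0.
  by have e := etrans (dotC _ _) (n1Om Ks0); rewrite /yv dotZr e mulr0.
move=> s Ks; have [_ _ _ e _] := fr s Ks.
rewrite -(cP s Ks) -(cQ s Ks) e /xv scalerA divff// scale1r//.
Qed.

Definition box_a := 2 * H0 * Num.sqrt kap2.
Local Notation a := box_a.
(** A first integral: f^4/E times the square of the component of Z' orthogonal to the circle and to
    its centre. *)
Definition box_C2 u := f u ^+ 2 + (f u ^+ 2 - f1 u ^+ 2 / b2) / E u.

Lemma box_a_neq0 : a != 0. Proof. exact (mulf_neq0 (mulf_neq0 two H00) kap_neq0). Qed.

Lemma box_ab : b2 = a ^+ 2 - 4 * H0 ^+ 2.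
Proof. have -> : a ^+ 2 = 4 * H0 ^+ 2 * kap ^+ 2 by rewrite /box_a -/kap; move: kap => r; ring.
by rewrite kapE /box_b2; move: kap2 => r; ring. Qed.

(** Let [N0] be the centre of the circle n, [P] and [Q] a basis of the plane of the circle, and [M]
    a unit vector that completes them. The component of Z' along N0 is forced by n.Z' = -c and the
    one along M by the first integral. The axes S and T, at 45 degrees to N0, have the same product
    d with n; this is c2 = c3 = d. *)
Lemma box_normal_form D d y : (forall u, J u -> box_C2 u = D) -> d ^+ 2 = b2 / (2 * a ^+ 2) ->
  (forall u, J u -> is_derive u 1 y (- (2 * H0 * d / b2) * (f1 u / f u ^+ 2) +
     Num.sqrt 2^-1 * (Num.sqrt D * Num.sqrt (E u) / f u ^+ 2))) ->
  exists (O : 'M[R]_4) (v : 'rV[R]_4) (th : R -> R),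
  [/\ O *m O^T = 1%:M /\ 0 <= D, smooth1 K th, forall s, K s -> 0 < derive1 th s
    & forall u s, J u -> K s -> (vec Z u - (2 * H0 * f u)^-1 *: n s - v) *m O^T =
      mk4 (sin (th s) / (a * f u)) (cos (th s) / (a * f u)) (y u)
        ((2 * H0 - d * a ^+ 2 * f u * y u) / (d * a ^+ 2 * f u))].
Proof.
move=> C2D d2 yD.
have [th [P [Q [[sth th0 [PP QQ PQ]] [zPQ [OP OQ] kkPQ]]]]] := box_circle.
have a0 := box_a_neq0; have b20 := lt0r_neq0 box_b2_gt0.
have b2E : b2 = 2 * a ^+ 2 * d ^+ 2.
  by rewrite d2; move: b2 a a0 => b a' a0; field.
have d0 : d != 0 by apply: contraNneq b20 => e; rewrite b2E e expr0n mulr0.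
have kn0 := kn Ks0; have kz0 u (Ju : J u) := kz1 Ju Ks0; have kO := box_k_Om Ks0.
rewrite (kkE Ks0) in kn0 kO.
have nO : dot (n s0) (Om u0) = kap ^+ 2 - 1.
  have e := etrans (esym (dot_lin2 (al u0) (n s0) (Om u0) (n s0))) kn0.
  by move: e; rewrite (nn Ks0) alE (dotC (Om u0)) => e; rewrite -[in RHS]e; ring.
have OO : dot (Om u0) (Om u0) = kap ^+ 2 * (kap ^+ 2 - 1).
  have e := etrans (esym (dot_lin2 (al u0) (n s0) (Om u0) (Om u0))) kO.
  by move: e; rewrite nO alE => e; rewrite -[LHS]addr0 -[in LHS]oppr0 -[in LHS]e; ring.
have zO u : J u -> dot (z1 u) (Om u0) = - (kap ^+ 2 * c u).
  move=> Ju; have := kz0 u Ju; rewrite (kkE Ks0) => kz.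
  have e := etrans (esym (dot_lin2 (al u0) (n s0) (Om u0) (z1 u))) kz.
  move: e; rewrite (nz Ju Ks0) alE (dotC (Om u0)) => e.
  by rewrite -[LHS]addr0 -[in LHS]oppr0 -[in LHS]e; ring.
pose N0 := (kap ^+ 2)^-1 *: Om u0.
have kap20 : kap ^+ 2 != 0 := expf_neq0 2 kap_neq0.
have nE s : K s -> n s = N0 - kap^-1 *: (sin (th s) *: P + cos (th s) *: Q).
  move=> Ks; have e := kkPQ s Ks; rewrite /N0; apply/rowP => l.
  have h : (kk s) 0 l = kap * (sin (th s) *: P + cos (th s) *: Q) 0 l by rewrite e rVZ.
  rewrite /kk rVD rVZ alE in h; rewrite rVD rVN (rVZ (kap ^+ 2)^-1) (rVZ kap^-1).
  move: h; move: (n s 0 l) (Om u0 0 l) ((sin (th s) *: P + cos (th s) *: Q) 0 l) => p q r h.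
  have -> : q = kap * r + kap ^+ 2 * p by rewrite -h; ring.
  by move: kap kap_neq0 => t t0; field.
have hb := box_ab.
have ak : a = 2 * H0 * kap by [].
have NN : dot N0 N0 = b2 / a ^+ 2.
  rewrite /N0 dotZl dotZr OO hb ak; move: kap kap_neq0 => t t0.
  by field; rewrite ?t0 ?H00.
have NP : dot N0 P = 0 by rewrite /N0 dotZl OP mulr0.
have NQ : dot N0 Q = 0 by rewrite /N0 dotZl OQ mulr0.
have zN u : J u -> dot (z1 u) N0 = - c u.
  by move=> Ju; rewrite /N0 dotZr (zO u Ju) mulrN mulKf.
clearbody N0.
have [M [MP MQ MN MM M0]] : exists M, [/\ dot M P = 0, dot M Q = 0, dot M N0 = 0, dot M M = 1
    & 0 <= dot (z1 u0) M].
  have [M [MP MQ MN MM]] := unit_orthogonal P Q N0.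
  (* The sign of M is free; with this choice the root of D is the non-negative one. *)
  case: (lerP 0 (dot (z1 u0) M)) => h; first by exists M.
  by exists (- M); rewrite !dotNl !dotNr MP MQ MN MM oppr0 opprK oppr_ge0 ltW.
(* Since |N0|^2 = b^2/a^2, the vector g' N0 has length mu = 1/sqrt 2 as well, so S and T are
   orthonormal; moreover g' |N0|^2 = d. *)
pose mu : R := Num.sqrt 2^-1; pose g' := a ^+ 2 * d / b2.
have mu2 : mu ^+ 2 = 2^-1 by rewrite sqr_sqrtr// invr_ge0 ler0n.
have mm : 2 * mu ^+ 2 = 1 by rewrite mu2; field.
have half : (2^-1 : R) + 2^-1 = 1 by field.
have gb : g' ^+ 2 * (b2 / a ^+ 2) = 2^-1.
  by rewrite /g' b2E; move: a a0 => t t0; field; rewrite ?t0 ?d0.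
pose S := g' *: N0 + mu *: M; pose T := g' *: N0 - mu *: M.
have dS v : dot v S = g' * dot v N0 + mu * dot v M by rewrite /S dotDr !dotZr.
have dT v : dot v T = g' * dot v N0 - mu * dot v M by rewrite /T dotDr dotNr !dotZr.
have dSl v : dot S v = g' * dot N0 v + mu * dot M v by rewrite /S dotDl !dotZl.
have dTl v : dot T v = g' * dot N0 v - mu * dot M v by rewrite /T dotDl dotNl !dotZl.
have NM : dot N0 M = 0 by rewrite dotC.
have PN : dot P N0 = 0 by rewrite dotC.
have QN : dot Q N0 = 0 by rewrite dotC.
have PM : dot P M = 0 by rewrite dotC.
have QM : dot Q M = 0 by rewrite dotC.
have SS : dot S S = 1.
  rewrite dS !dSl NN NM MN MM [LHS](_ : _ = g' ^+ 2 * (b2 / a ^+ 2) + mu ^+ 2); last by ring.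
  by rewrite gb mu2 half.
have TT : dot T T = 1.
  rewrite dT !dTl NN NM MN MM [LHS](_ : _ = g' ^+ 2 * (b2 / a ^+ 2) + mu ^+ 2); last by ring.
  by rewrite gb mu2 half.
have ST : dot S T = 0.
  rewrite dT !dSl NN NM MN MM [LHS](_ : _ = g' ^+ 2 * (b2 / a ^+ 2) - mu ^+ 2); last by ring.
  by rewrite gb mu2 subrr.
pose O := frame P Q S T.
have PS : dot P S = 0 by rewrite dS PN PM !mulr0 addr0.
have PT : dot P T = 0 by rewrite dT PN PM !mulr0 subr0.
have QS : dot Q S = 0 by rewrite dS QN QM !mulr0 addr0.
have QT : dot Q T = 0 by rewrite dT QN QM !mulr0 subr0.
have OO1 : O *m O^T = 1%:M :=
  frame_orthonormal (And4 PP QQ SS TT) (And3 PQ PS PT) (And3 QS QT ST).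
have zP u (Ju : J u) := (zPQ u Ju).1; have zQ u (Ju : J u) := (zPQ u Ju).2.
pose m u := dot (z1 u) M.
have zz u : J u -> dot (z1 u) (z1 u) = 2 * g' ^+ 2 * c u ^+ 2 + m u ^+ 2.
  move=> Ju; rewrite -(orthonormal_dot _ _ OO1) !mul_frame dot_mk4 zP// zQ// dS dT zN//.
  have -> : m u = dot (z1 u) M by [].
  have h : dot (z1 u) M ^+ 2 = 2 * mu ^+ 2 * dot (z1 u) M ^+ 2 by rewrite mm mul1r.
  by rewrite h; ring.
have hH : 4 * H0 ^+ 2 = a ^+ 2 - 2 * a ^+ 2 * d ^+ 2 by rewrite -b2E hb; ring.
(* The square of r is the first integral D, so r is constant and keeps the sign it has at u0. *)
pose r u := m u * (f u * f u) / Num.sqrt (E u).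
have sE0 u : J u -> Num.sqrt (E u) != 0.
  by move=> Ju; rewrite sqrtr_eq0 -ltNge box_E_gt0.
have r2 u : J u -> r u ^+ 2 = D.
  move=> Ju; rewrite -(C2D u Ju) /box_C2 /r.
  have -> : (m u * (f u * f u) / Num.sqrt (E u)) ^+ 2 =
      m u ^+ 2 * f u ^+ 4 / Num.sqrt (E u) ^+ 2 by move: (sE0 u Ju) => s1; field.
  rewrite sqr_sqrtr ?ltW ?box_E_gt0//.
  have -> : m u ^+ 2 = (E u + 1) / f u ^+ 2 + c u ^+ 2 * (1 - 2 * g' ^+ 2).
    by rewrite /E zz//; move: (f u) (fJ Ju) => A A0; field.
  have -> : 1 - 2 * g' ^+ 2 = - (4 * H0 ^+ 2) / b2.
    by rewrite hH /g' b2E; move: a a0 => t t0; field; rewrite ?t0 ?d0.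
  have -> : c u = f1 u / (2 * H0 * f u ^+ 2) by [].
  move: (f u) (fJ Ju) (f1 u) (E u) (lt0r_neq0 (box_E_gt0 Ju)) b2 b20 => A A0 A1 e e0 b b0.
  by field; rewrite ?A0 ?e0 ?b0 ?H00.
have rD u : J u -> is_derive u 1 r (derive1 r u).
  move=> Ju; have sqD := @is_derive1_comp R _ E u _ _ (is_derive1_sqrt (box_E_gt0 Ju))
    (box_E_derive Ju).
  have D1 := id_div (F := fun u => m u * (f u * f u)) (G := fun u => Num.sqrt (E u)) (sE0 u Ju)
    (idM (dot_cst_derive M (dv_smooth sZ) Ju) (idM (fD Ju) (fD Ju))) sqD.
  by rewrite (derive1_is D1); exact D1.
have r_ge0 : 0 <= r u0 by rewrite /r mulr_ge0 ?invr_ge0 ?sqrtr_ge0// mulr_ge0// -expr2 sqr_ge0.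
have rE u : J u -> r u = Num.sqrt D.
  move=> Ju; rewrite (square_const iJ Ju Ju0 rD r2 oJ) -(r2 u0 Ju0) sqrtr_sqr ger0_norm//.
have mE u : J u -> m u = Num.sqrt D * Num.sqrt (E u) / f u ^+ 2.
  move=> Ju; rewrite -(rE u Ju) /r; move: (sE0 u Ju) (f u) (fJ Ju) => s1 A A0.
  by field; rewrite ?s1 ?A0.
have cf u : J u -> f1 u / f u ^+ 2 = 2 * H0 * c u.
  move=> Ju; have -> : c u = f1 u / (2 * H0 * f u ^+ 2) by [].
  by move: (f u) (fJ Ju) => A A0; field; rewrite ?A0 ?H00.
(* The last coordinate of the model, written with 1/(2 H0 f), whose derivative is known. *)
pose w u := 4 * H0 ^+ 2 / (d * a ^+ 2) * (2 * H0 * f u)^-1 - y u.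
have cst_of (h : R -> R) : (forall u, J u -> is_derive u 1 h 0) -> forall u, J u -> h u = h u0.
  by move=> hD u Ju; exact: (derive0_cst iJ Ju Ju0 hD).
have cP : forall u, J u -> dot (vec Z u) P = dot (vec Z u0) P.
  by apply: cst_of => u Ju; apply: (is_derive_as (dot_cst_derive P sZ Ju)) => //; rewrite zP.
have cQ : forall u, J u -> dot (vec Z u) Q = dot (vec Z u0) Q.
  by apply: cst_of => u Ju; apply: (is_derive_as (dot_cst_derive Q sZ Ju)) => //; rewrite zQ.
(* The offsets between the S- and T-coordinates of the surface and those of the model are constant;
   they provide two components of the translation. *)
pose A u := dot (vec Z u) S - d * (2 * H0 * f u)^-1 - y u.
pose B' u := dot (vec Z u) T - d * (2 * H0 * f u)^-1 - w u.
have cA : forall u, J u -> A u = A u0.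
  apply: cst_of => u Ju.
  apply: (is_derive_as (idB (idB (dot_cst_derive S sZ Ju)
    (idM (is_derive_cst d u 1) (invf1 Ju))) (yD u Ju))) => //.
  rewrite dS zN// -/(m u) -(mE u Ju) cf// mulr0 addr0 -/mu /g' /cst.
  exact: profile_algebra1 a0 d0 two hH b2E.
have cB : forall u, J u -> B' u = B' u0.
  apply: cst_of => u Ju.
  apply: (is_derive_as (idB (idB (dot_cst_derive T sZ Ju)
    (idM (is_derive_cst d u 1) (invf1 Ju)))
    (idB (idM (is_derive_cst (4 * H0 ^+ 2 / (d * a ^+ 2)) u 1) (invf1 Ju)) (yD u Ju)))) => //.
  rewrite dT zN// -/(m u) -(mE u Ju) cf// !mulr0 !addr0 -/mu /g' /cst.
  exact: profile_algebra2 a0 d0 two hH b2E.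
exists O, (mk4 (dot (vec Z u0) P) (dot (vec Z u0) Q) (A u0) (B' u0) *m O), th; split=> //.
  by split; [exact OO1 | rewrite -(r2 u0 Ju0) sqr_ge0].
move=> u s Ju Ks; rewrite mulmxBl -mulmxA OO1 mulmx1 mul_frame.
have nd v : dot (n s) v = dot N0 v - kap^-1 * (sin (th s) * dot P v + cos (th s) * dot Q v).
  by rewrite (nE s Ks) dotDl dotNl dotZl dotDl !dotZl.
have sub4 p1 p2 p3 p4 q1 q2 q3 q4 : mk4 p1 p2 p3 p4 - mk4 q1 q2 q3 q4 =
    mk4 (p1 - q1) (p2 - q2) (p3 - q3) (p4 - q4) :> 'rV[R]_4.
  by rewrite -scaleN1r mk4Z mk4D !mulN1r.
rewrite sub4 -(cP u Ju) -(cQ u Ju) -(cA u Ju) -(cB u Ju).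
have dsub v : dot (vec Z u - (2 * H0 * f u)^-1 *: n s) v =
    dot (vec Z u) v - (2 * H0 * f u)^-1 * dot (n s) v by rewrite dotDl dotNl dotZl.
have nS : dot (n s) S = d.
  rewrite nd !dS NN NM PN PM QN QM /g' !mulr0 !addr0 !mulr0 addr0 mulr0 subr0.
  by move: a a0 b2 b20 => t t0 b b0; field; rewrite ?t0 ?b0.
have nT : dot (n s) T = d.
  rewrite nd !dT NN NM PN PM QN QM /g' !mulr0 !subr0 !mulr0 addr0 mulr0 subr0.
  by move: a a0 b2 b20 => t t0 b b0; field; rewrite ?t0 ?b0.
rewrite !dsub nS nT !nd NP NQ PP QQ PQ (dotC Q P) PQ /A /B' /w ak.
move: (f u) (fJ Ju) kap kap_neq0 (dot _ _) (dot _ _) (sin _) (cos _) (y u) => F F0 t t0 *.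
move: (dot _ _) (dot _ _) => *.
by congr mk4; field; rewrite ?F0 ?t0 ?H00 ?d0.
Qed.

(** The first form is diagonal and phi_s has no time component, so the tangential part of d/dt is
    -phi_u/E. *)
Lemma box_tan_part u s : J u -> K s -> tan_part g X (mk2 u s) (d_dt R) 0 0 = - (E u)^-1.
Proof.
move=> Ju Ks; have Bw := Bmk Ju Ks.
have E0 := lt0r_neq0 (box_E_gt0 Ju); have L0 := l2_neq0 Ks.
have G0 : l2 s / (4 * H0 ^+ 2) != 0.
  by rewrite mulf_neq0// invr_neq0// mulf_neq0 ?pnatr_eq0// expf_neq0.
have gE : gdet f X (mk2 u s) = E u * (l2 s / (4 * H0 ^+ 2)).
  have H := congr2 (fun x y => x - y) (congr2 *%R (ip00 Ju Ks) (ip11 Ju Ks))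
    (congr2 *%R (ip01 Ju Ks) (ip01 Ju Ks)).
  by apply: (etrans H); rewrite mulr0 subr0.
have dg := inv_diag2 (giE (gdet0 Bw)) gE (ip00 Ju Ks) (ip01 Ju Ks) (ip11 Ju Ks) E0 G0.
set v := d_dt R.
have S := diag_sum2 (fun i j => inner g (X (mk2 u s)) v (partial j X (mk2 u s)) *:
  partial i X (mk2 u s)) dg.
have -> : tan_part g X (mk2 u s) v = _ :=
  etrans (eq_bigr _ (fun i _ => eq_bigr _ (fun j _ => esym (scalerA _ _ _)))) S.
have v0 : v 0 0 = 1 by rewrite mxE.
have spv : sp v = 0 by apply/rowP => l; rewrite !mxE.
rewrite (dX0 Bw) (dX1 Bw) !inner_rw !mk50 !sp_mk5 rVD !rVZ !mk50 spv v0 !dot0l.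
by rewrite !(mulr0, addr0, mulr1) mulrN1.
Qed.

End Box.

Local Transparent partial gam dgam.

(** * Local profiles in an arbitrary chart *)

Lemma centered_interval (R : realType) (u0 e : R) : 0 < e ->
  [/\ open [set u : R | `|u - u0| < e], is_interval [set u : R | `|u - u0| < e]
    & [set u : R | `|u - u0| < e] u0].
Proof.
move=> e0; have -> : [set u : R | `|u - u0| < e] = [set` `]u0 - e, u0 + e[%R].
  by apply/seteqP; split=> x /=; rewrite in_itv /= ltr_distl.
split; [exact: interval_open | exact: interval_is_interval |].
by rewrite /= in_itv /= ltrBlDr ltrDl e0.
Qed.

Local Opaque partial gam dgam.

(** [box_a] with kappa^2 recovered from b^2, so that it no longer refers to a box. *)
Definition profile_a (R : realType) (H0 b2 : R) := 2 * H0 * Num.sqrt (b2 / (4 * H0 ^+ 2) + 1).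

(** The derivative of the S-coordinate Z.S - d/(2 H0 f) of the surface. The second summand is the
    contribution of M, where sqrt(1/2) comes from the angle of 45 degrees. *)
Definition profile_derivative (R : realType) (f : R -> R) (H0 b2 d D : R) (E : R -> R) u :=
  - (2 * H0 * d / b2) * (derive1 f u / f u ^+ 2) +
  Num.sqrt 2^-1 * (Num.sqrt D * Num.sqrt (E u) / f u ^+ 2).

(** All that later arguments need of a box around p, in terms of the chart. D, d and y are
    quantified inside, so that constants and a profile found globally can be inserted into every
    box; the time component of the tangential part of d/dt ties E to the surface itself. *)
Definition has_profile (R : realType) (I : set R) (f : R -> R) (H0 : R) (U : set 'rV[R]_2)
    (F : 'rV[R]_2 -> 'rV[R]_5) (p : 'rV[R]_2) (b2 : R) (E : R -> R) : Prop :=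
  exists (u0 s0 e : R) (V : set 'rV[R]_2) (nk : 'rV[R]_2 -> R) (G : 'rV[R]_2 -> 'rV[R]_2),
  let J := [set u : R | `|u - u0| < e] in let K := [set s : R | `|s - s0| < e] in
  [/\ [/\ 0 < e, open V, V p, V `<=` U & sm V nk],
   forall q, V q -> [/\ J (F q 0 0), K (nk q), G (mk2 (F q 0 0) (nk q)) = q
     & - tan_part (rw_metric f) F q (d_dt R) 0 0 = (E (F q 0 0))^-1],
   (forall w, boxset J K w -> [/\ V (G w), F (G w) 0 0 = w 0 0 & nk (G w) = w 0 1]) /\
     (forall j, sm (boxset J K) (fun w => G w 0 j)),
   0 < b2 /\ forall u, J u -> [/\ I u, 0 < E u,
     is_derive u 1 E (2 * E u * (derive1 f u / f u) * (2 * E u + 1))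
     & E u * (2 * (derive1 f u / f u) ^+ 2 - b2) =
       derive1 (derive1 f) u / f u - (derive1 f u / f u) ^+ 2]
   & let a := profile_a H0 b2 in forall D d y,
     (forall u, J u -> f u ^+ 2 + (f u ^+ 2 - derive1 f u ^+ 2 / b2) / E u = D) ->
     d ^+ 2 = b2 / (2 * a ^+ 2) ->
     (forall u, J u -> is_derive u 1 y (profile_derivative f H0 b2 d D E u)) ->
     exists (O : 'M[R]_4) (v : 'rV[R]_4) (th : R -> R),
     [/\ O *m O^T = 1%:M /\ 0 <= D, smooth1 K th, forall s, K s -> 0 < derive1 th s
       & forall q, V q -> let t := F q 0 0 in (sp (F q) - v) *m O^T =
         mk4 (sin (th (nk q)) / (a * f t)) (cos (th (nk q)) / (a * f t)) (y t)
           ((2 * H0 - d * a ^+ 2 * f t * y t) / (d * a ^+ 2 * f t))]].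

Section LocalProfile.
Variables (R : realType) (I : set R) (f : R -> R) (H0 : R).
Hypotheses (oI : open I) (sf : smooth1 I f) (f0 : forall t, I t -> f t != 0).
Hypothesis gen : forall t, I t ->
  derive1 (derive1 f) t / f t - derive1 f t ^+ 2 / f t ^+ 2 != 0.
Hypothesis H00 : H0 != 0.
Variables (U : set 'rV[R]_2) (F e4 : 'rV[R]_2 -> 'rV[R]_5).
Hypotheses (oU : open U) (sF : smF U F) (FI : forall q, U q -> I (F q 0 0)).
Local Notation g := (rw_metric f).
Local Notation ip q := (inner g (F q)).
Hypothesis pd : forall q, U q -> positive_definite (first_form g F q).
Hypothesis se4 : smF U e4.
Hypothesis e4n : forall q, U q -> forall k, ip q (e4 q) (partial k F q) = 0.
Hypothesis e4u : forall q, U q -> ip q (e4 q) (e4 q) = 1.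
Hypothesis mcE : forall q, U q -> mean_curvature g F q = H0 *: e4 q.
Hypothesis par : forall q, U q -> forall i, nabla_perp g F i (mean_curvature g F) q = 0.
Hypothesis bic : forall q, U q -> tan_part g F q (bitension g F q) = 0.
Hypothesis T0 : forall q, U q -> tan_part g F q (d_dt R) != 0.

Lemma local_profile p : U p -> exists b2 E, has_profile I f H0 U F p b2 E.
Proof.
move=> Up.
have gdet0 q : U q -> gdet f F q != 0 by move=> Uq; case: (pd_gdet (pd Uq)) => _ /lt0r_neq0.
have [k [u0 [s0 [e [N [Z [V [G [[e0 oV Vp VU] VB BV [sG detG sN sZ] form]]]]]]]]] :=
  box_coordinates oI sf f0 gen H00 oU sF FI gdet0 se4 e4n e4u mcE par bic T0 Up.
have time := e4_time oI sf f0 gen H00 oU sF FI gdet0 se4 e4n e4u mcE par bic T0.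
set J := [set u : R | `|u - u0| < e] in VB BV sG detG sN sZ form *.
set K := [set s : R | `|s - s0| < e] in VB BV sG detG sN sZ form *.
have [oJ iJ Ju0] := centered_interval u0 e0; have [oK iK Ks0] := centered_interval s0 e0.
rewrite -/J in oJ iJ Ju0; rewrite -/K in oK iK Ks0.
pose B := boxset J K; have oB : open B := open_box oJ oK.
have BU w : B w -> U (G w) by move=> Bw; have [/VU] := BV w Bw.
have Bmk u s : J u -> K s -> B (mk2 u s) by move=> *; split; rewrite ?mk20 ?mk21.
have JI : J `<=` I.
  by move=> u Ju; have [/VU/FI + + _] := BV _ (Bmk _ _ Ju Ks0); rewrite mk20 => + <-.
pose FG w := F (G w).
pose X := box_map f H0 N Z.
have FX w : B w -> FG w = X w.
  move=> Bw; have [VG t1 n1] := BV w Bw; apply: rV5P; first by rewrite mk50.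
  apply/rowP => l; rewrite sp_mk5 rVD rVN rVZ !mxE.
  by have [_ ->] := form _ VG l; rewrite n1 t1 mulrC.
have e4X w : B w -> e4 (G w) = box_normal f N w.
  move=> Bw; have [VG t1 n1] := BV w Bw; apply: rV5P; first by rewrite mk50 (time _ (BU w Bw)).
  apply/rowP => l; rewrite sp_mk5 rVZ !mxE.
  have [+ _] := form _ VG l; rewrite n1 t1 => <-; by rewrite (mulKf (f0 (JI _ Bw.1))).
have ffX w : B w -> first_form g FG w = first_form g X w by exact: eq_first_form.
have XgdetN0 w : B w -> gdet f X w != 0.
  move=> Bw; rewrite gdet_det -ffX// -gdet_det.
  exact: (gdet_reparam0 oU sF oB BU sG detG gdet0 Bw).
have XE w : B w -> 0 < inner g (X w) (partial 0 X w) (partial 0 X w).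
  move=> Bw; rewrite -first_formE -ffX// (first_form_reparam f oU sF oB BU sG Bw).
  have -> : (jac G w *m first_form g F (G w) *m (jac G w)^T) 0 0 =
    (row 0 (jac G w) *m first_form g F (G w) *m (row 0 (jac G w))^T) 0 0.
    by rewrite -row_mul tr_row -row_mul !mxE; apply: eq_bigr => j _; rewrite !mxE.
  apply: pd (BU w Bw) _ _; apply: contraNneq (detG w Bw) => r0.
  have r0j j : jac G w 0 j = 0.
    by have := congr1 (fun v : 'rV[R]_2 => v 0 j) r0; rewrite mxE [in RHS]mxE.
  by rewrite det2 !r0j !mul0r subrr.
have pX i w : B w -> partial i FG w = partial i X w.
  by move=> Bw; exact: eq_partial oB Bw FX.
have Xu w : B w -> inner g (X w) (box_normal f N w) (box_normal f N w) = 1.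
  by move=> Bw; rewrite -FX// -e4X//; exact: e4u (BU w Bw).
have Xn w : B w -> forall k, inner g (X w) (box_normal f N w) (partial k X w) = 0.
  move=> Bw i; rewrite -(pX i w Bw) -FX// -e4X//.
  exact: (normal_reparam oU sF oB BU sG Bw (e4n (BU w Bw))).
have Xm w : B w -> mean_curvature g X w = H0 *: box_normal f N w.
  move=> Bw; rewrite -e4X// -(mcE (BU w Bw)).
  rewrite -(mean_curvature_reparam sf f0 oU sF FI oB BU sG detG gdet0 Bw).
  by exact (esym (eq_mean_curvature f oB FX Bw)).
exists (box_b2 f H0 Z u0), (box_E f H0 Z), u0, s0, e, V, (fun q => f (F q 0 0) * e4 q 0 (lift 0 k)), G.
rewrite -/J -/K /=; split.
- split=> //; apply: (sub_sm VU); apply: sm_mul => //; exact: (sm_comp1 oU oI sf (sF 0) FI).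
- move=> q Vq; have [Jq Kq Gq] := VB q Vq; split=> //.
  have Bq := Bmk _ _ Jq Kq.
  have := tan_part_reparam oU sF oB BU sG detG gdet0 (d_dt R) Bq; rewrite Gq => <-.
  rewrite (eq_tan_part f oB FX (d_dt R) Bq).
  have Tb : tan_part g X (mk2 (F q 0 0) (f (F q 0 0) * e4 q 0 (lift 0 k))) (d_dt R) 0 0 =
      - (box_E f H0 Z (F q 0 0))^-1.
    exact: (box_tan_part sf f0 H00 oJ oK JI sN sZ Ju0 Ks0 XgdetN0 XE Xu Xn Jq Kq).
  by rewrite Tb opprK.
- by split=> // w Bw; exact: BV.
- split; first exact: (box_b2_gt0 sf f0 gen H00 oJ oK JI sN sZ Ju0 Ks0 XgdetN0 XE Xu Xn Xm).
  move=> u Ju; split; first exact: JI.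
  + exact: (box_E_gt0 sf f0 H00 oJ JI sN sZ Ju0 Ks0 XE Xu Xn Ju).
  + exact: (box_E_derive sf f0 H00 oJ oK JI sN sZ Ju0 Ks0 XgdetN0 XE Xu Xn Xm Ju).
  + exact: (box_E_b2 sf f0 H00 oJ oK JI sN sZ Ju0 Ks0 XgdetN0 XE Xu Xn Xm Ju).
have aE : profile_a H0 (box_b2 f H0 Z u0) = box_a f H0 Z u0.
  rewrite /profile_a /box_a /box_b2; congr (_ * Num.sqrt _).
  by rewrite mulrC mulKf ?subrK// mulf_neq0 ?pnatr_eq0// expf_neq0.
move=> D d y C2D; rewrite aE => d2 yD.
have [Q [v [th [OO sth th0 nf]]]] := box_normal_form sf f0 gen H00 oJ oK iJ iK JI sN sZ Ju0 Ks0
  XgdetN0 XE Xu Xn Xm C2D d2 yD.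
exists Q, v, th; split=> // q Vq; have [Jq Kq Gq] := VB q Vq.
rewrite -(nf _ _ Jq Kq); congr ((_ - v) *m _); apply/rowP => l.
rewrite rVD rVN rVZ !mxE; have [_ ->] := form _ Vq l.
by rewrite (mulrC _^-1).
Qed.

End LocalProfile.

(** * Global structure *)

Lemma connected_locally_constant (T : topologicalType) (S : Type) (h : T -> S) :
  connected [set: T] -> (forall x, \forall y \near x, h y = h x) -> forall x y, h y = h x.
Proof.
move=> cT loc x y; pose A := [set z | h z = h x].
suff AT : A = [set: T] by have : A y by rewrite AT.
apply: cT; first by exists x.
- exists A; last by rewrite setTI.
  by rewrite openE => z Az; apply: filterS (loc z) => w hw; rewrite /A /= hw.
exists A; last by rewrite setTI.
rewrite -openC openE => z Az; apply: filterS (loc z) => w hw Aw; apply: Az.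
by rewrite /A /= -hw.
Qed.

(** Here s is the M-part of y', and the formula for 2 s^2 is D E/f^4 with D written out by the first
    integral. These data give |phi_u|^2 = E back, after which [eq1E] and [eq2E] become rational
    identities modulo the equation for f''. *)
Lemma system_algebra (R : realType) (H0 a b d F F1 F2 E s y1 y2 : R) :
  a != 0 -> d != 0 -> F != 0 -> E != 0 -> b ^+ 2 = 2 * a ^+ 2 * d ^+ 2 ->
  4 * H0 ^+ 2 = a ^+ 2 - b ^+ 2 ->
  F2 = F1 ^+ 2 / F + E * (2 * F1 ^+ 2 / F - b ^+ 2 * F) ->
  2 * s ^+ 2 = (F ^+ 2 * E + F ^+ 2 - F1 ^+ 2 / b ^+ 2) / F ^+ 4 ->
  y1 = - (2 * H0 * d / b ^+ 2) * (F1 / F ^+ 2) + s ->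
  y2 = - (2 * H0 * d / b ^+ 2) * ((F2 * F - 2 * F1 ^+ 2) / F ^+ 3) +
    s * (F1 / F) * (2 * E - 1) ->
  system_eq1 H0 a b d d F F1 F2 y1 y2 /\ system_eq2 H0 a b d d F F1 F2 y1 y2.
Proof.
move=> a0 d0 A0 E0 bE HE F2E sE y1E y2E.
have two : 2 != 0 :> R by rewrite pnatr_eq0.
have b0 : b ^+ 2 != 0 by rewrite bE !mulf_neq0// expf_neq0.
have bE' : b ^+ 2 = a ^+ 2 - 4 * H0 ^+ 2 by rewrite HE; ring.
have unitE : d ^+ 2 + d ^+ 2 + 4 * H0 ^+ 2 / a ^+ 2 = 1 by rewrite HE bE; field.
(* H0 is traded for h, whose square is rational in a^2 and b^2. *)
pose h := 2 * H0 * d / b ^+ 2.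
have hh : 2 * h ^+ 2 = (a ^+ 2 - b ^+ 2) / (a ^+ 2 * b ^+ 2).
  have -> : 2 * h ^+ 2 = 2 * (4 * H0 ^+ 2) * d ^+ 2 / (b ^+ 2) ^+ 2.
    by rewrite /h; move: (b ^+ 2) b0 => B B0; field.
  by rewrite HE bE; field; rewrite ?a0 ?d0.
have H2 : 2 * H0 = h * b ^+ 2 / d by rewrite /h; move: (b ^+ 2) b0 => B B0; field; rewrite ?B0 ?d0.
have H2' : 2 * H0 / (d * a) = 2 * h * a.
  by rewrite H2 bE; field; rewrite ?a0 ?d0.
have EE : F ^+ 2 * ((- F1 / (a * F ^+ 2)) ^+ 2 + (- h * (F1 / F ^+ 2) + s) ^+ 2 +
    (2 * h * a * (- F1 / (a * F ^+ 2)) - (- h * (F1 / F ^+ 2) + s)) ^+ 2) - 1 = E.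
  rewrite [LHS](_ : _ = F ^+ 2 * (F1 ^+ 2 / F ^+ 4 * (1 / a ^+ 2 + 2 * h ^+ 2) + 2 * s ^+ 2) - 1);
    last by field; rewrite ?a0 ?A0.
  by rewrite hh sE; move: (b ^+ 2) b0 => B B0; field; rewrite ?a0 ?A0 ?B0.
split.
  apply/(eq1E _ _ _ _ a0 d0 A0 bE' unitE); rewrite H2' y1E y2E -/h divff// !mul1r EE.
  rewrite [LHS](_ : _ = 2 * F * F1 * (F1 ^+ 2 / F ^+ 4 * (1 / a ^+ 2 + 2 * h ^+ 2) + 2 * s ^+ 2) +
    2 * F ^+ 2 * ((F2 * F - 2 * F1 ^+ 2) / F ^+ 3 * (F1 / F ^+ 2) * (1 / a ^+ 2 + 2 * h ^+ 2) +
      2 * s ^+ 2 * (F1 / F) * (2 * E - 1))); last first.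
    by field; rewrite ?a0 ?A0.
  by rewrite hh sE F2E; move: (b ^+ 2) b0 => B B0; field; rewrite ?a0 ?A0 ?B0.
apply/(eq2E _ _ _ _ a0 d0 A0 bE' unitE); rewrite H2' y1E y2E -/h divff// !mul1r EE.
rewrite H2 F2E; clearbody h; move: (b ^+ 2) b0 => B B0.
by field; rewrite ?a0 ?A0 ?d0.
Qed.

Lemma chart_cod_open (R : realType) (M : topologicalType) (c : chart R M) : open (ch_cod c).
Proof. exact: ch_cod_open. Qed.
Arguments chart_cod_open {R M} c.

Lemma chart_dom_open (R : realType) (M : topologicalType) (c : chart R M) : open (ch_dom c).
Proof. exact: ch_dom_open. Qed.
Arguments chart_dom_open {R M} c.

Lemma overlap_open (R : realType) (M : topologicalType) (c d : chart R M) : open (overlap c d).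
Proof.
rewrite /overlap openE => q [cq dq]; apply: filterI.
  exact: open_nbhs_nbhs (conj (chart_cod_open c) cq).
exact: ch_para_cont cq _ (open_nbhs_nbhs (conj (chart_dom_open d) dq)).
Qed.
Arguments overlap_open {R M} c d.

Section Converse.
Variables (R : realType) (I : set R) (f : R -> R) (H0 : R).
Hypotheses (oI : open I) (sf : smooth1 I f) (f0 : forall t, I t -> f t != 0).
Hypothesis gen : forall t, I t ->
  derive1 (derive1 f) t / f t - derive1 f t ^+ 2 / f t ^+ 2 != 0.
Hypothesis H00 : H0 != 0.
Variables (M : surface R) (phi : M -> 'rV[R]_5).
Hypothesis bs : biconservative_PMCV_surface I f phi H0.
Local Notation g := (rw_metric f).
Local Notation loc c := (phi \o ch_para c).
Local Notation f1 := (derive1 f).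
Local Notation f2 := (derive1 (derive1 f)).
Local Notation ch := (chart R M).

Lemma chart_near (c : ch) x (S : set 'rV[R]_2) : ch_dom c x -> open S -> S (ch_coord c x) ->
  \forall y \near x, ch_dom c y /\ S (ch_coord c y).
Proof.
move=> dx oS Sx; apply: filterI; first exact: open_nbhs_nbhs (conj (chart_dom_open c) dx).
exact: ch_coord_cont dx _ (open_nbhs_nbhs (conj oS Sx)).
Qed.

Let loc_smF (c : ch) : atlas c -> smF (ch_cod c) (loc c).
Proof.
by move=> ac; have [[_ sp] _ _ _ _] := bs; exact: (smVP _ (chart_cod_open c)).1 (sp c ac).1.
Qed.

Let loc_pd (c : ch) : atlas c -> forall q, ch_cod c q -> positive_definite (first_form g (loc c) q).
Proof. by move=> ac; have [[_ sp] _ _ _ _] := bs; exact: (sp c ac).2. Qed.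

Let loc_I (c : ch) : forall q, ch_cod c q -> I (loc c q 0 0).
Proof. by move=> q _; have [[In _] _ _ _ _] := bs; exact: In. Qed.

Let loc_gdet (c : ch) : atlas c -> forall q, ch_cod c q -> gdet f (loc c) q != 0.
Proof. by move=> ac q cq; case: (pd_gdet (loc_pd ac cq)) => _ /lt0r_neq0. Qed.

Let chart_profile (c : ch) p : atlas c -> ch_cod c p ->
  exists b2 E, has_profile I f H0 (ch_cod c) (loc c) p b2 E.
Proof.
move=> ac cp; have [_ T0 par bic [e4 e4P]] := bs; have [se4 e4c] := e4P c ac.
apply: (@local_profile R I f H0 oI sf f0 gen H00 (ch_cod c) (loc c) (e4 \o ch_para c)) => //.
- exact: chart_cod_open.
- exact: loc_smF.
- exact: loc_I.
- exact: loc_pd.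
- exact: (smVP _ (chart_cod_open c)).1 se4.
- by move=> q cq; have [h _ _] := e4c q cq; exact: h.
- by move=> q cq; have [_ h _] := e4c q cq; exact: h.
- by move=> q cq; have [_ _ h] := e4c q cq; exact: h.
- exact: par.
- exact: bic.
- exact: T0.
Qed.

Lemma tan_part_chart (c d : ch) x v : atlas c -> atlas d -> ch_dom c x -> ch_dom d x ->
  tan_part g (loc c) (ch_coord c x) v = tan_part g (loc d) (ch_coord d x) v.
Proof.
move=> ac ad cx dx; have oW := overlap_open c d.
have [cq pq] := ch_coordP cx.
have Wx : overlap c d (ch_coord c x) by split=> //; rewrite /= pq.
have WU w : overlap c d w -> ch_cod d (transition c d w) by case=> _ /ch_coordP [].
have sG : forall j, sm (overlap c d) (fun w => transition c d w 0 j).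
  exact: (smVP _ oW).1 (atlas_compatible ac ad).1.
have dG w : overlap c d w -> \det (jac (transition c d) w) != 0.
  by move=> Ww; exact: lt0r_neq0 (atlas_oriented ac ad Ww).
have FX w : overlap c d w -> loc c w = loc d (transition c d w).
  by move=> [_ dw]; rewrite /= (ch_coordP dw).2.
rewrite (eq_tan_part f oW FX v Wx).
rewrite (tan_part_reparam (chart_cod_open d) (loc_smF ad) oW WU sG dG (loc_gdet ad) v Wx).
by rewrite /transition /= pq.
Qed.

Let pick (x : M) := cid2 (atlas_cover x).
(* In the coordinates (u, s) of a box, tau = 1/E. *)
Let tau (x : M) := - tan_part g (loc (s2val (pick x))) (ch_coord (s2val (pick x)) x) (d_dt R) 0 0.

Let tauE (c : ch) x : atlas c -> ch_dom c x ->
  tau x = - tan_part g (loc c) (ch_coord c x) (d_dt R) 0 0.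
Proof.
move=> ac cx; congr (- (_ : 'rV[R]_5) 0 0).
exact: tan_part_chart (s2valP (pick x)) ac (s2valP' (pick x)) cx.
Qed.

(** The formula for b^2 with [tau] in place of 1/E: a function on M, without reference to charts, to
    which connectedness applies. *)
Let beta (x : M) := let t := phi x 0 0 in
  2 * (f1 t / f t) ^+ 2 - (f2 t / f t - (f1 t / f t) ^+ 2) * tau x.

Let beta_near (c : ch) x b2 E : atlas c -> ch_dom c x ->
  has_profile I f H0 (ch_cod c) (loc c) (ch_coord c x) b2 E -> \forall y \near x, beta y = b2.
Proof.
move=> ac cx [u0 [s0 [e [V [nk [G [[e0 oV Vp VU _] VB _ [_ EJ] _]]]]]]].
apply: filterS (chart_near cx oV Vp) => y [cy Vy].
have [cq pq] := ch_coordP cy; have [Jq _ _ tE] := VB _ Vy.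
rewrite /beta (tauE ac cy) tE; rewrite /= pq in Jq *.
have [_ E0 _ <-] := EJ _ Jq; rewrite [_ * _ * _^-1]mulrAC divff ?lt0r_neq0// mul1r.
by rewrite opprB addrC subrK.
Qed.

Let beta_const x y : beta y = beta x.
Proof.
have loc z : \forall w \near z, beta w = beta z.
  have [c ac cz] := atlas_cover z; have [cq _] := ch_coordP cz.
  have [b2 [E hp]] := chart_profile ac cq; have nb := beta_near ac cz hp.
  by apply: filterS nb => w ->; rewrite (nbhs_singleton (beta_near ac cz hp)).
exact: (connected_locally_constant (@surf_connected R M) loc x y).
Qed.

Local Notation J := [set phi p 0 0 | p in [set: M]].

Lemma uniform_profile : exists b2, forall x, exists c,
  [/\ atlas c, ch_dom c x & exists E, has_profile I f H0 (ch_cod c) (loc c) (ch_coord c x) b2 E].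
Proof.
have [x0 _] := surf_nonempty M; exists (beta x0) => x.
have [c ac cx] := atlas_cover x; have [cq _] := ch_coordP cx.
have [b2 [E hp]] := chart_profile ac cq.
exists c; split=> //; exists E.
by rewrite -(beta_const x0 x) (nbhs_singleton (beta_near ac cx hp)).
Qed.

Lemma time_range_interval : is_interval J.
Proof.
apply/connected_intervalP; apply: connected_continuous_connected; first exact: (@surf_connected R M).
apply: continuous_subspaceT => x; have [c ac cx] := atlas_cover x.
have [cq pq] := ch_coordP cx.
have cont : {for ch_coord c x, continuous (fun q => loc c q 0 0)}.
  exact: sm_continuous (loc_smF ac 0) cq.
have C : {for x, continuous ((fun q => loc c q 0 0) \o ch_coord c)}.
  exact: continuous_comp (ch_coord_cont cx) cont.
have near : \forall y \near x, ((fun q => loc c q 0 0) \o ch_coord c) y = phi y 0 0.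
  by apply: filterS (open_nbhs_nbhs (conj (chart_dom_open c) cx)) => y cy /=; rewrite (ch_coordP cy).2.
move: C; rewrite /prop_for /continuous_at (nbhs_singleton near) => C.
by apply: cvg_trans C; exact: near_eq_cvg.
Qed.

Let gen' t : I t -> f2 t / f t - (f1 t / f t) ^+ 2 != 0.
Proof. by move=> It; rewrite expr_div_n; exact: gen. Qed.

(** E solved from [box_E_b2]. The genericity of f makes the numerator non-zero, so the denominator
    cannot vanish where that relation holds. Each box has its own E; this formula is common to all
    of them. *)
Definition profile_E b2 u := (f2 u / f u - (f1 u / f u) ^+ 2) / (2 * (f1 u / f u) ^+ 2 - b2).

(** Near x, after a rigid motion, the surface is the model with the angle th(s) in place of a v. The
    chart, the box, the motion and th may vary with x, but a, d and y may not. *)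
Definition normal_form_at (a d D : R) (y : R -> R) (x : M) : Prop :=
  exists (c : ch) (u0 s0 e : R) (V : set 'rV[R]_2)
    (nk : 'rV[R]_2 -> R) (G : 'rV[R]_2 -> 'rV[R]_2) (O : 'M[R]_4) (v : 'rV[R]_4) (th : R -> R),
  let JJ := [set u : R | `|u - u0| < e] in let K := [set s : R | `|s - s0| < e] in
  [/\ [/\ atlas c, ch_dom c x & 0 < e] /\
      [/\ open V, V (ch_coord c x), V `<=` ch_cod c & sm V nk],
   forall q, V q -> [/\ JJ (loc c q 0 0), K (nk q) & G (mk2 (loc c q 0 0) (nk q)) = q],
   (forall w, boxset JJ K w -> [/\ V (G w), loc c (G w) 0 0 = w 0 0 & nk (G w) = w 0 1]) /\
     (forall j, sm (boxset JJ K) (fun w => G w 0 j)),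
   [/\ O *m O^T = 1%:M, 0 <= D, smooth1 K th & forall s, K s -> 0 < derive1 th s]
   & forall q, V q -> let t := loc c q 0 0 in (sp (loc c q) - v) *m O^T =
         mk4 (sin (th (nk q)) / (a * f t)) (cos (th (nk q)) / (a * f t)) (y t)
           ((2 * H0 - d * a ^+ 2 * f t * y t) / (d * a ^+ 2 * f t))].

Section Global.
Variable b2 : R.
Hypothesis prof : forall x, exists c,
  [/\ atlas c, ch_dom c x & exists E, has_profile I f H0 (ch_cod c) (loc c) (ch_coord c x) b2 E].
Local Notation E := (profile_E b2).

Let local_box x : exists u0 e : R, [/\ 0 < e, `|phi x 0 0 - u0| < e, 0 < b2 &
  forall u, `|u - u0| < e -> [/\ J u, I u, 0 < E u,
    E u * (2 * (f1 u / f u) ^+ 2 - b2) = f2 u / f u - (f1 u / f u) ^+ 2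
    & derive1 E u = 2 * E u * (f1 u / f u) * (2 * E u + 1)]].
Proof.
have [c [ac cx [E' [u0 [s0 [e [V [nk [G [[e0 oV Vp VU _] VB [BV _] [b20 EJ] _]]]]]]]]]] := prof x.
have [cq pq] := ch_coordP cx; have [Jx _ _ _] := VB _ Vp; rewrite /= pq in Jx.
have EE u : `|u - u0| < e -> E' u = E u.
  move=> Ju; have [Iu E0 _ h] := EJ u Ju; rewrite /profile_E -h mulfK//.
  by apply: contraNneq (gen' Iu) => z; rewrite -h z mulr0.
exists u0, e; split=> // u Ju; have [Iu E0 D h] := EJ u Ju.
have [oK _ _] := centered_interval u0 e0; have [_ _ s0K] := centered_interval s0 e0.
split=> //; rewrite -?(EE u Ju) //.
  have Bw : boxset [set u | `|u - u0| < e] [set s | `|s - s0| < e] (mk2 u s0).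
    by split; rewrite ?mk20 ?mk21.
  by exists (ch_para c (G (mk2 u s0))) => //; have [_ + _] := BV _ Bw; rewrite mk20.
rewrite -(derive1_is D); apply: derive1_near.
by apply: filterS (open_nbhs_nbhs (conj oK Ju)) => v Jv; rewrite EE.
Qed.

Lemma time_range_open : open J.
Proof.
rewrite openE => _ [x _ <-]; have [u0 [e [e0 Jx _ box]]] := local_box x.
have [oK _ _] := centered_interval u0 e0.
by apply: filterS (open_nbhs_nbhs (conj oK Jx)) => u /box [].
Qed.

Let facts u : J u -> [/\ I u, 0 < E u,
    E u * (2 * (f1 u / f u) ^+ 2 - b2) = f2 u / f u - (f1 u / f u) ^+ 2
    & derive1 E u = 2 * E u * (f1 u / f u) * (2 * E u + 1)].
Proof. by move=> [x _ <-]; have [u0 [e [e0 Jx _ box]]] := local_box x; have [] := box _ Jx. Qed.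

Let b2_gt0 : 0 < b2.
Proof. by have [x _] := surf_nonempty M; have [u0 [e []]] := local_box x. Qed.

Let JI : J `<=` I. Proof. by move=> u /facts []. Qed.

Let fJ u : J u -> f u != 0. Proof. by move=> /JI /f0. Qed.

Let sj h : smooth1 I h -> sm (strip J) (fun q : 'rV[R]_2 => h (q 0 0)).
Proof. by move=> sh; exact: (smooth1_strip _ time_range_open).1 (sub_smooth1 JI sh). Qed.

Let smE : smooth1 J E.
Proof.
apply/(smooth1_strip _ time_range_open); have oS := open_strip time_range_open.
have sq : sm (strip J) (fun q : 'rV[R]_2 => f1 (q 0 0) / f (q 0 0)).
  by apply: sm_div => //; [move=> q; exact: fJ | exact: sj (smooth1_derive sf) | exact: sj].
apply: sm_div => //.
- move=> q Jq; have [Iu _ h _] := facts Jq.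
  by apply: contraNneq (gen' Iu) => z; rewrite -h z mulr0.
- apply: sm_sub => //; last exact: sm_exp.
  apply: sm_div => //; [by move=> q; exact: fJ | | exact: sj].
  exact: sj (smooth1_derive (smooth1_derive sf)).
- apply: sm_sub => //; last exact: sm_cst.
  by apply: sm_mul => //; [exact: sm_cst | exact: sm_exp].
Qed.

Let ED u : J u -> is_derive u 1 E (2 * E u * (f1 u / f u) * (2 * E u + 1)).
Proof. by move=> Ju; have [_ _ _ <-] := facts Ju; exact: smooth1_is_derive smE Ju. Qed.

Let f2E u : J u -> f2 u = f1 u ^+ 2 / f u + E u * (2 * f1 u ^+ 2 / f u - b2 * f u).
Proof.
move=> Ju; have [_ _ h _] := facts Ju; have A0 := fJ Ju.
have -> : f2 u = f u * (f2 u / f u - (f1 u / f u) ^+ 2) + f1 u ^+ 2 / f u by field.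
by rewrite -h; field.
Qed.

Let C2 u := f u ^+ 2 + (f u ^+ 2 - f1 u ^+ 2 / b2) / E u.

(** The formulas for f'' and E' make the derivative vanish; since the time range is an interval, one
    constant D serves all boxes. *)
Let C2_const u v : J u -> J v -> C2 u = C2 v.
Proof.
move=> Ju Jv; apply: (derive0_cst time_range_interval Ju Jv) => w Jw.
have [Iw E0 _ _] := facts Jw; have e0 := lt0r_neq0 E0; have A0 := fJ Jw.
have fD := smooth1_is_derive sf Iw; have f1D := smooth1_is_derive (smooth1_derive sf) Iw.
apply: (is_derive_as (idD (idM fD fD) (id_div (F := fun u => f u * f u - f1 u * f1 u * b2^-1) e0
  (idB (idM fD fD) (idM (idM f1D f1D) (is_derive_cst b2^-1 w 1))) (ED Jw)))).
  by apply/funext => x; rewrite /C2 !expr2.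
rewrite (f2E Jw) /cst; move: (f w) (f1 w) (E w) b2 (lt0r_neq0 b2_gt0) A0 e0 => F F1 e b b0 A0 e0.
by field; rewrite ?A0 ?b0 ?e0.
Qed.

Let a := profile_a H0 b2.
Let H20 : 4 * H0 ^+ 2 != 0. Proof. by rewrite mulf_neq0 ?pnatr_eq0// expf_neq0. Qed.
Let H2_gt0 : 0 < 4 * H0 ^+ 2. Proof. by rewrite lt0r H20 mulr_ge0// sqr_ge0. Qed.

Let a2 : a ^+ 2 = b2 + 4 * H0 ^+ 2.
Proof.
rewrite /a /profile_a.
have s2 : Num.sqrt (b2 / (4 * H0 ^+ 2) + 1) ^+ 2 = b2 / (4 * H0 ^+ 2) + 1.
  by rewrite sqr_sqrtr// addr_ge0// ltW// divr_gt0.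
have -> : (2 * H0 * Num.sqrt (b2 / (4 * H0 ^+ 2) + 1)) ^+ 2 =
  4 * H0 ^+ 2 * Num.sqrt (b2 / (4 * H0 ^+ 2) + 1) ^+ 2 by ring.
by rewrite s2 mulrDr mulr1 mulrC divfK.
Qed.

Let a0 : a != 0.
Proof.
have : 0 < a ^+ 2 by rewrite a2 addr_gt0.
by apply: contraTneq => ->; rewrite expr0n ltxx.
Qed.

(** The solution of 2 d^2 = 1 - 4 H0^2/a^2 = b^2/a^2, which is the relation between the constants
    for c2 = c3 = d. *)
Let d := Num.sqrt (b2 / 2) / a.

Let d2 : d ^+ 2 = b2 / (2 * a ^+ 2).
Proof.
rewrite /d expr_div_n sqr_sqrtr; last by rewrite ltW// divr_gt0.
by move: a a0 => t t0; field.
Qed.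

Let d0 : d != 0.
Proof.
have : 0 < d ^+ 2 by rewrite d2 divr_gt0// mulr_gt0// a2 addr_gt0.
by apply: contraTneq => ->; rewrite expr0n ltxx.
Qed.

Section WithConstant.
Variable D : R.
Hypothesis C2D : forall u, J u -> C2 u = D.
Local Notation dy := (profile_derivative f H0 b2 d D E).

Let sE0 u : J u -> Num.sqrt (E u) != 0.
Proof. by move=> /facts [_ e _ _]; rewrite sqrtr_eq0 -ltNge. Qed.

Let smooth_dy : smooth1 J dy.
Proof.
apply/(smooth1_strip _ time_range_open); have oS := open_strip time_range_open.
have sF2 : sm (strip J) (fun q : 'rV[R]_2 => f (q 0 0) ^+ 2) by apply: sm_exp => //; exact: sj.
have F20 (q : 'rV[R]_2) : strip J q -> f (q 0 0) ^+ 2 != 0.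
  by move=> Jq; rewrite expf_neq0// fJ.
apply: sm_add => //; apply: sm_mul => //; try exact: sm_cst; apply: sm_div => //.
  exact: sj (smooth1_derive sf).
apply: sm_mul => //; first exact: sm_cst.
apply: sm_sqrt => //; first by move=> q /facts [].
exact: (smooth1_strip _ time_range_open).1 smE.
Qed.

(** The logarithmic derivative of sqrt(E)/f^2 is (f'/f)(2E + 1) - 2 f'/f = (f'/f)(2E - 1). *)
Let dyD u : J u -> derive1 dy u = - (2 * H0 * d / b2) * ((f2 u * f u - 2 * f1 u ^+ 2) / f u ^+ 3) +
  Num.sqrt 2^-1 * (Num.sqrt D * Num.sqrt (E u) / f u ^+ 2) * (f1 u / f u) * (2 * E u - 1).
Proof.
move=> Ju; have [Iu E0 _ _] := facts Ju; have A0 := fJ Ju; have s0 := sE0 Ju.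
have fD := smooth1_is_derive sf Iu; have f1D := smooth1_is_derive (smooth1_derive sf) Iu.
have sqD := @is_derive1_comp R _ E u _ _ (is_derive1_sqrt E0) (ED Ju).
have ff : f u * f u != 0 by rewrite mulf_neq0.
apply: derive1_is.
apply: (is_derive_as (idD (idM (is_derive_cst (- (2 * H0 * d / b2)) u 1)
    (id_div (G := fun u => f u * f u) ff f1D (idM fD fD)))
  (idM (is_derive_cst (Num.sqrt 2^-1) u 1)
    (id_div (F := fun u => Num.sqrt D * Num.sqrt (E u)) (G := fun u => f u * f u) ff
      (idM (is_derive_cst (Num.sqrt D) u 1) sqD) (idM fD fD))))).
  by apply/funext => x; rewrite /profile_derivative /cst !expr2.
have eE : E u = Num.sqrt (E u) ^+ 2 by rewrite sqr_sqrtr// ltW.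
rewrite /cst; move: (Num.sqrt (E u)) s0 eE => s s0 ->.
move: (Num.sqrt D) (Num.sqrt 2^-1) (- (2 * H0 * d / b2)) (f u) A0 (f1 u) (f2 u) => *.
by field; apply/andP; split.
Qed.

Lemma global_profile : exists y : R -> R, smooth1 J y /\ forall u, J u -> derive1 y u = dy u.
Proof.
apply: primitive smooth_dy; split; [exact: time_range_open | exact: time_range_interval |].
by have [x _] := surf_nonempty M; exists (phi x 0 0), x.
Qed.

Variable y : R -> R.
Hypotheses (sy : smooth1 J y) (yE : forall u, J u -> derive1 y u = dy u).

Lemma profile_normal_form x : normal_form_at a d D y x.
Proof.
have [c [ac cx [E' [u0 [s0 [e [V [nk [G [[e0 oV Vp VU snk] VB BV [b20 EJ] nf]]]]]]]]]] := prof x.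
have [_ _ s0K] := centered_interval s0 e0.
have EE u : `|u - u0| < e -> E' u = E u.
  move=> Ju; have [Iu E0 _ h] := EJ u Ju; rewrite /profile_E -h mulfK//.
  by apply: contraNneq (gen' Iu) => z; rewrite -h z mulr0.
have JJ u : `|u - u0| < e -> J u.
  move=> Ju; have Bw : boxset [set u | `|u - u0| < e] [set s | `|s - s0| < e] (mk2 u s0).
    by split; rewrite ?mk20 ?mk21.
  by exists (ch_para c (G (mk2 u s0))) => //; have [_ + _] := BV.1 _ Bw; rewrite mk20.
have CD u : `|u - u0| < e -> f u ^+ 2 + (f u ^+ 2 - f1 u ^+ 2 / b2) / E' u = D.
  by move=> Ju; rewrite EE// -(C2D (JJ u Ju)).
have yD u : `|u - u0| < e -> is_derive u 1 y (profile_derivative f H0 b2 d D E' u).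
  move=> Ju; rewrite /profile_derivative EE// -/(profile_derivative f H0 b2 d D E u).
  by have h := smooth1_is_derive sy (JJ u Ju); rewrite (yE (JJ u Ju)) in h; exact h.
have [Q [v [th [[QQ D0] sth th0 form]]]] := nf D d y CD d2 yD.
exists c, u0, s0, e, V, nk, G, Q, v, th; split=> //.
by move=> q Vq; have [? ? ? _] := VB q Vq.
Qed.

Lemma profile_admissible : admissible_constants H0 a (Num.sqrt b2) d d.
Proof.
have bb : Num.sqrt b2 ^+ 2 = b2 by rewrite sqr_sqrtr// ltW.
split=> //; split; rewrite ?bb ?a2//; first by rewrite addrK.
have a20 : a ^+ 2 != 0 := expf_neq0 2 a0.
rewrite d2 a2; rewrite a2 in a20.
by move: (4 * H0 ^+ 2) b2 a20 => h b h0; field.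
Qed.

Lemma profile_system : system_on J H0 a (Num.sqrt b2) d d f y.
Proof.
(* On each box D is a square, and any single box shows the sign. *)
have D0 : 0 <= D.
  by have [x _] := surf_nonempty M;
    have [c [u0 [s0 [e [V [nk [G [Q [v [th [_ _ _ [_ ? _ _] _]]]]]]]]]]] := profile_normal_form x.
have bb : Num.sqrt b2 ^+ 2 = b2 by rewrite sqr_sqrtr// ltW.
move=> u Ju; have [Iu E0 _ _] := facts Ju; have A0 := fJ Ju.
have y2E : derive1 (derive1 y) u = derive1 dy u.
  by apply: derive1_near; apply: filterS (open_nbhs_nbhs (conj time_range_open Ju)).
have b20 := lt0r_neq0 b2_gt0.
apply: (system_algebra (E := E u) (s := Num.sqrt 2^-1 * (Num.sqrt D * Num.sqrt (E u) / f u ^+ 2))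
  a0 d0 A0 (lt0r_neq0 E0)).
- by rewrite bb d2; move: a a0 b2 => t t0 b; field.
- by rewrite bb a2; ring.
- by rewrite bb; exact: f2E.
- rewrite bb; have -> : 2 * (Num.sqrt 2^-1 * (Num.sqrt D * Num.sqrt (E u) / f u ^+ 2)) ^+ 2 =
    2 * Num.sqrt 2^-1 ^+ 2 * Num.sqrt D ^+ 2 * Num.sqrt (E u) ^+ 2 / f u ^+ 4.
    by move: (f u) A0 => F F0; field.
  rewrite (sqr_sqrtr D0) (sqr_sqrtr (ltW E0)) (@sqr_sqrtr _ 2^-1) ?invr_ge0 ?ler0n//.
  rewrite -(C2D Ju) /C2.
  move: (E u) (lt0r_neq0 E0) => e e0; move: (f u) A0 (f1 u) b2 b20 => F F0 F1 b b0.
  by field; rewrite ?F0 ?e0 ?b0.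
- by rewrite bb; exact: yE.
by rewrite bb; exact: etrans y2E (dyD Ju).
Qed.

End WithConstant.

Lemma global_normal_form : exists (y : R -> R) (a b d D : R),
  [/\ smooth1 J y, admissible_constants H0 a b d d, system_on J H0 a b d d f y
    & forall x, normal_form_at a d D y x].
Proof.
have [x0 _] := surf_nonempty M.
have C2D u : J u -> C2 u = C2 (phi x0 0 0) by move=> Ju; apply: C2_const => //; exists x0.
have [y [sy yE]] := global_profile (C2 (phi x0 0 0)).
exists y, a, (Num.sqrt b2), d, (C2 (phi x0 0 0)); split=> //.
- exact: profile_admissible.
- exact: (profile_system C2D sy yE).
- exact: (profile_normal_form C2D sy yE).
Qed.

End Global.

End Converse.

(** * Adapted charts and local congruence *)

Section ReparametrizedChart.
Variables (R : realType) (M : topologicalType) (c : chart R M).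
Variables (A B : set 'rV[R]_2) (Phi Psi : 'rV[R]_2 -> 'rV[R]_2).
Hypotheses (oA : open A) (oB : open B) (Ac : A `<=` ch_cod c).
Hypotheses (sPhi : forall j, sm A (fun q => Phi q 0 j)) (sPsi : forall j, sm B (fun q => Psi q 0 j)).
Hypotheses (PhiK : forall q, A q -> B (Phi q) /\ Psi (Phi q) = q).
Hypotheses (PsiK : forall w, B w -> A (Psi w) /\ Phi (Psi w) = w).

Let dom := [set x | ch_dom c x /\ A (ch_coord c x)].

Let dom_open : open dom.
Proof.
rewrite openE => x [dx Ax]; apply: filterI.
  exact: open_nbhs_nbhs (conj (chart_dom_open c) dx).
exact: ch_coord_cont dx _ (open_nbhs_nbhs (conj oA Ax)).
Qed.

Let coordP x : dom x -> B (Phi (ch_coord c x)) /\ ch_para c (Psi (Phi (ch_coord c x))) = x.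
Proof. by move=> [dx /PhiK [BP ->]]; have [] := ch_coordP dx. Qed.

Let paraP w : B w -> dom (ch_para c (Psi w)) /\ Phi (ch_coord c (ch_para c (Psi w))) = w.
Proof. by move=> /PsiK [AP e]; have [dx e'] := ch_paraP (Ac AP); rewrite /dom /= e'. Qed.

Let coord_cont x : dom x -> {for x, continuous (fun x => Phi (ch_coord c x))}.
Proof.
move=> [dx Ax]; apply: (@continuous_comp _ _ _ (ch_coord c) Phi); first exact: ch_coord_cont.
by apply: continuous_rV => j; exact: sm_continuous (sPhi j) Ax.
Qed.

Let para_cont w : B w -> {for w, continuous (fun w => ch_para c (Psi w))}.
Proof.
move=> Bw; apply: (@continuous_comp _ _ _ Psi (ch_para c)).
  by apply: continuous_rV => j; exact: sm_continuous (sPsi j) Bw.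
by apply: ch_para_cont; apply: Ac; have [] := PsiK Bw.
Qed.

Definition reparam_chart : chart R M :=
  Chart dom_open oB coordP paraP coord_cont para_cont.

Lemma reparam_chart_compatible (d : chart R M) : compatible c d -> compatible reparam_chart d.
Proof.
have oW := @overlap_open R M; move=> [s1 s2].
have {}s1 := (smVP _ (oW c d)).1 s1; have {}s2 := (smVP _ (oW d c)).1 s2.
split.
  apply/(smVP _ (oW reparam_chart d)) => j k.
  apply: (Ck_comp (U := overlap c d) (F := fun q => transition c d q 0 j) (G := Psi)).
  - exact: oW.
  - exact: oW.
  - by move=> w [Bw dw]; split=> //; apply: Ac; have [] := PsiK Bw.
  - exact: s1.
  - move=> i; apply: (@Ck_sub R 2 k B); last exact: sPsi.
    by move=> w [].
apply/(smVP _ (oW d reparam_chart)) => j k.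
apply: (Ck_comp (U := A) (F := fun q => Phi q 0 j) (G := transition d c)).
- exact: oW.
- exact: oA.
- by move=> w [_ [_ Aw]].
- exact: sPhi.
- move=> i; apply: (@Ck_sub R 2 k (overlap d c)); last exact: s2.
  by move=> w [dw [cw _]].
Qed.

End ReparametrizedChart.

Lemma sm_compose (R : realType) (V U : set 'rV[R]_2) (F : 'rV[R]_2 -> R) (G : 'rV[R]_2 -> 'rV[R]_2) :
  open V -> open U -> (forall q, V q -> U (G q)) -> sm U F ->
  (forall j, sm V (fun q => G q 0 j)) -> sm V (fun q => F (G q)).
Proof. by move=> oV oU VU sF sG k; apply: (Ck_comp oV oU VU (sF k)) => j; exact: sG. Qed.

(** The map (u, s) to (u, th(s)/a) turns the angle th(s) into the angle a v of the model; th' > 0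
    makes its Jacobian non-zero. *)
Lemma shear_coordinates (R : realType) (J K : set R) (th : R -> R) (a : R) (w0 : 'rV[R]_2) :
  open J -> open K -> smooth1 K th -> (forall s, K s -> 0 < derive1 th s) -> a != 0 ->
  boxset J K w0 -> let psi (w : 'rV[R]_2) := mk2 (w 0 0) (th (w 0 1) / a) in
  exists (V W : set 'rV[R]_2) (G : 'rV[R]_2 -> 'rV[R]_2),
    [/\ [/\ open V, open W, V w0 & V `<=` boxset J K],
    forall q, V q -> W (psi q) /\ G (psi q) = q, forall w, W w -> V (G w) /\ psi (G w) = w &
    forall j, sm W (fun w => G w 0 j)].
Proof.
move=> oJ oK sth th0 a0 Bw0 psi; have oB := open_box oJ oK.
have psi0 : (fun q => psi q 0 0) = (fun q : 'rV[R]_2 => q 0 0) by apply/funext => q; rewrite mk20.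
have psi1 : (fun q => psi q 0 1) = (fun q : 'rV[R]_2 => th (q 0 1) * a^-1).
  by apply/funext => q; rewrite mk21.
have spsi : forall j, sm (boxset J K) (fun q => psi q 0 j).
  apply: ord2P; rewrite ?psi0 ?psi1; first exact: sm_coord.
  apply: sm_mul => //; last exact: sm_cst.
  apply: (sm_comp1 oB oK sth (@sm_coord _ _ _ 1)) => q Bq; exact: Bq.2.
apply: (inverse_function oB spsi Bw0).
rewrite /jdet /jent psi0 psi1 !partial_coord mul0r subr0 mul1r.
have D := idM (coord_comp_derive 1 (smooth1_derivable sth Bw0.2))
  (is_derive_cst a^-1 w0 (delta_mx 0 1 : 'rV[R]_2)).
rewrite (partialE D) /cst mulr0 add0r eqxx mul1r mulf_neq0 ?invr_neq0//.
exact: lt0r_neq0 (th0 _ Bw0.2).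
Qed.

Section LocalCongruence.
Variables (R : realType) (I : set R) (f : R -> R) (H0 : R).
Hypothesis oI : open I.
Variables (M : surface R) (phi : M -> 'rV[R]_5).
Hypothesis bs : biconservative_PMCV_surface I f phi H0.
Local Notation J := [set phi p 0 0 | p in [set: M]].

(** The adapted chart is (t, th(n_k)/a), obtained from the given chart through the box coordinates.
    Its image lies in the strip because its first coordinate is the time of a point of M. *)
Lemma normal_form_congruent (a d D : R) (y : R -> R) : a != 0 ->
  (forall x, normal_form_at f H0 phi a d D y x) ->
  locally_congruent I f phi (strip J) (model_surface H0 a d d f y).
Proof.
move=> a0 nf x.
have [c [u0 [s0 [e [V [nk [G [Q [v [th]]]]]]]]]] := nf x.
move=> /= [[[ac cx e0] [oV Vx Vc snk]] VB [BV sG] [QQ _ sth th0] form].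
have [oJJ _ _] := centered_interval u0 e0; have [oK _ _] := centered_interval s0 e0.
set JJ := [set u | `|u - u0| < e] in oJJ VB BV sG; set K := [set s | `|s - s0| < e] in oK VB BV sG sth th0.
have oB := open_box oJJ oK.
have sloc : smF (ch_cod c) (phi \o ch_para c).
  have [[_ sp] _ _ _ _] := bs.
  exact: (smVP _ (chart_cod_open c)).1 (sp c ac).1.
have st : sm V (fun q => phi (ch_para c q) 0 0) by exact: sub_sm Vc (sloc 0).
pose S q := mk2 (phi (ch_para c q) 0 0) (nk q).
have SB q : V q -> boxset JJ K (S q).
  by move=> Vq; have [Jq Kq _] := VB q Vq; split; rewrite ?mk20 ?mk21.
have GS q : V q -> G (S q) = q by move=> Vq; have [] := VB q Vq.
have SG w : boxset JJ K w -> V (G w) /\ S (G w) = w.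
  by move=> Bw; have [VG t1 n1] := BV w Bw; split=> //; apply: rV2P; rewrite ?mk20 ?mk21.
have [V1 [W1 [H [[oV1 oW1 V1x V1B] V1K W1K sH]]]] :=
  shear_coordinates oJJ oK sth th0 a0 (SB _ Vx).
pose Phi q := mk2 (phi (ch_para c q) 0 0) (th (nk q) / a).
have PhiE q : Phi q = mk2 (S q 0 0) (th (S q 0 1) / a) by rewrite /S mk20 mk21.
(* The part of V whose box coordinates lie where (u, th(s)/a) is inverted by [H]. *)
pose A := [set q | V q /\ V1 (S q)].
have oA : open A.
  rewrite openE => q [Vq V1q]; apply: filterI; first exact: open_nbhs_nbhs (conj oV Vq).
  have cS : {for q, continuous S}.
    apply: continuous_rV; apply: ord2P.
      have -> : (fun q => S q 0 0) = (fun q => phi (ch_para c q) 0 0).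
        by apply/funext => r; rewrite mk20.
      exact: sm_continuous st Vq.
    have -> : (fun q => S q 0 1) = nk by apply/funext => r; rewrite mk21.
    exact: sm_continuous snk Vq.
  exact: cS _ (open_nbhs_nbhs (conj oV1 V1q)).
have AV : A `<=` V by move=> q [].
have sPhi : forall j, sm A (fun q => Phi q 0 j).
  apply: ord2P.
    have -> : (fun q => Phi q 0 0) = (fun q => phi (ch_para c q) 0 0).
      by apply/funext => r; rewrite mk20.
    exact: sub_sm AV st.
  have -> : (fun q => Phi q 0 1) = (fun q => th (nk q) * a^-1).
    by apply/funext => r; rewrite mk21.
  apply: sm_mul => //; last exact: sm_cst.
  apply: (sm_comp1 oA oK sth (sub_sm AV snk)) => q [Vq _].
  by have [] := VB q Vq.
have sPsi j : sm W1 (fun w => G (H w) 0 j).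
  apply: (sm_compose oW1 oB _ (sG j) sH) => w /W1K [V1H _]; exact: V1B.
have PhiK q : A q -> W1 (Phi q) /\ G (H (Phi q)) = q.
  by move=> [Vq V1q]; rewrite PhiE; have [Wq ->] := V1K _ V1q; rewrite GS.
have PsiK w : W1 w -> A (G (H w)) /\ Phi (G (H w)) = w.
  move=> /W1K [V1H e1]; have [VG SGw] := SG _ (V1B _ V1H).
  by rewrite PhiE SGw; split=> //; split=> //; rewrite SGw.
have Ac : A `<=` ch_cod c by move=> q /AV /Vc.
pose c' := reparam_chart oA oW1 Ac sPhi sPsi PhiK PsiK.
exists (fun p : 'rV[R]_5 => mk5 (p 0 0) ((sp p - v) *m Q^T)), c'; split.
- exact: orthonormal_isometry.
- by move=> d' ad; apply: reparam_chart_compatible; exact: atlas_compatible.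
- by split.
- move=> w /PsiK [_ e1]; exists (ch_para c (G (H w))) => //.
  by rewrite -[in RHS]e1 mk20.
move=> w /= Ww; have [[VG _] e1] := PsiK w Ww.
have t1 : phi (ch_para c (G (H w))) 0 0 = w 0 0 by rewrite -[in RHS]e1 mk20.
have n1 : th (nk (G (H w))) = a * w 0 1.
  by rewrite -[in RHS]e1 mk21 mulrC divfK.
have := form _ VG; rewrite /= t1 n1 => ->.
apply: rV5P; first by rewrite mk50 mxE.
by rewrite sp_mk5; apply/rowP => -[[|[|[|[|l]]]] ll]; rewrite !mxE.
Qed.

End LocalCongruence.

Theorem theorem5p3 (R : realType) (I : set R) (f : R -> R) (H0 : R)
    (I_interval : open_interval I) (f_smooth : smooth1 I f)
    (f_neq0 : forall t, I t -> f t != 0)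
    (f_generic : forall t, I t ->
       let f1 : R := f^`() t in let f2 : R := f^`(2) t in
       f2 / f t - f1 ^+ 2 / f t ^+ 2 != 0)
    (H0_neq0 : H0 != 0) :
  (forall (J : set R) (y : R -> R) (a b c2 c3 : R),
     open_interval J -> J `<=` I -> smooth1 J y ->
     admissible_constants H0 a b c2 c3 ->
     system_on J H0 a b c2 c3 f y ->
     (forall q, strip J q ->
        positive_definite
          (first_form (rw_metric f) (model_surface H0 a c2 c3 f y) q)) ->
     exists (M : surface R) (phi : M -> 'rV[R]_5),
       biconservative_PMCV_surface I f phi H0 /\
       parametrized_by phi (strip J) (model_surface H0 a c2 c3 f y))
  /\
  (forall (M : surface R) (phi : M -> 'rV[R]_5),
     biconservative_PMCV_surface I f phi H0 ->
     let J := [set phi p 0 0 | p in [set: M]] in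
     exists (y : R -> R) (a b c2 c3 : R),
       [/\ smooth1 J y,
           admissible_constants H0 a b c2 c3,
           system_on J H0 a b c2 c3 f y
         & locally_congruent I f phi (strip J)
             (model_surface H0 a c2 c3 f y)]).
Proof.
have [oI _ _] := I_interval; split.
  move=> J y a b c2 c3 [oJ iJ [u0 Ju0]] JI sy ac sys pd.
  exists (strip_surface oJ iJ Ju0); eexists; exact: (model_is_surface oI f_smooth f_neq0 oJ iJ JI sy ac sys Ju0 pd).
move=> M phi bs J.
have [b2 prof] := uniform_profile oI f_smooth f_neq0 f_generic H0_neq0 bs.
have [y [a [b [d [D [sy ac sys nf]]]]]] :=
  global_normal_form f_smooth f_neq0 f_generic H0_neq0 bs prof.
exists y, a, b, d, d; split=> //; have [[a0 _ _] _] := ac.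
exact: (normal_form_congruent oI bs a0 nf).
Qed.
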